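(* Let $d\ge1$, $\beta>0$, $\gamma>0$, and let $V:\mathbb{R}^d\to\mathbb{R}$ be a smooth confining potential such that, for some constant $D$, $\|\nabla V(x)-\nabla V(y)\|\le D\|x-y\|$ for all $x,y\in\mathbb{R}^d$. Let $g:\mathbb{R}^d\to\mathbb{R}$ be a differentiable function such that: (1) there is $C_1>0$ with $|g(x)-g(y)|\le C_1\|x-y\|$ for all $x,y\in\mathbb{R}^d$; (2) $\nabla g$ exists and there is $C_2>0$ with $\|\nabla g(x)-\nabla g(y)\|\le C_2\|x-y\|$ for all $x,y\in\mathbb{R}^d$; (3) there are constants $0<m_1<M_1$ with $m_1<g(x)<M_1$ for all $x\in\mathbb{R}^d$; (4) there is $C_3>0$ with $\|\nabla V(x)g(x)-\nabla V(y)g(y)\|\le C_3\|x-y\|$ for all $x,y\in\mathbb{R}^d$. Then the system of SDEs for $(x,p)\in\mathbb{R}^d\times\mathbb{R}^d$ $$\begin{cases}dx=g(x)\,p\,dt,\\ dp=-g(x)\nabla_xV(x)\,dt+\beta^{-1}\nabla_xg(x)\,dt-\gamma g(x)\,p\,dt+\sqrt{2\gamma\beta^{-1}g(x)}\,dW(t)\end{cases}$$ has the invariant distribution with density $$\rho(x,p)=\frac1Z\exp(-\beta H(x,p)),\qquad Z=\int_{\mathbb{R}^{2d}}\exp(-\beta H(x,p))\,dx\,dp,$$ where $H(x,p)=\tfrac12\|p\|^2+V(x)$.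
   Context: $\|\cdot\|$ is the Euclidean norm; $W$ is a standard $d$-dimensional Brownian motion; SDEs are in the Itô sense, and the scalar coefficient $\sqrt{2\gamma\beta^{-1}g(x)}$ multiplies the $d$-dimensional increment $dW(t)$. A potential $V$ is confining if $V(x)\to+\infty$ as $\|x\|\to\infty$ and $e^{-\beta V}\in L^1(\mathbb{R}^d)$ for all $\beta>0$. An invariant distribution of an SDE is a probability measure that is preserved by the Markov semigroup of its solution. *)

(* Defs.v *)
From HB Require Import structures.
From mathcomp Require Import all_boot all_order all_algebra.
From mathcomp Require Import all_classical all_reals all_analysis.

Set Implicit Arguments.
Unset Strict Implicit.
Unset Printing Implicit Defensive.

Import Order.TTheory GRing.Theory Num.Theory.
Import numFieldNormedType.Exports.

Local Open Scope classical_set_scope.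
Local Open Scope ring_scope.

(* The Borel sigma-algebra of R^n, generated by the coordinates, as for
   n.-tuple R in the library. *)
Definition measure_rV_display : measure_display -> measure_display.
Proof. exact. Qed.

Section measurable_rV.
Context {d} {T : sigmaRingType d}.
Variable n : nat.

Let coord (i : 'I_n) (x : 'rV[T]_n) : T := x ord0 i.

Let rV_set0 : g_sigma_preimage coord set0.
Proof. exact: sigma_algebra0. Qed.

Let rV_setC A : g_sigma_preimage coord A -> g_sigma_preimage coord (~` A).
Proof. exact: sigma_algebraC. Qed.

Let rV_bigcup (F : _^nat) : (forall i, g_sigma_preimage coord (F i)) ->
  g_sigma_preimage coord (\bigcup_i (F i)).
Proof. exact: sigma_algebra_bigcup. Qed.

HB.instance Definition _ := @isMeasurable.Build (measure_rV_display d)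
  'rV[T]_n (g_sigma_preimage coord) rV_set0 rV_setC rV_bigcup.

Lemma measurable_coord (i : 'I_n) :
  measurable_fun [set: 'rV[T]_n] (fun x : 'rV[T]_n => x ord0 i).
Proof.
move=> _ Y mY; rewrite setTI; apply: sub_sigma_algebra => /=.
rewrite -bigcup_seq/=; exists i => /=; first by rewrite mem_index_enum.
by exists Y => //; rewrite setTI.
Qed.

Lemma measurable_fun_rVP d1 (T1 : measurableType d1) (f : T1 -> 'rV[T]_n) :
  (forall i, measurable_fun [set: T1] (fun x => f x ord0 i)) ->
  measurable_fun [set: T1] f.
Proof.
move=> mf.
have H : g_sigma_preimage (fun i => coord i \o f) `<=` measurable.
  apply: smallest_sub; first exact: sigma_algebra_measurable.
  rewrite -bigcup_seq; apply: bigcup_sub => i _.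
  by move=> A [B mB <-]; exact: mf.
rewrite g_sigma_preimage_comp in H.
by move=> _ A mA; apply: H; exists A.
Qed.

End measurable_rV.

(* Lebesgue measure on R^n, by recursion: the image of the product of the
   Lebesgue measures on R and on R^n under (t, v) |-> row_mx t v. *)
Section lebesgue_rV.
Context {R : realType}.

Definition rV_cons n (q : R * 'rV[R]_n) : 'rV[R]_n.+1 :=
  row_mx (\row_(_ < 1) q.1) q.2.

Lemma rV_cons0 n (q : R * 'rV[R]_n) : rV_cons q ord0 ord0 = q.1.
Proof.
rewrite /rV_cons (_ : ord0 = lshift n (ord0 : 'I_1)); last exact: val_inj.
by rewrite (row_mxEl (\row_(_ < 1) q.1)) mxE.
Qed.

Lemma rV_cons_lift n (q : R * 'rV[R]_n) (i : 'I_n) :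
  rV_cons q ord0 (lift ord0 i) = q.2 ord0 i.
Proof.
rewrite /rV_cons (_ : lift ord0 i = rshift 1 i); last exact: val_inj.
by rewrite (row_mxEr (\row_(_ < 1) q.1)).
Qed.

Lemma measurable_rV_cons n : measurable_fun [set: R * 'rV[R]_n] (@rV_cons n).
Proof.
apply: measurable_fun_rVP => i.
case: (unliftP ord0 i) => [j|] ->.
  under eq_fun do rewrite rV_cons_lift.
  apply: (measurableT_comp (measurable_coord j)).
  exact: measurable_snd.
by under eq_fun do rewrite rV_cons0; exact: measurable_fst.
Qed.

Let rV_uncons n (v : 'rV[R]_n.+1) : R * 'rV[R]_n :=
  (v ord0 ord0, \row_j v ord0 (lift ord0 j)).

Let measurable_rV_uncons n :
  measurable_fun [set: 'rV[R]_n.+1] (@rV_uncons n).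
Proof.
apply: measurable_fun_pair => /=; first exact: measurable_coord.
apply: measurable_fun_rVP => i.
by under eq_fun do rewrite mxE; exact: measurable_coord.
Qed.

Let rV_consK n : cancel (@rV_cons n) (@rV_uncons n).
Proof.
move=> [t v]; rewrite /rV_uncons rV_cons0; congr (_, _).
by apply/rowP => j; rewrite mxE rV_cons_lift.
Qed.

Section step.
Variables (n : nat) (mu : {sigma_finite_measure set 'rV[R]_n -> \bar R}).

Definition lebesgue_rV_step : set 'rV[R]_n.+1 -> \bar R :=
  pushforward (@lebesgue_measure R \x mu)%E (@rV_cons n).

Let step0 : lebesgue_rV_step set0 = 0%E.
Proof. by rewrite /lebesgue_rV_step /pushforward preimage_set0 measure0. Qed.

Let step_ge0 A : (0 <= lebesgue_rV_step A)%E.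
Proof. exact: (measure_ge0 (@lebesgue_measure R \x mu)%E). Qed.

Let step_sigma_additive : semi_sigma_additive lebesgue_rV_step.
Proof.
move=> F mF tF mUF; rewrite /lebesgue_rV_step /pushforward preimage_bigcup.
apply: measure_semi_sigma_additive.
- by move=> i; rewrite -[X in measurable X]setTI; exact: measurable_rV_cons.
- apply/trivIsetP => /= i j _ _ ij; rewrite -preimage_setI.
  by move/trivIsetP : tF => /(_ _ _ _ _ ij) ->//; rewrite preimage_set0.
- rewrite -preimage_bigcup -[X in measurable X]setTI.
  exact: measurable_rV_cons.
Qed.

HB.instance Definition _ := isMeasure.Build _ _ _ lebesgue_rV_step
  step0 step_ge0 step_sigma_additive.

Let step_sigma_finite : sigma_finite setT lebesgue_rV_step.
Proof.
have /sigma_finiteP[F [TF ndF Foo]] := sigma_finiteT (@lebesgue_measure R).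
have /sigma_finiteP[G [TG ndG Goo]] := sigma_finiteT mu.
exists (fun i => @rV_uncons n @^-1` (F i `*` G i)).
  rewrite -preimage_bigcup; apply/esym/seteqP; split => // v _ /=.
  have : (\bigcup_i F i) (rV_uncons v).1 by rewrite -TF.
  have : (\bigcup_i G i) (rV_uncons v).2 by rewrite -TG.
  move=> [j _ Gj] [i _ Fi]; exists (maxn i j) => //; split.
    by move: Fi; exact/subsetPset/ndF/leq_maxl.
  by move: Gj; exact/subsetPset/ndG/leq_maxr.
move=> i; have [mF Fi] := Foo i; have [mG Gi] := Goo i; split.
  rewrite -[X in measurable X]setTI; apply: measurable_rV_uncons => //.
  exact: measurableX.
rewrite /lebesgue_rV_step /pushforward -comp_preimage.
rewrite (_ : _ \o _ = id); last by apply/funext => q /=; rewrite rV_consK.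
by rewrite preimage_id product_measure1E// lte_mul_pinfty// ge0_fin_numE.
Qed.

HB.instance Definition _ := Measure_isSigmaFinite.Build _ _ _
  lebesgue_rV_step step_sigma_finite.

End step.

Fixpoint lebesgue_rV n : {sigma_finite_measure set 'rV[R]_n -> \bar R} :=
  match n with
  | 0 => \d_(0 : 'rV[R]_0)
  | n'.+1 => lebesgue_rV_step (lebesgue_rV n')
  end.

Lemma lebesgue_rV_box n (A : 'I_n -> set R) :
  (forall i, measurable (A i)) ->
  lebesgue_rV n [set v | forall i, A i (v ord0 i)] =
  (\prod_(i < n) lebesgue_measure (A i))%E.
Proof.
elim: n A => [|n IH] A mA /=.
  rewrite big_ord0 diracE mem_set//.
  by move=> [].
rewrite big_ord_recl -IH//.
rewrite /lebesgue_rV_step /pushforward.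
pose B := [set v : 'rV[R]_n | forall i, A (lift ord0 i) (v ord0 i)].
rewrite -/B.
have mB : measurable B.
  rewrite (_ : B = \big[setI/setT]_(i < n)
      ((fun v : 'rV[R]_n => v ord0 i) @^-1` A (lift ord0 i))).
    apply: bigsetI_measurable => i _.
    by rewrite -[X in measurable X]setTI; exact: measurable_coord.
  rewrite -bigcap_seq; apply/seteqP; split => v /= Bv i; first by move=> _; exact: Bv.
  by apply: (Bv i) => /=; rewrite mem_index_enum.
rewrite -(@product_measure1E _ _ _ _ _ (@lebesgue_measure R))//.
congr ((@lebesgue_measure R \x lebesgue_rV n)%E _).
  apply/seteqP; split => q /=.
    move=> Aq; split; first by have := Aq ord0; rewrite rV_cons0.
    by move=> i; have := Aq (lift ord0 i); rewrite rV_cons_lift.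
  move=> [q1 q2] i; case: (unliftP ord0 i) => [j|] ->.
    by rewrite rV_cons_lift; exact: q2.
  by rewrite rV_cons0.
exact: mA.
Qed.

End lebesgue_rV.

Section calculus.
Context {R : realType}.

(* The library norm on matrices is the sup norm, so the Euclidean one is
   defined here. *)
Definition enorm n (x : 'rV[R]_n) : R :=
  Num.sqrt (\sum_(i < n) x ord0 i ^+ 2).

Definition partial n (i : 'I_n) (f : 'rV[R]_n -> R) : 'rV[R]_n -> R :=
  fun x => 'D_(delta_mx ord0 i) f x.

Definition grad n (f : 'rV[R]_n -> R) (x : 'rV[R]_n) : 'rV[R]_n :=
  \row_i partial i f x.

(* C^infinity: every iterated partial derivative is differentiable, hence
   continuous. *)
Definition smooth n (f : 'rV[R]_n -> R) : Prop :=
  forall (s : seq 'I_n) (x : 'rV[R]_n),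
    differentiable (foldr (@partial n) f s) x.

Definition confining n (V : 'rV[R]_n -> R) : Prop :=
  (forall A : R, exists r : R, forall x, r <= enorm x -> A <= V x) /\
  (forall beta : R, 0 < beta ->
    (@lebesgue_rV R n).-integrable setT (fun x => (expR (- beta * V x))%:E)).

End calculus.

Section stochastic_calculus.
Context {R : realType} {d} {Omega : measurableType d}.
Variable P : probability Omega R.

(* Only times t >= 0 matter. *)
Definition complete_filtration (F : R -> set (set Omega)) : Prop :=
  [/\ forall t, 0 <= t -> sigma_algebra setT (F t),
      forall t, 0 <= t -> F t `<=` measurable,
      forall s t, 0 <= s -> s <= t -> F s `<=` F t &
      forall N, measurable N -> P N = 0%E -> F 0 N].

Definition measurable_wrt d' (T : measurableType d') (G : set (set Omega))
    (f : Omega -> T) : Prop :=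
  forall B, measurable B -> G (f @^-1` B).

Definition adapted d' (T : measurableType d') (F : R -> set (set Omega))
    (X : R -> Omega -> T) : Prop :=
  forall t, 0 <= t -> measurable_wrt (F t) (X t).

Definition brownian_motion m (F : R -> set (set Omega))
    (W : R -> Omega -> 'rV[R]_m) : Prop :=
  [/\ {ae P, forall w, W 0 w = 0},
      {ae P, forall w, {within `[0, +oo[%classic, continuous (W ^~ w)}},
      adapted F W,
      forall s t, 0 <= s -> s < t -> forall A B, F s A -> measurable B ->
        P (A `&` (fun w => (W t w - W s w)%R) @^-1` B) =
        (P A * P ((fun w => (W t w - W s w)%R) @^-1` B))%E &
      forall s t, 0 <= s -> s < t -> forall B : 'I_m -> set R,
        (forall i, measurable (B i)) ->
        P [set w | forall i, B i (W t w ord0 i - W s w ord0 i)] =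
        (\prod_(i < m) normal_prob 0 (Num.sqrt (t - s)) (B i))%E].

(* Elementary integrands \sum_(i < k) e_i 1_[s_i, s_(i+1)) on [0, t], with
   e_i bounded and F_(s_i)-measurable, and their integrals against B. *)
Definition elementary (F : R -> set (set Omega)) (t : R)
    (k : nat) (s : nat -> R) (e : nat -> Omega -> R) : Prop :=
  [/\ s 0%N = 0, s k = t, forall i, (i < k)%N -> s i <= s i.+1,
      forall i, (i < k)%N -> measurable_wrt (F (s i)) (e i) &
      exists M : R, forall i w, (i < k)%N -> `|e i w| <= M].

Definition elementary_process (k : nat) (s : nat -> R)
    (e : nat -> Omega -> R) (r : R) (w : Omega) : R :=
  \sum_(i < k) e i w * \1_(`[s i, s i.+1[%classic) r.

Definition elementary_integral (B : R -> Omega -> R) (k : nat) (s : nat -> R)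
    (e : nat -> Omega -> R) (w : Omega) : R :=
  \sum_(i < k) e i w * (B (s i.+1) w - B (s i) w).

(* I is (a version of) the Ito integral over [0, t] of the square-integrable
   adapted process H against B: the L^2 limit of the integrals of elementary
   processes that converge to H in L^2([0, t] x Omega). *)
Definition ito_integral (F : R -> set (set Omega)) (B : R -> Omega -> R)
    (t : R) (H : R -> Omega -> R) (I : Omega -> R) : Prop :=
  [/\ measurable_fun (`[0, t]%classic `*` [set: Omega])
        (fun q : R * Omega => H q.1 q.2),
      forall r, 0 <= r -> r <= t -> measurable_wrt (F r) (H r),
      (\int[P]_w \int[lebesgue_measure]_(r in `[0%R, t]) (H r w ^+ 2)%:E
         < +oo)%E,
      measurable_fun setT I &
      exists (k : nat -> nat) (s : nat -> nat -> R)
             (e : nat -> nat -> Omega -> R),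
        [/\ forall n, elementary F t (k n) (s n) (e n),
            (fun n => \int[P]_w \int[lebesgue_measure]_(r in `[0%R, t])
              ((H r w - elementary_process (k n) (s n) (e n) r w) ^+ 2)%:E)%E
              @ \oo --> 0%E &
            (fun n => \int[P]_w
              ((I w - elementary_integral B (k n) (s n) (e n) w) ^+ 2)%:E)%E
              @ \oo --> 0%E]].

(* Z is a solution of dZ = b(Z) dt + sigma(Z) dW, Z_0 = z, that is, for
   every t, Z_t = z + \int_0^t b(Z_s) ds + \int_0^t sigma(Z_s) dW_s almost
   surely; this contains Z_0 = z (take t = 0).
   Vectors are rows: the j-th noise term is \sum_i sigma(Z)_(i, j) dW^i. *)
Definition sde_solution m n (F : R -> set (set Omega))
    (W : R -> Omega -> 'rV[R]_m)
    (b : 'rV[R]_n -> 'rV[R]_n) (sigma : 'rV[R]_n -> 'M[R]_(m, n))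
    (z : 'rV[R]_n) (Z : R -> Omega -> 'rV[R]_n) : Prop :=
  [/\ adapted F Z,
      forall w, {within `[0, +oo[%classic, continuous (Z ^~ w)},
      forall t (j : 'I_n), 0 <= t -> {ae P, forall w,
        (@lebesgue_measure R).-integrable `[0, t]
          (fun s => (b (Z s w) ord0 j)%:E)} &
      forall t (j : 'I_n), 0 <= t -> exists I : 'I_m -> Omega -> R,
        (forall i, ito_integral F (fun s w => W s w ord0 i) t
                     (fun s w => sigma (Z s w) i j) (I i)) /\
        {ae P, forall w, Z t w ord0 j =
          z ord0 j
          + \int[lebesgue_measure]_(s in `[0, t]) b (Z s w) ord0 j
          + \sum_(i < m) I i w}].

Definition markov_semigroup n (K : R -> R.-pker 'rV[R]_n ~> 'rV[R]_n) : Prop :=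
  (forall z A, measurable A -> K 0 z A = \d_z A) /\
  (forall s t, 0 <= s -> 0 <= t -> forall z A, measurable A ->
    K (s + t) z A = (\int[K s z]_y K t y A)%E).

(* K_t(z, .) is the law at time t of the solution started at z; the solution
   exists for every z and all solutions have that law. *)
Definition solution_semigroup m n (F : R -> set (set Omega))
    (W : R -> Omega -> 'rV[R]_m)
    (b : 'rV[R]_n -> 'rV[R]_n) (sigma : 'rV[R]_n -> 'M[R]_(m, n))
    (K : R -> R.-pker 'rV[R]_n ~> 'rV[R]_n) : Prop :=
  markov_semigroup K /\
  forall z, (exists Z, sde_solution F W b sigma z Z) /\
    (forall Z, sde_solution F W b sigma z Z ->
      forall t A, 0 <= t -> measurable A -> P (Z t @^-1` A) = K t z A).

Definition invariant_distribution m n (F : R -> set (set Omega))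
    (W : R -> Omega -> 'rV[R]_m)
    (b : 'rV[R]_n -> 'rV[R]_n) (sigma : 'rV[R]_n -> 'M[R]_(m, n))
    (mu : probability 'rV[R]_n R) : Prop :=
  exists K : R -> R.-pker 'rV[R]_n ~> 'rV[R]_n,
    solution_semigroup F W b sigma K /\
    forall t A, 0 <= t -> measurable A -> (\int[mu]_z K t z A)%E = mu A.

End stochastic_calculus.

(* The phase space R^d x R^d is 'rV_(d + d): z = row_mx x p. *)
Section langevin.
Context {R : realType}.
Variable d : nat.
Implicit Types (V g : 'rV[R]_d -> R) (z : 'rV[R]_(d + d)).

Definition langevin_drift (beta gamma : R) V g z : 'rV[R]_(d + d) :=
  let x := lsubmx z in let p := rsubmx z in
  row_mx (g x *: p)
         (- (g x *: grad V x) + beta^-1 *: grad g x - (gamma * g x) *: p).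

Definition langevin_diffusion (beta gamma : R) g z : 'M[R]_(d, d + d) :=
  row_mx 0 (Num.sqrt (2 * gamma * beta^-1 * g (lsubmx z)))%:M.

Definition hamiltonian V z : R := enorm (rsubmx z) ^+ 2 / 2 + V (lsubmx z).

Definition partition_function (beta : R) V : R :=
  \int[@lebesgue_rV R (d + d)]_z expR (- beta * hamiltonian V z).

Definition gibbs_density (beta : R) V z : R :=
  (partition_function beta V)^-1 * expR (- beta * hamiltonian V z).

End langevin.

(* Main.v *)
(* The coefficient [sigma(x) = sqrt (2 gamma g(x) / beta)] depends only on [x],
   whose paths are C^1, so the Ito integral is the pathwise expression
   [sigma(x_t) W_t - \int W_s (sigma(x_s))' ds].  The SDE thus becomes, path by
   path, an ordinary differential equation for [(x, p - sigma(x) W)], with locally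
   Lipschitz coefficients of linear growth: solutions exist, are unique, and are
   limits of a splitting scheme driven by the increments of [W], jointly with the
   initial point.  Independence of the increments makes the scheme a Markov
   chain, and the semigroup property passes to the limit.
   One step of the scheme is a Hamiltonian part, made of shears
   [x_i += h g(x) k(p_i)] and [p_i += h c_i(x)], followed by an Ornstein-Uhlenbeck
   part that preserves the Gibbs weight [exp (- beta H)] exactly.  The shears are
   explicit changes of variables, and they preserve the Gibbs weight up to
   [O(h^2)]: the first-order terms cancel because the drift term
   [beta^-1 grad g] makes the field divergence free for the Gibbs density.  Over
   [t / h] steps the error is [O(h)], hence the limit semigroup preserves the
   Gibbs measure against bounded continuous functions, which determine it. *)
Require Import Defs.
From HB Require Import structures.
From mathcomp Require Import all_boot all_order all_algebra.
From mathcomp Require Import all_classical all_reals all_analysis.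
From mathcomp Require Import measurable_realfun.
From mathcomp Require Import ring lra.

Set Implicit Arguments.
Unset Strict Implicit.
Unset Printing Implicit Defensive.

Import Order.TTheory GRing.Theory Num.Theory.
Import numFieldNormedType.Exports.

Local Open Scope classical_set_scope.
Local Open Scope ring_scope.

(** * Measurability and integration on row vectors *)

(** The usual argument integrates the generator against the Gibbs density; here [grad g] is only
    Lipschitz and [grad V] is unbounded, so no smooth semigroup is at hand. A discrete scheme asks
    for no more than Lipschitz coefficients and turns invariance into changes of variables. Three
    obstacles shape it. A shear of [x_i] with unbounded momentum may fold over, hence [cutoff]. The
    error of a step grows polynomially with the energy, so it is measured by the Gibbs weight at
    inverse temperature [beta / 2]: half of the exponent pays for the polynomial and for the
    exponential of the energy increment. Finally, the stochastic equation holds almost surely at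
    each single time while the scheme works along every path: the Brownian motion is first replaced
    by a version without exceptional paths, and solutions are identified at the times [k / (n + 1)]
    before continuity extends the identity. All constants are gathered in one [B >= 1] that may be
    enlarged at will, so its powers are never optimised. *)

Section rV_measurability.
Context {R : realType}.

Lemma norm_rV_leP n (v : 'rV[R]_n) (c : R) : 0 <= c ->
  (`|v| <= c) <-> (forall i, `|v ord0 i| <= c).
Proof.
move=> c0; rewrite [`|v|]/(Num.norm v)/= mx_normrE; split.
  move=> vc i; apply: le_trans vc.
  exact: (le_bigmax _ (fun ij : 'I_1 * 'I_n => `|v ij.1 ij.2|) (ord0, i)).
by move=> vc; apply/bigmax_leP; split => // -[i j] _ /=; rewrite ord1.
Qed.

Lemma norm_coord_le n (v : 'rV[R]_n) i : `|v ord0 i| <= `|v|.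
Proof. exact: (norm_rV_leP v (normr_ge0 v)).1. Qed.

Lemma cvg_rVP n (T : Type) (F : set_system T) {FF : Filter F}
    (f : T -> 'rV[R]_n) (l : 'rV[R]_n) :
  f @ F --> l <-> forall i, (fun t => f t ord0 i) @ F --> l ord0 i.
Proof.
split=> [fl i|fl].
  apply/cvgrPdist_le => e e0; move/cvgrPdist_le : fl => /(_ e e0).
  apply: filterS => t; move/(norm_rV_leP _ (ltW e0))=> /(_ i).
  by rewrite !mxE.
apply/cvgrPdist_le => e e0.
have : \forall t \near F, forall i, `|l ord0 i - f t ord0 i| <= e.
  apply: filter_forall => i.
  by move: (fl i) => /cvgrPdist_le /(_ e e0).
apply: filterS => t te; apply/norm_rV_leP => [|i]; first exact: ltW.
by rewrite !mxE.
Qed.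

Lemma continuous_rVP n (T : topologicalType) (f : T -> 'rV[R]_n) :
  continuous f <-> forall i, continuous (fun t => f t ord0 i).
Proof.
split=> [fl i x|fl x]; last by apply/cvg_rVP => i; exact: fl.
by have /cvg_rVP := fl x; exact.
Qed.

Lemma continuous_coord n (i : 'I_n) : continuous (fun v : 'rV[R]_n => v ord0 i).
Proof. by apply: (continuous_rVP (@id 'rV[R]_n)).1 => x; exact: cvg_id. Qed.

Let box n (c : nat * 'rV[int]_n) : set 'rV[R]_n :=
  [set v | forall i, Num.floor (v ord0 i * c.1.+1%:R) = c.2 ord0 i].

Let measurable_box n (c : nat * 'rV[int]_n) : measurable (box c).
Proof.
rewrite (_ : box c = \bigcap_(i in [set: 'I_n])
    ((fun v : 'rV[R]_n => v ord0 i * c.1.+1%:R) @^-1`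
       `[(c.2 ord0 i)%:~R, (c.2 ord0 i + 1)%:~R[%classic)).
  apply: fin_bigcap_measurable => // i _.
  rewrite -[X in measurable X]setTI.
  have : measurable_fun setT (fun v : 'rV[R]_n => v ord0 i * c.1.+1%:R).
    by apply: measurable_funM => //; exact: measurable_coord.
  by apply => //; exact: measurable_itv.
apply/seteqP; split => v /= vc i; last first.
  by have := vc i Logic.I; rewrite /preimage/= in_itv/= -floor_eq => /eqP.
by move=> _; rewrite /preimage/= in_itv/= -floor_eq vc.
Qed.

(** The sigma-algebra is generated by the coordinates, so open sets have to be built: an open set is
    the union of the grid cells [box c] that it contains, and the cells have a countable index
    type. *)
Lemma open_measurable_rV n (U : set 'rV[R]_n) : open U -> measurable U.
Proof.
move=> oU.
pose B (k : nat) : set 'rV[R]_n :=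
  if unpickle k is Some c then (if `[< box c `<=` U >] then box c else set0)
  else set0.
rewrite (_ : U = \bigcup_k B k).
  apply: bigcupT_measurable => k; rewrite /B.
  case: unpickle => [c|]; last exact: measurable0.
  by case: ifP => _; [exact: measurable_box|exact: measurable0].
apply/seteqP; split => [x Ux|x [k _]]; last first.
  rewrite /B; case: unpickle => // c; case: ifPn => // /asboolP cU; exact: cU.
have /nbhs_ballP[e' /= e'0 e'U] : nbhs x U by move: oU; rewrite openE => /(_ _ Ux).
(* Cells of side [1 / (m + 1) < e']: the one containing [x] lies in the ball. *)
pose m := Num.truncn (e'^-1).
have mE : (m.+1%:R : R)^-1 < e'.
  rewrite invf_plt ?posrE//; exact: truncnS_gt.
pose c := (m, \row_i Num.floor (x ord0 i * m.+1%:R)) : nat * 'rV[int]_n.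
have xc : box c x by move=> i /=; rewrite mxE.
exists (pickle c) => //; rewrite /B pickleK.
suff -> : `[< box c `<=` U >] by [].
apply/asboolP => y yc; apply: e'U.
split=> // i j; rewrite ord1 /ball/=; apply: le_lt_trans mE.
have := yc j; rewrite /= mxE => /esym/eqP; rewrite floor_eq => /andP[y1 y2].
have /andP[x1 x2] := floor_itv (x ord0 j * m.+1%:R).
move/eqP: (yc j); rewrite /= mxE floor_eq => /andP[y3 y4].
have m0 : (0 : R) < m.+1%:R by [].
rewrite -[leRHS]mul1r ler_pdivlMr// -[X in _ * X](gtr0_norm m0) -normrM mulrBl ler_norml.
by move: x1 x2 y3 y4; rewrite !intrD; lra.
Qed.

Lemma continuous_measurable_rV n (f : 'rV[R]_n -> R) :
  continuous f -> measurable_fun setT f.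
Proof.
move/continuousP => cf; apply: (measurability _ (RGenOpens.measurableE R)).
move=> _ [_ [a [b ->] <-]]; rewrite setTI; apply: open_measurable_rV.
exact/cf/interval_open.
Qed.

End rV_measurability.

(** Covers functions given piece by piece, such as a step function, where [k t] is the index of the
    grid interval containing [t]. *)
Lemma measurable_fun_glue d1 d2 (T : measurableType d1) (U : measurableType d2)
    (D : set T) (k : T -> nat) (f : nat -> T -> U) :
  measurable_fun D k -> (forall n, measurable_fun D (f n)) ->
  measurable_fun D (fun t => f (k t) t).
Proof.
move=> mk mf mD B mB.
rewrite (_ : _ `&` _ = \bigcup_n ((D `&` k @^-1` [set n]) `&` (D `&` f n @^-1` B))).
  apply: bigcupT_measurable => n; apply: measurableI; first exact: mk.
  exact: mf.
apply/seteqP; split => [t /= [Dt Bt]|t /= [n _ [[Dt <-] [_ Bt]]]//].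
by exists (k t).
Qed.

Lemma measurable_truncn (R : realType) (c : R) :
  measurable_fun setT (fun t : R => Num.truncn (t / c)).
Proof.
move=> _ B _; rewrite setTI.
rewrite (_ : _ @^-1` B = \bigcup_(n in B) ((fun t => Num.truncn (t / c)) @^-1` [set n])).
  apply: bigcup_measurable => n _.
  have mc : measurable_fun setT (fun t : R => t / c) by apply: measurable_funM.
  case: n => [|n].
    rewrite (_ : _ @^-1` _ = (fun t => t / c) @^-1` `]-oo, 1[%classic).
      by rewrite -[X in measurable X]setTI; apply: mc => //; exact: measurable_itv.
    apply/seteqP; split => t /=; rewrite in_itv/=.
      by move=> h; rewrite -[1]/(1%:R) -truncn_le_nat h.
    by move=> h; apply/eqP; rewrite -leqn0 truncn_le_nat.
  rewrite (_ : _ @^-1` _ = (fun t => t / c) @^-1` `[n.+1%:R, n.+2%:R[%classic).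
    by rewrite -[X in measurable X]setTI; apply: mc => //; exact: measurable_itv.
  apply/seteqP; split => t /=; rewrite in_itv/=.
    by move=> h; rewrite -truncn_le_nat h leqnn andbT -truncn_gt_nat h.
  move=> /andP[h1 h2]; apply/eqP; rewrite eqn_leq truncn_le_nat h2/=.
  by rewrite truncn_gt_nat.
by apply/seteqP; split => [t Bt|t [n Bn /= ->]//]; exists (Num.truncn (t / c)).
Qed.

(** * Measures with a density *)

Section density_measure.
Context {d} {T : measurableType d} {R : realType}.
Local Open Scope ereal_scope.
Variables (mu : {measure set T -> \bar R}) (w : T -> R).
Hypotheses (mw : measurable_fun setT w) (w0 : forall x, (0 <= w x)%R).

(** The two proofs are arguments of the measure itself, so that its canonical measure structure can
    be inferred from [density mw w0]. *)
Definition density & measurable_fun setT w & (forall x, (0 <= w x)%R) :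
  set T -> \bar R := fun A => \int[mu]_(x in A) (w x)%:E.

Local Notation nu := (density mw w0).

Import HBNNSimple.

Let nu0 : nu set0 = 0. Proof. exact: integral_set0. Qed.

Let nu_ge0 A : 0 <= nu A.
Proof. by apply: integral_ge0 => x _; rewrite lee_fin. Qed.

Let nu_sigma_additive : semi_sigma_additive nu.
Proof.
move=> F mF tF mUF; rewrite /density ge0_integral_bigcup//=.
- by apply: is_cvg_ereal_nneg_natsum_cond => n _ _; exact: nu_ge0.
- exact/measurable_funTS/measurable_EFinP.
- by move=> x _; rewrite lee_fin.
Qed.

HB.instance Definition _ := isMeasure.Build _ _ _ nu nu0 nu_ge0
  nu_sigma_additive.

(** Both sides are limits along one increasing sequence of simple functions; on an indicator the
    identity is the definition of [density]. *)
Lemma ge0_integral_density (f : T -> \bar R) :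
  measurable_fun setT f -> (forall x, 0 <= f x) ->
  \int[nu]_x f x = \int[mu]_x (f x * (w x)%:E).
Proof.
move=> mf f0.
pose h := nnsfun_approx measurableT mf.
have fE x : f x = lim ((EFin \o h n) x @[n --> \oo]).
  by apply/esym/cvg_lim => //; exact: cvg_nnsfun_approx.
have mhn n : measurable_fun setT (EFin \o h n).
  by apply/measurable_EFinP; exact: measurable_funP.
have mwE : measurable_fun setT (EFin \o w) by exact/measurable_EFinP.
transitivity (lim (\int[nu]_x (EFin \o h n) x @[n --> \oo])).
  under eq_integral => x _ do rewrite fE.
  apply: monotone_convergence => //.
  - by move=> n x _ //=; rewrite lee_fin.
  - by move=> x _ a b ab; rewrite lee_fin; exact/lefP/nd_nnsfun_approx.
transitivity (lim (\int[mu]_x ((h n x)%:E * (w x)%:E) @[n --> \oo])); last first.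
  apply/esym.
  have fg x : f x * (w x)%:E = lim (((EFin \o h n) x * (w x)%:E) @[n --> \oo]).
    by apply/esym/cvg_lim => //; apply: cvgeZr => //; exact: cvg_nnsfun_approx.
  under eq_integral => x _ do rewrite fg.
  apply: monotone_convergence => //.
  - by move=> n; exact: emeasurable_funM.
  - by move=> n x _ /=; rewrite mule_ge0// lee_fin.
  - move=> x _ a b ab /=; rewrite lee_wpmul2r// lee_fin//.
    exact/lefP/nd_nnsfun_approx.
apply/congr_lim/funext => n /=.
have hE x : (h n x)%:E = \sum_(y \in range (h n)) (y * \1_(h n @^-1` [set y]) x)%:E.
  by rewrite /= fimfunE -fsumEFin.
have my y : measurable_fun setT (fun x => (y * \1_(h n @^-1` [set y]) x)%:E).
  by apply/measurable_EFinP; exact: measurable_funM.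
under [LHS]eq_integral => x _ do rewrite hE.
rewrite ge0_integral_fsum//; last by move=> m x _; exact: nnfun_muleindic_ge0.
under [RHS]eq_integral => x _.
  rewrite hE ge0_mule_fsuml; last by move=> y; exact: nnfun_muleindic_ge0.
  over.
rewrite ge0_integral_fsum//; last 2 first.
  - by move=> y; apply: emeasurable_funM.
  - by move=> m x _; rewrite mule_ge0 ?lee_fin// -lee_fin nnfun_muleindic_ge0.
apply: eq_fsbigr => r rhn.
have r0 : (0 <= r)%R by move: rhn; rewrite inE => -[x _ <-].
under [LHS]eq_integral do rewrite EFinM.
rewrite ge0_integralZl_EFin//; last by apply/measurable_EFinP.
rewrite integral_indic// setIT.
under [RHS]eq_integral do rewrite EFinM -muleA.
rewrite ge0_integralZl_EFin//; last 2 first.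
- by move=> x _; rewrite mule_ge0 ?lee_fin// indicE.
- by apply: emeasurable_funM => //; exact/measurable_EFinP.
congr (_ * _); transitivity (\int[mu]_(x in h n @^-1` [set r]) (w x)%:E) => //.
rewrite integral_mkcond; apply: eq_integral => x _.
by rewrite epatch_indic muleC.
Qed.

End density_measure.

(** * Boxes determine finite measures *)

Section boxes.
Context {R : realType}.

Definition rV_box n (B : 'I_n -> set R) : set 'rV[R]_n :=
  [set v | forall i, B i (v ord0 i)].

Lemma measurable_rV_box n (B : 'I_n -> set R) :
  (forall i, measurable (B i)) -> measurable (rV_box B).
Proof.
move=> mB.
rewrite (_ : rV_box B = \bigcap_(i in [set: 'I_n])
    ((fun v : 'rV[R]_n => v ord0 i) @^-1` B i)).
  apply: fin_bigcap_measurable => // i _; rewrite -[X in measurable X]setTI.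
  exact: measurable_coord.
by apply/seteqP; split => [v vB i _|v vB i]; [exact: vB|exact: (vB i Logic.I)].
Qed.

(** Boxes are stable under intersection and generate the sigma-algebra; as the total mass is finite,
    the constant cover by [setT] is enough. *)
Lemma rV_box_measure_unique n (m1 m2 : {measure set 'rV[R]_n -> \bar R}) :
  (forall B : 'I_n -> set R, (forall i, measurable (B i)) ->
    m1 (rV_box B) = m2 (rV_box B)) ->
  (m1 setT < +oo)%E -> forall A, measurable A -> m1 A = m2 A.
Proof.
move=> m12 m1T.
pose G := [set A | exists B : 'I_n -> set R,
   (forall i, measurable (B i)) /\ A = rV_box B].
have GT : G setT.
  by exists (fun=> setT); split => //; apply/seteqP; split.
apply: (@measure_unique _ _ _ G (fun=> setT)) => //.
- apply/seteqP; split.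
    apply: smallest_sub; first exact: smallest_sigma_algebra.
    move=> A; rewrite -bigcup_seq/= => -[i _] [B mB <-]; apply: sub_sigma_algebra.
    rewrite setTI; exists (fun j => if j == i then B else setT); split.
      by move=> j; case: ifP.
    apply/seteqP; split => v /=; last by move/(_ i); rewrite eqxx.
    by move=> Bv j; case: eqP => // ->.
  apply: smallest_sub; first exact: sigma_algebra_measurable.
  by move=> A [B [mB ->]]; exact: measurable_rV_box.
- move=> A B [A' [mA ->]] [B' [mB ->]].
  exists (fun i => A' i `&` B' i); split; first by move=> i; exact: measurableI.
  apply/seteqP; split => v /=; first by move=> [? ?] i.
  by move=> AB; split => i; have [] := AB i.
- by rewrite bigcup_const.
- by move=> A [B [mB ->]]; exact: m12.
Qed.

End boxes.

(** * Tonelli for the recursively defined Lebesgue measure *)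

Section lebesgue_rV_fubini.
Context {R : realType}.
Local Open Scope ereal_scope.
Notation leb := (@lebesgue_measure R).

Lemma measurable_row_mx m n :
  measurable_fun setT (fun q : 'rV[R]_m * 'rV[R]_n => row_mx q.1 q.2).
Proof.
apply: measurable_fun_rVP => i.
case: (split_ordP i) => j ->; under eq_fun do rewrite ?row_mxEl ?row_mxEr.
  exact: (measurableT_comp (measurable_coord j) measurable_fst).
exact: (measurableT_comp (measurable_coord j) measurable_snd).
Qed.

Lemma measurable_lsubmx m n : measurable_fun setT (fun z : 'rV[R]_(m + n) => lsubmx z).
Proof.
apply: measurable_fun_rVP => i; under eq_fun do rewrite mxE.
exact: measurable_coord.
Qed.

Lemma measurable_rsubmx m n : measurable_fun setT (fun z : 'rV[R]_(m + n) => rsubmx z).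
Proof.
apply: measurable_fun_rVP => i; under eq_fun do rewrite mxE.
exact: measurable_coord.
Qed.

Lemma measurable_rV_cons1 n t : measurable_fun setT (fun u : 'rV[R]_n => rV_cons (t, u)).
Proof.
apply: (measurableT_comp (@measurable_rV_cons R n)).
by apply: measurable_fun_pair.
Qed.

Lemma ge0_integral_rV_cons n (F : 'rV[R]_n.+1 -> \bar R) :
  measurable_fun setT F -> (forall v, 0 <= F v) ->
  \int[lebesgue_rV n.+1]_v F v = \int[leb]_t \int[lebesgue_rV n]_u F (rV_cons (t, u)).
Proof.
move=> mF F0; transitivity (\int[leb \x lebesgue_rV n]_q F (rV_cons q)).
  have := @ge0_integral_pushforward _ _ (measurableTypeR R * 'rV[R]_n)%type
    _ _ _ (@measurable_rV_cons R n)
    (leb \x lebesgue_rV n) setT F measurableT mF (fun v _ => F0 v).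
  by rewrite preimage_setT.
rewrite fubini_tonelli1//; apply: (measurableT_comp mF).
exact: measurable_rV_cons.
Qed.

Lemma ge0_integral_rV_cons_swap n (F : 'rV[R]_n.+1 -> \bar R) :
  measurable_fun setT F -> (forall v, 0 <= F v) ->
  \int[lebesgue_rV n.+1]_v F v = \int[lebesgue_rV n]_u \int[leb]_t F (rV_cons (t, u)).
Proof.
move=> mF F0; rewrite ge0_integral_rV_cons//.
apply: (fubini_tonelli (m1 := leb) (m2 := lebesgue_rV n)
  (fun q => F (rV_cons q))) => //.
apply: (measurableT_comp mF); exact: measurable_rV_cons.
Qed.

Lemma ge0_integral_rV_prod n (f : 'I_n -> R -> R) :
  (forall i, measurable_fun setT (f i)) -> (forall i t, (0 <= f i t)%R) ->
  \int[lebesgue_rV n]_v (\prod_(i < n) f i (v ord0 i))%:E =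
  \prod_(i < n) \int[leb]_t (f i t)%:E.
Proof.
elim: n f => [|n IH] f mf f0.
  rewrite big_ord0 (eq_integral (cst 1)); last by move=> v _; rewrite big_ord0.
  by rewrite integral_cst// mul1e /= diracT.
rewrite ge0_integral_rV_cons; last 2 first.
- apply/measurable_EFinP/measurable_prod => i _.
  exact: measurableT_comp (mf i) (measurable_coord i).
- by move=> v; rewrite lee_fin prodr_ge0.
have E t u : (\prod_(i < n.+1) f i (rV_cons (t, u) ord0 i))%R =
    (f ord0 t * \prod_(i < n) f (lift ord0 i) (u ord0 i))%R.
  rewrite big_ord_recl rV_cons0; congr (_ * _)%R.
  by apply: eq_bigr => i _; rewrite rV_cons_lift.
have mp : measurable_fun setT
    (fun u : 'rV[R]_n => (\prod_(i < n) f (lift ord0 i) (u ord0 i))%:E).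
  apply/measurable_EFinP/measurable_prod => i _.
  exact: measurableT_comp (mf _) (measurable_coord i).
rewrite big_ord_recl -IH//.
under eq_integral => t _.
  under eq_integral => u _ do rewrite E EFinM.
  rewrite ge0_integralZl_EFin//; last by move=> u _; rewrite lee_fin prodr_ge0.
  over.
rewrite ge0_integralZr//=.
- by apply/measurable_EFinP; exact: mf.
- by move=> t _; rewrite lee_fin.
- by apply: integral_ge0 => u _; rewrite lee_fin prodr_ge0.
Qed.

Lemma measurable_integral_snd d1 d2 (T1 : measurableType d1) (T2 : measurableType d2)
    (m2 : {sigma_finite_measure set T2 -> \bar R}) (f : T1 * T2 -> \bar R) :
  measurable_fun setT f -> (forall q, 0 <= f q) ->
  measurable_fun setT (fun x => \int[m2]_y f (x, y)).
Proof. by move=> mf f0; exact: measurable_fun_fubini_tonelli_F. Qed.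

(** The induction on [m] follows the recursion that defines [lebesgue_rV]; for [m = 0] the outer
    measure is a Dirac mass, which evaluates the inner integral at the empty row. *)
Lemma ge0_integral_row_mx m n (F : 'rV[R]_(m + n) -> \bar R) :
  measurable_fun setT F -> (forall v, 0 <= F v) ->
  \int[lebesgue_rV (m + n)]_z F z =
  \int[lebesgue_rV m]_x \int[lebesgue_rV n]_p F (row_mx x p).
Proof.
elim: m F => [|m IH] F mF F0.
  rewrite integral_dirac//=; last first.
    apply: (@measurable_integral_snd _ _ _ _ _ (fun q => F (row_mx q.1 q.2))) => //.
    apply: (measurableT_comp mF); exact: measurable_row_mx.
  rewrite diracT mul1e; apply: eq_integral => p _; congr F.
  apply/rowP => i; case: (split_ordP i) => j -> //; first by case: j.
  by rewrite row_mxEr; congr (p _ _); exact: val_inj.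
transitivity (\int[leb]_t \int[lebesgue_rV (m + n)]_u F (rV_cons (t, u))).
  exact: (@ge0_integral_rV_cons (m + n) F).
rewrite ge0_integral_rV_cons; last 2 first.
- apply: (@measurable_integral_snd _ _ _ _ _ (fun q => F (row_mx q.1 q.2))) => //.
  apply: (measurableT_comp mF); exact: measurable_row_mx.
- by move=> x; apply: integral_ge0.
apply: eq_integral => t _.
rewrite IH; last 2 first.
- exact: (measurableT_comp mF (@measurable_rV_cons1 _ t)).
- by move=> v; exact: F0.
apply: eq_integral => x _; apply: eq_integral => p _; congr F.
apply/rowP => i; case: (unliftP ord0 i) => [j|] ->.
  rewrite rV_cons_lift/=; case: (split_ordP j) => k ->.
    rewrite row_mxEl (_ : lift _ _ = lshift n (lift ord0 k)); last exact: val_inj.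
    by rewrite (@row_mxEl _ _ m.+1) rV_cons_lift.
  rewrite row_mxEr (_ : lift _ _ = rshift m.+1 k); last exact: val_inj.
  by rewrite row_mxEr.
rewrite rV_cons0 (_ : ord0 = lshift n (ord0 : 'I_m.+1)); last exact: val_inj.
by rewrite (@row_mxEl _ _ m.+1) rV_cons0.
Qed.

End lebesgue_rV_fubini.

(** * Change of variables in one coordinate *)

Section coordinate_substitution.
Context {R : realType}.
Local Open Scope ereal_scope.
Notation leb := (@lebesgue_measure R).

(** Generalises [rV_cons] to an insertion at position [i]: Lebesgue measure is defined by splitting
    off coordinate 0, but the shears move an arbitrary coordinate. *)
Definition rV_ins n (i : 'I_n.+1) (q : R * 'rV[R]_n) : 'rV[R]_n.+1 :=
  \row_j oapp (fun k => q.2 ord0 k) q.1 (unlift i j).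

Lemma measurable_rV_ins n (i : 'I_n.+1) : measurable_fun setT (@rV_ins n i).
Proof.
apply: measurable_fun_rVP => j; under eq_fun do rewrite mxE.
case: (unlift i j) => [k|] /=; last exact: measurable_fst.
exact: (measurableT_comp (measurable_coord k) measurable_snd).
Qed.

Lemma rV_ins0 n q : rV_ins ord0 q = rV_cons q :> 'rV[R]_n.+1.
Proof.
apply/rowP => j; rewrite mxE; case: (unliftP ord0 j) => [k|] -> /=.
  by rewrite rV_cons_lift.
by rewrite rV_cons0.
Qed.

Lemma rV_ins_lift n (j : 'I_n.+1) t s (u : 'rV[R]_n) :
  rV_ins (lift ord0 j) (t, rV_cons (s, u)) = rV_cons (s, rV_ins j (t, u)).
Proof.
apply/rowP => k; rewrite mxE.
case: (unliftP ord0 k) => [l|] ->; rewrite ?rV_cons_lift ?rV_cons0/=.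
  rewrite mxE; case: (unliftP j l) => [m|] ->.
    rewrite (_ : lift ord0 (lift j m) = lift (lift ord0 j) (lift ord0 m)); last first.
      by apply: val_inj; rewrite /= /bump /= !add1n ltnS addnS.
    by rewrite liftK/= rV_cons_lift.
  by rewrite unlift_none.
rewrite (_ : ord0 = lift (lift ord0 j) (ord0 : 'I_n.+1)); last exact: val_inj.
by rewrite liftK/= rV_cons0.
Qed.

(** Any coordinate may be integrated first: insertion at [lift ord0 j] commutes with the insertion
    of the first coordinate, and the induction handles [j]. *)
Lemma ge0_integral_rV_ins n (i : 'I_n.+1) (F : 'rV[R]_n.+1 -> \bar R) :
  measurable_fun setT F -> (forall v, 0 <= F v) ->
  \int[lebesgue_rV n.+1]_v F v =
  \int[lebesgue_rV n]_u \int[leb]_t F (rV_ins i (t, u)).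
Proof.
elim: n i F => [|n IH] i F mF F0; case: (unliftP ord0 i) => [j|] ->.
- by case: j.
- rewrite (ge0_integral_rV_cons_swap mF F0).
  by under [RHS]eq_integral do under eq_integral do rewrite rV_ins0.
- rewrite ge0_integral_rV_cons// [RHS]ge0_integral_rV_cons; last 2 first.
  + have := @measurable_integral_snd R _ _ 'rV[R]_n.+1 (measurableTypeR R) leb
      (fun q => F (rV_ins (lift ord0 j) (q.2, q.1))); apply => //.
    apply: (measurableT_comp mF); apply: (measurableT_comp (measurable_rV_ins _)).
    exact: measurable_swap.
  + by move=> u; apply: integral_ge0.
  apply: eq_integral => t _; rewrite (IH j); last 2 first.
  + exact: (measurableT_comp mF (@measurable_rV_cons1 _ _ t)).
  + by [].
  by under [RHS]eq_integral do under eq_integral do rewrite rV_ins_lift.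
- rewrite (ge0_integral_rV_cons_swap mF F0).
  by under [RHS]eq_integral do under eq_integral do rewrite rV_ins0.
Qed.

Definition rV_upd n (z : 'rV[R]_n) (k : 'I_n) (t : R) : 'rV[R]_n :=
  \row_j if j == k then t else z ord0 j.

Lemma rV_upd_ins n (k : 'I_n.+1) t s (u : 'rV[R]_n) :
  rV_upd (rV_ins k (t, u)) k s = rV_ins k (s, u).
Proof.
apply/rowP => j; rewrite !mxE; case: (unliftP k j) => [l|] ->.
  by rewrite eq_sym (negbTE (neq_lift _ _)).
by rewrite eqxx.
Qed.

Lemma rV_updE n (z : 'rV[R]_n) k t : rV_upd z k t ord0 k = t.
Proof. by rewrite mxE eqxx. Qed.

Lemma rV_upd_ne n (z : 'rV[R]_n) k t j : j != k -> rV_upd z k t ord0 j = z ord0 j.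
Proof. by move=> /negbTE jk; rewrite mxE jk. Qed.

Lemma measurable_rV_upd d (T : measurableType d) n k (f : T -> 'rV[R]_n) (g : T -> R) :
  measurable_fun setT f -> measurable_fun setT g ->
  measurable_fun setT (fun x => rV_upd (f x) k (g x)).
Proof.
move=> mf mg; apply: measurable_fun_rVP => j; under eq_fun do rewrite mxE.
by case: (j == k) => //; exact: (measurableT_comp (measurable_coord j) mf).
Qed.

(** Only coordinate [k] moves, so the substitution is one-dimensional on each line parallel to that
    axis, with [J] in the role of the derivative; no determinant is formed. *)
Lemma ge0_integral_rV_upd n (k : 'I_n) (phi J : 'rV[R]_n -> R) (F : 'rV[R]_n -> \bar R) :
  measurable_fun setT phi -> measurable_fun setT J -> (forall z, (0 <= J z)%R) ->
  measurable_fun setT F -> (forall z, 0 <= F z) ->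
  (forall z (f : R -> \bar R), measurable_fun setT f -> (forall t, 0 <= f t) ->
    \int[leb]_t (f (phi (rV_upd z k t)) * (J (rV_upd z k t))%:E) = \int[leb]_t f t) ->
  \int[lebesgue_rV n]_z (F (rV_upd z k (phi z)) * (J z)%:E) = \int[lebesgue_rV n]_z F z.
Proof.
case: n k phi J F => [[]//|n] k phi J F mphi mJ J0 mF F0 sub.
rewrite (ge0_integral_rV_ins k); last 2 first.
- apply: emeasurable_funM; last exact/measurable_EFinP.
  by apply: (measurableT_comp mF); apply: measurable_rV_upd.
- by move=> z; rewrite mule_ge0// lee_fin.
rewrite (ge0_integral_rV_ins k)//; apply: eq_integral => u _.
under eq_integral do rewrite rV_upd_ins.
rewrite -(sub (rV_ins k (0%R, u)) (fun t => F (rV_ins k (t, u))))//.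
  by under [RHS]eq_integral do rewrite rV_upd_ins.
apply: (measurableT_comp mF); apply: (measurableT_comp (measurable_rV_ins k)).
exact: measurable_fun_pair.
Qed.

End coordinate_substitution.

Definition image_measure d d' (T1 : measurableType d) (T2 : measurableType d')
    (R : realType) (m : {measure set T1 -> \bar R}) (f : T1 -> T2)
    (mf : measurable_fun setT f) : {measure set T2 -> \bar R} :=
  measure_function_pushforward__canonical__measure_function_Measure m mf.

(** * Substitution on the real line *)

Section line_substitution.
Context {R : realType}.
Notation leb := (@lebesgue_measure R).

(** The lower bound [c] on the derivative makes [phi] an increasing bijection of the line. The
    measure with density [psi], pushed forward by [phi], gives []phi al, phi be]] the mass
    [phi be - phi al] by the fundamental theorem of calculus, hence it is Lebesgue measure. *)
Lemma increasing_substitution (phi psi : R -> R) (c : R) (f : R -> \bar R) :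
  0 < c -> (forall t : R, is_derive t 1 phi (psi t)) -> continuous psi ->
  (forall t, c <= psi t) -> measurable_fun setT f -> (forall t, 0 <= f t)%E ->
  (\int[leb]_t (f (phi t) * (psi t)%:E) = \int[leb]_t f t)%E.
Proof.
move=> c0 dphi cpsi psic mf f0.
have cphi : continuous phi.
  by move=> t; apply: differentiable_continuous; apply/derivable1_diffP.
have inc a b : a <= b -> c * (b - a) <= phi b - phi a.
  rewrite le_eqVlt => /predU1P[->|ab]; first by rewrite !subrr mulr0.
  have [x _ ->] := MVT ab (fun x _ => dphi x) (continuous_subspaceT cphi).
  by rewrite ler_pM2r ?subr_gt0.
have phi_lt a b : (phi a < phi b) = (a < b).
  apply/idP/idP => [|ab]; last first.
    rewrite -subr_gt0; apply: lt_le_trans (inc _ _ (ltW ab)).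
    by rewrite mulr_gt0// subr_gt0.
  apply: contraTT; rewrite -!leNgt => ba; rewrite -subr_ge0.
  by apply: le_trans (inc _ _ ba); rewrite mulr_ge0 ?subr_ge0// ltW.
have phi_le a b : (phi a <= phi b) = (a <= b) by rewrite !leNgt phi_lt.
have sur y : exists t, phi t = y.
  (* As [phi] grows at rate at least [c], its values at [- M] and [M] enclose [y]. *)
  pose M := `|y - phi 0| / c.
  have M0 : 0 <= M by rewrite divr_ge0// ltW.
  have h1 : phi (- M) <= y.
    have := inc (- M) 0 _; rewrite oppr_le0 sub0r opprK => /(_ M0).
    rewrite /M mulrCA divff ?gt_eqF// mulr1 => h.
    by have := ler_norm (phi 0 - y); rewrite distrC; lra.
  have h2 : y <= phi M.
    have := inc 0 M M0; rewrite subr0 /M mulrCA divff ?gt_eqF// mulr1.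
    by have := ler_norm (y - phi 0); lra.
  have MM : - M <= M by rewrite ge0_cp.
  have [//||t _ <-] := @IVT R phi (- M) M y MM; last by exists t.
    exact: continuous_subspaceT.
  by rewrite (min_idPl _) ?(max_idPr _) ?h1 ?h2// phi_le.
have mpsi : measurable_fun setT psi by exact: continuous_measurable_fun.
have psi0 x : 0 <= psi x by apply: le_trans (psic x); rewrite ltW.
have mphi : measurable_fun setT phi by exact: continuous_measurable_fun.
pose nu := density leb mpsi psi0.
pose nu' := @image_measure _ _ (measurableTypeR R) (measurableTypeR R) R nu phi mphi.
have H A : measurable A -> leb A = nu' A.
  apply: lebesgue_measure_unique => _ [[a b]] /= _ <-.
  have [al ala] := sur a; have [be beb] := sur b.
  rewrite lebesgue_measure_itv/= lte_fin -ala -beb.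
  rewrite /nu' /image_measure/= /pushforward (_ : phi @^-1` _ = `]al, be]%classic); last first.
    by apply/seteqP; split => t /=; rewrite !in_itv/= phi_lt phi_le.
  rewrite /nu /density.
  case: ifPn => [|]; last first.
    rewrite phi_lt -leNgt => ba; rewrite set_itv_ge ?integral_set0//.
    by rewrite bnd_simp -leNgt.
  rewrite phi_lt => ab.
  rewrite integral_itv_obnd_cbnd; last exact/measurable_funTS/measurable_EFinP.
  rewrite (continuous_FTC2 ab (F := phi))//.
  - exact: continuous_subspaceT.
  - split.
    + by move=> x _.
    + by apply: cvg_at_right_filter; exact: cphi.
    + by apply: cvg_at_left_filter; exact: cphi.
  - by move=> x _; rewrite derive1E derive_val.
transitivity (\int[nu]_t (f (phi t)))%E.
  by rewrite ge0_integral_density//; exact: measurableT_comp.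
have -> : (\int[leb]_t f t = \int[nu']_t f t)%E.
  by apply/esym; apply: eq_measure_integral => A mA _; rewrite -H.
rewrite [RHS](@ge0_integral_pushforward _ _ (measurableTypeR R) (measurableTypeR R))//.
Qed.

End line_substitution.

(** * Integrals over compact intervals *)

Section interval_integrals.
Context {R : realType}.
Notation leb := (@lebesgue_measure R).
Implicit Types (f : R -> R) (a b c e : R).

Lemma bounded_integrable_itv f a b c : measurable_fun `[a, b] f ->
  (forall s, a <= s <= b -> `|f s| <= c) ->
  leb.-integrable `[a, b] (EFin \o f).
Proof.
move=> mf fc; apply: measurable_bounded_integrable => //.
  rewrite /= lebesgue_measure_itv/=; case: ifP => _; last exact: ltry.
  by rewrite -EFinD ltry.
exists c; split => [|M cM x /=]; first exact: num_real.
by rewrite in_itv/= => /fc xc; apply: le_trans xc _; exact: ltW.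
Qed.

Lemma integrable_itvS f a b c e : a <= c -> e <= b ->
  leb.-integrable `[a, b] (EFin \o f) -> leb.-integrable `[c, e] (EFin \o f).
Proof.
move=> ac eb; apply: integrableS => //; apply: subset_itv; rewrite bnd_simp//.
Qed.

Lemma Rintegral_itv_cat f a b c : a <= b -> b <= c ->
  leb.-integrable `[a, c] (EFin \o f) ->
  \int[leb]_(s in `[a, c]) f s =
  \int[leb]_(s in `[a, b]) f s + \int[leb]_(s in `[b, c]) f s.
Proof.
move=> ab bc intf.
have := Rintegral_itvB intf; move=> /(_ b); rewrite !bnd_simp => /(_ ab bc) h.
have : \int[leb]_(s in `]b, c]) f s = \int[leb]_(s in `[b, c]) f s.
  apply: Rintegral_itv_obnd_cbnd.
  by apply: integrableS intf => //; apply: subset_itv; rewrite bnd_simp.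
by move: h => /[swap] -> <-; rewrite addrC subrK.
Qed.

Lemma Rintegral_itv_cst a b c : a <= b -> \int[leb]_(_ in `[a, b]) c = c * (b - a).
Proof.
move=> ab; rewrite Rintegral_cst//= lebesgue_measure_itv/= lte_fin.
move: ab; rewrite le_eqVlt => /predU1P[->|->//].
by rewrite ltxx subrr.
Qed.

(** The bound is asked on [[a, b[] only: step functions are constant on half-open grid intervals and
    jump at the right end. *)
Lemma le_norm_Rintegral_itv f a b e : a <= b ->
  leb.-integrable `[a, b] (EFin \o f) ->
  (forall s, a <= s < b -> `|f s| <= e) ->
  `|\int[leb]_(s in `[a, b]) f s| <= e * (b - a).
Proof.
move=> ab intf fe.
rewrite -Rintegral_itv_bndo_bndc; last first.
  by apply: integrableS intf => //; apply: subset_itv; rewrite bnd_simp.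
have intf' : leb.-integrable `[a, b[ (EFin \o f).
  by apply: integrableS intf => //; apply: subset_itv; rewrite bnd_simp.
apply: le_trans (le_normr_Rintegral _ intf') _ => //.
have -> : e * (b - a) = \int[leb]_(s in `[a, b[) e.
  rewrite Rintegral_cst//= lebesgue_measure_itv/= lte_fin.
  move: ab; rewrite le_eqVlt => /predU1P[->|->//].
  by rewrite ltxx subrr.
apply: le_Rintegral => //.
- exact: integrable_norm.
- apply: measurable_bounded_integrable => //.
    rewrite /= lebesgue_measure_itv/=; case: ifP => _; last exact: ltry.
    by rewrite -EFinD ltry.
  exists `|e|; split => [|M cM x _ /=]; first exact: num_real.
  exact: ltW.
Qed.

Lemma Rintegral_itv_approx f a b c e : a <= b ->
  leb.-integrable `[a, b] (EFin \o f) ->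
  (forall s, a <= s < b -> `|f s - c| <= e) ->
  `|\int[leb]_(s in `[a, b]) f s - (b - a) * c| <= e * (b - a).
Proof.
move=> ab intf fc.
have intc : leb.-integrable `[a, b] (EFin \o cst c).
  apply: (@bounded_integrable_itv _ _ _ `|c|) => //.
rewrite mulrC -(Rintegral_itv_cst c ab) -RintegralB//.
apply: le_norm_Rintegral_itv => //.
by have := integrableB _ intf intc; exact.
Qed.

Lemma continuous_itv_integrable f a b : continuous f ->
  leb.-integrable `[a, b] (EFin \o f).
Proof.
move=> cf; apply: continuous_compact_integrable; first exact: segment_compact.
exact: continuous_subspaceT.
Qed.

End interval_integrals.

(** * Convergence of one-step methods *)

Section one_step_methods.
Context {R : realType} {N : nat}.
Notation leb := (@lebesgue_measure R).
Variables (G : R -> 'rV[R]_N -> 'rV[R]_N) (h : nat -> R)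
  (Gn : nat -> R -> 'rV[R]_N -> 'rV[R]_N).

Definition locally_lipschitz := forall T r : R, exists L, 0 < L /\
  forall (s : R) y y', 0 <= s <= T -> `|y| <= r -> `|y'| <= r ->
    `|G s y - G s y'| <= L * `|y - y'|.

(** Growth is asked of the scheme; local boundedness of the field [G] then follows from consistency,
    see [G_bounded]. *)
Definition linear_growth := forall T : R, exists C, 0 < C /\
  \forall n \near \oo, forall (t : R) y, 0 <= t <= T -> `|Gn n t y| <= C * (1 + `|y|).

(** The scheme is evaluated at the left end [t] of a grid interval and the field at any time [s] of
    that interval, so consistency also absorbs the variation of the field in time. *)
Definition consistent := forall T r e : R, 0 < e -> \forall n \near \oo,
  forall (s t : R) y, 0 <= t -> t <= s -> s <= T -> s <= t + h n -> `|y| <= r ->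
    `|Gn n t y - G s y| <= e.

Fixpoint one_step n (y0 : 'rV[R]_N) k : 'rV[R]_N :=
  if k is k'.+1 then
    one_step n y0 k' + h n *: Gn n (k'%:R * h n) (one_step n y0 k')
  else y0.

(** [Num.truncn] sends negative numbers to 0, so the step function rests at [y0] for [t < 0], and
    limits exist at every real time. *)
Definition step_fun n y0 (t : R) := one_step n y0 (Num.truncn (t / h n)).

Hypotheses (h_gt0 : forall n, 0 < h n) (h_cvg0 : h @ \oo --> 0)
  (Gcont : forall y, continuous (G ^~ y)) (Glip : locally_lipschitz)
  (Ggrowth : linear_growth) (Gcons : consistent).

(** A solution up to a defect [e]: exact solutions have [e = 0], step functions a small [e]. The
    radius [r] belongs to the notion because the field is Lipschitz on balls only. *)
Definition approx_sol (y0 : 'rV[R]_N) (T r e : R) (y : R -> 'rV[R]_N) :=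
  [/\ forall t : R, 0 <= t <= T -> `|y t| <= r,
      forall j, leb.-integrable `[0, T] (fun s => (G s (y s) ord0 j)%:E) &
      forall (t : R) j, 0 <= t <= T ->
        `|y t ord0 j - y0 ord0 j - \int[leb]_(s in `[0, t]) G s (y s) ord0 j| <= e].

(* Gronwall with the weight [expR (2 L t)]: the integral of the weight is at
   most half of the weight, so the weighted supremum absorbs it. *)
Lemma approx_sol_dist y0 (T r L e e' : R) y y' : 0 < L -> 0 <= e -> 0 <= e' ->
  (forall (s : R) z z', 0 <= s <= T -> `|z| <= r -> `|z'| <= r ->
    `|G s z - G s z'| <= L * `|z - z'|) ->
  approx_sol y0 T r e y -> approx_sol y0 T r e' y' ->
  forall t : R, 0 <= t <= T -> `|y t - y' t| <= 2 * (e + e') * expR (2 * L * T).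
Proof.
move=> L0 e0 e'0 lip [yr iy ye] [yr' iy' ye'] t tT.
have T0 : 0 <= T by move: tT; lra.
pose w (s : R) := expR (2 * L * s).
have w0 s : 0 < w s by exact: expR_gt0.
pose S := [set `|y s - y' s| / w s | s in `[0, T]].
have w1 (s : R) : 0 <= s -> 1 <= w s.
  by move=> s0; rewrite -expR0 ler_expR !mulr_ge0// ltW.
(* The weighted distances are bounded because both solutions stay in the ball of radius [r] and the
   weight is at least 1. *)
have supS : has_sup S.
  split; first by exists (`|y 0 - y' 0| / w 0), 0 => //=; rewrite in_itv/= lexx.
  exists (r + r) => _ [s /= sT <-]; move: sT; rewrite in_itv/= => sT.
  have s0 : 0 <= s by case/andP: sT.
  rewrite ler_pdivrMr//; apply: (@le_trans _ _ (r + r)).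
    by apply: le_trans (ler_normB _ _) _; rewrite lerD ?yr ?yr'.
  by rewrite ler_peMr ?w1//; have := yr _ sT; have := normr_ge0 (y s); lra.
pose m := sup S.
have Sm (s : R) : 0 <= s <= T -> `|y s - y' s| <= m * w s.
  move=> sT; rewrite -ler_pdivrMr//; apply: ub_le_sup; first exact: supS.2.
  by exists s => //=; rewrite in_itv/=.
have m0 : 0 <= m by have := le_trans (normr_ge0 _) (Sm _ tT); rewrite pmulr_lge0.
have step (s : R) : 0 <= s <= T -> `|y s - y' s| <= (e + e') + m * w s / 2.
  move=> sT; have /andP[s0 sT'] := sT.
  have ee0 : 0 <= e + e' + m * w s / 2.
    by rewrite !addr_ge0// divr_ge0// mulr_ge0// ltW.
  apply/(norm_rV_leP _ ee0) => j; rewrite !mxE.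
  have i1 := integrable_itvS (lexx 0) sT' (iy j).
  have i2 := integrable_itvS (lexx 0) sT' (iy' j).
  have E : y s ord0 j - y' s ord0 j =
    (y s ord0 j - y0 ord0 j - \int[leb]_(u in `[0, s]) G u (y u) ord0 j)
    - (y' s ord0 j - y0 ord0 j - \int[leb]_(u in `[0, s]) G u (y' u) ord0 j)
    + \int[leb]_(u in `[0, s]) (G u (y u) ord0 j - G u (y' u) ord0 j).
    by rewrite RintegralB//; ring.
  rewrite E; apply: le_trans (ler_normD _ _) _; apply: lerD.
    by apply: le_trans (ler_normB _ _) _; apply: lerD; [exact: ye|exact: ye'].
  have i12 : leb.-integrable `[0, s]
      (EFin \o (fun u => G u (y u) ord0 j - G u (y' u) ord0 j)).
    by have := integrableB _ i1 i2; exact.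
  apply: le_trans (le_normr_Rintegral _ i12) _ => //.
  have cw : continuous (fun u => L * m * w u).
    move=> u; apply: cvgM; first exact: cvg_cst.
    apply: continuous_comp; last exact: continuous_expR.
    exact: mulrl_continuous.
  apply: (@le_trans _ _ (\int[leb]_(u in `[0, s]) (L * m * w u))).
    apply: le_Rintegral => //.
    - exact: integrable_norm.
    - exact: continuous_itv_integrable.
    - move=> u /=; rewrite in_itv/= => /andP[u0 us].
      have uT : 0 <= u <= T by rewrite u0 (le_trans us).
      have := norm_coord_le (G u (y u) - G u (y' u)) j; rewrite !mxE.
      move/le_trans; apply; apply: le_trans (lip _ _ _ uT (yr _ uT) (yr' _ uT)) _.
      by rewrite -mulrA ler_pM2l// Sm.
  have [->|s_neq0] := eqVneq s 0.
    by rewrite set_itv1 Rintegral_set1 divr_ge0// mulr_ge0// ltW.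
  have s_gt0 : 0 < s by rewrite lt_neqAle eq_sym s_neq0.
  have dw : forall x : R, is_derive x 1 (fun u => m / 2 * w u) (L * m * w x).
    move=> x; rewrite /w; apply: is_derive_eq.
    by rewrite /GRing.scale/=; field.
  have cF : continuous (fun u => m / 2 * w u).
    by move=> x; apply: differentiable_continuous; apply/derivable1_diffP.
  rewrite /Rintegral (continuous_FTC2 s_gt0 (F := fun u => m / 2 * w u))//=.
  - rewrite mulrAC lerBlDr lerDl mulr_ge0 ?divr_ge0//; exact: ltW.
  - exact: continuous_subspaceT.
  - split.
    + by move=> x _.
    + by apply: cvg_at_right_filter; exact: cF.
    + by apply: cvg_at_left_filter; exact: cF.
  - by move=> x _; rewrite derive1E derive_val.
have mle : m <= (e + e') + m / 2.
  apply: ge_sup; first exact: supS.1.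
  move=> _ [s /= sT <-]; move: sT; rewrite in_itv/= => sT; rewrite ler_pdivrMr//.
  apply: le_trans (step _ sT) _; rewrite mulrDl mulrAC lerD2r ler_peMr ?addr_ge0//.
  by apply: w1; case/andP: sT.
have mle' : m <= 2 * (e + e') by lra.
apply: le_trans (Sm _ tT) _; apply: ler_pM => //; first exact: ltW.
by rewrite ler_expR ler_pM2l ?mulr_gt0//; case/andP: tT.
Qed.

(** Discrete Gronwall: one step multiplies [1 + |y|] by at most [1 + C * h n <= expR (C * h n)]. *)
Lemma one_step_bound n y0 (T C : R) k : 0 < C ->
  (forall (t : R) y, 0 <= t <= T -> `|Gn n t y| <= C * (1 + `|y|)) ->
  k%:R * h n <= T ->
  1 + `|one_step n y0 k| <= (1 + `|y0|) * expR (C * (k%:R * h n)).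
Proof.
move=> C0 gr; elim: k => [_|k IH kT] /=.
  by rewrite mul0r mulr0 expR0 mulr1.
have hn := h_gt0 n.
have kT' : k%:R * h n <= T by apply: le_trans kT; rewrite ler_pM2r// ler_nat.
have k0 : 0 <= k%:R * h n by rewrite mulr_ge0// ltW.
set Y := one_step n y0 k.
have g : `|Gn n (k%:R * h n) Y| <= C * (1 + `|Y|) by apply: gr; rewrite k0.
apply: (@le_trans _ _ ((1 + `|Y|) * (1 + C * h n))).
  have : `|Y + h n *: Gn n (k%:R * h n) Y| <= `|Y| + h n * (C * (1 + `|Y|)).
    apply: le_trans (ler_normD _ _) _; rewrite lerD2l normrZ gtr0_norm//.
    by rewrite ler_pM2l.
  by move=> H; apply: le_trans (lerD (lexx 1) H) _; lra.
apply: (@le_trans _ _ ((1 + `|y0|) * expR (C * (k%:R * h n)) * expR (C * h n))).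
  have q0 : 0 <= 1 + `|Y| by rewrite addr_ge0.
  have q1 : 0 <= 1 + C * h n by rewrite addr_ge0// mulr_ge0// ltW.
  exact: (ler_pM q0 q1 (IH kT') (expR_ge1Dx _)).
have -> : k.+1%:R * h n = k%:R * h n + h n by rewrite -natr1; ring.
by rewrite -mulrA -expRD -mulrDr.
Qed.

(** Consistency with [e = 1] and [s = t] puts [G] within 1 of a scheme of linear growth. *)
Lemma G_bounded (T r : R) : exists B, 0 <= B /\
  forall s y, 0 <= s <= T -> `|y| <= r -> `|G s y| <= B.
Proof.
have [C [C0 gr]] := Ggrowth T.
have [n [nP grn]] := filter_ex (filterI (Gcons T r ltr01) gr).
exists (1 + C * (1 + `|r|)); split; first by rewrite addr_ge0// mulr_ge0// ?addr_ge0// ltW.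
move=> s y sT yr; have /andP[s0 s1] := sT.
have := nP s s y s0 (lexx s) s1 _ yr; rewrite lerDl ltW ?h_gt0// => /(_ isT) H.
rewrite -(subrK (Gn n s y) (G s y)); apply: le_trans (ler_normD _ _) _.
rewrite distrC lerD//; apply: le_trans (grn _ _ sT) _.
by rewrite ler_pM2l// lerD2l (le_trans yr) ?ler_norm.
Qed.

Lemma measurable_G_step n y0 (k : 'I_N) :
  measurable_fun setT (fun s : R => G s (step_fun n y0 s) ord0 k).
Proof.
rewrite /step_fun; apply: (measurable_fun_glue
  (f := fun m (s : R) => G s (one_step n y0 m) ord0 k)); first exact: measurable_truncn.
move=> m; apply: continuous_measurable_fun => s.
by have /cvg_rVP := @Gcont (one_step n y0 m) s; exact.
Qed.

Lemma step_funE n y0 k (s : R) : k%:R * h n <= s < k.+1%:R * h n ->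
  step_fun n y0 s = one_step n y0 k.
Proof.
move=> ks; rewrite /step_fun (@truncn_def _ _ k)//.
by rewrite ler_pdivlMr ?ltr_pdivrMr.
Qed.

Lemma truncn_step n (t : R) : 0 <= t ->
  (Num.truncn (t / h n))%:R * h n <= t < (Num.truncn (t / h n)).+1%:R * h n.
Proof.
move=> t0; rewrite -ler_pdivlMr// -ltr_pdivrMr//; apply: truncn_itv.
by rewrite divr_ge0// ltW.
Qed.

(** [e * t] accumulates the consistency error over the complete steps, [B * h n] bounds the last,
    incomplete one. *)
Lemma step_fun_integral n y0 (T r e B : R) : 0 <= B ->
  (forall s, 0 <= s <= T -> `|step_fun n y0 s| <= r) ->
  (forall s y, 0 <= s <= T -> `|y| <= r -> `|G s y| <= B) ->
  (forall s t y, 0 <= t -> t <= s -> s <= T -> s <= t + h n -> `|y| <= r ->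
    `|Gn n t y - G s y| <= e) ->
  (forall j, leb.-integrable `[0, T] (fun s => (G s (step_fun n y0 s) ord0 j)%:E)) /\
  forall t j, 0 <= t <= T ->
    `|step_fun n y0 t ord0 j - y0 ord0 j -
       \int[leb]_(s in `[0, t]) G s (step_fun n y0 s) ord0 j| <= e * t + B * h n.
Proof.
move=> B0 yr GB cons; have hn := h_gt0 n.
have int j : leb.-integrable `[0, T] (EFin \o (fun s => G s (step_fun n y0 s) ord0 j)).
  apply: (@bounded_integrable_itv _ _ _ _ B).
    by apply: measurable_funTS; exact: measurable_G_step.
  move=> s sT; apply: le_trans (norm_coord_le _ _) _.
  by apply: GB => //; exact: yr.
split=> // t j /andP[t0 tT].
have grid k : k%:R * h n <= T ->
    `|one_step n y0 k ord0 j - y0 ord0 j -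
      \int[leb]_(s in `[0, k%:R * h n]) G s (step_fun n y0 s) ord0 j| <= e * (k%:R * h n).
  elim: k => [_|k IH kT].
    by rewrite /= mul0r set_itv1 Rintegral_set1 mulr0 !subrr normr0.
  have kT' : k%:R * h n <= T by apply: le_trans kT; rewrite ler_pM2r// ler_nat.
  have k0 : 0 <= k%:R * h n by rewrite mulr_ge0// ltW.
  have kk : k%:R * h n <= k.+1%:R * h n by rewrite ler_pM2r// ler_nat.
  have kE : k.+1%:R * h n - k%:R * h n = h n by rewrite -natr1; ring.
  rewrite (@Rintegral_itv_cat _ _ _ (k%:R * h n))//; last first.
    exact: integrable_itvS (int j).
  set Y := one_step n y0 k.
  have Yr : `|Y| <= r.
    by rewrite /Y -(@step_funE n y0 k (k%:R * h n)) ?yr ?k0// lexx/= ltr_pM2r// ltr_nat.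
  have := IH kT'; rewrite -/Y.
  have := @Rintegral_itv_approx _ (fun s => G s (step_fun n y0 s) ord0 j)
     (k%:R * h n) (k.+1%:R * h n) (Gn n (k%:R * h n) Y ord0 j) e kk
     (integrable_itvS k0 kT (int j)).
  rewrite kE /= -/Y => /(_ _)/wrap[s sk|].
    rewrite (step_funE _ sk) -/Y.
    have := norm_coord_le (Gn n (k%:R * h n) Y - G s Y) j; rewrite !mxE distrC.
    move/le_trans; apply; case/andP: sk => s1 s2; apply: cons => //.
      by apply: le_trans kT; exact: ltW.
    by move: s2; rewrite -natr1 mulrDl mul1r; exact: ltW.
  rewrite !mxE !ler_norml -natr1.
  set I1 := Rintegral _ _ _; set I2 := Rintegral _ _ _.
  by lra.
have := truncn_step n t0; set k := Num.truncn _ => kt; have /andP[k1 k2] := kt.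
have k0 : 0 <= k%:R * h n by rewrite mulr_ge0// ltW.
have := grid k (le_trans k1 tT).
rewrite (@Rintegral_itv_cat _ _ _ (k%:R * h n) t)//; last exact: integrable_itvS (int j).
rewrite (step_funE _ kt).
have : `|\int[leb]_(s in `[k%:R * h n, t]) G s (step_fun n y0 s) ord0 j| <=
    B * (t - k%:R * h n).
  apply: le_norm_Rintegral_itv => //; first exact: integrable_itvS (int j).
  move=> s /andP[s1 s2]; apply: le_trans (norm_coord_le _ _) _.
  have sT : 0 <= s <= T by rewrite (le_trans k0)//= (le_trans _ tT)// ltW.
  by apply: GB => //; exact: yr.
have : B * (t - k%:R * h n) <= B * h n.
  by apply: ler_wpM2l => //; move: k2; rewrite -natr1 mulrDl mul1r; lra.
(* [0 <= e] is read off the consistency bound at [s = t]. *)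
have : e * (k%:R * h n) <= e * t.
  apply: ler_wpM2l => //.
  have T0 : 0 <= T by exact: le_trans tT.
  have := @cons t t (step_fun n y0 t) t0 (lexx _) tT _ _.
  by rewrite lerDl ltW// yr ?t0// => /(_ isT isT); apply: le_trans.
set I1 := Rintegral _ _ _; set I2 := Rintegral _ _ _; set Y := one_step _ _ _ _ _.
rewrite !ler_norml.
by lra.
Qed.

Lemma step_fun_approx (y0_ : nat -> 'rV[R]_N) y0 (T : R) : 0 <= T ->
  y0_ @ \oo --> y0 -> exists r, forall e, 0 < e ->
    \forall n \near \oo, approx_sol y0 T r e (step_fun n (y0_ n)).
Proof.
move=> T0 y0cvg; have [C [C0 gr]] := Ggrowth T.
(* The bound of [one_step_bound] for starting points within 1 of [y0]. *)
pose r := (1 + (`|y0| + 1)) * expR (C * T).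
have [B [B0 GB]] := G_bounded T r.
exists r => e e0.
(* The three thirds pay for consistency over a time at most [T], for the incomplete last step and
   for the error of the starting point. *)
have e'0 : 0 < e / (T + 1) / 3 by rewrite !divr_gt0// ltr_wpDl.
have e30 : 0 < e / 3 by rewrite divr_gt0.
have hB : \forall n \near \oo, B * h n <= e / 3.
  have e4 : 0 < e / 3 / (B + 1) by rewrite divr_gt0// ltr_wpDl.
  move/cvgrPdist_le : h_cvg0 => /(_ _ e4); apply: filterS => n.
  rewrite sub0r normrN gtr0_norm// ler_pdivlMr ?ltr_wpDl// => H.
  by apply: le_trans H; rewrite mulrC ler_pM2l// lerDl.
near=> n.
have d1 : `|y0 - y0_ n| <= e / 3.
  by near: n; move/cvgrPdist_le : y0cvg; apply.
have d2 : `|y0 - y0_ n| <= 1.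
  by near: n; move/cvgrPdist_le : y0cvg; apply.
have grn : forall (t : R) y, 0 <= t <= T -> `|Gn n t y| <= C * (1 + `|y|) by near: n.
have yr s : 0 <= s <= T -> `|step_fun n (y0_ n) s| <= r.
  move=> /andP[s0 sT].
  have /andP[k1 k2] := truncn_step n s0.
  have := @one_step_bound n (y0_ n) T C (Num.truncn (s / h n)) C0 grn (le_trans k1 sT).
  rewrite -/(step_fun n (y0_ n) s) => H.
  apply: (@le_trans _ _ (1 + `|step_fun n (y0_ n) s|)); first by rewrite lerDr.
  apply: le_trans H _; apply: ler_pM; rewrite ?addr_ge0// ?expR_ge0//.
    rewrite lerD2l -(subrKC y0 (y0_ n)); apply: le_trans (ler_normD _ _) _.
    by rewrite lerD2l distrC.
  by rewrite ler_expR ler_pM2l// (le_trans k1).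
have cons : forall s t y, 0 <= t -> t <= s -> s <= T -> s <= t + h n -> `|y| <= r ->
    `|Gn n t y - G s y| <= e / (T + 1) / 3.
  by near: n; exact: Gcons.
have hBn : B * h n <= e / 3 by near: n.
have [i1 i2] := step_fun_integral B0 yr GB cons.
split=> // t j tT; have := i2 t j tT.
have := norm_coord_le (y0 - y0_ n) j; rewrite !mxE.
have : e / (T + 1) / 3 * t <= e / 3.
  rewrite mulrAC ler_pM2r// -mulrA ler_piMr ?(ltW e0)//.
  by rewrite mulrC ler_pdivrMr ?ltr_wpDl// mul1r; case/andP: tT; lra.
set I := Rintegral _ _ _; rewrite !ler_norml => H1 H2 H3.
move: d1 => /(le_trans (norm_coord_le _ j)); rewrite !mxE ler_norml.
by lra.
Unshelve. all: by end_near. Qed.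

Definition ode_sol (y0 : 'rV[R]_N) y := forall T, 0 <= T -> exists r, approx_sol y0 T r 0 y.

Lemma ode_sol_lipschitz y0 y (T : R) : ode_sol y0 y -> 0 <= T -> exists2 B, 0 <= B &
  forall s t, 0 <= s <= T -> 0 <= t <= T -> `|y t - y s| <= B * `|t - s|.
Proof.
move=> ysol T0; have [r [yr yi ye]] := ysol _ T0.
have [B [B0 GB]] := G_bounded T r; exists B => //.
suff main s t : 0 <= s -> s <= t -> t <= T -> `|y t - y s| <= B * (t - s).
  move=> s t /andP[s0 sT] /andP[t0 tT]; have [st|ts] := leP s t.
    by rewrite [`|t - s|]ger0_norm ?subr_ge0// main.
  by rewrite distrC [`|t - s|]ltr0_norm ?subr_lt0// opprB main// ltW.
move=> s0 st tT; have t0 := le_trans s0 st.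
have bs0 : 0 <= B * (t - s) by rewrite mulr_ge0// subr_ge0.
apply/(norm_rV_leP _ bs0) => j; rewrite !mxE.
have := ye t j; have := ye s j; rewrite s0 t0 tT (le_trans st tT) => /(_ isT) + /(_ isT).
rewrite (@Rintegral_itv_cat _ _ _ s t)//; last exact: integrable_itvS (yi j).
have : `|\int[leb]_(u in `[s, t]) G u (y u) ord0 j| <= B * (t - s).
  apply: le_norm_Rintegral_itv => //; first exact: integrable_itvS (yi j).
  move=> u /andP[u1 u2]; apply: le_trans (norm_coord_le _ _) _.
  have uT : 0 <= u <= T by rewrite (le_trans s0)//= (le_trans _ tT)// ltW.
  by apply: GB => //; exact: yr.
set I := Rintegral _ _ _; set I' := Rintegral _ _ _.
by rewrite !normr_le0 !ler_norml => H /eqP H1 /eqP H2; lra.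
Qed.

(** Starting point and final time both vary with [n]: in the semigroup property the second half of
    the path starts where the chain stands after the first half, at a grid time near the wanted one.
    The horizon [t + 1] leaves room for grid times beyond [t]. *)
Lemma ode_sol_cvg (y0_ : nat -> 'rV[R]_N) y0 y (K : nat -> nat) (t : R) :
  ode_sol y0 y -> y0_ @ \oo --> y0 -> 0 <= t ->
  (fun n => (K n)%:R * h n) @ \oo --> t ->
  (fun n => one_step n (y0_ n) (K n)) @ \oo --> y t.
Proof.
move=> ysol y0cvg t0 Kt; have T0 : 0 <= t + 1 by rewrite addr_ge0.
have [r [yr yi ye]] := ysol _ T0.
have [r' r'P] := step_fun_approx T0 y0cvg.
have [L [L0 Lip]] := Glip (t + 1) (Num.max r r').
have [B B0 yB] := ode_sol_lipschitz ysol T0.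
apply/cvgrPdist_le => e e0.
pose w := expR (2 * L * (t + 1)).
have w0 : 0 < w by exact: expR_gt0.
have e'0 : 0 < e / 2 / (2 * w) by rewrite !divr_gt0// mulr_gt0.
have e''0 : 0 < e / 2 / (B + 1) by rewrite !divr_gt0// ltr_wpDl.
near=> n.
have Kn1 : `|t - (K n)%:R * h n| <= 1 by near: n; move/cvgrPdist_le : Kt; apply.
have Kn2 : `|t - (K n)%:R * h n| <= e / 2 / (B + 1).
  by near: n; move/cvgrPdist_le : Kt; apply.
have ap : approx_sol y0 (t + 1) r' (e / 2 / (2 * w)) (step_fun n (y0_ n)).
  by near: n; exact: r'P.
have hn := h_gt0 n.
pose s := (K n)%:R * h n.
have s0 : 0 <= s by rewrite mulr_ge0// ltW.
have sT : s <= t + 1 by move: Kn1; rewrite -/s ler_norml; lra.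
have -> : one_step n (y0_ n) (K n) = step_fun n (y0_ n) s.
  by rewrite (@step_funE n _ (K n))// /s lexx/= ltr_pM2r// ltr_nat.
rewrite -(subrKA (y s)); apply: le_trans (ler_normD _ _) _.
have -> : e = e / 2 + e / 2 by rewrite -mulrDl -mulr2n -[e *+ 2]mulr_natr mulfK.
apply: lerD.
  apply: le_trans (yB _ _ _ _) _; rewrite ?s0 ?sT ?t0 ?lerDl/= ?ler01//.
  apply: le_trans (ler_wpM2l B0 Kn2) _.
  by rewrite mulrCA ler_piMr ?(ltW (divr_gt0 e0 _))// ler_pdivrMr ?ltr_wpDl// mul1r lerDl.
have h1 : approx_sol y0 (t + 1) (Num.max r r') 0 y.
  by split=> // u uT; rewrite le_max yr.
have h2 : approx_sol y0 (t + 1) (Num.max r r') (e / 2 / (2 * w)) (step_fun n (y0_ n)).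
  by case: ap => a1 a2 a3; split=> // u uT; rewrite le_max a1 ?orbT.
have := approx_sol_dist L0 (lexx 0) (ltW e'0) Lip h1 h2; move=> /(_ s).
rewrite s0 sT => /(_ isT) /le_trans; apply.
rewrite add0r -/w (_ : 2 * _ * w = e / 2)//.
by field; rewrite gt_eqF.
Unshelve. all: by end_near. Qed.

(** No Picard iteration: the step functions have vanishing defect, so [approx_sol_dist] makes them
    Cauchy, uniformly on [[0, T]], and the limit inherits the integral equation. *)
Lemma ode_sol_exists y0 : exists y, [/\ ode_sol y0 y,
  forall t, (fun n => step_fun n y0 t) @ \oo --> y t & y 0 = y0].
Proof.
have cst_cvg : (fun _ : nat => y0) @ \oo --> y0 by exact: cvg_cst.
have cau t : cvg ((fun n => step_fun n y0 t) @ \oo).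
  have [t0|t0] := ltP t 0.
    have -> : (fun n => step_fun n y0 t) = (fun=> y0); last exact: is_cvg_cst.
    apply/funext => n; rewrite /step_fun truncn_floor ifF//.
    by apply/negbTE; rewrite -ltNge ltr_pdivrMr// mul0r.
  have [r rP] := step_fun_approx t0 cst_cvg.
  have [L [L0 Lip]] := Glip t r.
  apply: cauchy_cvg; apply/cauchy_ballP => e e0.
  pose w := expR (2 * L * t).
  have w0 : 0 < w by exact: expR_gt0.
  have e'0 : 0 < e / (8 * w) by rewrite !divr_gt0// mulr_gt0.
  have [M _ MP] := rP _ e'0.
  exists ((fun n => step_fun n y0 t) @` [set n | (M <= n)%N],
          (fun n => step_fun n y0 t) @` [set n | (M <= n)%N]).
    by split; exists M => // n /= Mn; exists n.
  move=> [_ _] [/= [n Mn <-] [m Mm <-]].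
  rewrite -ball_normE/=.
  have := approx_sol_dist L0 (ltW e'0) (ltW e'0) Lip (MP _ Mn) (MP _ Mm).
  move=> /(_ t); rewrite t0 lexx => /(_ isT) /le_lt_trans; apply.
  rewrite -/w (_ : 2 * _ * w = e / 2); last by field; rewrite gt_eqF.
  by rewrite ltr_pdivrMr// ltr_pMr// ltr1n.
pose y t := lim ((fun n => step_fun n y0 t) @ \oo).
have ycvg t : (fun n => step_fun n y0 t) @ \oo --> y t by exact: cau.
exists y; split=> //; last first.
  apply/esym; apply: (cvg_unique _ _ (ycvg 0)) => //.
  have -> : (fun n => step_fun n y0 0) = (fun=> y0); last exact: cvg_cst.
  by apply/funext => n; rewrite /step_fun mul0r truncn0.
move=> T T0; have [r rP] := step_fun_approx T0 cst_cvg.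
have yr t : 0 <= t <= T -> `|y t| <= r.
  move=> tT; apply: (cvgr_to_le (cvg_norm (ycvg t))).
  by have := rP 1 ltr01; apply: filterS => n [+ _ _]; exact.
have [L [L0 Lip]] := Glip T r; have [B [B0 GB]] := G_bounded T r.
(* Letting one index of the Cauchy estimate tend to infinity makes the convergence uniform in
   time. *)
have unif e : 0 < e -> \forall n \near \oo, forall t, 0 <= t <= T ->
    `|step_fun n y0 t - y t| <= e.
  move=> e0; pose w := expR (2 * L * T); have w0 : 0 < w by exact: expR_gt0.
  have e'0 : 0 < e / (4 * w) by rewrite !divr_gt0// mulr_gt0.
  have [M _ MP] := rP _ e'0; exists M => // n /= Mn t tT.
  apply: (cvgr_to_le (cvg_norm (cvgB (cvg_cst _) (ycvg t)))).
  exists M => // m /= Mm.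
  have := approx_sol_dist L0 (ltW e'0) (ltW e'0) Lip (MP _ Mn) (MP _ Mm) tT.
  by move/le_trans; apply; rewrite -/w (_ : 2 * _ * w = e)//; field; rewrite gt_eqF.
have int j : leb.-integrable `[0, T] (EFin \o (fun s => G s (y s) ord0 j)).
  apply: (@bounded_integrable_itv _ _ _ _ B); last first.
    move=> s sT; apply: le_trans (norm_coord_le _ _) _.
    by apply: GB => //; exact: yr.
  apply: (measurable_fun_cvg (h := fun n s => G s (step_fun n y0 s) ord0 j)).
    by move=> n; apply: measurable_funTS; exact: measurable_G_step.
  move=> s; rewrite /= in_itv/= => sT; apply/cvgrPdist_le => e e0.
  have e'0 : 0 < e / L by rewrite divr_gt0.
  near=> n.
  have H1 : approx_sol y0 T r 1 (step_fun n y0) by near: n; exact: rP.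
  have H2 : `|step_fun n y0 s - y s| <= e / L by move: (s) sT; near: n; exact: unif.
  have := norm_coord_le (G s (y s) - G s (step_fun n y0 s)) j; rewrite !mxE.
  move/le_trans; apply; case: H1 => H1 _ _.
  apply: le_trans (Lip _ _ _ sT (yr _ sT) (H1 _ sT)) _.
  by rewrite distrC -ler_pdivlMl// mulrC.
exists r; split => // t j tT; have /andP[t0 tT'] := tT.
apply/ler_addgt0Pr => e e0; rewrite add0r.
(* One [e1] for the distance at time [t], one for the defect of the step function, [L * T * e1] for
   the difference of the integrals. *)
pose e1 := e / (2 + L * T).
have LT : 0 < 2 + L * T by rewrite ltr_wpDr// mulr_ge0// ltW.
have e10 : 0 < e1 by rewrite divr_gt0.
near \oo => n.
have [H1 H2 H3] : approx_sol y0 T r e1 (step_fun n y0) by near: n; exact: rP.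
have H4 : forall t, 0 <= t <= T -> `|step_fun n y0 t - y t| <= e1 by near: n; exact: unif.
have i1 := integrable_itvS (lexx 0) tT' (int j).
have i2 := integrable_itvS (lexx 0) tT' (H2 j).
have H5 : `|\int[leb]_(s in `[0, t]) (G s (step_fun n y0 s) ord0 j - G s (y s) ord0 j)| <=
    L * e1 * T.
  apply: (@le_trans _ _ (L * e1 * (t - 0))); last first.
    by rewrite subr0 ler_pM2l// mulr_gt0.
  apply: le_norm_Rintegral_itv => //; first by have := integrableB _ i2 i1; exact.
  move=> s /andP[s0 st]; have sT : 0 <= s <= T by rewrite s0 (le_trans (ltW st)).
  have := norm_coord_le (G s (step_fun n y0 s) - G s (y s)) j; rewrite !mxE.
  move/le_trans; apply; apply: le_trans (Lip _ _ _ sT (H1 _ sT) (yr _ sT)) _.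
  by rewrite ler_pM2l// H4.
move: H5; rewrite RintegralB//; have := H3 t j tT.
have := le_trans (norm_coord_le _ j) (H4 t tT); rewrite !mxE.
have : e1 + e1 + L * e1 * T = e by rewrite /e1; field; rewrite gt_eqF.
set I1 := Rintegral _ _ _; set I2 := Rintegral _ _ _; rewrite !ler_norml.
by lra.
Unshelve. all: by end_near. Qed.

End one_step_methods.

(** * Block rows and the dot product in the sup norm *)

Section row_vectors.
Context {R : realType}.

Lemma norm_row_mx_leP m n (x : 'rV[R]_m) (p : 'rV[R]_n) (e : R) : 0 <= e ->
  (`|row_mx x p| <= e) <-> (`|x| <= e /\ `|p| <= e).
Proof.
move=> e0; split=> [/(norm_rV_leP _ e0) H|[/(norm_rV_leP _ e0) Hx /(norm_rV_leP _ e0) Hp]].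
  split; apply/(norm_rV_leP _ e0) => i.
    by have := H (lshift n i); rewrite row_mxEl.
  by have := H (rshift m i); rewrite row_mxEr.
by apply/(norm_rV_leP _ e0) => i; case: (split_ordP i) => j ->; rewrite ?row_mxEl ?row_mxEr.
Qed.

Lemma norm_lsubmx_le m n (z : 'rV[R]_(m + n)) : `|lsubmx z| <= `|z|.
Proof.
by have := (norm_row_mx_leP (lsubmx z) (rsubmx z) (normr_ge0 z)).1; rewrite hsubmxK => /(_ (lexx _))[].
Qed.

Lemma norm_rsubmx_le m n (z : 'rV[R]_(m + n)) : `|rsubmx z| <= `|z|.
Proof.
by have := (norm_row_mx_leP (lsubmx z) (rsubmx z) (normr_ge0 z)).1; rewrite hsubmxK => /(_ (lexx _))[].
Qed.

Definition dotrV n (u v : 'rV[R]_n) : R := \sum_(i < n) u ord0 i * v ord0 i.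

Lemma dotrVBr n (u v w : 'rV[R]_n) : dotrV u (v - w) = dotrV u v - dotrV u w.
Proof. by rewrite /dotrV -sumrB; apply: eq_bigr => i _; rewrite !mxE mulrBr. Qed.

Lemma dotrVBl n (u v w : 'rV[R]_n) : dotrV (u - v) w = dotrV u w - dotrV v w.
Proof. by rewrite /dotrV -sumrB; apply: eq_bigr => i _; rewrite !mxE mulrBl. Qed.

Lemma dotrVZr n a (u v : 'rV[R]_n) : dotrV u (a *: v) = a * dotrV u v.
Proof. by rewrite /dotrV mulr_sumr; apply: eq_bigr => i _; rewrite !mxE mulrCA. Qed.

Lemma norm_dotrV_le n (u v : 'rV[R]_n) : `|dotrV u v| <= n%:R * (`|u| * `|v|).
Proof.
apply: le_trans (ler_norm_sum _ _ _) _.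
apply: (@le_trans _ _ (\sum_(i < n) (`|u| * `|v|))).
  by apply: ler_sum => i _; rewrite normrM ler_pM// norm_coord_le.
by rewrite sumr_const card_ord mulr_natl.
Qed.

End row_vectors.

(** * The splitting scheme *)

Section langevin_scheme.
Context {R : realType}.
Variables (d : nat) (gamma : R) (g sigma : 'rV[R]_d -> R) (c : 'rV[R]_d -> 'rV[R]_d).
Implicit Types (z : 'rV[R]_(d + d)) (x p v : 'rV[R]_d) (h : R).

(* Keeps the drift substep below monotone in [x_i]: the velocity [cutoff h q] is
   at most [h^(-1/2)/2], and differs from [q] by [O(h)]. *)
Definition cutoff h (q : R) : R := q / (1 + h * q ^+ 2).

Definition drift_step h z (i : 'I_d) :=
  rV_upd z (lshift d i)
    (z ord0 (lshift d i) + h * g (lsubmx z) * cutoff h (z ord0 (rshift d i))).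

Definition kick_step h z (i : 'I_d) :=
  rV_upd z (rshift d i) (z ord0 (rshift d i) + h * c (lsubmx z) ord0 i).

Definition ham_step h z (i : 'I_d) := kick_step h (drift_step h z i) i.

(** The pairs [(x_i, p_i)] are swept one after the other, so that each shear moves a single
    coordinate and its Jacobian is a scalar. *)
Definition ham h z := foldl (ham_step h) z (enum 'I_d).

(** Preferred to [expR (- gamma * g x * h)]: with [a] this root and [s = sigma x], the relation
    [a ^+ 2 + beta * (s ^+ 2 * h) = 1] holds without error as soon as
    [beta * s ^+ 2 = 2 * gamma * g x] and the radicand is nonnegative, so that the noise can stay
    the raw Brownian increment. *)
Definition damping h x := Num.sqrt (1 - 2 * gamma * g x * h).

(* Exactly preserves the Gaussian law of the momentum, see [ou_op_invariant]. *)
Definition ou_step h z v :=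
  row_mx (lsubmx z)
    (damping h (lsubmx z) *: rsubmx z + sigma (lsubmx z) *: v) : 'rV[R]_(d + d).

Definition langevin_step h z v := ou_step h (ham h z) v.

Lemma cutoff_norm_le h q : 0 <= h -> `|cutoff h q| <= `|q|.
Proof.
move=> h0; rewrite /cutoff normrM ler_piMr// normfV.
have q0 : 1 <= 1 + h * q ^+ 2 by rewrite lerDl mulr_ge0// sqr_ge0.
by rewrite ger0_norm ?(le_trans _ q0)// invf_le1// (lt_le_trans _ q0).
Qed.

Lemma cutoff_dist h q : 0 <= h -> `|cutoff h q - q| <= h * `|q| ^+ 3.
Proof.
move=> h0; have q0 : 1 <= 1 + h * q ^+ 2 by rewrite lerDl mulr_ge0// sqr_ge0.
have q1 : 0 < 1 + h * q ^+ 2 by exact: lt_le_trans q0.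
have -> : cutoff h q - q = - (h * q ^+ 3) / (1 + h * q ^+ 2).
  by rewrite /cutoff; field; rewrite gt_eqF.
rewrite normrM normrN normrM normrX (ger0_norm h0) ler_piMr ?mulr_ge0 ?exprn_ge0//.
by rewrite normfV ger0_norm ?(ltW q1)// invf_le1.
Qed.

Variable B : R.
Hypotheses (B1 : 1 <= B) (g0 : forall x, 0 < g x) (gB : forall x, g x <= B)
  (g_lip : forall x y, `|g x - g y| <= B * `|x - y|)
  (c_lip : forall x y, `|c x - c y| <= B * `|x - y|).

Let B0 : 0 < B. Proof. exact: lt_le_trans B1. Qed.

(** A pair is touched once in the sweep and keeps its initial value until then, so the result is an
    Euler step whose [g] and [c] are evaluated at intermediate positions, all within [r] of the
    start. *)
Lemma ham_foldP h z (s : seq 'I_d) : 0 <= h -> uniq s ->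
  let z' := foldl (ham_step h) z s in
  let r := h * B * `|rsubmx z| in
  forall i : 'I_d,
    if i \in s then
      (exists2 y, `|y - lsubmx z| <= r &
         lsubmx z' ord0 i = lsubmx z ord0 i + h * g y * cutoff h (rsubmx z ord0 i)) /\
      (exists2 y, `|y - lsubmx z| <= r &
         rsubmx z' ord0 i = rsubmx z ord0 i + h * c y ord0 i)
    else lsubmx z' ord0 i = lsubmx z ord0 i /\ rsubmx z' ord0 i = rsubmx z ord0 i.
Proof.
move=> h0 + z' r; rewrite /z'; elim/last_ind: s {z'} => [//|s k IH].
rewrite rcons_uniq => /andP[ks us]; rewrite foldl_rcons.
move: (IH us); set w := foldl _ _ _ => {}IH.
have r0 : 0 <= r by rewrite !mulr_ge0// ltW.
have wk : w ord0 (lshift d k) = lsubmx z ord0 k /\ w ord0 (rshift d k) = rsubmx z ord0 k.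
  by have := IH k; rewrite (negbTE ks) !mxE.
have coord (u : 'rV[R]_d) i y : u ord0 i = lsubmx z ord0 i + h * g y * cutoff h (rsubmx z ord0 i) ->
    `|u ord0 i - lsubmx z ord0 i| <= r.
  move=> ->; rewrite addrAC subrr add0r 2!normrM (ger0_norm h0) (gtr0_norm (g0 y)).
  rewrite ler_pM ?mulr_ge0 ?(ltW (g0 _))// ?ler_wpM2l//.
  by apply: le_trans (cutoff_norm_le _ h0) _; exact: norm_coord_le.
have near_w : `|lsubmx w - lsubmx z| <= r.
  apply/(norm_rV_leP _ r0) => i; rewrite mxE [X in _ + X]mxE.
  have := IH i; case: ifP => _; last by move=> [-> _]; rewrite subrr normr0.
  by move=> [[y _ E] _]; exact: (coord (lsubmx w) i y).
set w1 := drift_step h w k.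
have w1k : lsubmx w1 ord0 k = lsubmx z ord0 k + h * g (lsubmx w) * cutoff h (rsubmx z ord0 k).
  by rewrite mxE rV_updE wk.1 wk.2.
have w1i i : i != k -> lsubmx w1 ord0 i = lsubmx w ord0 i.
  by move=> ik; rewrite mxE rV_upd_ne ?mxE// (inj_eq (@lshift_inj _ _)).
have w1p i : w1 ord0 (rshift d i) = w ord0 (rshift d i).
  by rewrite rV_upd_ne// eq_sym eq_lrshift.
have near_w1 : `|lsubmx w1 - lsubmx z| <= r.
  apply/(norm_rV_leP _ r0) => i; rewrite mxE [X in _ + X]mxE.
  have [->|ik] := eqVneq i k; first exact: (coord (lsubmx w1) k _ w1k).
  rewrite w1i//; have := norm_coord_le (lsubmx w - lsubmx z) i.
  by rewrite mxE [X in _ + X]mxE => /le_trans; apply.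
have Ex i : lsubmx (ham_step h w k) ord0 i = lsubmx w1 ord0 i.
  by rewrite [LHS]mxE /ham_step /kick_step rV_upd_ne ?eq_lrshift// [RHS]mxE.
have Ep i : i != k -> rsubmx (ham_step h w k) ord0 i = rsubmx w ord0 i.
  move=> ik; rewrite [LHS]mxE /ham_step /kick_step rV_upd_ne; last first.
    by rewrite (inj_eq (@rshift_inj _ _)).
  by rewrite w1p [RHS]mxE.
have Ek : rsubmx (ham_step h w k) ord0 k = rsubmx z ord0 k + h * c (lsubmx w1) ord0 k.
  by rewrite mxE /ham_step /kick_step rV_updE w1p wk.2.
move=> i; rewrite mem_rcons inE Ex; have [->|ik] /= := eqVneq i k.
  by split; [exists (lsubmx w)|exists (lsubmx w1)].
by rewrite w1i// Ep//; exact: IH.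
Qed.

Lemma hamP h z (i : 'I_d) : 0 <= h ->
  let r := h * B * `|rsubmx z| in
  (exists2 y, `|y - lsubmx z| <= r & lsubmx (ham h z) ord0 i =
     lsubmx z ord0 i + h * g y * cutoff h (rsubmx z ord0 i)) /\
  (exists2 y, `|y - lsubmx z| <= r & rsubmx (ham h z) ord0 i =
     rsubmx z ord0 i + h * c y ord0 i).
Proof.
by move=> h0; have := ham_foldP z h0 (enum_uniq 'I_d) i; rewrite mem_enum.
Qed.

Lemma ham_x_dist h z : 0 <= h -> `|lsubmx (ham h z) - lsubmx z| <= h * B * `|rsubmx z|.
Proof.
move=> h0; apply/norm_rV_leP => [|i]; first by rewrite !mulr_ge0// ltW.
have [[y _ E] _] := hamP z i h0; rewrite mxE [X in _ + X]mxE E.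
rewrite addrAC subrr add0r 2!normrM (ger0_norm h0) (gtr0_norm (g0 y)).
rewrite ler_pM ?mulr_ge0 ?(ltW (g0 _))// ?ler_wpM2l//.
by apply: le_trans (cutoff_norm_le _ h0) _; exact: norm_coord_le.
Qed.

(** The quadratic term comes from the displaced argument of [g], the cubic one from the cutoff. *)
Lemma ham_x_taylor h z : 0 <= h ->
  `|lsubmx (ham h z) - lsubmx z - (h * g (lsubmx z)) *: rsubmx z| <=
  h ^+ 2 * (B ^+ 2 * `|rsubmx z| ^+ 2 + B * `|rsubmx z| ^+ 3).
Proof.
move=> h0; set p := rsubmx z; set x := lsubmx z.
have p0 : 0 <= `|p| by [].
apply/norm_rV_leP => [|i].
  by rewrite mulr_ge0 ?addr_ge0 ?mulr_ge0 ?exprn_ge0 ?(ltW B0).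
have [[y yx E] _] := hamP z i h0; rewrite !mxE; rewrite mxE in E; rewrite E.
have -> : lsubmx z ord0 i + h * g y * cutoff h (rsubmx z ord0 i) - z ord0 (lshift d i) -
    h * g x * z ord0 (rshift d i) =
    h * ((g y - g x) * cutoff h (p ord0 i)) + h * (g x * (cutoff h (p ord0 i) - p ord0 i)).
  by rewrite !mxE; ring.
rewrite -mulrDr normrM (ger0_norm h0) expr2 -mulrA ler_wpM2l// [leRHS]mulrDr.
apply: le_trans (ler_normD _ _) _; rewrite (normrM (g y - g x)) (normrM (g x)); apply: lerD.
  apply: (@le_trans _ _ (B * (h * B * `|p|) * `|p|)); last by rewrite le_eqVlt; apply/orP; left; apply/eqP; ring.
  apply: ler_pM => //.
    by apply: le_trans (g_lip _ _) _; rewrite ler_pM2l.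
  by apply: le_trans (cutoff_norm_le _ h0) _; exact: norm_coord_le.
rewrite mulrCA; apply: ler_pM => //; first by rewrite gtr0_norm.
apply: le_trans (cutoff_dist _ h0) _; rewrite ler_wpM2l// lerXn2r ?nnegrE//.
exact: norm_coord_le.
Qed.

Lemma ham_p_taylor h z : 0 <= h ->
  `|rsubmx (ham h z) - rsubmx z - h *: c (lsubmx z)| <= h ^+ 2 * B ^+ 2 * `|rsubmx z|.
Proof.
move=> h0; set p := rsubmx z; set x := lsubmx z.
apply/norm_rV_leP => [|i]; first by rewrite !mulr_ge0 ?exprn_ge0 ?(ltW B0).
have [_ [y yx E]] := hamP z i h0; rewrite !mxE; rewrite mxE in E; rewrite E.
rewrite -/p -/x (_ : p ord0 i + _ - _ - _ = h * (c y - c x) ord0 i); last first.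
  by rewrite !mxE; ring.
rewrite normrM (ger0_norm h0) expr2 -!mulrA ler_wpM2l//.
apply: le_trans (norm_coord_le _ _) _; apply: le_trans (c_lip _ _) _.
apply: (@le_trans _ _ (B * (h * B * `|p|))); first by rewrite ler_pM2l.
by rewrite le_eqVlt; apply/orP; left; apply/eqP; ring.
Qed.

Hypothesis c0B : `|c 0| <= B.

Lemma c_growth x : `|c x| <= B * (1 + `|x|).
Proof.
rewrite -(subrK (c 0) (c x)); apply: le_trans (ler_normD _ _) _.
have := c_lip x 0; rewrite subr0 mulrDr mulr1; have := c0B; lra.
Qed.

Lemma ham_p_dist h z : 0 <= h ->
  `|rsubmx (ham h z) - rsubmx z| <= h * B * (1 + `|lsubmx z| + h * B * `|rsubmx z|).
Proof.
move=> h0; set p := rsubmx z; set x := lsubmx z.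
apply/norm_rV_leP => [|i].
  by rewrite !mulr_ge0 ?addr_ge0 ?mulr_ge0 ?(ltW B0).
have [_ [y yx E]] := hamP z i h0; rewrite mxE [X in _ + X]mxE E.
rewrite -/p -/x addrAC subrr add0r normrM (ger0_norm h0) -mulrA ler_wpM2l//.
apply: le_trans (norm_coord_le _ _) _; apply: le_trans (c_growth _) _.
rewrite ler_pM2l// -addrA lerD2l -(subrKC x y); apply: le_trans (ler_normD _ _) _.
by rewrite lerD2l.
Qed.

Hypotheses (gamma0 : 0 < gamma) (gammaB : gamma <= B).

(** With [a] the damping and [u = 2 * gamma * g x * h], the relation [a ^+ 2 = 1 - u] gives
    [1 - a <= u]; hence [a - 1 + u / 2 = - ((1 - a) ^+ 2 / 2)] is of second order. *)
Lemma damping_bounds h x : 0 <= h -> 2 * B ^+ 2 * h <= 1 ->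
  [/\ 0 <= damping h x <= 1, 1 - damping h x <= 2 * B ^+ 2 * h &
      `|damping h x - 1 + gamma * g x * h| <= 2 * B ^+ 4 * h ^+ 2].
Proof.
move=> h0 hB; rewrite /damping; set u := 2 * gamma * g x * h.
have gg : gamma * g x <= B ^+ 2.
  by rewrite expr2 ler_pM// ltW.
have gg0 : 0 <= gamma * g x by rewrite mulr_ge0// ltW.
have uB : u <= 2 * B ^+ 2 * h by rewrite /u ler_wpM2r// -mulrA ler_pM2l.
have u0 : 0 <= u by rewrite /u mulr_ge0// -mulrA mulr_ge0.
set a := Num.sqrt _.
have a0 : 0 <= a by exact: sqrtr_ge0.
have aE : a ^+ 2 = 1 - u by rewrite sqr_sqrtr// subr_ge0 (le_trans uB).
have a1 : a <= 1.
  by rewrite -(@ler_pXn2r _ 2)// ?nnegrE// expr1n aE lerBlDr lerDl.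
have au : 1 - a <= u.
  by rewrite lerBlDl -lerBlDr -aE expr2 ler_piMr.
split; [by rewrite a0|exact: le_trans uB|].
have -> : a - 1 + gamma * g x * h = - ((1 - a) ^+ 2 / 2).
  have -> : gamma * g x * h = u / 2 by rewrite /u; field.
  have uE : u = 1 - a ^+ 2 by rewrite aE; ring.
  by rewrite {}uE; field.
rewrite normrN ger0_norm ?divr_ge0 ?sqr_ge0// ler_pdivrMr//.
have -> : 2 * B ^+ 4 * h ^+ 2 * 2 = (2 * B ^+ 2 * h) ^+ 2 by ring.
by rewrite lerXn2r ?nnegrE ?subr_ge0//; [rewrite (le_trans u0)|exact: le_trans uB].
Qed.

Variable sg : 'rV[R]_d -> 'rV[R]_d.
Hypotheses (sigmaB : forall x, `|sigma x| <= B)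
  (sigma_lip : forall x y, `|sigma x - sigma y| <= B * `|x - y|)
  (sgB : forall x v, `|dotrV (sg x) v| <= B * `|v|)
  (sg_lip : forall x y v, `|dotrV (sg x - sg y) v| <= B * `|x - y| * `|v|)
  (sg_taylor : forall x y,
     `|sigma y - sigma x - dotrV (sg x) (y - x)| <= B * `|y - x| ^+ 2).

(* The equation in the variables [(x, p - sigma x w)], with the path [w] of the
   Brownian motion frozen. *)
Definition lang_field (w : R -> 'rV[R]_d) (s : R) (y : 'rV[R]_(d + d)) : 'rV[R]_(d + d) :=
  let x := lsubmx y in let p := rsubmx y + sigma x *: w s in
  row_mx (g x *: p)
    (c x - (gamma * g x) *: p - dotrV (sg x) (g x *: p) *: w s).

(** [h^-1] times the increment of [(x, p - sigma x w)] over one step of the chain. The Brownian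
    increment added to [p] cancels against that of [sigma x w], so only the value [w t] at the left
    end remains. *)
Definition lang_scheme h (w : R -> 'rV[R]_d) (t : R) (y : 'rV[R]_(d + d)) : 'rV[R]_(d + d) :=
  let x := lsubmx y in let p := rsubmx y + sigma x *: w t in
  let z := ham h (row_mx x p) in
  h^-1 *: row_mx (lsubmx z - x)
    (damping h (lsubmx z) *: rsubmx z - p - (sigma (lsubmx z) - sigma x) *: w t).

Lemma norm_p_le (y : 'rV[R]_(d + d)) v : `|v| <= B ->
  `|rsubmx y + sigma (lsubmx y) *: v| <= B ^+ 2 * (1 + `|y|).
Proof.
move=> vB; apply: le_trans (ler_normD _ _) _; rewrite normrZ.
have h1 : `|sigma (lsubmx y)| * `|v| <= B ^+ 2 by rewrite expr2 ler_pM.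
have h2 : `|rsubmx y| <= B ^+ 2 * `|y|.
  apply: le_trans (norm_rsubmx_le _) _; rewrite ler_peMl//.
  by rewrite exprn_ege1.
by rewrite mulrDr mulr1 addrC lerD.
Qed.

(** Linear in [y], since [B] bounds the path but not [y]. Here and below, powers of [B >= 1] are
    raised to the largest one in sight. *)
Lemma lang_scheme_growth h (w : R -> 'rV[R]_d) t y : 0 < h -> h <= 1 -> 2 * B ^+ 2 * h <= 1 ->
  `|w t| <= B -> `|lang_scheme h w t y| <= 8 * B ^+ 5 * (1 + `|y|).
Proof.
move=> h0 h1 hB wB; rewrite /lang_scheme; set x := lsubmx y.
set p := rsubmx y + _; set z := ham _ _.
have hp := norm_p_le y wB; rewrite -/x -/p in hp.
have := ham_x_dist (row_mx x p) (ltW h0); rewrite row_mxKl row_mxKr -/z => hx.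
have := ham_p_dist (row_mx x p) (ltW h0); rewrite row_mxKl row_mxKr -/z => hpp.
have [/andP[a0 a1] a2 _] := damping_bounds (lsubmx z) (ltW h0) hB.
set a := damping _ _ in a0 a1 a2 *.
set Y := 1 + `|y|; have Y1 : 1 <= Y by rewrite lerDl.
have Y0 : 0 <= Y by exact: le_trans Y1.
have xY : 1 + `|x| <= Y by rewrite lerD2l norm_lsubmx_le.
have BB (k m : nat) : (k <= m)%N -> B ^+ k <= B ^+ m by move=> km; rewrite ler_weXn2l.
have B5 : 0 <= B ^+ 5 by rewrite exprn_ge0// ltW.
have RHS0 : 0 <= 8 * B ^+ 5 * Y by do 2! apply: mulr_ge0 => //.
have bx : `|lsubmx z - x| <= h * (B ^+ 5 * Y).
  apply: le_trans hx _; rewrite -mulrA ler_pM2l//.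
  apply: (@le_trans _ _ (B * (B ^+ 2 * Y))); first by rewrite ler_pM2l.
  by rewrite mulrA -exprS ler_wpM2r// BB.
have bp : `|rsubmx z - p| <= h * (2 * B ^+ 5 * Y).
  apply: le_trans hpp _; rewrite -mulrA ler_pM2l//.
  have t1 : B * (1 + `|x|) <= B ^+ 5 * Y.
    by rewrite ler_pM ?(ltW B0)// ?addr_ge0//; exact: (BB 1%N 5%N).
  have t2 : B * (h * B * `|p|) <= B ^+ 5 * Y.
    apply: (@le_trans _ _ (B * (1 * B * (B ^+ 2 * Y)))).
      rewrite ler_pM2l// ler_pM// ?mulr_ge0 ?(ltW B0) ?(ltW h0)//.
      by rewrite ler_pM2r.
    have -> : B * (1 * B * (B ^+ 2 * Y)) = B ^+ 4 * Y by ring.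
    by rewrite ler_wpM2r// BB.
  by rewrite mulrDr; lra.
have ba : `|a *: rsubmx z - p| <= h * (4 * B ^+ 5 * Y).
  have -> : a *: rsubmx z - p = a *: (rsubmx z - p) - (1 - a) *: p.
    by rewrite scalerBr scalerBl scale1r opprB addrA subrK.
  apply: le_trans (ler_normB _ _) _; rewrite !normrZ (ger0_norm a0).
  rewrite (@ger0_norm _ (1 - a)) ?subr_ge0//.
  have t1 : a * `|rsubmx z - p| <= h * (2 * B ^+ 5 * Y).
    by apply: le_trans bp; rewrite ler_piMl.
  have t2 : (1 - a) * `|p| <= h * (2 * B ^+ 5 * Y).
    apply: (@le_trans _ _ (2 * B ^+ 2 * h * (B ^+ 2 * Y))).
      by rewrite ler_pM// subr_ge0.
    have -> : 2 * B ^+ 2 * h * (B ^+ 2 * Y) = h * (2 * B ^+ 4 * Y) by ring.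
    by rewrite ler_pM2l// ler_wpM2r// ler_pM2l// BB.
  by apply: le_trans (lerD t1 t2) _; rewrite -mulrDr ler_pM2l//; lra.
have bs : `|(sigma (lsubmx z) - sigma x) *: w t| <= h * (B ^+ 5 * Y).
  rewrite normrZ.
  apply: (@le_trans _ _ (B * (h * B * (B ^+ 2 * Y)) * B)).
    rewrite ler_pM//; apply: le_trans (sigma_lip _ _) _; rewrite ler_pM2l//.
    by apply: le_trans hx _; rewrite ler_pM2l// mulr_gt0.
  by rewrite le_eqVlt; apply/orP; left; apply/eqP; ring.
rewrite normrZ normfV (gtr0_norm h0) ler_pdivrMl//.
apply/norm_row_mx_leP; first by rewrite mulr_ge0// ltW.
have hY0 : 0 <= h * (B ^+ 5 * Y) by rewrite !mulr_ge0// ltW.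
split; first by apply: le_trans bx _; lra.
by apply: le_trans (ler_normB _ _) _; lra.
Qed.

Lemma lang_field_time (w : R -> 'rV[R]_d) s t (y : 'rV[R]_(d + d)) : `|y| <= B -> `|w s| <= B -> `|w t| <= B ->
  `|lang_field w t y - lang_field w s y| <= 4 * B ^+ 5 * `|w t - w s|.
Proof.
move=> yB wsB wtB; rewrite /lang_field; set x := lsubmx y; set q := rsubmx y.
set dw := w t - w s; set D := `|dw|; have D0 : 0 <= D by exact: normr_ge0.
have BB (k m : nat) : (k <= m)%N -> B ^+ k <= B ^+ m by move=> km; rewrite ler_weXn2l.
have gx : `|g x| <= B by rewrite gtr0_norm.
have pE : q + sigma x *: w t - (q + sigma x *: w s) = sigma x *: dw.
  by rewrite opprD addrACA subrr add0r -scalerBr.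
have dp : `|sigma x *: dw| <= B * D by rewrite normrZ ler_wpM2r.
have dgp : `|g x *: (sigma x *: dw)| <= B ^+ 2 * D.
  by rewrite normrZ expr2 -mulrA ler_pM.
have ps : `|q + sigma x *: w s| <= 2 * B ^+ 2.
  apply: le_trans (ler_normD _ _) _; rewrite normrZ mulr_natl mulr2n lerD//.
    apply: le_trans (norm_rsubmx_le _) _; apply: le_trans yB _; exact: (BB 1%N 2%N).
  by rewrite expr2 ler_pM.
have B3 : 0 <= B ^+ 5 by rewrite exprn_ge0// ltW.
have mono k : (k <= 5)%N -> B ^+ k * D <= B ^+ 5 * D by move=> k5; rewrite ler_wpM2r// BB.
have RHS0 : 0 <= 4 * B ^+ 5 * D by do 2! apply: mulr_ge0 => //.
rewrite opp_row_mx add_row_mx; apply/norm_row_mx_leP => //; split.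
  rewrite -scalerBr pE; apply: le_trans dgp _; apply: le_trans (mono 2%N isT) _.
  by have := mono 5%N isT; have : 0 <= B ^+ 5 * D by [rewrite mulr_ge0]; lra.
set pt := q + sigma x *: w t; set ps' := q + sigma x *: w s.
have -> : c x - (gamma * g x) *: pt - dotrV (sg x) (g x *: pt) *: w t -
    (c x - (gamma * g x) *: ps' - dotrV (sg x) (g x *: ps') *: w s) =
    - ((gamma * g x) *: (pt - ps')) - dotrV (sg x) (g x *: (pt - ps')) *: w t
    - dotrV (sg x) (g x *: ps') *: dw.
  rewrite [g x *: (pt - _)]scalerBr dotrVBr.
  apply/rowP => i; rewrite /dw !mxE; ring.
rewrite pE.
have t1 : `|(gamma * g x) *: (sigma x *: dw)| <= B ^+ 5 * D.
  apply: le_trans (mono 3%N isT); rewrite normrZ normrM (gtr0_norm gamma0).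
  by rewrite (_ : B ^+ 3 * D = (B * B) * (B * D)); [rewrite ler_pM ?mulr_ge0 ?(ltW gamma0)// ler_pM// ltW|ring].
have t2 : `|dotrV (sg x) (g x *: (sigma x *: dw)) *: w t| <= B ^+ 5 * D.
  apply: le_trans (mono 4%N isT); rewrite normrZ.
  rewrite (_ : B ^+ 4 * D = B * (B ^+ 2 * D) * B); last ring.
  by rewrite ler_pM//; apply: le_trans (sgB _ _) _; rewrite ler_pM2l.
have t3 : `|dotrV (sg x) (g x *: ps') *: dw| <= 2 * B ^+ 5 * D.
  rewrite normrZ ler_wpM2r//; apply: le_trans (sgB _ _) _.
  apply: (@le_trans _ _ (B * (B * (2 * B ^+ 2)))).
    by rewrite ler_pM2l// normrZ ler_pM.
  by rewrite (_ : B * _ = 2 * B ^+ 4); [rewrite ler_pM2l// BB|ring].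
apply: le_trans (ler_normB _ _) _.
by have := ler_normB (- ((gamma * g x) *: (sigma x *: dw)))
  (dotrV (sg x) (g x *: (sigma x *: dw)) *: w t); rewrite normrN; lra.
Qed.

(** Local in [y]: products such as [g x *: p] multiply a Lipschitz coefficient by an unbounded
    momentum, and their Lipschitz constant grows with it. *)
Lemma lang_field_lip (w : R -> 'rV[R]_d) s (y y' : 'rV[R]_(d + d)) :
  `|y| <= B -> `|y'| <= B -> `|w s| <= B ->
  `|lang_field w s y - lang_field w s y'| <= 16 * B ^+ 5 * `|y - y'|.
Proof.
move=> yB y'B wB; rewrite /lang_field; set x := lsubmx y; set x' := lsubmx y'.
set p := rsubmx y + _; set p' := rsubmx y' + _.
set D := `|y - y'|; have D0 : 0 <= D by exact: normr_ge0.
have BB (k m : nat) : (k <= m)%N -> B ^+ k <= B ^+ m by move=> km; rewrite ler_weXn2l.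
have xD : `|x - x'| <= D.
  have -> : x - x' = lsubmx (y - y') by apply/rowP => i; rewrite !mxE.
  exact: norm_lsubmx_le.
have gx u : `|g u| <= B by rewrite gtr0_norm.
have pp : `|p - p'| <= 2 * B ^+ 2 * D.
  have -> : p - p' = rsubmx (y - y') + (sigma x - sigma x') *: w s.
    by apply/rowP => i; rewrite !mxE; ring.
  apply: le_trans (ler_normD _ _) _; rewrite normrZ.
  have h1 : `|rsubmx (y - y')| <= B ^+ 2 * D.
    by apply: le_trans (norm_rsubmx_le _) _; rewrite ler_peMl// exprn_ege1.
  have h2 : `|sigma x - sigma x'| * `|w s| <= B ^+ 2 * D.
    have -> : B ^+ 2 * D = B * D * B by ring.
    by rewrite ler_pM//; apply: le_trans (sigma_lip _ _) _; rewrite ler_pM2l.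
  by move: h1 h2; lra.
have pB (u : 'rV[R]_(d + d)) : `|u| <= B ->
    `|rsubmx u + sigma (lsubmx u) *: w s| <= 2 * B ^+ 2.
  move=> uB; apply: le_trans (ler_normD _ _) _; rewrite normrZ mulr_natl mulr2n lerD//.
    apply: le_trans (norm_rsubmx_le _) _; apply: le_trans uB _; exact: (BB 1%N 2%N).
  by rewrite expr2 ler_pM.
have p1 : `|p| <= 2 * B ^+ 2 by exact: pB.
have p2 : `|p'| <= 2 * B ^+ 2 by exact: pB.
have gpp : `|g x *: p - g x' *: p'| <= 4 * B ^+ 3 * D.
  have -> : g x *: p - g x' *: p' = g x *: (p - p') + (g x - g x') *: p'.
    by apply/rowP => i; rewrite !mxE; ring.
  apply: le_trans (ler_normD _ _) _; rewrite !normrZ.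
  have h1 : `|g x| * `|p - p'| <= B * (2 * B ^+ 2 * D) by rewrite ler_pM.
  have h2 : `|g x - g x'| * `|p'| <= B * D * (2 * B ^+ 2).
    by rewrite ler_pM//; apply: le_trans (g_lip _ _) _; rewrite ler_pM2l.
  by apply: le_trans (lerD h1 h2) _; rewrite le_eqVlt; apply/orP; left; apply/eqP; ring.
have gp2 : `|g x' *: p'| <= 2 * B ^+ 3.
  by rewrite normrZ (_ : 2 * B ^+ 3 = B * (2 * B ^+ 2)); [rewrite ler_pM|ring].
have B5 : 0 <= B ^+ 5 by rewrite exprn_ge0// ltW.
have mono k : (k <= 5)%N -> B ^+ k * D <= B ^+ 5 * D by move=> k5; rewrite ler_wpM2r// BB.
have B5D : 0 <= B ^+ 5 * D by exact: mulr_ge0.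
rewrite opp_row_mx add_row_mx; apply/norm_row_mx_leP; first by do 2! apply: mulr_ge0 => //.
split; first by apply: le_trans gpp _; have := mono 3%N isT; lra.
have -> : c x - (gamma * g x) *: p - dotrV (sg x) (g x *: p) *: w s -
    (c x' - (gamma * g x') *: p' - dotrV (sg x') (g x' *: p') *: w s) =
    (c x - c x') - gamma *: (g x *: p - g x' *: p')
    - (dotrV (sg x) (g x *: p - g x' *: p') + dotrV (sg x - sg x') (g x' *: p')) *: w s.
  by rewrite dotrVBr dotrVBl; apply/rowP => i; rewrite !mxE; ring.
have t1 : `|c x - c x'| <= B ^+ 5 * D.
  apply: le_trans (mono 1%N isT); apply: le_trans (c_lip _ _) _.
  by rewrite ler_pM2l.
have t2 : `|gamma *: (g x *: p - g x' *: p')| <= 4 * (B ^+ 5 * D).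
  apply: (@le_trans _ _ (4 * (B ^+ 4 * D))); last by rewrite ler_pM2l// mono.
  rewrite normrZ (gtr0_norm gamma0) (_ : 4 * _ = B * (4 * B ^+ 3 * D)); last ring.
  by rewrite ler_pM// ltW.
have t3 : `|dotrV (sg x) (g x *: p - g x' *: p')| <= 4 * B ^+ 4 * D.
  apply: le_trans (sgB _ _) _; rewrite (_ : 4 * B ^+ 4 * D = B * (4 * B ^+ 3 * D)); last ring.
  by rewrite ler_pM2l.
have t4 : `|dotrV (sg x - sg x') (g x' *: p')| <= 2 * B ^+ 4 * D.
  apply: le_trans (sg_lip _ _ _) _.
  rewrite (_ : 2 * B ^+ 4 * D = B * D * (2 * B ^+ 3)); last ring.
  by rewrite ler_pM ?mulr_ge0 ?(ltW B0)// ler_pM2l.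
have t5 : `|(dotrV (sg x) (g x *: p - g x' *: p') + dotrV (sg x - sg x') (g x' *: p')) *: w s|
    <= 6 * (B ^+ 5 * D).
  rewrite normrZ (_ : 6 * _ = 6 * B ^+ 4 * D * B); last ring.
  by rewrite ler_pM//; apply: le_trans (ler_normD _ _) _; lra.
apply: le_trans (ler_normB _ _) _.
by have := ler_normB (c x - c x') (gamma *: (g x *: p - g x' *: p')); lra.
Qed.

Lemma lang_scheme_taylor h (w : R -> 'rV[R]_d) t (y : 'rV[R]_(d + d)) :
  0 < h -> h <= 1 -> 2 * B ^+ 2 * h <= 1 -> `|w t| <= B -> `|lsubmx y| <= B ->
  `|rsubmx y + sigma (lsubmx y) *: w t| <= B ->
  `|lang_scheme h w t y - lang_field w t y| <= 32 * B ^+ 7 * h.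
Proof.
move=> h0 h1 hB wB; rewrite /lang_scheme /lang_field; set x := lsubmx y.
set p := rsubmx y + _ => xB pB; set z := ham _ _.
have hge0 := ltW h0; have Bge0 := ltW B0.
have := ham_x_dist (row_mx x p) hge0; rewrite row_mxKl row_mxKr -/z => dX.
have := ham_x_taylor (row_mx x p) hge0; rewrite row_mxKl row_mxKr -/z => tX.
have := ham_p_dist (row_mx x p) hge0; rewrite row_mxKl row_mxKr -/z => dP.
have := ham_p_taylor (row_mx x p) hge0; rewrite row_mxKl row_mxKr -/z => tP.
have [/andP[a0 a1] a2 a3] := damping_bounds (lsubmx z) hge0 hB.
set a := damping _ _ in a0 a1 a2 a3 *.
set X := lsubmx z in dX tX a3 *; set P := rsubmx z in dP tP *.
have BB (k m : nat) : (k <= m)%N -> B ^+ k <= B ^+ m by move=> km; rewrite ler_weXn2l.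
have BBh (k m : nat) : (k <= m)%N -> h * B ^+ k <= h * B ^+ m.
  by move=> km; rewrite ler_pM2l// BB.
have Bp k : 0 <= B ^+ k by rewrite exprn_ge0.
have gx u : `|g u| <= B by rewrite gtr0_norm.
have {}dX : `|X - x| <= h * B ^+ 2.
  by apply: le_trans dX _; rewrite expr2 mulrA ler_wpM2l// mulr_ge0.
have {}tX : `|X - x - (h * g x) *: p| <= h ^+ 2 * (2 * B ^+ 4).
  apply: le_trans tX _; rewrite ler_wpM2l ?exprn_ge0//.
  have p2 : `|p| ^+ 2 <= B ^+ 2 by rewrite lerXn2r ?nnegrE.
  have p3 : `|p| ^+ 3 <= B ^+ 3 by rewrite lerXn2r ?nnegrE.
  have q2 : B ^+ 2 * `|p| ^+ 2 <= B ^+ 2 * B ^+ 2 by rewrite ler_wpM2l.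
  have q3 : B * `|p| ^+ 3 <= B * B ^+ 3 by rewrite ler_wpM2l.
  by move: q2 q3; rewrite -exprD -exprS; lra.
have {}tP : `|P - p - h *: c x| <= h ^+ 2 * B ^+ 3.
  by apply: le_trans tP _; rewrite (exprSr B 2) mulrA ler_wpM2l// mulr_ge0// exprn_ge0.
have {}dP : `|P - p| <= h * (3 * B ^+ 3).
  apply: le_trans dP _; rewrite -mulrA ler_wpM2l//.
  have q1 : B * 1 <= B ^+ 3 by rewrite mulr1; exact: (BB 1%N 3%N).
  have q2 : B * `|x| <= B ^+ 3.
    apply: (@le_trans _ _ (B * B)); first by rewrite ler_wpM2l.
    by rewrite -expr2 BB.
  have q3 : B * (h * B * `|p|) <= B ^+ 3.
    apply: (@le_trans _ _ (B * (1 * B * B))).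
      by rewrite ler_wpM2l// ler_pM ?mulr_ge0// ler_wpM2r.
    by rewrite le_eqVlt; apply/orP; left; apply/eqP; ring.
  by rewrite !mulrDr; lra.
have PB : `|P| <= 4 * B ^+ 3.
  rewrite -(subrK p P); apply: le_trans (ler_normD _ _) _.
  have q : h * (3 * B ^+ 3) <= 3 * B ^+ 3 by rewrite ler_piMl// mulr_ge0.
  by have := BB 1%N 3%N isT; rewrite expr1; lra.
set E := 32 * B ^+ 7 * h.
have E0 : 0 <= E by do 2! apply: mulr_ge0 => //.
have eqE k (n : nat) : (k <= 7)%N -> (n <= 32)%N -> h * (n%:R * B ^+ k) <= n%:R * (B ^+ 7 * h).
  by move=> k7 n32; rewrite mulrCA ler_wpM2l// mulrC ler_wpM2r// BB.
have hV : 0 <= h^-1 by rewrite invr_ge0.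
have hVn : `|h^-1| = h^-1 by rewrite ger0_norm.
rewrite scale_row_mx opp_row_mx add_row_mx; apply/norm_row_mx_leP => //; split.
  have -> : h^-1 *: (X - x) - g x *: p = h^-1 *: (X - x - (h * g x) *: p).
      by apply/rowP => i; rewrite !mxE; field; rewrite gt_eqF.
  rewrite normrZ hVn ler_pdivrMl//; apply: le_trans tX _.
  rewrite expr2 -mulrA ler_pM2l//; apply: le_trans (@eqE 4%N 2%N isT isT) _.
  rewrite /E -mulrA ler_wpM2r ?mulr_ge0//.
  by rewrite ler_nat.
(* Grouped by origin: error of the kick, error of the damping, change of [g] and of the momentum
   during the step, then the Taylor remainder of [sigma] and the error of the position. *)
have -> : h^-1 *: (a *: P - p - (sigma X - sigma x) *: w t) -
    (c x - (gamma * g x) *: p - dotrV (sg x) (g x *: p) *: w t) =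
    h^-1 *: ((P - p - h *: c x) + (a - 1 + gamma * g X * h) *: P
      - h *: (gamma *: ((g X - g x) *: P + g x *: (P - p)))
      - ((sigma X - sigma x - dotrV (sg x) (X - x)) +
          dotrV (sg x) (X - x - (h * g x) *: p)) *: w t).
  rewrite !dotrVBr -scalerA !dotrVZr.
  by apply/rowP => i; rewrite !mxE; field; rewrite gt_eqF.
rewrite normrZ hVn ler_pdivrMl//.
have s1 : `|P - p - h *: c x| <= h * (B ^+ 7 * h).
  apply: le_trans tP _; rewrite expr2 -mulrA ler_pM2l//.
  by have := @eqE 3%N 1%N isT isT; rewrite !mul1r.
have s2 : `|(a - 1 + gamma * g X * h) *: P| <= h * (8 * (B ^+ 7 * h)).
  rewrite normrZ; apply: (@le_trans _ _ (2 * B ^+ 4 * h ^+ 2 * (4 * B ^+ 3))).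
    by rewrite ler_pM.
  by rewrite le_eqVlt; apply/orP; left; apply/eqP; ring.
have s3 : `|h *: (gamma *: ((g X - g x) *: P + g x *: (P - p)))| <= h * (7 * (B ^+ 7 * h)).
  rewrite normrZ (ger0_norm hge0) ler_pM2l// normrZ (gtr0_norm gamma0).
  have q1 : `|(g X - g x) *: P| <= h * (4 * B ^+ 6).
    rewrite normrZ; apply: (@le_trans _ _ (B * (h * B ^+ 2) * (4 * B ^+ 3))).
      by rewrite ler_pM//; apply: le_trans (g_lip _ _) _; rewrite ler_pM2l.
    by rewrite le_eqVlt; apply/orP; left; apply/eqP; ring.
  have q2 : `|g x *: (P - p)| <= h * (3 * B ^+ 6).
    rewrite normrZ; apply: (@le_trans _ _ (B * (h * (3 * B ^+ 3)))); first by rewrite ler_pM.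
    have -> : B * (h * (3 * B ^+ 3)) = h * (3 * B ^+ 4) by ring.
    by rewrite ler_pM2l// ler_pM2l// BB.
  have q3 : `|(g X - g x) *: P + g x *: (P - p)| <= 7 * B ^+ 6 * h.
    by apply: le_trans (ler_normD _ _) _; move: q1 q2; lra.
  apply: (@le_trans _ _ (B * (7 * B ^+ 6 * h))); first by rewrite ler_pM// ltW.
  by rewrite le_eqVlt; apply/orP; left; apply/eqP; ring.
have s4 : `|((sigma X - sigma x - dotrV (sg x) (X - x)) +
          dotrV (sg x) (X - x - (h * g x) *: p)) *: w t| <= h * (3 * (B ^+ 7 * h)).
  have q1 : `|sigma X - sigma x - dotrV (sg x) (X - x)| <= h ^+ 2 * B ^+ 5.
    apply: le_trans (sg_taylor _ _) _; apply: (@le_trans _ _ (B * (h * B ^+ 2) ^+ 2)).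
      by rewrite ler_pM2l// lerXn2r ?nnegrE// mulr_ge0.
    by rewrite le_eqVlt; apply/orP; left; apply/eqP; ring.
  have q2 : `|dotrV (sg x) (X - x - (h * g x) *: p)| <= h ^+ 2 * (2 * B ^+ 5).
    apply: le_trans (sgB _ _) _; apply: (@le_trans _ _ (B * (h ^+ 2 * (2 * B ^+ 4)))).
      by rewrite ler_pM2l.
    by rewrite le_eqVlt; apply/orP; left; apply/eqP; ring.
  rewrite normrZ; apply: (@le_trans _ _ (h ^+ 2 * (3 * B ^+ 5) * B)).
    by rewrite ler_pM//; apply: le_trans (ler_normD _ _) _; move: q1 q2; lra.
  have -> : h ^+ 2 * (3 * B ^+ 5) * B = h * (h * (3 * B ^+ 6)) by ring.
  by rewrite ler_pM2l//; exact: (@eqE 6%N 3%N).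
set v1 := P - p - _ in s1 *; set v2 := (a - 1 + _) *: P in s2 *.
set v3 := h *: (gamma *: _) in s3 *; set v4 := _ *: w t in s4 *.
have n1 := ler_normB (v1 + v2 - v3) v4; have n2 := ler_normB (v1 + v2) v3.
have n3 := ler_normD v1 v2.
have hE : h * E = h * (32 * (B ^+ 7 * h)) by rewrite /E; ring.
have hb : 0 <= h * (B ^+ 7 * h) by rewrite !mulr_ge0.
rewrite hE; move: s1 s2 s3 s4 n1 n2 n3 hb.
rewrite ![h * (_%:R * _)]mulrCA.
set q := h * (B ^+ 7 * h); lra.
Qed.

End langevin_scheme.

(** Compactness of [[0, T]] gives one modulus of continuity for all [s]; [t] itself may leave the
    interval. *)
Lemma continuous_uniform_itv (R : realType) (n : nat) (w : R -> 'rV[R]_n) (T e : R) :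
  continuous w -> 0 < e -> \forall del \near 0^'+,
    forall s t, 0 <= s <= T -> `|t - s| <= del -> `|w t - w s| <= e.
Proof.
move=> cw e0.
have := (@compact_near_coveringP _ (`[0, T]%classic : set R)).1 (@segment_compact R 0 T).
move=> /(_ _ (0^'+ : set_system R)
  (fun del s => forall t, `|t - s| <= del -> `|w t - w s| <= e) _).
case/(_ _)/wrap.
  move=> x _; have e2 : 0 < e / 2 by rewrite divr_gt0.
  have /cvgrPdist_le /(_ _ e2) /nbhs_ballP [r /= r0 xr] := cw x.
  have r2 : 0 < r / 2 by rewrite divr_gt0.
  exists (ball x (r / 2), [set del | del < r / 2]).
    split; first exact: nbhsx_ballx.
    by exists (r / 2) => // u /=; rewrite sub0r normrN => + u0; rewrite gtr0_norm.
  move=> [s del] [/= xs dr] t ts.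
  have h1 : `|w x - w s| <= e / 2.
    apply: xr; move: xs; rewrite /ball/= => /lt_le_trans; apply.
    by rewrite ler_pdivrMr// ler_peMr ?(ltW r0)// ler1n.
  have h2 : `|w x - w t| <= e / 2.
    apply: xr; rewrite /ball/= -(subrKA s); apply: le_lt_trans (ler_normD _ _) _.
    move: xs; rewrite /ball/= => xs; rewrite [`|s - t|]distrC.
    by move: xs ts dr; lra.
  rewrite -(subrKA (w x)); apply: le_trans (ler_normD _ _) _.
  by rewrite [`|w t - _|]distrC; lra.
by apply: filterS => del H s t sT; apply: H; rewrite /= in_itv.
Qed.

Lemma continuous_bounded_itv (R : realType) (n : nat) (w : R -> 'rV[R]_n) (T : R) :
  continuous w -> exists M, forall s, 0 <= s <= T -> `|w s| <= M.
Proof.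
move=> cw; have cn : {within `[0, T], continuous (fun s => `|w s|)}.
  apply: continuous_subspaceT => s; apply: (continuous_comp (cw s)).
  exact: norm_continuous.
have [T0|T0] := leP 0 T; last first.
  by exists 0 => s /andP[s0 sT]; have := le_trans s0 sT; rewrite leNgt T0.
have [s _ sM] := EVT_max T0 cn.
by exists `|w s| => u uT; apply: sM; rewrite in_itv.
Qed.

(** * Convergence of the scheme along a fixed path *)

Section langevin_paths.
Context {R : realType}.
Variables (d : nat) (gamma : R) (g sigma : 'rV[R]_d -> R)
  (c sg : 'rV[R]_d -> 'rV[R]_d).

(** One constant bounds everything, and the properties are monotone in it, so that [B] can be
    enlarged to dominate also the radius of a ball or the supremum of a path. [sg] stands for the
    gradient of [sigma]. *)
Record langevin_bounds (B : R) : Prop := LangevinBounds {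
  lb_B1 : 1 <= B;
  lb_gamma0 : 0 < gamma;
  lb_gamma : gamma <= B;
  lb_g0 : forall x, 0 < g x;
  lb_g : forall x, g x <= B;
  lb_g_lip : forall x y, `|g x - g y| <= B * `|x - y|;
  lb_c0 : `|c 0| <= B;
  lb_c_lip : forall x y, `|c x - c y| <= B * `|x - y|;
  lb_sigma : forall x, `|sigma x| <= B;
  lb_sigma_lip : forall x y, `|sigma x - sigma y| <= B * `|x - y|;
  lb_sg : forall x v, `|dotrV (sg x) v| <= B * `|v|;
  lb_sg_lip : forall x y v, `|dotrV (sg x - sg y) v| <= B * `|x - y| * `|v|;
  lb_sg_taylor : forall x y,
     `|sigma y - sigma x - dotrV (sg x) (y - x)| <= B * `|y - x| ^+ 2 }.

Lemma langevin_bounds_le B B' : B <= B' -> langevin_bounds B -> langevin_bounds B'.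
Proof.
move=> BB [] *.
have mono a b : 0 <= b -> a <= B * b -> a <= B' * b.
  by move=> b0 /le_trans; apply; rewrite ler_wpM2r.
split=> //; try by [apply: le_trans BB|move=> *; apply: le_trans BB];
  try by move=> *; apply: mono => //; apply: exprn_ge0.
by move=> *; rewrite -mulrA; apply: mono; rewrite ?mulr_ge0// mulrA.
Qed.

Variables (B h0 : R).
Hypotheses (HB : langevin_bounds B) (h00 : 0 < h0) (h01 : h0 <= 1)
  (h0B : 2 * B ^+ 2 * h0 <= 1).

(** Every mesh is at most [h0], so smallness conditions imposed on [h0] hold for all [n], not only
    eventually. *)
Definition mesh (n : nat) : R := h0 / n.+1%:R.

Lemma mesh_gt0 n : 0 < mesh n. Proof. by rewrite divr_gt0. Qed.

Lemma mesh_le n : mesh n <= h0.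
Proof. by rewrite ler_pdivrMr// ler_peMr ?(ltW h00)// ler1n. Qed.

Lemma mesh_le1 n : mesh n <= 1. Proof. exact: le_trans (mesh_le n) h01. Qed.

Lemma mesh_cvg0 : mesh @ \oo --> 0.
Proof.
rewrite -(mulr0 h0); apply: cvgM; first exact: cvg_cst.
exact: cvg_harmonic.
Qed.

Fixpoint chain h (dw : nat -> 'rV[R]_d) (z : 'rV[R]_(d + d)) k : 'rV[R]_(d + d) :=
  if k is k'.+1 then langevin_step gamma g sigma c h (chain h dw z k') (dw k') else z.

(** Subtracting [sigma x *: v] removes the rough part of the momentum; what remains is
    differentiable in time when [v] is the current value of the path. *)
Definition to_ode (v : 'rV[R]_d) (z : 'rV[R]_(d + d)) : 'rV[R]_(d + d) :=
  row_mx (lsubmx z) (rsubmx z - sigma (lsubmx z) *: v).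

Definition of_ode (v : 'rV[R]_d) (y : 'rV[R]_(d + d)) : 'rV[R]_(d + d) :=
  row_mx (lsubmx y) (rsubmx y + sigma (lsubmx y) *: v).

Lemma to_odeK v : cancel (to_ode v) (of_ode v).
Proof. by move=> z; rewrite /of_ode /to_ode row_mxKl row_mxKr subrK hsubmxK. Qed.

Lemma of_odeK v : cancel (of_ode v) (to_ode v).
Proof. by move=> z; rewrite /of_ode /to_ode row_mxKl row_mxKr addrK hsubmxK. Qed.

Lemma sigma_cvg (T : Type) (F : set_system T) {FF : Filter F} (x : T -> 'rV[R]_d) (x0 : 'rV[R]_d) :
  x @ F --> x0 -> sigma (x t) @[t --> F] --> sigma x0.
Proof.
move=> xc; apply/cvgrPdist_le => e e0.
have B0 : 0 < B by exact: lt_le_trans (lb_B1 HB).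
have eB : 0 < e / B by rewrite divr_gt0.
move/cvgrPdist_le : xc => /(_ _ eB); apply: filterS => t xt.
apply: le_trans (lb_sigma_lip HB _ _) _.
by rewrite -ler_pdivlMl// mulrC.
Qed.

Lemma lsubmx_cvg (T : Type) (F : set_system T) {FF : Filter F} m n (z : T -> 'rV[R]_(m + n)) (z0 : 'rV[R]_(m + n)) :
  z @ F --> z0 -> lsubmx (z t) @[t --> F] --> lsubmx z0.
Proof.
move=> /cvg_rVP zc; apply/cvg_rVP => i; rewrite mxE; under eq_fun do rewrite mxE.
exact: zc.
Qed.

Lemma rsubmx_cvg (T : Type) (F : set_system T) {FF : Filter F} m n (z : T -> 'rV[R]_(m + n)) (z0 : 'rV[R]_(m + n)) :
  z @ F --> z0 -> rsubmx (z t) @[t --> F] --> rsubmx z0.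
Proof.
move=> /cvg_rVP zc; apply/cvg_rVP => i; rewrite mxE; under eq_fun do rewrite mxE.
exact: zc.
Qed.

Lemma row_mx_cvg (T : Type) (F : set_system T) {FF : Filter F} m n
    (x : T -> 'rV[R]_m) (p : T -> 'rV[R]_n) (x0 : 'rV[R]_m) (p0 : 'rV[R]_n) :
  x @ F --> x0 -> p @ F --> p0 -> row_mx (x t) (p t) @[t --> F] --> row_mx x0 p0.
Proof.
move=> /cvg_rVP xc /cvg_rVP pc; apply/cvg_rVP => i.
case: (split_ordP i) => j ->; rewrite ?row_mxEl ?row_mxEr;
  under eq_fun do rewrite ?row_mxEl ?row_mxEr; [exact: xc|exact: pc].
Qed.

Lemma of_ode_cvg (T : Type) (F : set_system T) {FF : Filter F}
    (v : T -> 'rV[R]_d) (y : T -> 'rV[R]_(d + d)) (v0 : 'rV[R]_d) (y0 : 'rV[R]_(d + d)) :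
  v @ F --> v0 -> y @ F --> y0 -> of_ode (v t) (y t) @[t --> F] --> of_ode v0 y0.
Proof.
move=> vc yc; apply: row_mx_cvg; first exact: lsubmx_cvg.
apply: cvgD; first exact: rsubmx_cvg.
by apply: cvgZ => //; apply: sigma_cvg; exact: lsubmx_cvg.
Qed.

Variable w : R -> 'rV[R]_d.
Hypothesis cw : continuous w.

Notation field := (lang_field gamma g sigma c sg w).
Notation scheme := (fun n => lang_scheme gamma g sigma c (mesh n) w).

Definition path_sol (z : 'rV[R]_(d + d)) (Z : R -> 'rV[R]_(d + d)) :=
  ode_sol field (to_ode (w 0) z) (fun t => to_ode (w t) (Z t)).

Let bigB (T r : R) : exists B', [/\ langevin_bounds B', r <= B' &
  forall s, 0 <= s <= T -> `|w s| <= B'].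
Proof.
have [M wM] := continuous_bounded_itv T cw.
exists (Num.max B (Num.max r M)); split.
- by apply: langevin_bounds_le HB; rewrite le_max lexx.
- by rewrite !le_max lexx orbT.
- by move=> s sT; rewrite !le_max wM ?orbT.
Qed.

Let field_time B' s t y : langevin_bounds B' -> `|y| <= B' -> `|w s| <= B' -> `|w t| <= B' ->
  `|field t y - field s y| <= 4 * B' ^+ 5 * `|w t - w s|.
Proof. by case=> *; exact: (@lang_field_time _ _ _ _ _ _ B'). Qed.

Lemma lang_field_lipschitz : locally_lipschitz field.
Proof.
move=> T r; have [B' [HB' rB' wB']] := bigB T r.
have B0 : 0 < B' by exact: lt_le_trans (lb_B1 HB').
exists (16 * B' ^+ 5); split; first by rewrite mulr_gt0// exprn_gt0.
move=> s y y' sT yr y'r; case: HB' => *.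
apply: lang_field_lip => //; by [apply: le_trans rB'|apply: wB'].
Qed.

Lemma lang_field_continuous y : continuous (field ^~ y).
Proof.
move=> s; pose B' := Num.max B (Num.max `|y| (`|w s| + 1)).
have HB' : langevin_bounds B' by apply: langevin_bounds_le HB; rewrite le_max lexx.
have B0 : 0 < 4 * B' ^+ 5.
  by rewrite mulr_gt0// exprn_gt0//; exact: lt_le_trans (lb_B1 HB').
apply/cvgrPdist_le => e e0.
have e1 : 0 < e / (4 * B' ^+ 5) by rewrite divr_gt0.
have /cvgrPdist_le ct := @cw s.
near=> t.
have wst : `|w s - w t| <= e / (4 * B' ^+ 5) by near: t; exact: ct.
have wst1 : `|w s - w t| <= 1 by near: t; exact: ct.
apply: (@le_trans _ _ (4 * B' ^+ 5 * `|w s - w t|)); last by rewrite -ler_pdivlMl// mulrC.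
apply: field_time => //; rewrite /B' !le_max ?lexx ?orbT//.
  rewrite (_ : `|w t| <= `|w s| + 1) ?orbT//.
  by rewrite -(subKr (w s) (w t)); apply: le_trans (ler_normB _ _) _; rewrite lerD2l.
by rewrite lerDl ler01 !orbT.
Unshelve. all: by end_near. Qed.

Lemma mesh_le_near (e : R) : 0 < e -> \forall n \near \oo, mesh n <= e.
Proof.
move=> e0; have /cvgrPdist_le /(_ _ e0) := mesh_cvg0; apply: filterS => n.
by rewrite sub0r normrN gtr0_norm ?mesh_gt0.
Qed.

Let near_meshB B' : 0 < B' -> \forall n \near \oo, 2 * B' ^+ 2 * mesh n <= 1.
Proof.
move=> B0; have e0 : 0 < (2 * B' ^+ 2)^-1 by rewrite invr_gt0 mulr_gt0// exprn_gt0.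
have := mesh_le_near e0; apply: filterS => n.
by rewrite -[X in _ <= X -> _]mulr1 ler_pdivlMl// mulr_gt0// exprn_gt0.
Qed.

Lemma lang_scheme_linear_growth : linear_growth scheme.
Proof.
move=> T; have [B' [HB' _ wB']] := bigB T 0.
have B0 : 0 < B' by exact: lt_le_trans (lb_B1 HB').
exists (8 * B' ^+ 5); split; first by rewrite mulr_gt0// exprn_gt0.
have := near_meshB B0; apply: filterS => n nB t y tT; case: HB' => *.
by apply: lang_scheme_growth => //; [exact: mesh_gt0|exact: mesh_le1|exact: wB'].
Qed.

Lemma lang_scheme_consistent : consistent field mesh scheme.
Proof.
move=> T r e e0; have [B1 [HB1 rB1 wB1]] := bigB T (Num.max r 1).
have B10 : 0 < B1 by exact: lt_le_trans (lb_B1 HB1).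
(* On the ball of radius [B1], [norm_p_le] bounds the momentum [rsubmx y + sigma x *: w t] by this
   number, and [lang_scheme_taylor] needs it below its constant. *)
pose B' := B1 ^+ 2 * (1 + B1).
have BB' : B1 <= B'.
  rewrite /B' expr2 -mulrA ler_peMr ?(ltW B10)// mulr_ege1 ?(lb_B1 HB1)//.
  by rewrite lerDl ltW.
have HB' := langevin_bounds_le BB' HB1.
have B0 : 0 < B' by exact: lt_le_trans BB'.
have e1 : 0 < e / 2 / (4 * B' ^+ 5) by rewrite !divr_gt0// mulr_gt0// exprn_gt0.
have e2 : 0 < e / 2 / (32 * B' ^+ 7) by rewrite !divr_gt0// mulr_gt0// exprn_gt0.
have [del /= del0 delP] := continuous_uniform_itv T cw e1.
have d2 : 0 < del / 2 by rewrite divr_gt0.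
near=> n => s t y t0 ts sT st yr.
have nB : 2 * B' ^+ 2 * mesh n <= 1 by near: n; exact: near_meshB.
have n1 : mesh n <= del / 2 by near: n; exact: mesh_le_near.
have n2 : mesh n <= e / 2 / (32 * B' ^+ 7) by near: n; exact: mesh_le_near.
have tT : 0 <= t <= T by rewrite t0 (le_trans ts).
have sT' : 0 <= s <= T by rewrite sT (le_trans t0).
have wtB : `|w t| <= B' by apply: le_trans BB'; exact: wB1.
have wsB : `|w s| <= B' by apply: le_trans BB'; exact: wB1.
have yB1 : `|y| <= B1 by apply: le_trans yr _; apply: le_trans rB1; rewrite le_max lexx.
have yB : `|y| <= B' by exact: le_trans BB'.
have wst : `|w t - w s| <= e / 2 / (4 * B' ^+ 5).
  apply: (delP (del / 2)) => //=.
    by rewrite sub0r normrN gtr0_norm// ltr_pdivrMr// ltr_pMr// ltr1n.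
  by rewrite ler_norml; move: n1; lra.
have f1 : `|field t y - field s y| <= e / 2.
  apply: (@le_trans _ _ (4 * B' ^+ 5 * `|w t - w s|)); first exact: field_time.
  by rewrite mulrC -ler_pdivlMr// mulr_gt0// exprn_gt0.
have f2 : `|scheme n t y - field t y| <= e / 2.
  apply: (@le_trans _ _ (32 * B' ^+ 7 * mesh n)); last first.
    by rewrite mulrC -ler_pdivlMr// mulr_gt0// exprn_gt0.
  have pB : `|rsubmx y + sigma (lsubmx y) *: w t| <= B'.
    have wt1 := wB1 t tT; case: HB1 => *.
    apply: (@le_trans _ _ (B1 ^+ 2 * (1 + `|y|))); first exact: norm_p_le.
    by rewrite /B' ler_pM2l ?exprn_gt0// lerD2l.
  have xB : `|lsubmx y| <= B' by apply: le_trans yB; exact: norm_lsubmx_le.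
  by case: HB' => *; apply: lang_scheme_taylor => //; [exact: mesh_gt0|exact: mesh_le1].
rewrite -(subrKA (field t y)); apply: le_trans (ler_normD _ _) _.
by move: f1 f2; lra.
Unshelve. all: by end_near. Qed.

(** [to_ode] conjugates the chain to an explicit one-step method: in the new variables the
    increments of [w] add up to its values at grid times. *)
Lemma chain_one_step n z k :
  chain (mesh n) (fun j => w (j.+1%:R * mesh n) - w (j%:R * mesh n)) z k =
  of_ode (w (k%:R * mesh n)) (one_step mesh scheme n (to_ode (w 0) z) k).
Proof.
suff <- : to_ode (w (k%:R * mesh n))
    (chain (mesh n) (fun j => w (j.+1%:R * mesh n) - w (j%:R * mesh n)) z k) =
    one_step mesh scheme n (to_ode (w 0) z) k by rewrite to_odeK.
elim: k => [|k IH] /=; first by rewrite mul0r.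
rewrite -IH; set zk := chain _ _ _ k; set t := k%:R * mesh n; set t' := k.+1%:R * mesh n.
have mn : mesh n != 0 by rewrite gt_eqF ?mesh_gt0.
rewrite /lang_scheme -/(of_ode (w t) (to_ode (w t) zk)) to_odeK scalerA divff// scale1r.
rewrite /langevin_step /ou_step /to_ode !row_mxKl !row_mxKr subrK.
set y := ham g c _ zk.
rewrite add_row_mx; congr row_mx; first by rewrite subrKC.
by apply/rowP => i; rewrite !mxE; ring.
Qed.

Theorem chain_cvg z_ z Z (K : nat -> nat) (t : R) :
  path_sol z Z -> z_ @ \oo --> z -> 0 <= t ->
  (fun n => (K n)%:R * mesh n) @ \oo --> t ->
  (fun n => chain (mesh n) (fun j => w (j.+1%:R * mesh n) - w (j%:R * mesh n)) (z_ n) (K n))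
    @ \oo --> Z t.
Proof.
move=> Zsol zc t0 Kt; under eq_fun do rewrite chain_one_step.
rewrite -[Z t](to_odeK (w t)); apply: of_ode_cvg.
  by apply: (cvg_comp _ _ Kt); exact: cw.
apply: (ode_sol_cvg mesh_gt0 mesh_cvg0 lang_field_continuous lang_field_lipschitz
  lang_scheme_linear_growth lang_scheme_consistent Zsol) => //.
apply: row_mx_cvg; first exact: lsubmx_cvg.
apply: cvgB; first exact: rsubmx_cvg.
by apply: cvgZl; apply: sigma_cvg; exact: lsubmx_cvg.
Qed.

Lemma truncn_mesh_cvg (t : R) : 0 <= t ->
  (fun n => (Num.truncn (t / mesh n))%:R * mesh n) @ \oo --> t.
Proof.
move=> t0; apply/cvgrPdist_le => e e0; have := mesh_le_near e0; apply: filterS => n.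
apply: le_trans; have mn := mesh_gt0 n.
have := truncn_itv (divr_ge0 t0 (ltW mn)); rewrite ler_pdivlMr// ltr_pdivrMr//.
set k := Num.truncn _; rewrite -natr1 mulrDl mul1r => /andP[k1 k2].
by rewrite ger0_norm ?subr_ge0//; lra.
Qed.

Theorem path_sol_exists z : exists Z, [/\ path_sol z Z, continuous Z &
  forall t, 0 <= t -> (fun n => chain (mesh n)
      (fun j => w (j.+1%:R * mesh n) - w (j%:R * mesh n)) z (Num.truncn (t / mesh n)))
    @ \oo --> Z t].
Proof.
have [y [ysol yc y0]] := ode_sol_exists mesh_gt0 mesh_cvg0 lang_field_continuous
  lang_field_lipschitz lang_scheme_linear_growth lang_scheme_consistent (to_ode (w 0) z).
have Zsol : path_sol z (fun t => of_ode (w t) (y t)).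
  rewrite /path_sol (_ : (fun t => _) = y)//.
  by apply/funext => t; rewrite of_odeK.
exists (fun t => of_ode (w t) (y t)); split=> //; last first.
  move=> t t0; exact: (@chain_cvg (fun=> z) z _ (fun n => Num.truncn (t / mesh n)) t
    Zsol (cvg_cst _) t0 (truncn_mesh_cvg t0)).
(* The step functions are constant before time 0, hence so is [y]; continuity on the whole line then
   follows from the Lipschitz bound at nonnegative times. *)
have yneg t : t < 0 -> y t = y 0.
  move=> t0; rewrite -(cvg_lim (@norm_hausdorff R _) (yc t)) y0.
  rewrite (_ : (fun n => _) = (fun=> to_ode (w 0) z)).
    by apply: cvg_lim; [exact: norm_hausdorff|exact: cvg_cst].
  apply/funext => n; rewrite /step_fun truncn_floor ifF//.
  by apply/negbTE; rewrite -ltNge pmulr_llt0// invr_gt0 mesh_gt0.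
have ymax t : y t = y (Num.max 0 t).
  by case: leP => // t0; rewrite yneg.
move=> s; apply: of_ode_cvg; first exact: cw.
apply/cvgrPdist_le => e e0.
have [B' B0 yB] := ode_sol_lipschitz mesh_gt0 lang_scheme_linear_growth
  lang_scheme_consistent ysol (addr_ge0 (normr_ge0 s) ler01).
have e1 : 0 < e / (B' + 1) by rewrite divr_gt0// ltr_wpDl.
near=> t.
have t1 : `|s - t| <= 1 by near: t; exact: cvgr_dist_le.
have t2 : `|s - t| <= e / (B' + 1) by near: t; exact: cvgr_dist_le.
rewrite (ymax s) (ymax t).
have pos u : `|s - u| <= 1 -> 0 <= Num.max 0 u <= `|s| + 1.
  move=> su; rewrite le_max lexx/= ge_max addr_ge0//=.
  by have := ler_norm s; move: su; rewrite ler_norml; lra.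
apply: le_trans (yB _ _ (pos t t1) (pos s _)) _; first by rewrite subrr normr0.
apply: (@le_trans _ _ (B' * `|s - t|)).
  rewrite ler_wpM2l// !maxEle.
  by case: (leP 0 s) => ?; case: (leP 0 t) => ?; rewrite !ler_norml; have := ler_norm (s - t);
    have := ler_norm (t - s); rewrite (distrC t s); lra.
apply: (@le_trans _ _ ((B' + 1) * `|s - t|)); first by rewrite ler_wpM2r// lerDl.
by rewrite mulrC -ler_pdivlMr// ltr_wpDl.
Unshelve. all: by end_near. Qed.

End langevin_paths.

(** * Almost invariance of the Gibbs weight *)

Section gaussian_rV.
Context {R : realType}.
Local Open Scope ereal_scope.
Notation leb := (@lebesgue_measure R).

Lemma measurable_prod_coord n (f : R -> R) : measurable_fun setT f ->
  measurable_fun setT (fun v : 'rV[R]_n => \prod_(i < n) f (v ord0 i))%R.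
Proof.
by move=> mf; apply: measurable_prod => i _; exact: measurableT_comp mf (measurable_coord i).
Qed.

Lemma prod_rV_cons n (f : R -> R) t (u : 'rV[R]_n) :
  (\prod_(i < n.+1) f (rV_cons (t, u) ord0 i) = f t * \prod_(i < n) f (u ord0 i))%R.
Proof.
rewrite big_ord_recl rV_cons0; congr (_ * _)%R.
by apply: eq_bigr => i _; rewrite rV_cons_lift.
Qed.

Lemma measurable_affine_rV d (T : measurableType d) n (a s : R) (p v : T -> 'rV[R]_n) :
  measurable_fun setT p -> measurable_fun setT v ->
  measurable_fun setT (fun t => a *: p t + s *: v t)%R.
Proof.
move=> mp mv; apply: measurable_fun_rVP => i; under eq_fun do rewrite !mxE.
apply: measurable_funD; apply: measurable_funM => //.
  exact: (measurableT_comp (measurable_coord i) mp).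
exact: (measurableT_comp (measurable_coord i) mv).
Qed.

Variables (f phi : R -> R) (a s : R).
Hypotheses (mf : measurable_fun setT f) (mphi : measurable_fun setT phi)
  (f0 : forall t, (0 <= f t)%R) (phi0 : forall t, (0 <= phi t)%R)
  (stat1 : forall u : R -> \bar R, measurable_fun setT u -> (forall t, 0 <= u t) ->
    \int[leb]_p \int[leb]_v ((f p)%:E * (phi v)%:E * u (a * p + s * v)%R) =
    \int[leb]_p ((f p)%:E * u p)).

(** The kernel is a product over coordinates: the induction hypothesis integrates out the tail, and
    [stat1] is applied to the function of the first coordinate that remains. *)
Lemma prod_stationary n (u : 'rV[R]_n -> \bar R) :
  measurable_fun setT u -> (forall v, 0 <= u v) ->
  \int[lebesgue_rV n]_p \int[lebesgue_rV n]_v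
    ((\prod_(i < n) f (p ord0 i))%:E * (\prod_(i < n) phi (v ord0 i))%:E *
      u (a *: p + s *: v)%R) =
  \int[lebesgue_rV n]_p ((\prod_(i < n) f (p ord0 i))%:E * u p).
Proof.
elim: n u => [|n IH] u mu u0.
  have E (F : 'rV[R]_0 -> \bar R) : \int[lebesgue_rV 0]_p F p = F 0%R.
    rewrite (_ : F = cst (F 0%R)); last by apply/funext => p; rewrite (thinmx0 p).
    by rewrite integral_cst//= diracT mule1.
  by rewrite !E !big_ord0 mul1e !thinmx0.
pose Pf k (p : 'rV[R]_k) := (\prod_(i < k) f (p ord0 i))%R.
pose Pp k (p : 'rV[R]_k) := (\prod_(i < k) phi (p ord0 i))%R.
have Pf0 k p : (0 <= Pf k p)%R by exact: prodr_ge0.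
have Pp0 k p : (0 <= Pp k p)%R by exact: prodr_ge0.
have mPf k : measurable_fun setT (Pf k) by exact: measurable_prod_coord.
have mPp k : measurable_fun setT (Pp k) by exact: measurable_prod_coord.
have K0 k (p v : 'rV[R]_k) (e : \bar R) : 0 <= e -> 0 <= (Pf k p)%:E * (Pp k v)%:E * e.
  by move=> e0; rewrite !mule_ge0// lee_fin.
have mK d (T : measurableType d) k (p v : T -> 'rV[R]_k) (F : T -> \bar R) :
    measurable_fun setT p -> measurable_fun setT v -> measurable_fun setT F ->
    measurable_fun setT (fun t => (Pf k (p t))%:E * (Pp k (v t))%:E * F t).
  move=> mp mv mF; apply: emeasurable_funM => //; apply: emeasurable_funM.
    by apply/measurable_EFinP; exact: (measurableT_comp (mPf k) mp).
  by apply/measurable_EFinP; exact: (measurableT_comp (mPp k) mv).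
(* The test function with its tail averaged under the stationary weight. *)
pose U (t : R) := \int[lebesgue_rV n]_q ((Pf n q)%:E * u (rV_cons (t, q))).
have mU : measurable_fun setT U.
  apply: (@measurable_integral_snd _ _ _ (measurableTypeR R) _ (lebesgue_rV n)
    (fun q => (Pf n q.2)%:E * u (rV_cons q))) => [|q]; last first.
    by rewrite mule_ge0// lee_fin.
  apply: emeasurable_funM; last exact: (measurableT_comp mu (@measurable_rV_cons R n)).
  by apply/measurable_EFinP; exact: (measurableT_comp (mPf n) measurable_snd).
have U0 t : 0 <= U t by apply: integral_ge0 => q _; rewrite mule_ge0// lee_fin.
have consD t1 t2 (q1 q2 : 'rV[R]_n) : (a *: rV_cons (t1, q1) + s *: rV_cons (t2, q2) =
    rV_cons (a * t1 + s * t2, a *: q1 + s *: q2) :> 'rV[R]_n.+1)%R.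
  apply/rowP => i; rewrite [LHS]mxE [X in (X + _)%R]mxE [X in (_ + X)%R]mxE.
  case: (unliftP ord0 i) => [j|] ->; first by rewrite !rV_cons_lift/= !mxE.
  by rewrite !rV_cons0.
transitivity (\int[leb]_p \int[leb]_v ((f p)%:E * (phi v)%:E * U (a * p + s * v)%R)); last first.
  rewrite stat1// [RHS]ge0_integral_rV_cons; last 2 first.
  - by apply: emeasurable_funM => //; apply/measurable_EFinP; exact: (mPf n.+1).
  - by move=> v; rewrite mule_ge0// lee_fin; exact: (Pf0 n.+1).
  apply: eq_integral => t _; rewrite -ge0_integralZl_EFin//; last 2 first.
  - by move=> q _; rewrite mule_ge0// lee_fin.
  - apply: emeasurable_funM; first by apply/measurable_EFinP; exact: mPf.
    by apply: measurableT_comp => //; exact: measurable_rV_cons1.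
  by apply: eq_integral => q _; rewrite prod_rV_cons EFinM muleA.
rewrite ge0_integral_rV_cons; last 2 first.
- apply: (@measurable_integral_snd _ _ _ _ _ (lebesgue_rV n.+1)
    (fun q : 'rV[R]_n.+1 * 'rV[R]_n.+1 => (Pf n.+1 q.1)%:E * (Pp n.+1 q.2)%:E *
      u (a *: q.1 + s *: q.2)%R)) => [|q]; last exact: K0.
  by apply: mK => //; apply: measurableT_comp => //; exact: measurable_affine_rV.
- by move=> v; apply: integral_ge0 => q _; exact: K0.
apply: eq_integral => p0 _.
transitivity (\int[lebesgue_rV n]_p \int[leb]_v0 \int[lebesgue_rV n]_v
   ((f p0)%:E * (phi v0)%:E * ((Pf n p)%:E * (Pp n v)%:E *
       u (rV_cons (a * p0 + s * v0, a *: p + s *: v)%R)))).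
  apply: eq_integral => p _; rewrite ge0_integral_rV_cons; last 2 first.
  - apply: (mK _ _ _ (fun=> _)) => //; apply: measurableT_comp => //.
    exact: measurable_affine_rV.
  - by move=> v; exact: K0.
  apply: eq_integral => v0 _; apply: eq_integral => v _.
  rewrite !prod_rV_cons consD !EFinM -!/(Pf n _) -!/(Pp n _).
  by rewrite !muleA; congr (_ * _); rewrite -!muleA; congr (_ * _); rewrite muleCA.
pose T4 := (('rV[R]_n * measurableTypeR R) * 'rV[R]_n)%type.
pose F4 (q : T4) := (f p0)%:E * (phi q.1.2)%:E * ((Pf n q.1.1)%:E * (Pp n q.2)%:E *
   u (rV_cons (a * p0 + s * q.1.2, a *: q.1.1 + s *: q.2)%R)).
have F40 q : 0 <= F4 q by apply: mule_ge0; [rewrite mule_ge0// lee_fin|exact: K0].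
have m11 : measurable_fun [set: T4] (fun q => q.1.1).
  exact: (measurableT_comp measurable_fst measurable_fst).
have m12 : measurable_fun [set: T4] (fun q => q.1.2).
  exact: (measurableT_comp measurable_snd measurable_fst).
have m2 : measurable_fun [set: T4] (fun q => q.2) by exact: measurable_snd.
have maf : measurable_fun [set: T4]
    (fun q => rV_cons (a * p0 + s * q.1.2, a *: q.1.1 + s *: q.2)%R).
  apply: (measurableT_comp (@measurable_rV_cons R n)).
  apply: measurable_fun_pair.
    by apply: measurable_funD => //; apply: measurable_funM.
  exact: measurable_affine_rV.
have mF4 : measurable_fun setT F4.
  apply: emeasurable_funM.
    apply: emeasurable_funM => //; apply/measurable_EFinP.
    exact: (measurableT_comp mphi m12).
  by apply: mK => //; exact: measurableT_comp.
have mF3 := @measurable_integral_snd _ _ _ _ _ (lebesgue_rV n) F4 mF4 F40.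
(* The order is [p0], [p], [v0], [v]; exchanging [p] and [v0] brings the two tails together for the
   induction hypothesis. *)
rewrite (fubini_tonelli (m1 := lebesgue_rV n) (m2 := leb) _ mF3); last first.
  by move=> q; apply: integral_ge0.
apply: eq_integral => v0 _.
transitivity (\int[lebesgue_rV n]_p ((f p0)%:E * (phi v0)%:E *
    \int[lebesgue_rV n]_v ((Pf n p)%:E * (Pp n v)%:E *
       u (rV_cons (a * p0 + s * v0, a *: p + s *: v)%R)))).
  apply: eq_integral => p _; rewrite -[RHS]ge0_integralZl//.
  - apply: (mK _ _ _ (fun=> _)) => //; apply: measurableT_comp => //.
    apply: (measurableT_comp (@measurable_rV_cons R n)); apply: measurable_fun_pair => //.
    exact: measurable_affine_rV.
  - by move=> v _; exact: K0.
  - by rewrite mule_ge0// lee_fin.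
rewrite ge0_integralZl//; last 3 first.
- apply: (@measurable_integral_snd _ _ _ _ _ (lebesgue_rV n)
    (fun q : 'rV[R]_n * 'rV[R]_n => (Pf n q.1)%:E * (Pp n q.2)%:E *
      u (rV_cons (a * p0 + s * v0, a *: q.1 + s *: q.2)%R))) => [|q]; last exact: K0.
  apply: mK => //; apply: measurableT_comp => //.
  apply: (measurableT_comp (@measurable_rV_cons R n)); apply: measurable_fun_pair => //.
  exact: measurable_affine_rV.
- by move=> p _; apply: integral_ge0 => v _; exact: K0.
- by rewrite mule_ge0// lee_fin.
congr (_ * _); apply: (IH (fun q => u (rV_cons (a * p0 + s * v0, q)%R))) => //.
by apply: measurableT_comp => //; exact: measurable_rV_cons1.
Qed.

End gaussian_rV.

(** * Reversibility of the Ornstein-Uhlenbeck step in dimension one *)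

Section ou_stationary.
Context {R : realType}.
Local Open Scope ereal_scope.
Notation leb := (@lebesgue_measure R).

Lemma normal_pdf0E (s t : R) : s != 0%R ->
  normal_pdf 0 s t = (normal_peak s * expR (- (t ^+ 2 / (s ^+ 2 *+ 2))))%R.
Proof. by move=> s0; rewrite normal_pdfE// /normal_fun subr0 mulNr. Qed.

Variables (beta h a s : R).
Hypotheses (beta0 : (0 < beta)%R) (h0 : (0 < h)%R) (s0 : (0 < s)%R)
  (has : (a ^+ 2 + beta * (s ^+ 2 * h) = 1)%R).

Let f (p : R) := expR (- (beta * (p ^+ 2 / 2))).
Let phi := normal_pdf 0 (Num.sqrt h) : R -> R.

Let mf : measurable_fun setT f.
Proof.
apply: measurableT_comp => //; apply: measurable_funN.
by apply: measurable_funM => //; apply: measurable_funM.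
Qed.

Let mphi : measurable_fun setT phi. Proof. exact: measurable_normal_pdf. Qed.

(** Up to normalisation, the joint density of a Gaussian [p] and of [y = a * p + s * v]. *)
Let k (p y : R) := (f p * (phi ((y - a * p) / s) / s))%R.

(** Detailed balance. The exponent is symmetric in [p] and [y] because
    [a ^+ 2 + beta * (s ^+ 2 * h) = 1]; eliminating [beta] through this relation leaves a rational
    identity. *)
Let k_sym p y : k p y = k y p.
Proof.
have sh : Num.sqrt h != 0%R by rewrite gt_eqF// sqrtr_gt0.
rewrite /k /f /phi !normal_pdf0E// sqr_sqrtr ?(ltW h0)//.
rewrite ![(_ * expR _ / s)%R]mulrAC ![(expR _ * (_ * expR _))%R]mulrCA -!expRD.
congr (_ * expR _)%R.
have r0 : (s ^+ 2 * h != 0)%R by rewrite mulf_neq0 ?expf_neq0 ?gt_eqF.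
have -> : (beta = (1 - a ^+ 2) / (s ^+ 2 * h))%R by rewrite -has; field; rewrite !gt_eqF.
by rewrite -mulr_natr; field; rewrite !gt_eqF.
Qed.

Let k0 p y : (0 <= k p y)%R.
Proof. by rewrite /k mulr_ge0 ?expR_ge0// divr_ge0 ?normal_pdf_ge0// ltW. Qed.

Let mk : measurable_fun setT (fun q : R * R => k q.1 q.2).
Proof.
apply: measurable_funM.
  exact: (measurableT_comp mf measurable_fst).
apply: measurable_funM => //; apply: (measurableT_comp mphi).
apply: measurable_funM => //; apply: measurable_funB => //.
by apply: measurable_funM.
Qed.

Let subst p (F : R -> \bar R) : measurable_fun setT F -> (forall t, 0 <= F t) ->
  \int[leb]_v (F (a * p + s * v)%R * s%:E) = \int[leb]_y F y.
Proof.
move=> mF F0.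
apply: (@increasing_substitution R (fun v => a * p + s * v)%R (fun=> s) s) => //.
  move=> t; apply: is_derive_eq.
  by rewrite /= add0r mul1r; exact: mulr1.
by move=> t; exact: cvg_cst.
Qed.

Let s_neq0 : s != 0%R. Proof. by rewrite gt_eqF. Qed.

(** After the substitution [y = a * p + s * v] and Tonelli, detailed balance moves the weight from
    [p] to [y], and the inner integral that remains is that of a normal density, of mass 1. *)
Lemma gauss_stationary (u : R -> \bar R) :
  measurable_fun setT u -> (forall t, 0 <= u t) ->
  \int[leb]_p \int[leb]_v ((f p)%:E * (phi v)%:E * u (a * p + s * v)%R) =
  \int[leb]_p ((f p)%:E * u p).
Proof.
move=> mu u0.
have mkp p : measurable_fun setT (fun y => (k p y)%:E).
  by apply/measurable_EFinP; exact: (measurableT_comp mk (measurable_pair1 p)).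
transitivity (\int[leb]_p \int[leb]_y ((k p y)%:E * u y)).
  apply: eq_integral => p _; rewrite -[RHS](subst p); last 2 first.
  - exact: emeasurable_funM.
  - by move=> t; rewrite mule_ge0// lee_fin.
  apply: eq_integral => v _; rewrite [RHS]muleAC; congr (_ * _).
  rewrite /k (_ : (a * p + s * v - a * p) / s = v)%R; last by field.
  by rewrite -!EFinM -!mulrA mulVf// mulr1.
have mku : measurable_fun setT
    (fun q : measurableTypeR R * measurableTypeR R => (k q.1 q.2)%:E * u q.2).
  apply: emeasurable_funM; first exact/measurable_EFinP.
  exact: (measurableT_comp mu measurable_snd).
rewrite (fubini_tonelli (m1 := leb) (m2 := leb) _ mku); last first.
  by move=> q; rewrite mule_ge0// lee_fin.
apply: eq_integral => y _ /=.
under eq_integral do rewrite k_sym.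
rewrite ge0_integralZr//=; last 2 first.
- exact: mkp.
- by move=> p _; rewrite lee_fin.
congr (_ * _).
under eq_integral do rewrite /k EFinM.
rewrite ge0_integralZl_EFin ?expR_ge0//; last 2 first.
- by move=> p _; rewrite lee_fin divr_ge0 ?normal_pdf_ge0// ltW.
- apply/measurable_EFinP; apply: measurable_funM => //; apply: (measurableT_comp mphi).
  by apply: measurable_funM => //; exact: measurable_funB.
rewrite -[RHS]mule1; congr (_ * _); rewrite -(integral_normal_pdf 0 (Num.sqrt h)).
rewrite -(@subst y (fun p : R => (phi ((p - a * y) / s) / s)%:E)); last 2 first.
- apply/measurable_EFinP; apply: measurable_funM => //; apply: (measurableT_comp mphi).
  by apply: measurable_funM => //; exact: measurable_funB.
- by move=> t; rewrite lee_fin divr_ge0 ?normal_pdf_ge0// ltW.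
apply: eq_integral => v _.
rewrite (_ : (a * y + s * v - a * y) / s = v)%R; last by field.
by rewrite -EFinM divfK.
Qed.

Lemma gauss_integral_lty : \int[leb]_p (f p)%:E < +oo.
Proof.
pose sg := Num.sqrt beta^-1.
have sg0 : sg != 0%R by rewrite gt_eqF// sqrtr_gt0 invr_gt0.
have fE p : f p = ((normal_peak sg)^-1 * normal_pdf 0 sg p)%R.
  rewrite normal_pdf0E// mulKf ?gt_eqF ?normal_peak_gt0//.
  rewrite sqr_sqrtr ?invr_ge0 ?(ltW beta0)//; congr expR.
  by rewrite -mulr_natr; field; rewrite gt_eqF.
under eq_integral do rewrite fE EFinM.
rewrite ge0_integralZl_EFin//.
- by rewrite integral_normal_pdf mule1 ltry.
- by move=> p _; rewrite lee_fin normal_pdf_ge0.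
- by apply/measurable_EFinP; exact: measurable_normal_pdf.
- by rewrite invr_ge0 normal_peak_ge0.
Qed.

End ou_stationary.

(** * Elementary exponential estimates *)

Section ratio_bounds.
Context {R : realType}.

Lemma expR_taylor2 (y : R) : `|expR y - 1 - y| <= y ^+ 2 * expR `|y|.
Proof.
have e1 := expR_ge1Dx y; have e2 := expR_ge1Dx (- y).
have ep := expR_gt0 y; have ey : expR y * expR (- y) = 1 by rewrite -expRD subrr expR0.
have h1 : expR y * (1 - y) <= 1 by rewrite -[leRHS]ey ler_pM2l.
have [y0|y0] := leP 0 y.
  rewrite (ger0_norm y0) ger0_norm; last lra.
  have h2 : y * (expR y - 1) <= y * (y * expR y) by rewrite ler_wpM2l//; lra.
  by rewrite expr2; lra.
rewrite ger0_norm; last lra.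
rewrite ltr0_norm//.
have h3 : - y * (1 - expR y) <= - y * - y by rewrite ler_wpM2l//; lra.
have h4 : 1 <= expR (- y) by rewrite -expR0 ler_expR; lra.
have h5 : y ^+ 2 <= y ^+ 2 * expR (- y) by rewrite ler_peMr// sqr_ge0.
by move: h5; rewrite {1}expr2; lra.
Qed.

(** [y] is to be [beta] times the energy increment and [1 + eta] the Jacobian of a substep. They
    compensate up to second-order quantities: [a], which bounds [y - eta], and [b ^+ 2], where [b]
    bounds [y]. *)
Lemma ratio_bound (y eta a b : R) : `|y| <= b -> `|y - eta| <= a ->
  `|expR (- y) * (1 + eta) - 1| <= expR (2 * b) * (a + b ^+ 2).
Proof.
move=> yb ya; have b0 : 0 <= b by exact: le_trans yb.
have a0 : 0 <= a by exact: le_trans ya.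
have ey : expR (- y) * expR y = 1 by rewrite -expRD addNr expR0.
have -> : expR (- y) * (1 + eta) - 1 = expR (- y) * ((eta - y) - (expR y - 1 - y)).
  rewrite (_ : eta - y - _ = (1 + eta) - expR y); last ring.
  by rewrite mulrBr ey.
rewrite normrM (@gtr0_norm _ (expR _)) ?expR_gt0//.
have -> : 2 * b = b + b by ring.
rewrite expRD -mulrA; apply: ler_pM => //.
  by rewrite ler_expR; move: yb; rewrite ler_norml; lra.
have eb1 : 1 <= expR b by rewrite -expR0 ler_expR.
apply: le_trans (ler_normB _ _) _; rewrite mulrDr distrC; apply: lerD.
  by apply: le_trans ya _; rewrite ler_peMl.
apply: le_trans (expR_taylor2 y) _; rewrite mulrC; apply: ler_pM => //.
- exact: sqr_ge0.
- by rewrite ler_expR.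
- by rewrite -real_normK ?num_real// lerXn2r ?nnegrE.
Qed.

(** Trades a power of the energy for a fraction of the exponent; the constant comes from
    [1 + (k * x) ^+ 2 / 2 <= expR (k * x)]. *)
Lemma sqr_le_expR (k x : R) : 0 < k -> 0 <= x -> x ^+ 2 <= 2 / k ^+ 2 * expR (k * x).
Proof.
move=> k0 x0; have k2 : 0 < k ^+ 2 by rewrite exprn_gt0.
rewrite mulrAC ler_pdivlMr// -exprMn mulrC.
have kx0 : 0 <= k * x by rewrite mulr_ge0// ltW.
have : 1 + (k * x) ^+ 2 / 2 <= expR (k * x) := expR_ge1Dxn 1 kx0.
lra.
Qed.

End ratio_bounds.

Section energy_increment.
Context {R : realType}.

(* The terms of order [h] cancel: they are the divergence of the drift of the
   pair [(x_i, p_i)] against the Gibbs density, which vanishes. *)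
Lemma energy_increment (B E h beta q k vi gi G dV dc : R) :
  1 <= B -> 1 <= E -> 0 <= h -> h <= 1 -> 0 < beta -> beta <= B -> beta^-1 <= B ->
  `|k| <= `|q| -> `|k - q| <= h * `|q| ^+ 3 -> 0 <= G -> G <= B -> `|gi| <= B ->
  vi ^+ 2 <= B * E -> q ^+ 2 <= 2 * E ->
  `|dV - vi * (h * G * k)| <= B * (h * G * k) ^+ 2 -> `|dc| <= B * `|h * G * k| ->
  let c := - (G * vi) + beta^-1 * gi in
  let y := beta * (dV + ((q + h * (c + dc)) ^+ 2 - q ^+ 2) / 2) in
  `|y - h * gi * k| <= 16 * B ^+ 5 * h ^+ 2 * E ^+ 2 /\ `|y| <= 17 * B ^+ 5 * h * E.
Proof.
move=> B1 E1 h0 h1 beta0 betaB ibB kq kqd G0 GB giB viE qE dVE dcE c y.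
have B0 : 0 <= B by exact: le_trans B1.
have E0 : 0 <= E by exact: le_trans E1.
have ib0 : 0 <= beta^-1 by rewrite invr_ge0 ltW.
have BB (m n : nat) : (m <= n)%N -> B ^+ m <= B ^+ n by move=> ?; rewrite ler_weXn2l.
have Bp n : 0 <= B ^+ n by exact: exprn_ge0.
set n1 := h * G * k in dVE dcE.
have n1q : `|n1| <= h * B * `|q|.
  rewrite /n1 2!normrM (ger0_norm h0) (ger0_norm G0).
  by rewrite ler_pM ?mulr_ge0// ler_wpM2l.
have sq_norm (a : R) : `|a| ^+ 2 = a ^+ 2 by rewrite real_normK ?num_real.
have n1sq : n1 ^+ 2 <= h ^+ 2 * B ^+ 2 * (2 * E).
  rewrite -sq_norm; apply: (@le_trans _ _ ((h * B * `|q|) ^+ 2)).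
    by rewrite lerXn2r ?nnegrE// !mulr_ge0.
  by rewrite !exprMn sq_norm ler_wpM2l// mulr_ge0// exprn_ge0.
have EE : E <= E ^+ 2 by rewrite expr2 ler_peMr.
have hh : h ^+ 2 <= h by rewrite expr2 ler_piMr.
have h20 : 0 <= h ^+ 2 by exact: exprn_ge0.
have X0 : 0 <= h ^+ 2 * E ^+ 2 by rewrite mulr_ge0// exprn_ge0.
have q2E : `|q| ^+ 2 <= 2 * E by rewrite sq_norm.
have q20 : 0 <= `|q| ^+ 2 by exact: exprn_ge0.
have r1 : `|dV - vi * n1| <= 2 * B ^+ 3 * (h ^+ 2 * E).
  apply: le_trans dVE _; apply: (@le_trans _ _ (B * (h ^+ 2 * B ^+ 2 * (2 * E)))).
    by rewrite ler_wpM2l.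
  by rewrite le_eqVlt; apply/orP; left; apply/eqP; ring.
have dcq : `|dc| <= B * (h * B * `|q|) by apply: le_trans dcE _; rewrite ler_wpM2l.
(* [vi] and [q] are both of order [sqrt E], so a product of degree four in them is of order
   [E ^+ 2]. *)
have vq3 : `|vi| * `|q| ^+ 3 <= 3 * B * E ^+ 2.
  have -> : `|vi| * `|q| ^+ 3 = (`|vi| * `|q|) * `|q| ^+ 2 by ring.
  have amgm : `|vi| * `|q| <= (`|vi| ^+ 2 + `|q| ^+ 2) / 2.
    by rewrite ler_pdivlMr//; have := sqr_ge0 (`|vi| - `|q|); rewrite sqrrB; lra.
  have a1 : `|vi| * `|q| <= 3 / 2 * B * E.
    have : 2 * E <= 2 * (B * E) by rewrite ler_pM2l// ler_peMl.
    by move: amgm; rewrite !sq_norm; lra.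
  have -> : 3 * B * E ^+ 2 = (3 / 2 * B * E) * (2 * E) by field.
  by rewrite ler_pM ?mulr_ge0.
have q3 : `|q| ^+ 3 <= 3 * E ^+ 2.
  have -> : `|q| ^+ 3 = `|q| * `|q| ^+ 2 by ring.
  have a1 : `|q| <= 3 / 2 * E.
    by have := sqr_ge0 (`|q| - 1); rewrite sqrrB; lra.
  have -> : 3 * E ^+ 2 = (3 / 2 * E) * (2 * E) by field.
  by rewrite ler_pM.
have cE : (c + dc) ^+ 2 <= 12 * B ^+ 4 * E.
  have s2 (a b : R) : (a + b) ^+ 2 <= 2 * a ^+ 2 + 2 * b ^+ 2.
    by have := sqr_ge0 (a - b); rewrite sqrrB sqrrD; lra.
  have c1 : (G * vi) ^+ 2 <= B ^+ 4 * E.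
    rewrite exprMn; apply: (@le_trans _ _ (B ^+ 2 * (B * E))).
      by rewrite ler_pM ?sqr_ge0// lerXn2r ?nnegrE.
    by rewrite mulrA -exprSr ler_wpM2r// BB.
  have c2 : (beta^-1 * gi) ^+ 2 <= B ^+ 4 * E.
    apply: (@le_trans _ _ (B ^+ 4 * 1)); last by rewrite ler_wpM2l.
    rewrite mulr1 -sq_norm normrM (ger0_norm ib0) (_ : B ^+ 4 = (B * B) ^+ 2); last ring.
    by rewrite lerXn2r ?nnegrE ?mulr_ge0// ler_pM.
  have c3 : dc ^+ 2 <= 2 * B ^+ 4 * E.
    rewrite -sq_norm; apply: (@le_trans _ _ ((B * (h * B * `|q|)) ^+ 2)).
      by rewrite lerXn2r ?nnegrE// !mulr_ge0.
    have -> : (B * (h * B * `|q|)) ^+ 2 = B ^+ 4 * (h ^+ 2 * `|q| ^+ 2) by ring.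
    have -> : 2 * B ^+ 4 * E = B ^+ 4 * (2 * E) by ring.
    rewrite ler_wpM2l//; apply: le_trans q2E; rewrite ler_piMl//.
    by rewrite exprn_ile1.
  have := s2 c dc; have := s2 (- (G * vi)) (beta^-1 * gi); rewrite sqrrN -/c; lra.
have c'0 : 0 <= (c + dc) ^+ 2 by exact: sqr_ge0.
have t1 : `|G * vi * (h * (k - q))| <= 3 * B ^+ 4 * (h ^+ 2 * E ^+ 2).
  have -> : `|G * vi * (h * (k - q))| = (h * G) * (`|vi| * `|k - q|).
    by rewrite !normrM (ger0_norm h0) (ger0_norm G0); ring.
  apply: (@le_trans _ _ (h * B * (h * (3 * B * E ^+ 2)))).
    rewrite ler_pM ?mulr_ge0// ?ler_wpM2l//.
    by apply: (@le_trans _ _ (`|vi| * (h * `|q| ^+ 3))); [rewrite ler_wpM2l|rewrite mulrCA ler_wpM2l].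
  have -> : h * B * (h * (3 * B * E ^+ 2)) = 3 * B ^+ 2 * (h ^+ 2 * E ^+ 2) by ring.
  by rewrite ler_wpM2r// ler_pM2l// BB.
have t2 : `|q * (h * dc)| <= 2 * B ^+ 4 * (h ^+ 2 * E).
  have -> : `|q * (h * dc)| = h * `|q| * `|dc| by rewrite !normrM (ger0_norm h0); ring.
  apply: (@le_trans _ _ (h * `|q| * (B * (h * B * `|q|)))); first by rewrite ler_wpM2l// mulr_ge0.
  have -> : h * `|q| * (B * (h * B * `|q|)) = B ^+ 2 * (h ^+ 2 * `|q| ^+ 2) by ring.
  apply: (@le_trans _ _ (B ^+ 2 * (h ^+ 2 * (2 * E)))); first by rewrite !ler_wpM2l.
  have -> : B ^+ 2 * (h ^+ 2 * (2 * E)) = 2 * B ^+ 2 * (h ^+ 2 * E) by ring.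
  by rewrite ler_wpM2r ?mulr_ge0// ler_pM2l// BB.
have t3 : `|h ^+ 2 * (c + dc) ^+ 2 / 2| <= 6 * B ^+ 4 * (h ^+ 2 * E).
  have p0 : 0 <= h ^+ 2 * (c + dc) ^+ 2 / 2 by rewrite divr_ge0// (mulr_ge0 h20 c'0).
  rewrite (ger0_norm p0).
  rewrite ler_pdivrMr// (_ : _ * 2 = h ^+ 2 * (12 * B ^+ 4 * E)); last ring.
  by rewrite ler_wpM2l.
have t4 : `|h * gi * (q - k)| <= 3 * B ^+ 5 * (h ^+ 2 * E ^+ 2).
  rewrite 2!normrM (ger0_norm h0) [`|q - k|]distrC.
  apply: (@le_trans _ _ (h * B * (h * (3 * E ^+ 2)))).
    rewrite ler_pM ?mulr_ge0// ?ler_wpM2l//.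
    by apply: le_trans kqd _; rewrite ler_wpM2l.
  have -> : h * B * (h * (3 * E ^+ 2)) = 3 * B * (h ^+ 2 * E ^+ 2) by ring.
  by rewrite ler_wpM2r// ler_pM2l//; exact: (BB 1%N 5%N).
have hE2 : h ^+ 2 * E <= h ^+ 2 * E ^+ 2 by rewrite ler_wpM2l.
have hE1 : h ^+ 2 * E <= h * E by rewrite ler_wpM2r.
have B34 : 2 * B ^+ 3 <= 2 * B ^+ 4 by rewrite ler_pM2l// BB.
(* The work [vi * n1] of the drift and the term [- (G * vi)] of the kick cancel except for [k - q],
   while the term [beta^-1 * gi] of the kick, times [beta], gives [h * gi * q]: this is the
   first-order part [h * gi * k] of the Jacobian, again up to [q - k]. *)
have yE : y - h * gi * k = beta * (G * vi * (h * (k - q)) + (dV - vi * n1) + q * (h * dc)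
     + h ^+ 2 * (c + dc) ^+ 2 / 2) + h * gi * (q - k).
  by rewrite /y /c /n1; field; rewrite gt_eqF.
have hE20 : 0 <= h ^+ 2 * E by rewrite mulr_ge0.
have hE0 : 0 <= h * E by rewrite mulr_ge0.
have mB (a b : R) : `|a| <= b -> `|beta * a| <= B * b.
  by move=> ab; rewrite normrM (gtr0_norm beta0) ler_pM// ltW.
split.
  rewrite yE; apply: le_trans (ler_normD _ _) _.
  (* 13 = 3 + 2 + 2 + 6; the factor [beta <= B] then raises the power of [B] to 5 and [t4] adds 3 to
     make 16. *)
  have S : `|G * vi * (h * (k - q)) + (dV - vi * n1) + q * (h * dc)
     + h ^+ 2 * (c + dc) ^+ 2 / 2| <= 13 * B ^+ 4 * (h ^+ 2 * E ^+ 2).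
    have p1 : 2 * B ^+ 3 * (h ^+ 2 * E) <= 2 * B ^+ 4 * (h ^+ 2 * E ^+ 2).
      by rewrite ler_pM ?mulr_ge0.
    have p2 : 2 * B ^+ 4 * (h ^+ 2 * E) <= 2 * B ^+ 4 * (h ^+ 2 * E ^+ 2).
      by rewrite ler_wpM2l// mulr_ge0.
    have p3 : 6 * B ^+ 4 * (h ^+ 2 * E) <= 6 * B ^+ 4 * (h ^+ 2 * E ^+ 2).
      by rewrite ler_wpM2l// mulr_ge0.
    apply: le_trans (ler_normD _ _) _; apply: le_trans (lerD (ler_normD _ _) (lexx _)) _.
    apply: le_trans (lerD (lerD (ler_normD _ _) (lexx _)) (lexx _)) _.
    move: t1 t2 t3 r1 p1 p2 p3; lra.
  have := mB _ _ S.
  have -> : B * (13 * B ^+ 4 * (h ^+ 2 * E ^+ 2)) = 13 * B ^+ 5 * (h ^+ 2 * E ^+ 2) by ring.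
  by move: t4; lra.
have -> : y = beta * (vi * n1 + (dV - vi * n1) + q * (h * (c + dc)) + h ^+ 2 * (c + dc) ^+ 2 / 2).
  by rewrite /y; field.
have s1 : `|vi * n1| <= 2 * B ^+ 4 * (h * E).
  rewrite normrM; apply: (@le_trans _ _ (`|vi| * (h * B * `|q|))); first by rewrite ler_wpM2l.
  have amgm : `|vi| * `|q| <= 3 / 2 * B * E.
    have : 2 * E <= 2 * (B * E) by rewrite ler_pM2l// ler_peMl.
    have := sqr_ge0 (`|vi| - `|q|); rewrite sqrrB !sq_norm; lra.
  have -> : `|vi| * (h * B * `|q|) = h * B * (`|vi| * `|q|) by ring.
  apply: (@le_trans _ _ (h * B * (3 / 2 * B * E))); first by rewrite ler_wpM2l// mulr_ge0.
  have -> : h * B * (3 / 2 * B * E) = 3 / 2 * B ^+ 2 * (h * E) by ring.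
  by rewrite ler_wpM2r//; have := BB 2%N 4%N isT; have := Bp 2%N; lra.
have s2 : `|q * (h * (c + dc))| <= 7 * B ^+ 4 * (h * E).
  have -> : `|q * (h * (c + dc))| = h * (`|q| * `|c + dc|).
    by rewrite !normrM (ger0_norm h0); ring.
  have -> : 7 * B ^+ 4 * (h * E) = h * (7 * B ^+ 4 * E) by ring.
  rewrite ler_wpM2l//.
  have e1 : E <= B ^+ 4 * E by rewrite ler_peMl// exprn_ege1.
  have := sqr_ge0 (`|q| - `|c + dc|); rewrite sqrrB !sq_norm; lra.
(* 17 = 2 + 2 + 7 + 6. *)
have S : `|vi * n1 + (dV - vi * n1) + q * (h * (c + dc)) + h ^+ 2 * (c + dc) ^+ 2 / 2|
    <= 17 * B ^+ 4 * (h * E).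
  have p1 : 2 * B ^+ 3 * (h ^+ 2 * E) <= 2 * B ^+ 4 * (h * E).
    by rewrite ler_pM ?mulr_ge0.
  have p3 : 6 * B ^+ 4 * (h ^+ 2 * E) <= 6 * B ^+ 4 * (h * E).
    by rewrite ler_wpM2l// mulr_ge0.
  apply: le_trans (ler_normD _ _) _; apply: le_trans (lerD (ler_normD _ _) (lexx _)) _.
  apply: le_trans (lerD (lerD (ler_normD _ _) (lexx _)) (lexx _)) _.
  move: s1 s2 t3 r1 p1 p3; lra.
have := mB _ _ S.
by have -> : B * (17 * B ^+ 4 * (h * E)) = 17 * B ^+ 5 * h * E by ring.
Qed.

End energy_increment.

Section almost_invariance.
Local Open Scope ereal_scope.

(** The substitution turns the integral of [w * u] into that of [w (S z) * u (S z) * J z], which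
    differs pointwise from [w z * u (S z)] by at most [C * r z]. Two inequalities avoid a difference
    of extended reals. *)
Lemma almost_invariance d (T : measurableType d) (R : realType)
    (mu : {measure set T -> \bar R}) (S : T -> T) (J w r : T -> R) (C : R) (u : T -> R) :
  measurable_fun setT S -> measurable_fun setT J -> measurable_fun setT w ->
  measurable_fun setT r -> measurable_fun setT u ->
  (forall z, (0 <= J z)%R) -> (forall z, (0 <= w z)%R) -> (0 <= C)%R ->
  (forall z, (0 <= r z)%R) -> (forall z, (0 <= u z <= 1)%R) ->
  (forall F : T -> \bar R, measurable_fun setT F -> (forall z, 0 <= F z) ->
    \int[mu]_z (F (S z) * (J z)%:E) = \int[mu]_z F z) ->
  (forall z, (`|w z - w (S z) * J z| <= C * r z)%R) ->
  \int[mu]_z (w z * u (S z))%:E <= \int[mu]_z (w z * u z)%:E + C%:E * \int[mu]_z (r z)%:E /\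
  \int[mu]_z (w z * u z)%:E <= \int[mu]_z (w z * u (S z))%:E + C%:E * \int[mu]_z (r z)%:E.
Proof.
move=> mS mJ mw mr mu_ J0 w0 C0 r0 u01 sub wSJ.
have u0 z : (0 <= u z)%R by have /andP[] := u01 z.
have mwu : measurable_fun setT (fun z => (w z * u z)%R) by exact: measurable_funM.
have muS : measurable_fun setT (fun z => u (S z)) by exact: measurableT_comp.
have mwS : measurable_fun setT (fun z => w (S z)) by exact: measurableT_comp.
have mwuS : measurable_fun setT (fun z => (w z * u (S z))%R) by exact: measurable_funM.
have mCr : measurable_fun setT (fun z => (C * r z)%R) by exact: measurable_funM.
have mA : measurable_fun setT (fun z => (w (S z) * u (S z) * J z)%R).
  by apply: measurable_funM => //; exact: measurable_funM.
have key : \int[mu]_z (w z * u z)%:E = \int[mu]_z (w (S z) * u (S z) * J z)%:E.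
  rewrite -(sub (fun z => (w z * u z)%:E)).
  - by apply: eq_integral => z _; rewrite EFinM.
  - exact/measurable_EFinP.
  - by move=> z; rewrite lee_fin mulr_ge0.
have rE : C%:E * \int[mu]_z (r z)%:E = \int[mu]_z (C * r z)%:E.
  rewrite -ge0_integralZl_EFin//; last exact/measurable_EFinP.
  by move=> z _; rewrite lee_fin.
rewrite key rE -!ge0_integralD//; try by [
  move=> z _; rewrite lee_fin !mulr_ge0 | exact/measurable_EFinP].
have bound z : (`|w z * u (S z) - w (S z) * u (S z) * J z| <= C * r z)%R.
  have -> : (w z * u (S z) - w (S z) * u (S z) * J z = (w z - w (S z) * J z) * u (S z))%R by ring.
  rewrite normrM; apply: le_trans (wSJ z); have /andP[a b] := u01 (S z).
  by rewrite ler_piMr// ger0_norm.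
split; apply: ge0_le_integral => //; try by [
  move=> z _; rewrite lee_fin ?addr_ge0 ?mulr_ge0 ?mulr_ge0 |
  apply/measurable_EFinP => // | apply/measurable_EFinP; exact: measurable_funD |
  move=> z _; rewrite -EFinD lee_fin addr_ge0// !mulr_ge0 |
  under eq_fun do rewrite -EFinD; apply/measurable_EFinP; exact: measurable_funD ].
- by move=> z _; rewrite -EFinD lee_fin; have := bound z; rewrite ler_norml => /andP[]; lra.
- by move=> z _; rewrite -EFinD lee_fin; have := bound z; rewrite ler_norml => /andP[]; lra.
Qed.

End almost_invariance.

(** * Averages over a Gaussian increment *)

Section gauss_avg.
Context {R : realType}.
Variable n : nat.
Implicit Types (h : R) (v : 'rV[R]_n).

Definition gauss_pdf h v : R := \prod_(i < n) normal_pdf 0 (Num.sqrt h) (v ord0 i).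

Lemma gauss_pdf_ge0 h v : 0 <= gauss_pdf h v.
Proof. by apply: prodr_ge0 => i _; exact: normal_pdf_ge0. Qed.

Lemma measurable_gauss_pdf h : measurable_fun setT (gauss_pdf h).
Proof. by apply: measurable_prod_coord; exact: measurable_normal_pdf. Qed.

Lemma integral_gauss_pdf h : 0 < h -> (\int[lebesgue_rV n]_v (gauss_pdf h v)%:E = 1)%E.
Proof.
move=> h0; rewrite (@ge0_integral_rV_prod R n (fun=> normal_pdf 0 (Num.sqrt h)))//.
- by rewrite big1// => i _; rewrite integral_normal_pdf.
- by move=> i; exact: measurable_normal_pdf.
- by move=> i t; exact: normal_pdf_ge0.
Qed.

Definition gauss_avg h (u : 'rV[R]_n -> R) : R :=
  fine (\int[lebesgue_rV n]_v (gauss_pdf h v * u v)%:E).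

Variable h : R.
Hypothesis h0 : 0 < h.

Lemma gauss_avgE (u : 'rV[R]_n -> R) : measurable_fun setT u -> (forall v, 0 <= u v <= 1) ->
  (gauss_avg h u)%:E = (\int[lebesgue_rV n]_v (gauss_pdf h v * u v)%:E)%E /\
  0 <= gauss_avg h u <= 1.
Proof.
move=> mu u01; have mp := measurable_gauss_pdf h; have p0 := gauss_pdf_ge0 h.
have I0 : (0 <= \int[lebesgue_rV n]_v (gauss_pdf h v * u v)%:E)%E.
  by apply: integral_ge0 => v _; rewrite lee_fin mulr_ge0//; have /andP[] := u01 v.
have I1 : (\int[lebesgue_rV n]_v (gauss_pdf h v * u v)%:E <= 1)%E.
  rewrite -(integral_gauss_pdf h0); apply: ge0_le_integral => //.
  - by move=> v _; rewrite lee_fin mulr_ge0//; have /andP[] := u01 v.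
  - by apply/measurable_EFinP; exact: measurable_funM.
  - exact/measurable_EFinP.
  - by move=> v _; rewrite lee_fin ler_piMr//; have /andP[] := u01 v.
have If : (\int[lebesgue_rV n]_v (gauss_pdf h v * u v)%:E)%E \is a fin_num.
  by rewrite ge0_fin_numE// (le_lt_trans I1)// ltry.
rewrite /gauss_avg fineK//; split=> //.
by rewrite -!lee_fin fineK// I0.
Qed.

Lemma measurable_gauss_avg d (T : measurableType d) (f : T * 'rV[R]_n -> R) :
  measurable_fun setT f -> (forall q, 0 <= f q) ->
  measurable_fun setT (fun t => gauss_avg h (fun v => f (t, v))).
Proof.
move=> mf f0; apply: measurableT_comp => //.
apply: (@measurable_integral_snd R _ _ T 'rV[R]_n (lebesgue_rV n)
  (fun q => (gauss_pdf h q.2 * f q)%:E)).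
  apply/measurable_EFinP; apply: measurable_funM => //.
  exact: (measurableT_comp (measurable_gauss_pdf h) measurable_snd).
by move=> q; rewrite lee_fin mulr_ge0// gauss_pdf_ge0.
Qed.

End gauss_avg.

(** * One step of the scheme against the Gibbs weight *)

Section gibbs.
Context {R : realType}.
Variables (d : nat) (beta vm : R) (V g : 'rV[R]_d -> R) (dV dg : 'rV[R]_d -> 'rV[R]_d).
Implicit Types (z : 'rV[R]_(d + d)) (x p v : 'rV[R]_d) (h : R).

Let c x := - (g x *: dV x) + beta^-1 *: dg x.

Definition kinetic p : R := \sum_(i < d) p ord0 i ^+ 2 / 2.
(** The inverse temperature is a parameter because errors are measured by the weight at
    [beta / 2]. *)
Definition gibbs_weight (k : R) z : R :=
  expR (- (k * (kinetic (rsubmx z) + V (lsubmx z)))).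

(** [gb_dV] controls the force by the energy, so that error terms become polynomials in the energy.
    [gb_taylor] and [gb_derive] are stated along coordinate lines, the displacements made by a
    single shear. [dV] and [dg] stand for the gradients. *)
Record gibbs_bounds (B : R) : Prop := GibbsBounds {
  gb_B1 : 1 <= B;
  gb_beta0 : 0 < beta;
  gb_beta : beta <= B;
  gb_ibeta : beta^-1 <= B;
  gb_g0 : forall x, 0 < g x;
  gb_g : forall x, g x <= B;
  gb_dg : forall x i, `|dg x ord0 i| <= B;
  gb_V : forall x, vm <= V x;
  gb_dV : forall x i, dV x ord0 i ^+ 2 <= B * (1 + V x - vm);
  gb_taylor : forall x i s,
    `|V (rV_upd x i (x ord0 i + s)) - V x - dV x ord0 i * s| <= B * s ^+ 2;
  gb_c : forall x y, `|c x - c y| <= B * `|x - y|;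
  gb_mV : measurable_fun setT V;
  gb_mg : measurable_fun setT g;
  gb_mdg : measurable_fun setT dg;
  gb_mc : measurable_fun setT c;
  gb_derive : forall x i (t : R),
    is_derive t 1 (fun s => g (rV_upd x i s)) (dg (rV_upd x i t) ord0 i);
  gb_dgc : forall x i, continuous (fun t : R => dg (rV_upd x i t) ord0 i) }.

Variable B : R.
Hypothesis GB : gibbs_bounds B.

Lemma measurable_kinetic : measurable_fun setT kinetic.
Proof.
apply: measurable_sum => i; apply: measurable_funM => //; apply: measurable_funX.
exact: measurable_coord.
Qed.

Lemma measurable_gibbs_weight k : measurable_fun setT (gibbs_weight k).
Proof.
apply: measurableT_comp => //; apply: measurable_funN; apply: measurable_funM => //.
apply: measurable_funD.
  exact: (measurableT_comp measurable_kinetic (@measurable_rsubmx R d d)).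
exact: (measurableT_comp (gb_mV GB) (@measurable_lsubmx R d d)).
Qed.

Lemma measurable_cutoff h : 0 <= h -> measurable_fun setT (cutoff h : R -> R).
Proof.
move=> h0; apply: measurable_funM => //.
apply: continuous_measurable_fun => q; apply: cvgV.
  by rewrite gt_eqF// (@lt_le_trans _ _ 1)// lerDl mulr_ge0// sqr_ge0.
by apply: cvgD; [exact: cvg_cst|apply: cvgM; [exact: cvg_cst|exact: exprn_continuous]].
Qed.

Lemma measurable_drift_step h i : 0 <= h -> measurable_fun setT (drift_step g h ^~ i).
Proof.
move=> h0; apply: measurable_rV_upd => //; apply: measurable_funD.
  exact: measurable_coord.
apply: measurable_funM; last exact: (measurableT_comp (measurable_cutoff h0) (measurable_coord _)).
apply: measurable_funM => //.
exact: (measurableT_comp (gb_mg GB) (@measurable_lsubmx R d d)).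
Qed.

Lemma measurable_kick_step h i : measurable_fun setT (kick_step c h ^~ i).
Proof.
apply: measurable_rV_upd => //; apply: measurable_funD; first exact: measurable_coord.
apply: measurable_funM => //.
apply: (measurableT_comp (measurable_coord i)).
exact: (measurableT_comp (gb_mc GB) (@measurable_lsubmx R d d)).
Qed.

Lemma measurable_ham_step h i : 0 <= h -> measurable_fun setT (ham_step g c h ^~ i).
Proof.
move=> h0.
exact: (measurableT_comp (measurable_kick_step h i) (measurable_drift_step i h0)).
Qed.

Let jac h i z := 1 + h * dg (lsubmx z) ord0 i * cutoff h (z ord0 (rshift d i)).

Lemma measurable_jac h i : 0 <= h -> measurable_fun setT (jac h i).
Proof.
move=> h0; apply: measurable_funD => //; apply: measurable_funM.
  apply: measurable_funM => //; apply: (measurableT_comp (measurable_coord i)).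
  exact: (measurableT_comp (gb_mdg GB) (@measurable_lsubmx R d d)).
exact: (measurableT_comp (measurable_cutoff h0) (measurable_coord _)).
Qed.

(** This is [(1 - h * q ^+ 2) ^+ 2 >= 0]: the velocity [cutoff h q] peaks at [h * q ^+ 2 = 1]. *)
Lemma cutoff_sqr_le h (q : R) : 0 <= h -> h * cutoff h q ^+ 2 <= 4^-1.
Proof.
move=> h0; have q0 : 0 < 1 + h * q ^+ 2.
  by rewrite (@lt_le_trans _ _ 1)// lerDl mulr_ge0// sqr_ge0.
rewrite /cutoff expr_div_n mulrA ler_pdivrMr ?exprn_gt0// ler_pdivlMl//.
rewrite -subr_ge0 (_ : _ - _ = (1 - h * q ^+ 2) ^+ 2); last ring.
exact: sqr_ge0.
Qed.

(** The squared perturbation is [(h * e ^+ 2) * (h * k ^+ 2)], at most [1 * 4^-1] whatever the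
    momentum; with [q] itself in place of the cutoff it would be unbounded. *)
Lemma jac_ge h i z : 0 <= h -> h * B ^+ 2 <= 1 -> 1 / 2 <= jac h i z.
Proof.
move=> h0 hB; rewrite /jac; set k := cutoff _ _; set e := dg _ _ _.
suff : `|h * e * k| <= 1 / 2 by rewrite ler_norml => /andP[]; lra.
rewrite -(@ler_pXn2r _ 2)// ?nnegrE// real_normK ?num_real//.
rewrite (_ : (h * e * k) ^+ 2 = (h * e ^+ 2) * (h * k ^+ 2)); last ring.
rewrite (_ : (1 / 2) ^+ 2 = 1 * 4^-1); last by field.
have e0 (y : R) : 0 <= h * y ^+ 2 by rewrite mulr_ge0// sqr_ge0.
apply: (ler_pM (e0 e) (e0 k)); last exact: cutoff_sqr_le.
apply: le_trans hB; rewrite ler_wpM2l// -[X in X <= _]real_normK ?num_real//.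
by rewrite lerXn2r ?nnegrE// ?(gb_dg GB)// (le_trans _ (gb_B1 GB)).
Qed.

Local Notation leb := (@lebesgue_measure R).

Lemma lsubmx_upd_l z i t : lsubmx (rV_upd z (lshift d i) t) = rV_upd (lsubmx z) i t.
Proof. by apply/rowP => j; rewrite !mxE (inj_eq (@lshift_inj _ _)). Qed.

Lemma lsubmx_upd_r z i t : lsubmx (rV_upd z (rshift d i) t) = lsubmx z.
Proof. by apply/rowP => j; rewrite !mxE eq_lrshift. Qed.

Lemma rsubmx_upd_r z i t : rsubmx (rV_upd z (rshift d i) t) = rV_upd (rsubmx z) i t.
Proof. by apply/rowP => j; rewrite !mxE (inj_eq (@rshift_inj _ _)). Qed.

Lemma rsubmx_upd_l z i t : rsubmx (rV_upd z (lshift d i) t) = rsubmx z.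
Proof. by apply/rowP => j; rewrite !mxE eq_sym eq_lrshift. Qed.

(** Two shears: the drift moves [x_i] alone, with derivative [jac], and the kick translates [p_i] by
    an amount that does not depend on [p_i], with derivative 1. *)
Lemma ham_step_substitution h i (F : 'rV[R]_(d + d) -> \bar R) :
  0 <= h -> h * B ^+ 2 <= 1 ->
  measurable_fun setT F -> (forall z, 0 <= F z)%E ->
  (\int[lebesgue_rV (d + d)]_z (F (ham_step g c h z i) * (jac h i z)%:E) =
   \int[lebesgue_rV (d + d)]_z F z)%E.
Proof.
move=> h0 hB mF F0.
transitivity (\int[lebesgue_rV (d + d)]_z F (kick_step c h z i))%E.
  apply: (@ge0_integral_rV_upd R _ (lshift d i)
    (fun z => z ord0 (lshift d i) + h * g (lsubmx z) * cutoff h (z ord0 (rshift d i)))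
    (jac h i) (fun z => F (kick_step c h z i))).
  - apply: measurable_funD; first exact: measurable_coord.
    apply: measurable_funM; last exact: (measurableT_comp (measurable_cutoff h0) (measurable_coord _)).
    apply: measurable_funM => //.
    exact: (measurableT_comp (gb_mg GB) (@measurable_lsubmx R d d)).
  - exact: measurable_jac.
  - by move=> z; apply: le_trans (jac_ge i z h0 hB).
  - by apply: (measurableT_comp mF); exact: measurable_kick_step.
  - by move=> z; exact: F0.
  move=> z f mf f0; have half : 0 < 1 / 2 :> R by lra.
  pose x := lsubmx z; pose k := cutoff h (z ord0 (rshift d i)).
  have rE t : rV_upd z (lshift d i) t ord0 (rshift d i) = z ord0 (rshift d i).
    by rewrite rV_upd_ne// eq_sym eq_lrshift.
  transitivity (\int[leb]_t (f (t + h * g (rV_upd x i t) * k)%R *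
      (1 + h * dg (rV_upd x i t) ord0 i * k)%:E))%E.
    by apply: eq_integral => t _; rewrite /jac !lsubmx_upd_l rV_updE rE.
  apply: (@increasing_substitution R (fun t => t + h * g (rV_upd x i t) * k)
    (fun t => 1 + h * dg (rV_upd x i t) ord0 i * k) (1 / 2) f half) => //.
  - move=> t; have dgt := gb_derive GB x i t.
    apply: is_derive_eq.
    by rewrite scaler0 add0r /GRing.scale/=; ring.
  - move=> t; apply: cvgD; first exact: cvg_cst.
    apply: cvgM; last exact: cvg_cst.
    by apply: cvgM; [exact: cvg_cst|exact: (gb_dgc GB)].
  - by move=> t; have := jac_ge i (rV_upd z (lshift d i) t) h0 hB; rewrite /jac lsubmx_upd_l rE.
transitivity (\int[lebesgue_rV (d + d)]_z (F (kick_step c h z i) * 1%:E))%E.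
  by apply: eq_integral => z _; rewrite mule1.
apply: (@ge0_integral_rV_upd R _ (rshift d i)
  (fun z => z ord0 (rshift d i) + h * c (lsubmx z) ord0 i) (fun=> 1) F) => //.
  apply: measurable_funD; first exact: measurable_coord.
  apply: measurable_funM => //; apply: (measurableT_comp (measurable_coord i)).
  exact: (measurableT_comp (gb_mc GB) (@measurable_lsubmx R d d)).
move=> z f mf f0; pose k := h * c (lsubmx z) ord0 i.
transitivity (\int[leb]_t (f (t + k)%R * 1%:E))%E.
  by apply: eq_integral => t _; rewrite rV_updE lsubmx_upd_r.
apply: (@increasing_substitution R (fun t => t + k) (fun=> 1) 1 f) => //.
- by move=> t; apply: is_derive_eq; rewrite addr0.
- by move=> t; exact: cvg_cst.
Qed.

Lemma kinetic_ge0 p : 0 <= kinetic p.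
Proof. by apply: sumr_ge0 => i _; rewrite divr_ge0// sqr_ge0. Qed.

Lemma kinetic_upd p i t : kinetic (rV_upd p i t) = kinetic p + (t ^+ 2 - p ord0 i ^+ 2) / 2.
Proof.
rewrite /kinetic (bigD1 i)//= [in RHS](bigD1 i)//= rV_updE.
have -> : \sum_(j < d | j != i) rV_upd p i t ord0 j ^+ 2 / 2 =
    \sum_(j < d | j != i) p ord0 j ^+ 2 / 2.
  by apply: eq_bigr => j ji; rewrite rV_upd_ne.
by rewrite mulrBl; ring.
Qed.

Lemma kinetic_coord p i : p ord0 i ^+ 2 <= 2 * kinetic p.
Proof.
rewrite /kinetic (bigD1 i)//= mulrDr mulrCA divff// mulr1 lerDl mulr_ge0//.
by apply: sumr_ge0 => j _; rewrite divr_ge0// sqr_ge0.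
Qed.

(** 305 = 16 + 17 ^ 2, from the two bounds of [energy_increment] fed into [ratio_bound];
    [2 / (beta / 4) ^+ 2] is the constant of [sqr_le_expR] for [k = beta / 4]; the exponential
    undoes the shift by [1 - vm] in [E = 1 + kinetic p + V x - vm]. *)
Definition ham_step_cst := 305 * B ^+ 10 * (2 / (beta / 4) ^+ 2) * expR (beta / 2 * (1 - vm)).

Lemma ham_step_cst_ge0 : 0 <= ham_step_cst.
Proof.
have B0 : 0 <= B by exact: le_trans (gb_B1 GB).
have b0 := ltW (gb_beta0 GB).
apply: mulr_ge0 (expR_ge0 _); apply: mulr_ge0; last by rewrite divr_ge0// exprn_ge0// divr_ge0.
exact: (mulr_ge0 (ler0n _ _) (exprn_ge0 _ B0)).
Qed.

(** New weight times Jacobian over old weight is [expR (- y) * (1 + eta)], as in [ratio_bound]. Its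
    distance to 1 is at most [expR (2 * b)] times a multiple of [h ^+ 2 * E ^+ 2]; each of these two
    factors costs [expR (beta / 4 * E)], which lowers the weight from [beta] to [beta / 2]. The
    condition with 34 = 2 * 17 ensures [2 * b <= beta / 4 * E]. *)
Lemma gibbs_weight_ham_step h i z : 0 <= h -> h <= 1 -> h * B ^+ 2 <= 1 ->
  34 * B ^+ 5 * h <= beta / 4 ->
  `|gibbs_weight beta z - gibbs_weight beta (ham_step g c h z i) * jac h i z| <=
  ham_step_cst * h ^+ 2 * gibbs_weight (beta / 2) z.
Proof.
move=> h0 h1 hB hB5; have beta0 := gb_beta0 GB.
pose x := lsubmx z; pose p := rsubmx z; pose q := p ord0 i.
pose k := cutoff h q; pose n1 := h * g x * k.
pose E := 1 + kinetic p + V x - vm.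
have E1 : 1 <= E by have := kinetic_ge0 p; have := gb_V GB x; rewrite /E; lra.
have B1 := gb_B1 GB; have B0 : 0 <= B by exact: le_trans B1.
have zp : z ord0 (rshift d i) = q by rewrite /q /p mxE.
have zx : z ord0 (lshift d i) = x ord0 i by rewrite /x mxE.
pose x' := rV_upd x i (x ord0 i + n1).
have lE : lsubmx (ham_step g c h z i) = x'.
  by rewrite lsubmx_upd_r lsubmx_upd_l zp zx.
have rE : rsubmx (ham_step g c h z i) = rV_upd p i (q + h * c x' ord0 i).
  rewrite rsubmx_upd_r rsubmx_upd_l; congr rV_upd.
  rewrite rV_upd_ne ?zp; last by rewrite eq_sym eq_lrshift.
  by rewrite lsubmx_upd_l zp zx.
pose dc := c x' ord0 i - c x ord0 i.
pose dVx := V x' - V x.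
have x'x : `|x' - x| <= `|n1|.
  apply/norm_rV_leP => // j; rewrite !mxE; case: eqP => [->|_]; last by rewrite subrr normr0.
  by rewrite addrAC subrr add0r.
have cE : c x ord0 i = - (g x * dV x ord0 i) + beta^-1 * dg x ord0 i by rewrite !mxE.
have vE : dV x ord0 i ^+ 2 <= B * E.
  apply: le_trans (gb_dV GB x i) _; rewrite ler_wpM2l// /E.
  by have := kinetic_ge0 p; lra.
have qE : q ^+ 2 <= 2 * E.
  apply: le_trans (kinetic_coord p i) _; rewrite ler_pM2l// /E.
  by have := gb_V GB x; lra.
have dcE : `|dc| <= B * `|n1|.
  apply: le_trans (_ : `|c x' - c x| <= _).
    by have := norm_coord_le (c x' - c x) i; rewrite [X in `|X| <= _]mxE [X in `|_ + X| <= _]mxE.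
  by apply: le_trans (gb_c GB _ _) _; rewrite ler_wpM2l.
have := energy_increment B1 E1 h0 h1 beta0 (gb_beta GB) (gb_ibeta GB) (cutoff_norm_le q h0)
  (cutoff_dist q h0) (ltW (gb_g0 GB x)) (gb_g GB x) (gb_dg GB x i) vE qE
  (gb_taylor GB x i n1) dcE.
rewrite -cE -/k -/n1 -/x'; cbv zeta.
have -> : c x ord0 i + dc = c x' ord0 i by rewrite /dc addrC subrK.
set y := beta * _ => -[ya yb].
have wE : gibbs_weight beta (ham_step g c h z i) = gibbs_weight beta z * expR (- y).
  rewrite /gibbs_weight lE rE kinetic_upd -expRD; congr expR.
  by rewrite -/x -/p /y /q; ring.
have -> : gibbs_weight beta z - gibbs_weight beta (ham_step g c h z i) * jac h i z =
    - (gibbs_weight beta z * (expR (- y) * (1 + h * dg x ord0 i * k) - 1)).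
  by rewrite wE /jac -/x zp -/k; ring.
rewrite normrN normrM (ger0_norm (expR_ge0 _ : 0 <= gibbs_weight beta z)).
have := ratio_bound yb ya.
set a := 16 * _ * _ * _; set b := 17 * _ * _ * _ => rb.
have sE := @sqr_le_expR R (beta / 4) E (divr_gt0 beta0 _) (le_trans ler01 E1).
have {sE} sE := sE ltac:(done).
have b2 : expR (2 * b) <= expR (beta / 4 * E).
  rewrite ler_expR (_ : 2 * b = 34 * B ^+ 5 * h * E); last by rewrite /b; ring.
  by rewrite ler_wpM2r// (le_trans ler01).
have ab : a + b ^+ 2 <= 305 * B ^+ 10 * h ^+ 2 * E ^+ 2.
  have -> : b ^+ 2 = 289 * B ^+ 10 * h ^+ 2 * E ^+ 2 by rewrite /b; ring.
  have : a <= 16 * B ^+ 10 * h ^+ 2 * E ^+ 2.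
    rewrite ler_wpM2r ?sqr_ge0// ler_wpM2r ?sqr_ge0// ler_pM2l//.
    by rewrite ler_weXn2l.
  lra.
have fin : expR (2 * b) * (a + b ^+ 2) <=
    expR (beta / 4 * E) * (305 * B ^+ 10 * h ^+ 2 * (2 / (beta / 4) ^+ 2 * expR (beta / 4 * E))).
  have ab0 : 0 <= a + b ^+ 2.
    by rewrite addr_ge0 ?sqr_ge0//; exact: le_trans ya.
  apply: (ler_pM (expR_ge0 _) ab0 b2); apply: le_trans ab _.
  apply: ler_wpM2l sE; apply: mulr_ge0 (exprn_ge0 _ h0).
  exact: (mulr_ge0 (ler0n _ _) (exprn_ge0 _ B0)).
apply: le_trans (ler_wpM2l (expR_ge0 _ : 0 <= gibbs_weight beta z) (le_trans rb fin)) _.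
rewrite le_eqVlt; apply/orP; left; apply/eqP.
have -> : gibbs_weight (beta / 2) z = gibbs_weight beta z * expR (beta / 4 * E) *
    expR (beta / 4 * E) * expR (- (beta / 2 * (1 - vm))).
  rewrite /gibbs_weight -!expRD; by congr expR; rewrite /E -/p -/x; field.
have eK : expR (beta / 2 * (1 - vm)) * expR (- (beta / 2 * (1 - vm))) = 1.
  by rewrite -expRD subrr expR0.
rewrite /ham_step_cst; set e1 := expR (_ / 4 * _); set e2 := expR (- _) in eK *.
set e3 := expR _ in eK *; set w := gibbs_weight _ _.
rewrite -[LHS]mulr1 -eK; ring.
Qed.

Hypothesis V_int : forall k, 0 < k ->
  (\int[lebesgue_rV d]_x (expR (- (k * V x)))%:E < +oo)%E.

Lemma gibbs_weight_row k x p : gibbs_weight k (row_mx x p) =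
  expR (- (k * V x)) * \prod_(i < d) expR (- (k * (p ord0 i ^+ 2 / 2))).
Proof.
rewrite /gibbs_weight row_mxKl row_mxKr -expR_sum -expRD; congr expR.
by rewrite sumrN -mulr_sumr -/(kinetic p); ring.
Qed.

Let kf (k : R) (q : R) := expR (- (k * (q ^+ 2 / 2))).

Let mkf k : measurable_fun setT (kf k).
Proof.
apply: measurableT_comp => //; apply: measurable_funN.
by apply: measurable_funM => //; apply: measurable_funM.
Qed.

Lemma gibbs_weight_integral_lty k : 0 < k ->
  (\int[lebesgue_rV (d + d)]_z (gibbs_weight k z)%:E < +oo)%E.
Proof.
move=> k0; rewrite ge0_integral_row_mx; last 2 first.
- by apply/measurable_EFinP; exact: measurable_gibbs_weight.
- by move=> z; rewrite lee_fin expR_ge0.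
have I0 : (\int[lebesgue_rV d]_p (\prod_(i < d) kf k (p ord0 i))%:E < +oo)%E.
  rewrite (@ge0_integral_rV_prod R d (fun=> kf k))//; last by move=> *; exact: expR_ge0.
  have J0 : (0 <= \int[leb]_t (kf k t)%:E)%E.
    by apply: integral_ge0 => t _; rewrite lee_fin expR_ge0.
  have Jfin : (\int[leb]_t (kf k t)%:E)%E \is a fin_num.
    by rewrite ge0_fin_numE//; exact: gauss_integral_lty.
  elim/big_rec: _ => [|i y _ yoo]; first exact: ltry.
  exact: lte_mul_pinfty.
have mprod : measurable_fun setT (fun p : 'rV[R]_d => \prod_(i < d) kf k (p ord0 i)).
  exact: measurable_prod_coord.
have prod0 (p : 'rV[R]_d) : 0 <= \prod_(i < d) kf k (p ord0 i).
  by apply: prodr_ge0 => i _; exact: expR_ge0.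
have mV : measurable_fun setT (fun x => expR (- (k * V x))).
  apply: measurableT_comp => //; apply: measurable_funN.
  by apply: measurable_funM => //; exact: (gb_mV GB).
have Ex x : (\int[lebesgue_rV d]_p (gibbs_weight k (row_mx x p))%:E =
    (expR (- (k * V x)))%:E * \int[lebesgue_rV d]_p (\prod_(i < d) kf k (p ord0 i))%:E)%E.
  rewrite -ge0_integralZl_EFin ?expR_ge0//.
  - by apply: eq_integral => p _; rewrite gibbs_weight_row EFinM.
  - by move=> p _; rewrite lee_fin prod0.
  - exact/measurable_EFinP.
rewrite (eq_integral _ _ (fun x _ => Ex x)) ge0_integralZr//; last 2 first.
- exact/measurable_EFinP.
- by apply: integral_ge0 => p _; rewrite lee_fin prod0.
rewrite lte_mul_pinfty ?V_int//.
  by apply: integral_ge0 => x _; rewrite lee_fin expR_ge0.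
rewrite ge0_fin_numE ?V_int//; by apply: integral_ge0 => x _; rewrite lee_fin expR_ge0.
Qed.

(** Each of the [d] substeps contributes [ham_step_cst * h ^+ 2]; the induction composes the test
    function with the later substeps, which keeps its values in [[0, 1]]. *)
Lemma ham_almost_invariant h (u : 'rV[R]_(d + d) -> R) : 0 <= h -> h <= 1 -> h * B ^+ 2 <= 1 ->
  34 * B ^+ 5 * h <= beta / 4 -> measurable_fun setT u -> (forall z, 0 <= u z <= 1) ->
  let w := gibbs_weight beta in
  let e := ((d%:R * (ham_step_cst * h ^+ 2))%:E *
     \int[lebesgue_rV (d + d)]_z (gibbs_weight (beta / 2) z)%:E)%E in
  (\int[lebesgue_rV (d + d)]_z (w z * u (ham g c h z))%:E <=
     \int[lebesgue_rV (d + d)]_z (w z * u z)%:E + e)%E /\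
  (\int[lebesgue_rV (d + d)]_z (w z * u z)%:E <=
     \int[lebesgue_rV (d + d)]_z (w z * u (ham g c h z))%:E + e)%E.
Proof.
move=> h0 h1 hB hB5 mu u01 w.
have C0 : 0 <= ham_step_cst * h ^+ 2.
  by rewrite mulr_ge0 ?ham_step_cst_ge0// exprn_ge0.
pose I := (\int[lebesgue_rV (d + d)]_z (gibbs_weight (beta / 2) z)%:E)%E.
have I0 : (0 <= I)%E by apply: integral_ge0 => z _; rewrite lee_fin expR_ge0.
have eS (K : R) n : 0 <= K -> ((n.+1%:R * K)%:E * I = (n%:R * K)%:E * I + K%:E * I)%E.
  by move=> K0; rewrite -natr1 mulrDl mul1r EFinD ge0_muleDl// lee_fin mulr_ge0.
suff H (s : seq 'I_d) :
  let e := (((size s)%:R * (ham_step_cst * h ^+ 2))%:E * I)%E in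
  let u' := fun z => u (foldl (ham_step g c h) z s) in
  [/\ measurable_fun setT u',
  (\int[lebesgue_rV (d + d)]_z (w z * u' z)%:E <=
     \int[lebesgue_rV (d + d)]_z (w z * u z)%:E + e)%E &
  (\int[lebesgue_rV (d + d)]_z (w z * u z)%:E <=
     \int[lebesgue_rV (d + d)]_z (w z * u' z)%:E + e)%E].
  by have [_] := H (enum 'I_d); rewrite -cardE card_ord.
elim: s => [|i s [mu' IH1 IH2]] /=; first by rewrite !mul0r mul0e adde0.
set u' := (fun z => u (foldl _ _ _)) in mu' IH1 IH2 *.
have mS := measurable_ham_step i h0.
have J0 z : 0 <= jac h i z by exact: le_trans (jac_ge i z h0 hB).
have w0 z : 0 <= w z by exact: expR_ge0.
have r0 z : 0 <= gibbs_weight (beta / 2) z by exact: expR_ge0.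
have [H1 H2] := almost_invariance mS (measurable_jac i h0)
  (measurable_gibbs_weight beta) (measurable_gibbs_weight (beta / 2)) mu' J0 w0 C0 r0
  (fun z => u01 _) (fun F mF F0 => ham_step_substitution i h0 hB mF F0)
  (fun z => gibbs_weight_ham_step i z h0 h1 hB hB5).
rewrite (eS _ _ C0).
split; first exact: (measurableT_comp mu' mS).
- by apply: le_trans H1 _; rewrite addeA leeD.
- by apply: le_trans IH2 _; rewrite addeA addeAC leeD.
Qed.

Variables (gamma : R) (sigma : 'rV[R]_d -> R).
Hypotheses (msigma : measurable_fun setT sigma) (sigma0 : forall x, 0 < sigma x)
  (sigmaE : forall x, beta * sigma x ^+ 2 = 2 * gamma * g x).

Definition ou_op h (u : 'rV[R]_(d + d) -> R) z : R :=
  gauss_avg h (fun v => u (ou_step gamma g sigma h z v)).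

Definition langevin_op h (u : 'rV[R]_(d + d) -> R) z : R :=
  gauss_avg h (fun v => u (langevin_step gamma g sigma c h z v)).

Lemma measurable_ham h : 0 <= h -> measurable_fun setT (ham g c h).
Proof.
move=> h0; rewrite /ham; elim: (enum 'I_d) => [|i s IH] /=; first exact: measurable_id.
exact: (measurableT_comp IH (measurable_ham_step i h0)).
Qed.

Lemma measurable_ou_step h :
  measurable_fun setT (fun q : 'rV[R]_(d + d) * 'rV[R]_d => ou_step gamma g sigma h q.1 q.2).
Proof.
have ml : measurable_fun setT (fun q : 'rV[R]_(d + d) * 'rV[R]_d => lsubmx q.1).
  exact: (measurableT_comp (@measurable_lsubmx R d d) measurable_fst).
have mr : measurable_fun setT (fun q : 'rV[R]_(d + d) * 'rV[R]_d => rsubmx q.1).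
  exact: (measurableT_comp (@measurable_rsubmx R d d) measurable_fst).
have mgl : measurable_fun setT (fun q : 'rV[R]_(d + d) * 'rV[R]_d => g (lsubmx q.1)).
  exact: (measurableT_comp (gb_mg GB) ml).
have ms : measurable_fun setT (fun q : 'rV[R]_(d + d) * 'rV[R]_d => sigma (lsubmx q.1)).
  exact: (measurableT_comp msigma ml).
pose f (q : 'rV[R]_(d + d) * 'rV[R]_d) :=
  damping gamma g h (lsubmx q.1) *: rsubmx q.1 + sigma (lsubmx q.1) *: q.2.
have md : measurable_fun setT (fun q : 'rV[R]_(d + d) * 'rV[R]_d =>
    1 - 2 * gamma * g (lsubmx q.1) * h).
  by apply: measurable_funB => //; apply: measurable_funM => //; apply: measurable_funM.
suff mf : measurable_fun setT f.
  exact: (measurableT_comp (@measurable_row_mx R d d) (measurable_fun_pair ml mf)).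
apply: measurable_fun_rVP => i.
under eq_fun do rewrite mxE [X in X + _]mxE [X in _ + X]mxE.
apply: measurable_funD; apply: measurable_funM => //.
- exact: (measurableT_comp (continuous_measurable_fun (@sqrt_continuous R)) md).
- exact: (measurableT_comp (measurable_coord i) mr).
- exact: (measurableT_comp (measurable_coord i) measurable_snd).
Qed.

Lemma measurable_langevin_step h : 0 <= h ->
  measurable_fun setT (fun q : 'rV[R]_(d + d) * 'rV[R]_d => langevin_step gamma g sigma c h q.1 q.2).
Proof.
move=> h0.
have mh : measurable_fun setT (fun q : 'rV[R]_(d + d) * 'rV[R]_d => ham g c h q.1).
  exact: (measurableT_comp (measurable_ham h0) measurable_fst).
exact: (measurableT_comp (measurable_ou_step h) (measurable_fun_pair mh measurable_snd)).
Qed.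

Section one_step.
Variables (h : R) (u : 'rV[R]_(d + d) -> R).
Hypotheses (h0 : 0 < h) (hg : forall x, 2 * gamma * g x * h <= 1)
  (mu : measurable_fun setT u) (u01 : forall z, 0 <= u z <= 1).

Lemma ou_op01 z : 0 <= ou_op h u z <= 1.
Proof.
apply: (gauss_avgE h0 _ _).2 => //; apply: (measurableT_comp mu).
exact: (measurableT_comp (measurable_ou_step h) (measurable_pair1 z)).
Qed.

Lemma ou_opE z : (ou_op h u z)%:E =
  (\int[lebesgue_rV d]_v (gauss_pdf h v * u (ou_step gamma g sigma h z v))%:E)%E.
Proof.
apply: (gauss_avgE h0 _ _).1 => //; apply: (measurableT_comp mu).
exact: (measurableT_comp (measurable_ou_step h) (measurable_pair1 z)).
Qed.

Lemma measurable_ou_op : measurable_fun setT (ou_op h u).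
Proof.
apply: (@measurable_gauss_avg R d h _ _ (fun q => u (ou_step gamma g sigma h q.1 q.2))).
  exact: (measurableT_comp mu (measurable_ou_step h)).
by move=> q; have /andP[] := u01 (ou_step gamma g sigma h q.1 q.2).
Qed.

(* The damping factor [a] and [s = sigma x] satisfy [a ^ 2 + beta s ^ 2 h = 1],
   so that [a p + s N(0, h)] is [N(0, 1 / beta)] when [p] is. *)
Lemma ou_op_invariant :
  (\int[lebesgue_rV (d + d)]_z (gibbs_weight beta z * ou_op h u z)%:E =
   \int[lebesgue_rV (d + d)]_z (gibbs_weight beta z * u z)%:E)%E.
Proof.
have w0 z : 0 <= gibbs_weight beta z by exact: expR_ge0.
have u0 z : 0 <= u z by have /andP[] := u01 z.
have uo0 z : 0 <= ou_op h u z by have /andP[] := ou_op01 z.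
have mw := measurable_gibbs_weight beta.
rewrite ge0_integral_row_mx; last 2 first.
- apply/measurable_EFinP; apply: measurable_funM => //; exact: measurable_ou_op.
- by move=> z; rewrite lee_fin mulr_ge0.
rewrite [RHS]ge0_integral_row_mx; last 2 first.
- by apply/measurable_EFinP; exact: measurable_funM.
- by move=> z; rewrite lee_fin mulr_ge0.
apply: eq_integral => x _.
pose a := damping gamma g h x; pose s := sigma x.
have as1 : a ^+ 2 + beta * (s ^+ 2 * h) = 1.
  rewrite mulrA sigmaE /a /damping sqr_sqrtr ?subrK// subr_ge0; exact: hg.
pose F (p : 'rV[R]_d) := (\prod_(i < d) kf beta (p ord0 i)).
have mF : measurable_fun setT F by exact: measurable_prod_coord.
have F0 p : 0 <= F p by apply: prodr_ge0 => i _; exact: expR_ge0.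
have mux : measurable_fun setT (fun y : 'rV[R]_d => u (row_mx x y)).
  apply: (measurableT_comp mu).
  exact: (measurableT_comp (@measurable_row_mx R d d) (measurable_pair1 x)).
have muxs : measurable_fun setT (fun q : 'rV[R]_d * 'rV[R]_d => u (row_mx x (a *: q.1 + s *: q.2))).
  apply: (measurableT_comp mux).
  exact: (measurable_affine_rV a s measurable_fst measurable_snd).
have muE : measurable_fun setT (fun y : 'rV[R]_d => (u (row_mx x y))%:E).
  by apply/measurable_EFinP.
have uE0 (y : 'rV[R]_d) : (0 <= (u (row_mx x y))%:E)%E by rewrite lee_fin.
have stat := prod_stationary (mkf beta) (measurable_normal_pdf 0 (Num.sqrt h))
  (fun t => expR_ge0 _) (normal_pdf_ge0 0 (Num.sqrt h))
  (gauss_stationary h0 (sigma0 x) as1) muE uE0.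
have ouE p : (ou_op h u (row_mx x p))%:E =
    (\int[lebesgue_rV d]_v (gauss_pdf h v * u (row_mx x (a *: p + s *: v)))%:E)%E.
  rewrite ou_opE; by apply: eq_integral => v _; rewrite /ou_step row_mxKl row_mxKr.
transitivity ((expR (- (beta * V x)))%:E *
  \int[lebesgue_rV d]_p \int[lebesgue_rV d]_v ((F p)%:E * (gauss_pdf h v)%:E *
     (u (row_mx x (a *: p + s *: v)))%:E))%E; last first.
  rewrite stat -ge0_integralZl_EFin ?expR_ge0//.
  - by apply: eq_integral => p _; rewrite gibbs_weight_row -/(F p) -!EFinM mulrA.
  - by move=> p _; rewrite -EFinM lee_fin (mulr_ge0 (F0 p) (u0 _)).
  - by under eq_fun do rewrite -EFinM; apply/measurable_EFinP; exact: measurable_funM.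
rewrite -ge0_integralZl_EFin ?expR_ge0//.
- apply: eq_integral => p _; rewrite gibbs_weight_row -/(F p) EFinM ouE EFinM -muleA; congr (_ * _)%E.
  rewrite -ge0_integralZl_EFin//.
  + by apply: eq_integral => v _; rewrite EFinM muleA.
  + by move=> v _; rewrite lee_fin (mulr_ge0 (gauss_pdf_ge0 h v) (u0 _)).
  + apply/measurable_EFinP; apply: measurable_funM; first exact: measurable_gauss_pdf.
    exact: (measurableT_comp muxs (measurable_pair1 p)).
- by move=> p _; apply: integral_ge0 => v _; rewrite -!EFinM lee_fin (mulr_ge0 (mulr_ge0 (F0 p) (gauss_pdf_ge0 h v)) (u0 _)).
- apply: (@measurable_integral_snd R _ _ 'rV[R]_d 'rV[R]_d (lebesgue_rV d) (fun q => ((F q.1)%:E * (gauss_pdf h q.2)%:E *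
     (u (row_mx x (a *: q.1 + s *: q.2)))%:E)%E)).
  + under eq_fun do rewrite -!EFinM; apply/measurable_EFinP; apply: measurable_funM => //.
    apply: measurable_funM; first exact: (measurableT_comp mF measurable_fst).
    exact: (measurableT_comp (measurable_gauss_pdf h) measurable_snd).
  + by move=> q; rewrite -!EFinM lee_fin (mulr_ge0 (mulr_ge0 (F0 q.1) (gauss_pdf_ge0 h q.2)) (u0 _)).
Qed.

(** [langevin_op h u] is [ou_op h u] composed with [ham], so [ou_op h u] serves as test function in
    the Hamiltonian estimate, and [ou_op_invariant] then removes the average without error. *)
Lemma langevin_op_almost_invariant : h <= 1 -> h * B ^+ 2 <= 1 ->
  34 * B ^+ 5 * h <= beta / 4 ->
  let w := gibbs_weight beta in
  let e := ((d%:R * (ham_step_cst * h ^+ 2))%:E *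
     \int[lebesgue_rV (d + d)]_z (gibbs_weight (beta / 2) z)%:E)%E in
  (\int[lebesgue_rV (d + d)]_z (w z * langevin_op h u z)%:E <=
     \int[lebesgue_rV (d + d)]_z (w z * u z)%:E + e)%E /\
  (\int[lebesgue_rV (d + d)]_z (w z * u z)%:E <=
     \int[lebesgue_rV (d + d)]_z (w z * langevin_op h u z)%:E + e)%E.
Proof.
move=> h1 hB hB5; have [] := ham_almost_invariant (ltW h0) h1 hB hB5 measurable_ou_op ou_op01.
by move=> H1 H2 w e; rewrite -ou_op_invariant; split; [exact: H1|exact: H2].
Qed.

End one_step.

End gibbs.

(** * Second moment of the normal law *)

Section normal_moments.
Context {R : realType}.
Notation leb := (@lebesgue_measure R).
Variable s : R.
Hypothesis s0 : 0 < s.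

Let phi := normal_pdf 0 s : R -> R.
Let sn0 : s != 0. Proof. by rewrite gt_eqF. Qed.

Let cphi : continuous phi. Proof. exact: continuous_normal_pdf. Qed.

Let dphi (t : R) : is_derive t 1 (fun v => - (s ^+ 2 * (v * phi v))) (t ^+ 2 * phi t - s ^+ 2 * phi t).
Proof.
have phiE : phi = fun v => normal_peak s * expR (- (v ^+ 2 / (s ^+ 2 *+ 2))).
  by apply/funext => v; exact: normal_pdf0E.
rewrite phiE; apply: is_derive_eq.
by rewrite /GRing.scale/= -mulr_natr; field.
Qed.

(** Integration by parts: [v ^+ 2 * phi v - s ^+ 2 * phi v] is the derivative of
    [- (s ^+ 2 * (v * phi v))], and the boundary terms on growing intervals tend to 0. *)
Lemma normal_second_moment : (\int[leb]_v (v ^+ 2 * normal_pdf 0 s v)%:E = (s ^+ 2)%:E)%E.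
Proof.
pose F (n : nat) : set R := `[- n.+1%:R, n.+1%:R]%classic.
have nF : nondecreasing_seq F.
  move=> m n mn; apply/subsetPset; apply: subset_itv; rewrite bnd_simp ?lerN2 ler_nat ltnS//.
have UF : \bigcup_n F n = setT.
  apply/seteqP; split => // x _; exists (Num.truncn `|x|) => //=.
  by rewrite /F /= in_itv/= -ler_norml ltW// truncnS_gt.
have mF i : measurable (F i) by exact: measurable_itv.
have mphi : measurable_fun setT phi by exact: measurable_normal_pdf.
have cq : continuous (fun v : R => v ^+ 2 * phi v).
  by move=> v; apply: cvgM; [exact: exprn_continuous|exact: cphi].
have mq : measurable_fun setT (fun v : R => v ^+ 2 * phi v) by exact: continuous_measurable_fun.
have lim1 : (fun n => \int[leb]_(x in F n) (x ^+ 2 * phi x)%:E)%E @ \oo -->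
    (\int[leb]_v (v ^+ 2 * phi v)%:E)%E.
  rewrite -{1}UF; apply: ge0_nondecreasing_set_cvg_integral => //.
  - by move=> i; apply: measurable_funTS; exact/measurable_EFinP.
  - by move=> i x _; rewrite lee_fin mulr_ge0 ?sqr_ge0// normal_pdf_ge0.
have lim2 : (fun n => \int[leb]_(x in F n) (phi x)%:E)%E @ \oo --> 1%E.
  rewrite -(integral_normal_pdf 0 s) -[X in integral _ X _]UF.
  apply: ge0_nondecreasing_set_cvg_integral => //.
  - by move=> i; apply: measurable_funTS; exact/measurable_EFinP.
  - by move=> i x _; rewrite lee_fin normal_pdf_ge0.
(* The two boundary terms, equal because [phi] is even; [y <= expR y] bounds them by a multiple of
   [1 / (n + 1)]. *)
pose r (n : nat) : R := 2 * s ^+ 2 * (n.+1%:R * phi n.+1%:R).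
have lim3 : r @ \oo --> (0 : R).
  pose K : R := 2 * s ^+ 2 * (normal_peak s * (s ^+ 2 *+ 2)).
  have rK n : 0 <= r n <= K * harmonic n.
    have n0 : 0 < n.+1%:R :> R by [].
    have p0 : 0 <= normal_peak s :> R by exact: normal_peak_ge0.
    have s2 : 0 <= 2 * s ^+ 2 by rewrite mulr_ge0// sqr_ge0.
    apply/andP; split.
      exact: (mulr_ge0 s2 (mulr_ge0 (ltW n0) (normal_pdf_ge0 _ _ _))).
    rewrite /r /K -[leRHS]mulrA; apply: ler_wpM2l => //.
    rewrite /phi normal_pdf0E// [leLHS]mulrCA -[leRHS]mulrA; apply: ler_wpM2l => //.
    rewrite mulrC -ler_pdivlMr// /harmonic/=.
    set y := n.+1%:R ^+ 2 / (s ^+ 2 *+ 2).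
    have y0 : 0 < y by rewrite divr_gt0 ?exprn_gt0// mulrn_wgt0// exprn_gt0.
    have -> : s ^+ 2 *+ 2 / n.+1%:R / n.+1%:R = y^-1.
      by rewrite /y invf_div -mulrA -invfM -expr2.
    rewrite expRN lef_pV2 ?posrE ?expR_gt0//.
    by have := expR_ge1Dx y; lra.
  apply: (@squeeze_cvgr _ _ _ _ (fun=> 0) (fun n => K * harmonic n)).
  - by near=> n; exact: rK.
  - exact: cvg_cst.
  - rewrite -[X in _ --> X](mulr0 K); apply: cvgM; [exact: cvg_cst|exact: cvg_harmonic].
have E n : (\int[leb]_(x in F n) (x ^+ 2 * phi x)%:E =
    (s ^+ 2)%:E * \int[leb]_(x in F n) (phi x)%:E + (- r n)%:E)%E.
  have ab : - n.+1%:R < n.+1%:R :> R by rewrite gtrN.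
  have i1 : leb.-integrable (F n) (EFin \o (fun x => x ^+ 2 * phi x)) by exact: continuous_itv_integrable.
  have i2 : leb.-integrable (F n) (EFin \o phi) by exact: continuous_itv_integrable.
  have i3 : leb.-integrable (F n) (fun x => (s ^+ 2)%:E * (phi x)%:E)%E.
    have := @integrableZl _ _ R leb (F n) (mF n) (s ^+ 2) _ i2; exact.
  have : (\int[leb]_(x in F n) (x ^+ 2 * phi x - s ^+ 2 * phi x)%:E = (- r n)%:E)%E.
    rewrite (continuous_FTC2 ab (F := fun v => - (s ^+ 2 * (v * phi v)))).
    - have -> : phi (- n.+1%:R) = phi n.+1%:R by rewrite /phi !normal_pdf0E// sqrrN.
      by rewrite -EFinB; congr EFin; rewrite /r; ring.
    - apply: continuous_subspaceT => v; apply: cvgB; first exact: cq.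
      by apply: cvgM; [exact: cvg_cst|exact: cphi].
    - have cF : continuous (fun v : R => - (s ^+ 2 * (v * phi v))).
        by move=> v; apply: cvgN; apply: cvgM; [exact: cvg_cst|apply: cvgM; [exact: cvg_id|exact: cphi]].
      split.
      + by move=> x _; apply: (@ex_derive _ _ _ _ _ _ _ (dphi x)).
      + by apply: cvg_at_right_filter; exact: cF.
      + by apply: cvg_at_left_filter; exact: cF.
    - by move=> x _; rewrite derive1E (@derive_val _ _ _ _ _ _ _ (dphi x)).
  have -> : (\int[leb]_(x in F n) (x ^+ 2 * phi x - s ^+ 2 * phi x)%:E =
     \int[leb]_(x in F n) (x ^+ 2 * phi x)%:E -
     \int[leb]_(x in F n) ((s ^+ 2)%:E * (phi x)%:E))%E.
    by rewrite -(integralB _ i1 i3)//; exact: mF.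
  have ZE : (\int[leb]_(x in F n) ((s ^+ 2)%:E * (phi x)%:E) =
    (s ^+ 2)%:E * \int[leb]_(x in F n) (phi x)%:E)%E by rewrite (integralZl _ i2)//; exact: mF.
  move=> <-; rewrite -ZE.
  have Zf : (\int[leb]_(x in F n) ((s ^+ 2)%:E * (phi x)%:E))%E \is a fin_num.
    by apply: (integrable_fin_num _ i3); exact: mF.
  by rewrite addeCA subee ?adde0.
have lim4 : (fun n => \int[leb]_(x in F n) (x ^+ 2 * phi x)%:E)%E @ \oo --> (s ^+ 2)%:E.
  rewrite (_ : (s ^+ 2)%:E = (s ^+ 2)%:E * 1 + (- 0)%:E)%E; last by rewrite mule1 oppr0 adde0.
  under eq_fun do rewrite E.
  apply: cvgeD => //; first exact: cvgeZl.
  by apply: cvg_EFin; [near=> n|exact: cvgN].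
by rewrite -(cvg_lim _ lim1)// (cvg_lim _ lim4).
Unshelve. all: end_near. Qed.

End normal_moments.

(** * Brownian motion *)

Section laws.
Context {R : realType}.

Lemma density_probability d (T : measurableType d) (mu : {measure set T -> \bar R})
    (w : T -> R) (mw : measurable_fun setT w) (w0 : forall x, 0 <= w x) :
  (\int[mu]_x (w x)%:E = 1)%E ->
  exists p : probability T R, forall A, p A = density mu mw w0 A.
Proof.
move=> w1.
exists (HB.pack_for (probability T R) (density mu mw w0)
  (Measure_isProbability.Build _ _ _ (density mu mw w0) w1)).
by [].
Qed.

Lemma image_probability d d' (T : measurableType d) (T' : measurableType d')
    (P : probability T R) (f : T -> T') (mf : measurable_fun setT f) :
  exists p : probability T' R, forall A, measurable A -> p A = P (f @^-1` A).
Proof.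
have m1 : measurable_fun [set: T'] (fun=> 1 : R) by exact: measurable_cst.
have f1 : (\int[image_measure P mf]_x 1%:E = 1)%E.
  rewrite integral_cst// mul1e /image_measure/= /pushforward preimage_setT.
  exact: probability_setT.
have [p pE] := density_probability m1 (fun=> ler01) f1.
by exists p => A mA; rewrite pE /density integral_cst// mul1e.
Qed.

Lemma gauss_law m h : 0 < h -> exists p : probability 'rV[R]_m R,
  (forall B : 'I_m -> set R, (forall i, measurable (B i)) ->
    p (rV_box B) = \prod_(i < m) normal_prob 0 (Num.sqrt h) (B i))%E /\
  forall f : 'rV[R]_m -> R, measurable_fun setT f -> (forall v, 0 <= f v) ->
    (\int[p]_v (f v)%:E = \int[lebesgue_rV m]_v (gauss_pdf h v * f v)%:E)%E.
Proof.
move=> h0; have [p pE] := density_probability (measurable_gauss_pdf h)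
  (@gauss_pdf_ge0 R m h) (integral_gauss_pdf m h0).
exists p; split=> [B mB|f mf f0]; last first.
  transitivity (\int[density (lebesgue_rV m) (measurable_gauss_pdf h) (@gauss_pdf_ge0 R m h)]_v (f v)%:E)%E.
    by apply: eq_measure_integral => A mA _; exact: pE.
  rewrite ge0_integral_density//; last exact/measurable_EFinP.
  by apply: eq_integral => v _; rewrite -EFinM mulrC.
rewrite pE /density integral_mkcond.
pose f (i : 'I_m) t : R := \1_(B i) t * normal_pdf 0 (Num.sqrt h) t.
have mf i : measurable_fun setT (f i).
  by apply: measurable_funM; [exact: measurable_indic|exact: measurable_normal_pdf].
have f0 i t : 0 <= f i t by rewrite mulr_ge0// normal_pdf_ge0.
transitivity (\int[lebesgue_rV m]_v (\prod_(i < m) f i (v ord0 i))%:E)%E.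
  apply: eq_integral => v _; rewrite patchE; case: ifPn => [|/negP vB].
    rewrite inE => vB; congr EFin; apply: eq_bigr => i _.
    by rewrite /f indicE mem_set ?mul1r//; exact: vB.
  have [i Bi] : exists i, ~ B i (v ord0 i).
    by apply/existsNP => vB'; apply: vB; rewrite inE.
  by rewrite (bigD1 i)//= /f indicE memNset// mul0r mul0r.
rewrite ge0_integral_rV_prod//; apply: eq_bigr => i _.
rewrite /normal_prob [RHS]integral_mkcond; apply: eq_integral => t _.
rewrite patchE /f indicE; have [tB|tB] := pselect (B i t).
  by rewrite !mem_set// mul1r.
by rewrite !memNset// mul0r.
Qed.

(** Independence on rectangles makes the law of [(X, D)] a product, and boxes determine the law of
    [D]; Tonelli then integrates [D] out against the Gaussian density with [X] frozen. *)
Lemma joint_law dO (Omega : measurableType dO) (P : probability Omega R) m h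
    (D : Omega -> 'rV[R]_m) d (T : measurableType d) (X : Omega -> T) (f : T * 'rV[R]_m -> R) :
  0 < h -> measurable_fun setT D -> measurable_fun setT X ->
  (forall A B, measurable A -> measurable B ->
     P (X @^-1` A `&` D @^-1` B) = P (X @^-1` A) * P (D @^-1` B))%E ->
  (forall B : 'I_m -> set R, (forall i, measurable (B i)) ->
     P (D @^-1` rV_box B) = \prod_(i < m) normal_prob 0 (Num.sqrt h) (B i))%E ->
  measurable_fun setT f -> (forall q, 0 <= f q) ->
  (\int[P]_w (f (X w, D w))%:E =
   \int[P]_w \int[lebesgue_rV m]_v (gauss_pdf h v * f (X w, v))%:E)%E.
Proof.
move=> h0 mD mX ind law mf f0.
have [G [Gbox Gint]] := gauss_law m h0.
have [p pE] := image_probability P mX.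
have DG A : measurable A -> P (D @^-1` A) = G A.
  move=> mA; have [q qE] := image_probability P mD.
  rewrite -qE//; apply: rV_box_measure_unique => //; last first.
    by apply: (le_lt_trans (probability_le1 q measurableT)); exact: ltry.
  move=> B mB; have mBB := measurable_rV_box mB.
  exact: etrans (etrans (qE _ mBB) (law _ mB)) (esym (Gbox _ mB)).
have mXD : measurable_fun setT (fun w => (X w, D w)) by exact: measurable_fun_pair.
have H := @product_measure_unique _ _ _ _ R p G (image_measure P mXD).
have {}H A : measurable A -> (p \x G)%E A = image_measure P mXD A.
  apply: H => A1 A2 mA1 mA2; rewrite /image_measure/= /pushforward pE//.
  by rewrite -DG// -ind.
transitivity (\int[image_measure P mXD]_q (f q)%:E)%E.
  by rewrite ge0_integral_pushforward//; [exact/measurable_EFinP|move=> q _; rewrite lee_fin].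
transitivity (\int[p \x G]_q (f q)%:E)%E.
  by apply: eq_measure_integral => A mA _; rewrite -H.
rewrite fubini_tonelli1//; last exact/measurable_EFinP.
have mfx x : measurable_fun setT (fun v => f (x, v)) by exact: (measurableT_comp mf (measurable_pair1 x)).
transitivity (\int[p]_x \int[lebesgue_rV m]_v (gauss_pdf h v * f (x, v))%:E)%E.
  by apply: eq_integral => x _; rewrite /fubini_F Gint.
transitivity (\int[image_measure P mX]_x \int[lebesgue_rV m]_v (gauss_pdf h v * f (x, v))%:E)%E.
  by apply: eq_measure_integral => A mA _; exact: pE.
rewrite ge0_integral_pushforward//.
  apply: (@measurable_integral_snd R _ _ T 'rV[R]_m (lebesgue_rV m)
    (fun q => (gauss_pdf h q.2 * f q)%:E)).
    apply/measurable_EFinP; apply: measurable_funM => //.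
    exact: (measurableT_comp (measurable_gauss_pdf h) measurable_snd).
  by move=> q; rewrite lee_fin mulr_ge0// gauss_pdf_ge0.
by move=> x _; apply: integral_ge0 => v _; rewrite lee_fin mulr_ge0// gauss_pdf_ge0.
Qed.

End laws.

(** * Filtrations and a regular version of the Brownian motion *)

Section gaussian_motion.
Context {R : realType} {dO} {Omega : measurableType dO}.
Variables (P : probability Omega R) (F : R -> set (set Omega)).
Hypothesis hF : complete_filtration P F.

Lemma filtration_sigma_algebra t : 0 <= t -> sigma_algebra setT (F t).
Proof. by case: hF => + _ _ _; exact. Qed.

Lemma filtration_sub t : 0 <= t -> F t `<=` measurable.
Proof. by case: hF => _ + _ _; exact. Qed.

Lemma filtrationS s t : 0 <= s -> s <= t -> F s `<=` F t.
Proof. by case: hF => _ _ + _; exact. Qed.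

Lemma filtration_null t N : 0 <= t -> measurable N -> P N = 0%E -> F t N.
Proof. by move=> t0 mN PN; apply: (filtrationS (lexx 0) t0); case: hF => _ _ _; exact. Qed.

Lemma measurable_filtrationE t : 0 <= t ->
  (@measurable _ (g_sigma_algebraType (F t)) : set (set Omega)) = F t.
Proof. by move=> t0; exact: sigma_algebra_id (filtration_sigma_algebra t0). Qed.

(** Turns [f] into an ordinary measurable function on a type that carries [F t], so that the closure
    properties of measurable functions apply to adapted processes. *)
Lemma measurable_wrtP t d (T : measurableType d) (f : Omega -> T) : 0 <= t ->
  measurable_wrt (F t) f <->
  measurable_fun [set: g_sigma_algebraType (F t)] (f : g_sigma_algebraType (F t) -> T).
Proof.
move=> t0; have E := measurable_filtrationE t0; split=> [mf _ B mB|mf B mB].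
  by rewrite setTI E; exact: mf.
have H : (@measurable _ (g_sigma_algebraType (F t)) : set (set Omega)) (f @^-1` B).
  by have := mf measurableT B mB; rewrite setTI.
by move: H; rewrite E.
Qed.

Lemma measurable_wrt_fun t d (T : measurableType d) (f : Omega -> T) : 0 <= t ->
  measurable_wrt (F t) f -> measurable_fun setT f.
Proof. by move=> t0 mf _ B mB; rewrite setTI; apply: (filtration_sub t0); exact: mf. Qed.

Lemma measurable_wrtS s t d (T : measurableType d) (f : Omega -> T) : 0 <= s -> s <= t ->
  measurable_wrt (F s) f -> measurable_wrt (F t) f.
Proof. by move=> s0 st mf B mB; apply: (filtrationS s0 st); exact: mf. Qed.

(* Unlike a Brownian motion, its paths start at [0] and are continuous without
   exception, and are extended by [0] to negative times. *)
Record gaussian_motion m (B : R -> Omega -> 'rV[R]_m) : Prop := GaussianMotion {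
  gm_cont : forall w, continuous (B ^~ w);
  gm_0 : forall w, B 0 w = 0;
  gm_adapted : adapted F B;
  gm_law : forall s t, 0 <= s -> s < t -> forall d (T : measurableType d) (X : Omega -> T)
    (f : T * 'rV[R]_m -> R), measurable_wrt (F s) X -> measurable_fun setT f ->
    (forall q, 0 <= f q) ->
    (\int[P]_w (f (X w, B t w - B s w))%:E =
     \int[P]_w \int[lebesgue_rV m]_v (gauss_pdf (t - s) v * f (X w, v))%:E)%E }.

Lemma measure_setD_null (N A : set Omega) : measurable N -> P N = 0%E -> measurable A ->
  P A = P (A `\` N).
Proof.
move=> mN PN mA; have z : P (A `&` N) = 0%E.
  by apply: (subset_measure0 _ mN) => //; exact: measurableI.
by rewrite (measureDI P mA mN) [X in (_ + X)%E]z adde0.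
Qed.

Lemma continuous_max0 m (f : R -> 'rV[R]_m) : {within `[0, +oo[%classic, continuous f} ->
  continuous (fun t : R => f (Num.max 0 t)).
Proof.
move=> cf t; have A (t' : R) : `[0, +oo[%classic (Num.max 0 t') by rewrite /= in_itv/= andbT le_max lexx.
move/subspace_continuousP : cf => /(_ _ (A t)) cf.
apply: cvg_trans cf => Q [e /= e0 eQ].
exists e => //= s ts; apply: eQ; last exact: A.
rewrite /ball_/= in ts *; apply: le_lt_trans ts.
rewrite /Num.max; case: ifP => t0; case: ifP => s0//; rewrite ?subrr ?normr0//.
- move/negbT : s0; rewrite -leNgt => s0; rewrite subr0 !ger0_norm ?subr_ge0 ?(ltW t0)//; first lra.
  by rewrite (le_trans s0)// ltW.
- move/negbT : t0; rewrite -leNgt => t0; have ts : t <= s by exact: le_trans (ltW s0).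
  rewrite sub0r normrN gtr0_norm// distrC ger0_norm ?subr_ge0//; lra.
Qed.

(** Paths in a null set [N] are replaced by 0. Adaptedness survives because the filtration contains
    the null sets, and no probability changes. *)
Lemma regular_version m (W : R -> Omega -> 'rV[R]_m) : brownian_motion P F W ->
  exists B N, [/\ measurable N, P N = 0%E, gaussian_motion B &
    forall w t, ~ N w -> 0 <= t -> B t w = W t w].
Proof.
move=> [[N0 [mN0 PN0 sN0]] [N1 [mN1 PN1 sN1]] adW indW lawW].
pose N := N0 `|` N1.
have mN : measurable N by exact: measurableU.
have PN : P N = 0%E.
  by apply/eqP; rewrite eq_le measure_ge0 andbT; rewrite (le_trans (measureU2 _ mN0 mN1))//= PN0 PN1 adde0.
pose B t w := if w \in N then 0 else W (Num.max 0 t) w : 'rV[R]_m.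
have BW w t : ~ N w -> 0 <= t -> B t w = W t w.
  by move=> Nw t0; rewrite /B memNset//; congr (W _ _); apply/max_idPr.
have B0 w : B 0 w = 0.
  rewrite /B; case: ifPn => // /negP Nw; rewrite maxxx.
  by apply: contrapT => W0; apply: Nw; rewrite inE; left; apply: sN0.
have adB : adapted F B.
  move=> t t0 A mA.
  have -> : B t @^-1` A = (N `&` [set _ | A 0]) `|` (~` N `&` W t @^-1` A).
    apply/seteqP; split=> w /=.
      have [Nw|Nw] := pselect (N w); first by rewrite /B mem_set// => A0; left.
      by rewrite BW// => Aw; right.
    by move=> [[Nw A0]|[Nw Aw]]; [rewrite /B mem_set|rewrite BW].
  have FN := filtration_null t0 mN PN.
  have FW : F t (W t @^-1` A) by exact: adW.
  move: FN FW; rewrite -(measurable_filtrationE t0) => FN FW.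
  apply: measurableU; apply: measurableI => //; last exact: measurableC.
  have [A0|A0] := pselect (A 0).
    by rewrite (_ : [set _ | _] = setT)//; apply/seteqP; split.
  by rewrite (_ : [set _ | _] = set0)//; apply/seteqP; split.
exists B, N; split=> //; split=> //.
  move=> w; have [Nw|Nw] := pselect (N w).
    rewrite (_ : B ^~ w = fun=> 0); first by move=> t; exact: cvg_cst.
    by apply/funext => t; rewrite /B mem_set.
  rewrite (_ : B ^~ w = fun t => W (Num.max 0 t) w); last first.
    by apply/funext => t; rewrite /B memNset.
  apply: (@continuous_max0 m (W ^~ w)); apply: contrapT => ncW; apply: Nw; right; exact: sN1.
move=> s t s0 st d T X f adX mf f0.
have t0 : 0 <= t by rewrite (le_trans s0)// ltW.
have mB r : 0 <= r -> measurable_fun setT (B r) by move=> r0; exact: measurable_wrt_fun (adB r r0).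
have mW r : 0 <= r -> measurable_fun setT (W r) by move=> r0; exact: measurable_wrt_fun (adW r r0).
have msub (U : R -> Omega -> 'rV[R]_m) : (forall r, 0 <= r -> measurable_fun setT (U r)) ->
    measurable_fun setT (fun w => U t w - U s w).
  move=> mU; apply: measurable_fun_rVP => i; under eq_fun do rewrite !mxE.
  by apply: measurable_funB; apply: (measurableT_comp (measurable_coord i)); exact: mU.
have mDB := msub _ mB; have mDW := msub _ mW.
have mpre (D : Omega -> 'rV[R]_m) A : measurable_fun setT D -> measurable A -> measurable (D @^-1` A).
  by move=> mD mA; rewrite -[X in measurable X]setTI; exact: mD.
have eqD (A : set Omega) C : measurable A -> measurable C ->
    P (A `&` (fun w => B t w - B s w) @^-1` C) = P (A `&` (fun w => W t w - W s w) @^-1` C).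
  move=> mA mC; rewrite (measure_setD_null mN PN); last by apply: measurableI => //; exact: mpre.
  rewrite [RHS](measure_setD_null mN PN); last by apply: measurableI => //; exact: mpre.
  congr (P _); apply/seteqP; split=> w /= [[Aw Cw] Nw]; split=> //; split=> //.
    by move: Cw; rewrite !BW.
  by rewrite !BW.
have eqD' C : measurable C ->
    P ((fun w => B t w - B s w) @^-1` C) = P ((fun w => W t w - W s w) @^-1` C).
  by move=> mC; have := eqD setT C measurableT mC; rewrite !setTI.
apply: joint_law => //.
- by rewrite subr_gt0.
- exact: measurable_wrt_fun adX.
- move=> A C mA mC; rewrite eqD//; last first.
    by apply: (filtration_sub s0); exact: adX.
  by rewrite eqD'//; apply: indW => //; exact: adX.
- move=> C mC; rewrite eqD'; last exact: measurable_rV_box.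
  rewrite -lawW//; congr (P _); apply/seteqP; split=> w /= Cw i; have := Cw i; by rewrite !mxE.
Qed.

End gaussian_motion.

(** * The Ito integral *)

Section means.
Context {R : realType} {dO} {Omega : measurableType dO}.
Variables (mu : {measure set Omega -> \bar R}) (D : set Omega).
Hypothesis mD : measurable D.
Implicit Types X Y : Omega -> R.

(** Integrability and value travel together, so that sums, differences and multiples of expectations
    need no further side conditions. *)
Definition has_mean X (m : R) :=
  mu.-integrable D (EFin \o X) /\ \int[mu]_(w in D) X w = m.

Lemma has_mean0 : has_mean (fun=> 0) 0.
Proof.
split; first exact: integrable0.
by rewrite /Rintegral integral0_eq.
Qed.

Lemma has_meanD X Y m m' : has_mean X m -> has_mean Y m' ->
  has_mean (fun w => X w + Y w) (m + m').
Proof.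
move=> [iX EX] [iY EY]; split; last by rewrite RintegralD// EX EY.
by have := integrableD mD iX iY; exact.
Qed.

Lemma has_meanB X Y m m' : has_mean X m -> has_mean Y m' ->
  has_mean (fun w => X w - Y w) (m - m').
Proof.
move=> [iX EX] [iY EY]; split; last by rewrite RintegralB// EX EY.
by have := integrableB mD iX iY; exact.
Qed.

Lemma has_meanZ (k : R) X m : has_mean X m -> has_mean (fun w => k * X w) (k * m).
Proof.
move=> [iX EX]; split; last by rewrite RintegralZl// EX.
by have := integrableZl mD k iX; exact.
Qed.

Lemma has_mean_sum n (X : 'I_n -> Omega -> R) (m : 'I_n -> R) :
  (forall i, has_mean (X i) (m i)) ->
  has_mean (fun w => \sum_(i < n) X i w) (\sum_(i < n) m i).
Proof.
elim: n X m => [|n IH] X m H.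
  rewrite (_ : (fun w => _) = fun=> 0); last by apply/funext => w; rewrite big_ord0.
  by rewrite big_ord0; exact: has_mean0.
rewrite (_ : (fun w => _) = fun w => X ord0 w + \sum_(i < n) X (lift ord0 i) w); last first.
  by apply/funext => w; rewrite big_ord_recl.
by rewrite big_ord_recl; apply: has_meanD => //; exact: IH.
Qed.

Lemma has_mean_integral X m : has_mean X m -> (\int[mu]_(w in D) (X w)%:E = m%:E)%E.
Proof. by move=> [iX <-]; rewrite /Rintegral fineK//; exact: (integrable_fin_num mD iX). Qed.

End means.

Section expectations.
Context {R : realType} {dO} {Omega : measurableType dO}.
Variable P : probability Omega R.
Implicit Types X Y : Omega -> R.

Local Notation has_mean := (has_mean P setT).

Lemma has_mean_unique X m m' : has_mean X m -> has_mean X m' -> m = m'.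
Proof. by move=> [_ <-] [_ <-]. Qed.

Lemma has_mean_ge0 X m : measurable_fun setT X -> (forall w, 0 <= X w) ->
  (\int[P]_w (X w)%:E = m%:E)%E -> has_mean X m.
Proof.
move=> mX X0 EX; split; last by rewrite /Rintegral EX.
apply/integrableP; split; first exact/measurable_EFinP.
by under eq_integral do rewrite /= ger0_norm//; rewrite EX ltry.
Qed.

Lemma bounded_has_mean X (M : R) : measurable_fun setT X -> (forall w, `|X w| <= M) ->
  has_mean X (\int[P]_w X w).
Proof.
move=> mX XM; split => //; apply: measurable_bounded_integrable => //.
  by apply: (le_lt_trans (probability_le1 P measurableT)); exact: ltry.
exists M; split => [|M' MM' w _ /=]; first exact: num_real.
exact: le_trans (XM w) (ltW MM').
Qed.

Lemma has_mean_le X Y m : measurable_fun setT X -> (forall w, `|X w| <= Y w) ->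
  has_mean Y m -> has_mean X (\int[P]_w X w).
Proof.
move=> mX XY [iY _]; split => //; apply: le_integrable iY => //.
  exact/measurable_EFinP.
by move=> w _ /=; rewrite lee_fin (le_trans (XY w))// ler_norm.
Qed.

End expectations.

Section reflection.
Context {R : realType}.
Notation leb := (@lebesgue_measure R).

Lemma integral_opp (f : R -> \bar R) : measurable_fun setT f -> (forall t, 0 <= f t)%E ->
  (\int[leb]_t f (- t)%R = \int[leb]_t f t)%E.
Proof.
move=> mf f0; have mo : measurable_fun setT (-%R : R -> R) by apply: measurable_funN; exact: measurable_id.
pose nu := @image_measure _ _ (measurableTypeR R) (measurableTypeR R) R leb -%R mo.
have H A : measurable A -> leb A = nu A.
  apply: lebesgue_measure_unique => _ [[a b]] /= _ <-.
  rewrite /nu /image_measure/= /pushforward (_ : -%R @^-1` _ = `[- b, - a[%classic); last first.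
    by apply/seteqP; split => t /=; rewrite !in_itv/= => /andP[? ?]; apply/andP; split; lra.
  by rewrite !lebesgue_measure_itv/= !lte_fin ltrN2; case: ifP => // _; rewrite -!EFinB opprK addrC.
transitivity (\int[nu]_t f t)%E; last first.
  by apply/esym; apply: eq_measure_integral => A mA _; exact: H.
by rewrite (@ge0_integral_pushforward _ _ (measurableTypeR R) (measurableTypeR R)).
Qed.

End reflection.

(** * Moments of Brownian increments *)

Section increments.
Context {R : realType} {dO} {Omega : measurableType dO}.
Variables (P : probability Omega R) (F : R -> set (set Omega)).
Hypothesis hF : complete_filtration P F.
Variables (m : nat) (B : R -> Omega -> 'rV[R]_m) (i : 'I_m).
Hypothesis gB : gaussian_motion P F B.
Notation leb := (@lebesgue_measure R).
Local Notation has_mean := (has_mean P setT).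
Implicit Types Y : Omega -> R.

Let b t w := B t w ord0 i.

Lemma integral_gauss_coord h (f : R -> R) : 0 < h -> measurable_fun setT f -> (forall t, 0 <= f t) ->
  (\int[lebesgue_rV m]_v (gauss_pdf h v * f (v ord0 i))%:E =
   \int[leb]_v (normal_pdf 0 (Num.sqrt h) v * f v)%:E)%E.
Proof.
move=> h0 mf f0.
pose G j t := normal_pdf 0 (Num.sqrt h) t * (if j == i then f t else 1).
have mG j : measurable_fun setT (G j).
  apply: measurable_funM; first exact: measurable_normal_pdf.
  by case: (j == i).
have G0 j t : 0 <= G j t.
  by rewrite /G mulr_ge0 ?normal_pdf_ge0//; case: (j == i).
transitivity (\int[lebesgue_rV m]_v (\prod_(j < m) G j (v ord0 j))%:E)%E.
  apply: eq_integral => v _; congr EFin.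
  rewrite /gauss_pdf /G big_split/=; congr (_ * _).
  rewrite (bigD1 i)//= eqxx big1 ?mulr1// => j /negbTE ->//.
rewrite ge0_integral_rV_prod// (bigD1 i)//= big1 ?mule1.
  by apply: eq_integral => t _; rewrite /G eqxx.
move=> j /negbTE ji; under eq_integral do rewrite /G ji mulr1.
by rewrite integral_normal_pdf.
Qed.

Lemma gm_coord_law s t Y (f : R * R -> R) : 0 <= s -> s < t -> measurable_wrt (F s) Y ->
  measurable_fun setT f -> (forall q, 0 <= f q) ->
  (\int[P]_w (f (Y w, b t w - b s w))%:E =
   \int[P]_w \int[leb]_v (normal_pdf 0 (Num.sqrt (t - s)) v * f (Y w, v))%:E)%E.
Proof.
move=> s0 st adY mf f0.
pose f' (q : R * 'rV[R]_m) := f (q.1, q.2 ord0 i).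
have mf' : measurable_fun setT f'.
  apply: (measurableT_comp mf); apply: measurable_fun_pair; first exact: measurable_fst.
  exact: (measurableT_comp (measurable_coord i) measurable_snd).
have := gm_law gB s0 st adY mf' (fun q => f0 _).
under eq_integral do rewrite /f'/= mxE [X in _ + X]mxE.
move=> ->; apply: eq_integral => w _; rewrite /f'/=.
rewrite -(@integral_gauss_coord (t - s) (fun v => f (Y w, v)))// ?subr_gt0//.
exact: (measurableT_comp mf (measurable_pair1 (Y w))).
Qed.

Lemma increment_measurable s t : 0 <= s -> s <= t -> measurable_wrt (F t) (fun w => b t w - b s w).
Proof.
move=> s0 st; have t0 := le_trans s0 st; apply/(measurable_wrtP hF _ t0).
have mb r : 0 <= r -> r <= t ->
    measurable_fun [set: g_sigma_algebraType (F t)] (fun w : g_sigma_algebraType (F t) => b r w).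
  move=> r0 rt; apply: (measurableT_comp (measurable_coord i)).
  apply/(measurable_wrtP hF _ t0); apply: (measurable_wrtS hF r0 rt); exact: (gm_adapted gB).
by apply: measurable_funB; exact: mb.
Qed.

Let mwM s Y Y' : 0 <= s -> measurable_wrt (F s) Y -> measurable_wrt (F s) Y' ->
  measurable_wrt (F s) (fun w => Y w * Y' w).
Proof.
move=> s0 /(measurable_wrtP hF _ s0) mY /(measurable_wrtP hF _ s0) mY'.
by apply/(measurable_wrtP hF _ s0); exact: measurable_funM.
Qed.

Let mwf s Y : 0 <= s -> measurable_wrt (F s) Y -> measurable_fun setT Y.
Proof. by move=> s0 adY; exact: (measurable_wrt_fun hF s0 adY). Qed.

Let mD s t : 0 <= s -> s <= t -> measurable_fun setT (fun w => b t w - b s w).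
Proof.
move=> s0 st; apply: (mwf (le_trans s0 st)); exact: increment_measurable.
Qed.

Lemma increment_sqr_ge0 s t Y : 0 <= s -> s <= t -> measurable_wrt (F s) Y ->
  (forall w, 0 <= Y w) ->
  (\int[P]_w (Y w * (b t w - b s w) ^+ 2)%:E = (t - s)%:E * \int[P]_w (Y w)%:E)%E.
Proof.
move=> s0; rewrite le_eqVlt => /predU1P[<-|st] adY Y0.
  rewrite subrr mul0e; under eq_integral do rewrite subrr expr0n/= mulr0.
  exact: integral0.
have ts0 : 0 < t - s by rewrite subr_gt0.
have mY := mwf s0 adY.
have mf : measurable_fun setT (fun q : R * R => `|q.1| * q.2 ^+ 2).
  apply: measurable_funM; last by apply: measurable_funX; exact: measurable_snd.
  by apply: measurableT_comp => //; exact: measurable_fst.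
have := gm_coord_law s0 st adY mf (fun q => mulr_ge0 (normr_ge0 _) (sqr_ge0 _)).
under eq_integral do rewrite /= ger0_norm//.
move=> ->; rewrite -ge0_integralZl_EFin ?(ltW ts0)//.
- apply: eq_integral => w _ /=; rewrite -EFinM ger0_norm//.
  under eq_integral do rewrite mulrCA EFinM.
  have sq : 0 < Num.sqrt (t - s) by rewrite sqrtr_gt0.
  rewrite ge0_integralZl_EFin//.
  + under eq_integral do rewrite mulrC.
    by rewrite normal_second_moment// sqr_sqrtr ?(ltW ts0)// -EFinM mulrC.
  + by move=> v _; rewrite lee_fin mulr_ge0 ?normal_pdf_ge0// sqr_ge0.
  + apply/measurable_EFinP; apply: measurable_funM; first exact: measurable_normal_pdf.
    exact: measurable_funX.
- by move=> w _; rewrite lee_fin.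
- exact/measurable_EFinP.
Qed.

Let parts s Y M : 0 <= s -> measurable_wrt (F s) Y -> has_mean Y M ->
  exists Yp Yn Mp Mn, [/\ measurable_wrt (F s) Yp /\ measurable_wrt (F s) Yn,
    has_mean Yp Mp /\ has_mean Yn Mn, (forall w, 0 <= Yp w) /\ (forall w, 0 <= Yn w) &
    (forall w, Y w = Yp w - Yn w) /\ M = Mp - Mn].
Proof.
move=> s0 adY hY.
pose Yp w := Num.max 0 (Y w); pose Yn w := Num.max 0 (- Y w).
have adp : measurable_wrt (F s) Yp.
  apply/(measurable_wrtP hF _ s0); apply: measurable_maxr => //.
  exact/(measurable_wrtP hF _ s0).
have adn : measurable_wrt (F s) Yn.
  apply/(measurable_wrtP hF _ s0); apply: measurable_maxr => //.
  by apply: measurable_funN; exact/(measurable_wrtP hF _ s0).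
have le Z : (Z = Yp \/ Z = Yn) -> forall w, `|Z w| <= `|Y w|.
  case=> -> w; rewrite ger0_norm ?le_max ?lexx// ge_max normr_ge0/= ?ler_norm//.
  by rewrite -normrN ler_norm.
have hYa : has_mean (fun w => `|Y w|) (\int[P]_w `|Y w|).
  by split => //; exact: integrable_norm hY.1.
have hp : has_mean Yp (\int[P]_w Yp w).
  by apply: has_mean_le hYa; [exact: mwf adp|apply: le; left].
have hn : has_mean Yn (\int[P]_w Yn w).
  by apply: has_mean_le hYa; [exact: mwf adn|apply: le; right].
have YE w : Y w = Yp w - Yn w.
  by rewrite /Yp /Yn /Num.max; case: ifPn; case: ifPn; rewrite -?leNgt; lra.
exists Yp, Yn, (\int[P]_w Yp w), (\int[P]_w Yn w); split=> //.
  by split=> w; rewrite le_max lexx.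
split=> //; apply: has_mean_unique hY _; rewrite (_ : Y = fun w => Yp w - Yn w); last exact/funext.
exact: has_meanB.
Qed.

Lemma increment_sqr_mean s t Y M : 0 <= s -> s <= t -> measurable_wrt (F s) Y -> has_mean Y M ->
  has_mean (fun w => Y w * (b t w - b s w) ^+ 2) ((t - s) * M).
Proof.
move=> s0 st adY hY; have [Yp [Yn [Mp [Mn [[ap an] [hp hn] [p0 n0] [YE ->]]]]]] := parts s0 adY hY.
have sq Z N : measurable_wrt (F s) Z -> has_mean Z N -> (forall w, 0 <= Z w) ->
    has_mean (fun w => Z w * (b t w - b s w) ^+ 2) ((t - s) * N).
  move=> aZ hZ Z0; apply: has_mean_ge0.
  - apply: measurable_funM; first exact: mwf aZ.
    by apply: measurable_funX; exact: mD.
  - by move=> w; rewrite mulr_ge0// sqr_ge0.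
  - by rewrite increment_sqr_ge0// (has_mean_integral measurableT hZ) EFinM.
have := has_meanB measurableT (sq _ _ ap hp p0) (sq _ _ an hn n0); rewrite -mulrBr.
by congr (has_mean _ _); apply/funext => w; rewrite YE mulrBl.
Qed.

(** Given [F s], the increment has a symmetric law, so the positive and negative parts of its
    product with [Y] have the same mean. Integrability comes from [|Y x| <= |Y| + |Y| x ^+ 2] and
    the second moment. *)
Lemma increment_mean s t Y M : 0 <= s -> s <= t -> measurable_wrt (F s) Y -> has_mean Y M ->
  has_mean (fun w => Y w * (b t w - b s w)) 0.
Proof.
move=> s0 + adY hY; rewrite le_eqVlt => /predU1P[<-|st].
  rewrite (_ : (fun w => _) = fun=> 0); last by apply/funext => w; rewrite subrr mulr0.
  exact: has_mean0.
have mY := mwf s0 adY; have mDst := mD s0 (ltW st).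
have hYa : has_mean (fun w => `|Y w|) (\int[P]_w `|Y w|).
  by split => //; exact: integrable_norm hY.1.
have adYa : measurable_wrt (F s) (fun w => `|Y w|).
  apply/(measurable_wrtP hF _ s0); apply: measurableT_comp => //.
  exact/(measurable_wrtP hF _ s0).
have dom := has_meanD measurableT hYa (increment_sqr_mean s0 (ltW st) adYa hYa).
have mYD : measurable_fun setT (fun w => Y w * (b t w - b s w)) by exact: measurable_funM.
have le w : `|Y w * (b t w - b s w)| <= `|Y w| + `|Y w| * (b t w - b s w) ^+ 2.
  set x := b t w - b s w; rewrite normrM -[X in X + _]mulr1 -mulrDr ler_wpM2l//.
  by have := sqr_ge0 (`|x| - 1); rewrite sqrrB real_normK ?num_real//; have := normr_ge0 x; lra.
pose Zp w := Num.max 0 (Y w * (b t w - b s w)).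
pose Zn w := Num.max 0 (- (Y w * (b t w - b s w))).
have mZp : measurable_fun setT Zp by exact: measurable_maxr.
have mZn : measurable_fun setT Zn by apply: measurable_maxr => //; exact: measurable_funN.
have hp : has_mean Zp (\int[P]_w Zp w).
  apply: has_mean_le dom => // w; apply: le_trans (le w).
  by rewrite ger0_norm ?le_max ?lexx// ge_max normr_ge0/= ler_norm.
have hn : has_mean Zn (\int[P]_w Zn w).
  apply: has_mean_le dom => // w; apply: le_trans (le w).
  by rewrite ger0_norm ?le_max ?lexx// ge_max normr_ge0/= -normrN ler_norm.
have mf1 : measurable_fun setT (fun q : R * R => Num.max 0 (q.1 * q.2)).
  by apply: measurable_maxr => //; apply: measurable_funM; [exact: measurable_fst|exact: measurable_snd].
have mf2 : measurable_fun setT (fun q : R * R => Num.max 0 (- (q.1 * q.2))).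
  apply: measurable_maxr => //; apply: measurable_funN.
  by apply: measurable_funM; [exact: measurable_fst|exact: measurable_snd].
have ge0_max (r : R) : 0 <= Num.max 0 r by rewrite le_max lexx.
have L1 := gm_coord_law s0 st adY mf1 (fun q => ge0_max _).
have L2 := gm_coord_law s0 st adY mf2 (fun q => ge0_max _).
have pn : \int[P]_w Zp w = \int[P]_w Zn w.
  rewrite /Rintegral; congr fine; rewrite [LHS]L1 [RHS]L2; apply: eq_integral => w _ /=.
  rewrite -[RHS]integral_opp.
  - apply: eq_integral => v _; rewrite mulrN opprK; congr (_ * _)%:E.
    by rewrite !normal_pdf0E ?gt_eqF ?sqrtr_gt0 ?subr_gt0// sqrrN.
  - apply/measurable_EFinP; apply: measurable_funM; first exact: measurable_normal_pdf.
    by apply: measurable_maxr => //; apply: measurable_funN; exact: measurable_funM.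
  - by move=> v; rewrite lee_fin mulr_ge0 ?normal_pdf_ge0.
have := has_meanB measurableT hp hn; rewrite pn subrr.
congr (has_mean _ _); apply/funext => w.
by rewrite /Zp /Zn /Num.max; case: ifPn; case: ifPn; rewrite -?leNgt; lra.
Qed.

(** The longer increment is split at [p]: the square over [[c, p]] gives [p - c], and the cross term
    with the increment over [[p, q]] has mean 0. *)
Lemma increments_common_start c p q Y M : 0 <= c -> c <= p -> p <= q ->
  measurable_wrt (F c) Y -> has_mean Y M ->
  has_mean (fun w => Y w * (b p w - b c w) * (b q w - b c w)) ((p - c) * M).
Proof.
move=> c0 cp pq aY hY; have p0 := le_trans c0 cp.
have h1 := increment_sqr_mean c0 cp aY hY.
have h2 := increment_mean c0 cp aY hY.
have aYD : measurable_wrt (F p) (fun w => Y w * (b p w - b c w)).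
  apply: mwM => //; first exact: (measurable_wrtS hF c0 cp aY).
  exact: increment_measurable.
have := has_meanD measurableT h1 (increment_mean p0 pq aYD h2); rewrite addr0.
by congr (has_mean _ _); apply/funext => w; ring.
Qed.

(** Length of the intersection of [[a, b]] and [[c, d]]. *)
Definition overlap (a b c d : R) := Num.max 0 (Num.min b d - Num.max a c).

Lemma overlapC a p c q : overlap a p c q = overlap c q a p.
Proof. by rewrite /overlap [Num.min q p]minC [Num.max c a]maxC. Qed.

(** The interval that starts first is cut at [c]: what precedes [c] is known at time [c] and
    uncorrelated with the increment from [c], and the rest starts at [c] like the other interval. *)
Let cross_le a p c q (e e' : Omega -> R) (K : R) : 0 <= a -> a <= p -> a <= c -> c <= q ->
  measurable_wrt (F a) e -> measurable_wrt (F c) e' ->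
  (forall w, `|e w| <= K) -> (forall w, `|e' w| <= K) ->
  has_mean (fun w => e w * e' w * (b p w - b a w) * (b q w - b c w))
    (overlap a p c q * \int[P]_w (e w * e' w)).
Proof.
move=> a0 ap ac cq ae ae' eK e'K; have c0 := le_trans a0 ac.
have K0 : 0 <= K by exact: le_trans (eK point).
have aY : measurable_wrt (F c) (fun w => e w * e' w).
  by apply: mwM => //; exact: (measurable_wrtS hF a0 ac ae).
have YK w : `|e w * e' w| <= K ^+ 2 by rewrite normrM expr2 ler_pM.
have hY := bounded_has_mean P (mwf c0 aY) YK.
have acst (k r : R) : 0 <= r -> measurable_wrt (F r) (fun=> k : R).
  by move=> r0; apply/(measurable_wrtP hF _ r0); exact: measurable_cst.
have hK := bounded_has_mean P (@measurable_cst _ _ _ _ setT (K ^+ 2)) (fun=> lexx `|K ^+ 2|).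
have split_at r : a <= r -> r <= p -> r <= c ->
    has_mean (fun w => e w * e' w * (b r w - b a w) * (b q w - b c w)) 0.
  move=> ar rp rc; have r0 := le_trans a0 ar.
  have aYD : measurable_wrt (F c) (fun w => e w * e' w * (b r w - b a w)).
    apply: mwM => //; apply: (measurable_wrtS hF r0 rc).
    exact: increment_measurable.
  have dom := has_meanD measurableT hK (increment_sqr_mean a0 ar (acst (K ^+ 2) a a0) hK).
  have hYD := has_mean_le (mwf c0 aYD) _ dom.
  apply: (increment_mean c0 cq aYD (hYD _)) => w; set x := b r w - b a w.
  rewrite normrM -[X in X + _]mulr1 -mulrDr ler_pM//.
  by have := sqr_ge0 (`|x| - 1); rewrite sqrrB real_normK ?num_real//; have := normr_ge0 x; lra.
have [pc|cp] := leP p c.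
  rewrite (_ : overlap a p c q = 0) ?mul0r; first exact: split_at.
  apply/max_idPl; rewrite subr_le0 (le_trans _ (_ : c <= _))//; last by rewrite le_max lexx orbT.
  by rewrite ge_min pc.
have h1 := split_at c ac (ltW cp) (lexx c).
have h2 : has_mean (fun w => e w * e' w * (b p w - b c w) * (b q w - b c w))
    ((Num.min p q - c) * \int[P]_w (e w * e' w)).
  have [pq|qp] := leP p q; first exact: increments_common_start (ltW cp) pq aY hY.
  have := increments_common_start c0 cq (ltW qp) aY hY.
  by congr (has_mean _ _); apply/funext => w; ring.
have -> : overlap a p c q = Num.min p q - c.
  rewrite /overlap (max_idPr ac); apply/max_idPr.
  by rewrite subr_ge0 le_min (ltW cp).
have := has_meanD measurableT h1 h2; rewrite add0r.
by congr (has_mean _ _); apply/funext => w; ring.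
Qed.

Lemma increments_cross a p c q (e e' : Omega -> R) (K : R) :
  0 <= a -> a <= p -> 0 <= c -> c <= q ->
  measurable_wrt (F a) e -> measurable_wrt (F c) e' ->
  (forall w, `|e w| <= K) -> (forall w, `|e' w| <= K) ->
  has_mean (fun w => (e w * (b p w - b a w)) * (e' w * (b q w - b c w)))
    (overlap a p c q * \int[P]_w (e w * e' w)).
Proof.
move=> a0 ap c0 cq ae ae' eK e'K; have [ac|/ltW ca] := leP a c.
  have := cross_le a0 ap ac cq ae ae' eK e'K.
  by congr (has_mean _ _); apply/funext => w; ring.
have := cross_le c0 cq ca ap ae' ae e'K eK; rewrite overlapC.
rewrite (_ : (fun w => e' w * e w) = fun w => e w * e' w); last by apply/funext => w; ring.
by congr (has_mean _ _); apply/funext => w; ring.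
Qed.

End increments.

(** * The Ito isometry for elementary processes *)

Section isometry.
Context {R : realType} {dO} {Omega : measurableType dO}.
Variables (P : probability Omega R) (F : R -> set (set Omega)).
Hypothesis hF : complete_filtration P F.
Variables (m : nat) (B : R -> Omega -> 'rV[R]_m) (i : 'I_m).
Hypothesis gB : gaussian_motion P F B.
Notation leb := (@lebesgue_measure R).

Let b t w := B t w ord0 i.

(** The same [overlap] as in [increments_cross]: term by term, this coincidence is the isometry. *)
Lemma overlap_integral t (a p c q : R) : 0 <= a -> 0 <= c -> p <= t -> q <= t ->
  has_mean leb `[0, t]%classic (fun r => \1_(`[a, p[%classic) r * \1_(`[c, q[%classic) r)
    (overlap a p c q).
Proof.
move=> a0 c0 pt qt.
have E : (fun r => \1_(`[a, p[%classic) r * \1_(`[c, q[%classic) r) =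
    \1_(`[Num.max a c, Num.min p q[%classic) :> (R -> R).
  apply/funext => r; rewrite -[LHS]/((\1_(`[a, p[%classic) \* \1_(`[c, q[%classic)) r) -indicI.
  congr (\1_ _ r); apply/seteqP; split=> s /=; rewrite !in_itv/= ge_max lt_min.
    by move=> [/andP[-> ->] /andP[-> ->]].
  by move=> /andP[/andP[-> ->] /andP[-> ->]].
rewrite E; split.
  apply: measurable_bounded_integrable => //.
  - rewrite /= lebesgue_measure_itv/=; case: ifP => _; last exact: ltry.
    by rewrite -EFinD ltry.
  - exists 1; split => [|M M1 r _ /=]; first exact: num_real.
    by apply: le_trans (ltW M1); rewrite indicE; case: (_ \in _); rewrite ?normr1 ?normr0.
rewrite /Rintegral integral_indic//= setIidl; last first.
  move=> r /=; rewrite !in_itv/= ge_max lt_min => /andP[/andP[ar _] /andP[rp _]].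
  by rewrite (le_trans a0 ar) (le_trans (ltW rp)).
rewrite lebesgue_measure_itv/= lte_fin /overlap; case: ifP => [/ltW|/negbT].
  by rewrite -subr_ge0 => /max_idPr ->.
by rewrite -leNgt -subr_le0 => /max_idPl ->.
Qed.

(* The integrands need not come from a single partition, so the difference of
   two elementary integrals is covered. *)
Lemma elementary_isometry n t (s p : 'I_n -> R) (e : 'I_n -> Omega -> R) (K : R) :
  (forall k, 0 <= s k) -> (forall k, s k <= p k) -> (forall k, p k <= t) ->
  (forall k, measurable_wrt (F (s k)) (e k)) -> (forall k w, `|e k w| <= K) ->
  (\int[P]_w ((\sum_(k < n) e k w * (b (p k) w - b (s k) w)) ^+ 2)%:E =
   \int[P]_w \int[leb]_(r in `[0%R, t])
     ((\sum_(k < n) e k w * \1_(`[s k, p k[%classic) r) ^+ 2)%:E)%E.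
Proof.
move=> s0 sp pt ae eK.
have sqr_sum (x : 'I_n -> R) : (\sum_(k < n) x k) ^+ 2 = \sum_(k < n) \sum_(l < n) x k * x l.
  by rewrite expr2 mulr_suml; apply: eq_bigr => k _; rewrite mulr_sumr.
pose ov k l := overlap (s k) (p k) (s l) (p l).
pose S := \sum_(k < n) \sum_(l < n) ov k l * \int[P]_w (e k w * e l w).
have mee k l : measurable_fun setT (fun w => e k w * e l w).
  by apply: measurable_funM; apply: (measurable_wrt_fun hF (s0 _)); exact: ae.
have H1 : has_mean P setT (fun w => (\sum_(k < n) e k w * (b (p k) w - b (s k) w)) ^+ 2) S.
  under eq_fun do rewrite sqr_sum.
  apply: has_mean_sum => // k; apply: has_mean_sum => // l.
  exact: (increments_cross hF i gB (s0 k) (sp k) (s0 l) (sp l) (ae k) (ae l) (eK k) (eK l)).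
have H2 : has_mean P setT (fun w => \sum_(k < n) \sum_(l < n) ov k l * (e k w * e l w)) S.
  apply: has_mean_sum => // k; apply: has_mean_sum => // l; apply: has_meanZ => //.
  apply: (bounded_has_mean P (mee k l) (M := K ^+ 2)) => w.
  by rewrite normrM expr2 ler_pM.
rewrite (has_mean_integral measurableT H1) -(has_mean_integral measurableT H2).
apply: eq_integral => w _; apply/esym/has_mean_integral => //.
rewrite (_ : (fun r => _) = fun r => \sum_(k < n) \sum_(l < n)
  (e k w * \1_(`[s k, p k[%classic) r) * (e l w * \1_(`[s l, p l[%classic) r)); last first.
  by apply/funext => r; exact: sqr_sum.
apply: has_mean_sum => // k; apply: has_mean_sum => // l.
have := fun mD => has_meanZ mD (e k w * e l w) (overlap_integral (s0 k) (s0 l) (pt k) (pt l)).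
move=> /(_ (measurable_itv _)).
rewrite [X in has_mean _ _ _ X]mulrC; congr (has_mean _ _ _ _).
by apply/funext => r; ring.
Qed.

End isometry.

(** * Ito integrals as limits of Riemann sums *)

Section ito.
Context {R : realType} {dO} {Omega : measurableType dO}.
Variables (P : probability Omega R) (F : R -> set (set Omega)).
Hypothesis hF : complete_filtration P F.
Variables (m : nat) (B : R -> Omega -> 'rV[R]_m) (i : 'I_m).
Hypothesis gB : gaussian_motion P F B.
Notation leb := (@lebesgue_measure R).

Let b t w := B t w ord0 i.

Lemma sqr_integral_triangle d (T : measurableType d) (mu : {measure set T -> \bar R})
    (X Y : T -> R) : measurable_fun setT X -> measurable_fun setT Y ->
  (\int[mu]_x ((X x + Y x) ^+ 2)%:E <=
   2%:E * \int[mu]_x (X x ^+ 2)%:E + 2%:E * \int[mu]_x (Y x ^+ 2)%:E)%E.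
Proof.
move=> mX mY.
have mX2 : measurable_fun setT (fun x => (X x ^+ 2)%:E) by apply/measurable_EFinP; exact: measurable_funX.
have mY2 : measurable_fun setT (fun x => (Y x ^+ 2)%:E) by apply/measurable_EFinP; exact: measurable_funX.
have s0 (Z : T -> R) x : (0 <= (Z x ^+ 2)%:E)%E by rewrite lee_fin sqr_ge0.
rewrite -!ge0_integralZl_EFin// -ge0_integralD//; last 4 first.
- by move=> x _; rewrite -EFinM lee_fin mulr_ge0// sqr_ge0.
- by under eq_fun do rewrite -EFinM; apply/measurable_EFinP; apply: measurable_funM => //; exact: measurable_funX.
- by move=> x _; rewrite -EFinM lee_fin mulr_ge0// sqr_ge0.
- by under eq_fun do rewrite -EFinM; apply/measurable_EFinP; apply: measurable_funM => //; exact: measurable_funX.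
apply: ge0_le_integral => //.
- by move=> x _; rewrite lee_fin sqr_ge0.
- by apply/measurable_EFinP; apply: measurable_funX; exact: measurable_funD.
- under eq_fun do rewrite -!EFinM -EFinD; apply/measurable_EFinP.
  by apply: measurable_funD; apply: measurable_funM => //; exact: measurable_funX.
- move=> x _; rewrite -!EFinM -EFinD lee_fin.
  by have := sqr_ge0 (X x - Y x); rewrite sqrrB sqrrD; lra.
Qed.

(** Half-open at [t], since elementary processes vanish there whatever they approximate; the
    extension by 0 turns [dist2] into a squared L2 distance for a product measure. *)
Definition rect t (f : R -> Omega -> R) : R * Omega -> R :=
  (fun q => f q.1 q.2) \_ (`[0, t[%classic `*` [set: Omega]).

Lemma rectE t f r w : rect t f (r, w) = if 0 <= r < t then f r w else 0.
Proof.
rewrite /rect patchE; case: ifPn => [|/negP].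
  by rewrite inE => -[/=]; rewrite in_itv/= => ->.
rewrite inE/= in_itv/= => H; case: ifP => // rt; exfalso; apply: H; by split.
Qed.

Definition dist2 t (f g : R -> Omega -> R) : \bar R :=
  (\int[P]_w \int[leb]_(r in `[0%R, t]) ((f r w - g r w) ^+ 2)%:E)%E.

Lemma dist2E t f g : measurable_fun setT (rect t f) -> measurable_fun setT (rect t g) ->
  dist2 t f g = (\int[leb \x P]_q ((rect t f q - rect t g q) ^+ 2)%:E)%E.
Proof.
move=> mf mg.
have mh : measurable_fun setT (fun q => ((rect t f q - rect t g q) ^+ 2)%:E).
  by apply/measurable_EFinP; apply: measurable_funX; exact: measurable_funB.
rewrite fubini_tonelli2; last 2 first.
- exact: mh.
- by move=> q; rewrite lee_fin sqr_ge0.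
apply: eq_integral => w _; rewrite /fubini_G.
have E : (fun r => ((f r w - g r w) ^+ 2)%:E) \_ `[0, t[ =
    (fun r => ((rect t f (r, w) - rect t g (r, w)) ^+ 2)%:E).
  apply/funext => r; rewrite patchE !rectE; case: ifPn => [|/negP].
    by rewrite inE/= in_itv/= => ->.
  rewrite inE/= in_itv/=; case: ifP => // _ _.
  by rewrite subrr expr0n.
rewrite -E -integral_mkcond; apply/esym/integral_itv_bndo_bndc.
apply/(measurable_restrictT _ (measurable_itv _)); rewrite E.
exact: (measurableT_comp mh (measurable_pair2 w)).
Qed.

Lemma dist2_triangle t f g h : measurable_fun setT (rect t f) -> measurable_fun setT (rect t g) ->
  measurable_fun setT (rect t h) ->
  (dist2 t f h <= 2%:E * dist2 t f g + 2%:E * dist2 t g h)%E.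
Proof.
move=> mf mg mh; rewrite !dist2E//.
have := sqr_integral_triangle (leb \x P)%E (measurable_funB mf mg) (measurable_funB mg mh).
by under eq_integral do rewrite addrA subrK.
Qed.

Lemma dist2C t f g : dist2 t f g = dist2 t g f.
Proof.
by apply: eq_integral => w _; apply: eq_integral => r _; rewrite -sqrrN opprB.
Qed.

Lemma elementary_times t k (s : nat -> R) e j : elementary F t k s e -> (j <= k)%N -> 0 <= s j <= t.
Proof.
move=> [s0 sk mono _ _] jk; apply/andP; split.
  elim: j jk => [|j IH] jk; first by rewrite s0.
  by rewrite (le_trans (IH (ltnW jk)))// mono.
rewrite -sk -(subnKC jk).
suff H n : (n <= k - j)%N -> s j <= s (j + n)%N by exact: H.
elim: n => [|n IH] nk; first by rewrite addn0.
apply: le_trans (IH (ltnW nk)) _; rewrite addnS; apply: mono.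
by rewrite -ltn_subRL.
Qed.

Lemma elementary_process_rect t k s e : elementary F t k s e ->
  measurable_fun setT (rect t (elementary_process k s e)).
Proof.
move=> He; have [s0 sk mono ae _] := He.
apply/(measurable_restrictT _ (measurableX (measurable_itv _) measurableT)).
apply: measurable_funTS; apply: measurable_sum => j; apply: measurable_funM.
  have sj : 0 <= s j by case/andP: (elementary_times He (ltnW (ltn_ord j))).
  apply: (measurableT_comp _ measurable_snd).
  exact: (measurable_wrt_fun hF sj (ae j (ltn_ord j))).
by apply: (measurableT_comp _ measurable_fst); exact: measurable_indic.
Qed.

Lemma elementary_integral_measurable t k s e : elementary F t k s e ->
  measurable_fun setT (elementary_integral b k s e).
Proof.
move=> He; have [s0 sk mono ae _] := He.
apply: measurable_sum => j.
have /andP[sj _] := elementary_times He (ltnW (ltn_ord j)).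
apply: measurable_funM; first exact: (measurable_wrt_fun hF sj (ae j (ltn_ord j))).
have sj1 := mono j (ltn_ord j); have sj1' := le_trans sj sj1.
apply: (measurable_wrt_fun hF sj1'); exact: (increment_measurable hF i gB sj sj1).
Qed.

(** The two families are concatenated, the second with a minus sign, into one family of [k + k']
    terms, to which the isometry applies even though the intervals interleave. *)
Lemma elementary_dist t k s e k' s' e' : elementary F t k s e -> elementary F t k' s' e' ->
  (\int[P]_w ((elementary_integral b k s e w - elementary_integral b k' s' e' w) ^+ 2)%:E =
   dist2 t (elementary_process k s e) (elementary_process k' s' e'))%E.
Proof.
move=> He He'; have [s0 sk mono ae [K eK]] := He; have [s0' sk' mono' ae' [K' eK']] := He'.
pose S (j : 'I_(k + k')) : R := match fintype.split j with inl a => s a | inr c => s' c end.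
pose Q (j : 'I_(k + k')) : R := match fintype.split j with inl a => s a.+1 | inr c => s' c.+1 end.
pose E (j : 'I_(k + k')) : Omega -> R :=
  match fintype.split j with inl a => e a | inr c => fun w => - e' c w end.
have bigS (X : R -> R -> R) w : (forall x y, X (- x) y = - X x y) ->
   forall Y : R -> R -> R, \sum_(j < k + k') X (E j w) (Y (S j) (Q j)) =
   \sum_(j < k) X (e j w) (Y (s j) (s j.+1)) - \sum_(j < k') X (e' j w) (Y (s' j) (s' j.+1)).
  move=> XN Y; rewrite big_split_ord/= -sumrN; congr (_ + _); apply: eq_bigr => j _.
    by rewrite /S /Q /E (unsplitK (inl j)).
  by rewrite /S /Q /E (unsplitK (inr j)) XN.
have H := elementary_isometry hF i gB (t := t) (s := S) (p := Q) (e := E) (K := Num.max K K').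
rewrite /dist2.
under eq_integral do rewrite /elementary_integral -(bigS *%R _ (@mulNr _) (fun x y => b y _ - b x _)).
rewrite {}H.
- apply: eq_integral => w _; apply: eq_integral => r _.
  by rewrite (bigS *%R _ (@mulNr _) (fun x y => \1_(`[x, y[%classic) r)).
- move=> j; rewrite /S; case: (fintype.split j) => a.
    by case/andP: (elementary_times He (ltnW (ltn_ord a))).
  by case/andP: (elementary_times He' (ltnW (ltn_ord a))).
- by move=> j; rewrite /S /Q; case: (fintype.split j) => a; [exact: mono|exact: mono'].
- move=> j; rewrite /Q; case: (fintype.split j) => a.
    by case/andP: (elementary_times He (ltn_ord a)).
  by case/andP: (elementary_times He' (ltn_ord a)).
- move=> j; rewrite /S /E; case: (fintype.split j) => a; first exact: ae.
  have sa : 0 <= s' a by case/andP: (elementary_times He' (ltnW (ltn_ord a))).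
  have := ae' a (ltn_ord a) => /(measurable_wrtP hF _ sa) ma.
  by apply/(measurable_wrtP hF _ sa); exact: measurable_funN.
- move=> j w; rewrite /E le_max; case: (fintype.split j) => a; first by rewrite eK.
  by rewrite normrN eK' ?orbT.
Qed.

Let cvg_combination (u v w : nat -> \bar R) :
  u @ \oo --> 0%E -> v @ \oo --> 0%E -> w @ \oo --> 0%E ->
  (fun n => 2%:E * u n + 2%:E * (2%:E * v n + 2%:E * w n))%E @ \oo --> 0%E.
Proof.
move=> cu cv cw.
have c2 (x : nat -> \bar R) : x @ \oo --> 0%E -> (fun n => 2%:E * x n)%E @ \oo --> 0%E.
  by move=> cx; have := cvgeZl (erefl : 2%:E \is a fin_num) cx; rewrite mule0.
have cD (x y : nat -> \bar R) : x @ \oo --> 0%E -> y @ \oo --> 0%E ->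
    (fun n => x n + y n)%E @ \oo --> 0%E.
  move=> cx cy; have H : (fun n => x n + y n)%E @ \oo --> (0 + 0 : \bar R)%E by exact: cvgeD.
  by move: H; rewrite adde0.
by apply: (cD _ _ (c2 _ cu)); apply: (c2); apply: (cD); exact: c2.
Qed.

(** [ito_integral] provides one approximating sequence; by [elementary_dist], any other sequence of
    elementary processes tending to [H] has integrals with the same limit. *)
Lemma ito_elementary_cvg t H I (k : nat -> nat) (s : nat -> nat -> R) (e : nat -> nat -> Omega -> R) :
  0 <= t -> ito_integral P F b t H I -> (forall n, elementary F t (k n) (s n) (e n)) ->
  (fun n => dist2 t H (elementary_process (k n) (s n) (e n))) @ \oo --> 0%E ->
  (fun n => \int[P]_w ((I w - elementary_integral b (k n) (s n) (e n) w) ^+ 2)%:E)%E @ \oo --> 0%E.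
Proof.
move=> t0 [mH _ _ mI [k' [s' [e' [He' H'cvg I'cvg]]]]] He Hcvg.
have mrH : measurable_fun setT (rect t H).
  apply/(measurable_restrictT _ (measurableX (measurable_itv _) measurableT)).
  apply: measurable_funS mH; first exact: (measurableX (measurable_itv _) measurableT).
  move=> q [q1 _]; split => //; move: q1; rewrite /= !in_itv/= => /andP[-> /ltW ->]//.
pose al n := (\int[P]_w ((I w - elementary_integral b (k' n) (s' n) (e' n) w) ^+ 2)%:E)%E.
pose be n := dist2 t H (elementary_process (k' n) (s' n) (e' n)).
pose ga n := dist2 t H (elementary_process (k n) (s n) (e n)).
have d0 f g : (0 <= dist2 t f g)%E.
  by apply: integral_ge0 => w _; apply: integral_ge0 => r _; rewrite lee_fin sqr_ge0.
have al0 n : (0 <= al n)%E by apply: integral_ge0 => w _; rewrite lee_fin sqr_ge0.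
have le n : (\int[P]_w ((I w - elementary_integral b (k n) (s n) (e n) w) ^+ 2)%:E <=
    2%:E * al n + 2%:E * (2%:E * be n + 2%:E * ga n))%E.
  have mJ' := elementary_integral_measurable (He' n).
  have mJ := elementary_integral_measurable (He n).
  have := sqr_integral_triangle P (measurable_funB mI mJ') (measurable_funB mJ' mJ).
  under eq_integral do rewrite addrA subrK.
  move=> /le_trans; apply; rewrite leeD2l// lee_pmul2l// (elementary_dist (He' n) (He n)).
  rewrite (le_trans (dist2_triangle _ mrH _))//; [exact: elementary_process_rect|exact: elementary_process_rect|].
  by rewrite dist2C.
apply: (@squeeze_cvge _ _ _ _ (fun=> 0%E) _ (fun n => 2%:E * al n + 2%:E * (2%:E * be n + 2%:E * ga n))%E).
- by near=> n; rewrite le andbT; apply: integral_ge0 => w _; rewrite lee_fin sqr_ge0.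
- exact: cvg_cst.
- exact: (cvg_combination I'cvg H'cvg Hcvg).
Unshelve. all: end_near. Qed.

(** By Fatou's lemma. Applied to squared distances, it identifies an L2 limit with an almost sure
    limit. *)
Lemma integral_cvg0_ae d (T : measurableType d) (mu : {measure set T -> \bar R})
    (f : nat -> T -> R) (l : T -> R) :
  (forall n, measurable_fun setT (f n)) -> (forall n x, 0 <= f n x) ->
  (fun n => \int[mu]_x (f n x)%:E)%E @ \oo --> 0%E ->
  {ae mu, forall x, (fun n => f n x) @ \oo --> l x} -> {ae mu, forall x, l x = 0}.
Proof.
move=> mf f0 icvg fl.
have mfE n : measurable_fun setT (fun x => (f n x)%:E) by exact/measurable_EFinP.
have f0E n x : setT x -> (0 <= (f n x)%:E)%E by rewrite lee_fin.
have := fatou mu measurableT mfE f0E.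
rewrite (is_cvg_limn_einfE (cvgP _ icvg)) (cvg_lim _ icvg)// => le0.
have g0 x : (0 <= limn_einf (fun n => (f n x)%:E))%E.
  rewrite limn_einf_lim; apply: lime_ge; first exact: is_cvg_einfs.
  by near=> n; apply: le_ereal_inf_tmp => _ [k /= _ <-]; rewrite lee_fin.
have I0 : (\int[mu]_x `|limn_einf (fun n => (f n x)%:E)| = 0)%E.
  apply/eqP; rewrite eq_le; apply/andP; split; last exact: integral_ge0.
  by under eq_integral do rewrite gee0_abs//.
have mg : measurable_fun setT (fun x => limn_einf (fun n => (f n x)%:E)).
  rewrite /limn_einf; apply: measurableT_comp => //.
  by apply: measurable_fun_limn_esup => n; exact: measurableT_comp.
have /(ae_eq_integral_abs mu measurableT mg) := I0.
move=> gae; near=> x.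
have lx : limn_einf (fun n => (f n x)%:E) = 0%E by near: x; apply: filterS gae => x; exact.
have fx : (fun n => f n x) @ \oo --> l x by near: x.
have fxE : (fun n => (f n x)%:E) @ \oo --> (l x)%:E by apply: cvg_EFin; [exact: nearW|exact: fx].
by move: lx; rewrite (is_cvg_limn_einfE (cvgP _ fxE)) (cvg_lim _ fxE)// => -[].
Unshelve. all: end_near. Qed.

Lemma integral_cvg_le d (T : measurableType d) (mu : {measure set T -> \bar R})
    (f : nat -> T -> R) (l : T -> R) (c : \bar R) :
  (forall n, measurable_fun setT (f n)) -> (forall n x, 0 <= f n x) ->
  (fun n => \int[mu]_x (f n x)%:E)%E @ \oo --> c ->
  (forall x, (fun n => f n x) @ \oo --> l x) -> (\int[mu]_x (l x)%:E <= c)%E.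
Proof.
move=> mf f0 icvg fl.
have mfE n : measurable_fun setT (fun x => (f n x)%:E) by exact/measurable_EFinP.
have f0E n x : setT x -> (0 <= (f n x)%:E)%E by rewrite lee_fin.
have := fatou mu measurableT mfE f0E.
rewrite (is_cvg_limn_einfE (cvgP _ icvg)) (cvg_lim _ icvg)//; apply: le_trans.
rewrite le_eqVlt; apply/orP; left; apply/eqP; apply: eq_integral => x _.
have fxE : (fun n => (f n x)%:E) @ \oo --> (l x)%:E.
  by apply: cvg_EFin; [exact: nearW|exact: fl].
by rewrite (is_cvg_limn_einfE (cvgP _ fxE)) (cvg_lim _ fxE).
Qed.

Section riemann.
Variables (t K : R) (h : R -> Omega -> R).
Hypotheses (t0 : 0 <= t) (hK : forall r w, `|h r w| <= K)
  (ah : forall r, 0 <= r -> measurable_wrt (F r) (h r))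
  (ch : forall w, continuous (h ^~ w)).

Definition part (n k : nat) : R := k%:R * (t / n.+1%:R).

Let e n k := h (part n k).

Notation EP n := (elementary_process n.+1 (part n) (e n)).
Notation EI n := (elementary_integral b n.+1 (part n) (e n)).

Let dt0 n : 0 <= t / n.+1%:R. Proof. by rewrite divr_ge0. Qed.

Lemma part_ge0 n k : 0 <= part n k.
Proof. by rewrite mulr_ge0. Qed.

Lemma elementary_riemann n : elementary F t n.+1 (part n) (e n).
Proof.
split.
- by rewrite /part mul0r.
- by rewrite /part mulrC divfK.
- by move=> k _; rewrite ler_wpM2r// ler_nat.
- by move=> k _; apply: ah; exact: part_ge0.
- by exists K => k w _; exact: hK.
Qed.

Lemma riemann_value n r w : 0 <= r < t ->
  exists2 s, `|s - r| <= t / n.+1%:R & EP n r w = h s w.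
Proof.
move=> /andP[r0 rt]; have tp : 0 < t by exact: le_lt_trans rt.
have dt : 0 < t / n.+1%:R by rewrite divr_gt0.
pose k := Num.truncn (r / (t / n.+1%:R)).
have /andP[k1 k2] := truncn_itv (divr_ge0 r0 (dt0 n)).
rewrite -/k in k1 k2; rewrite ler_pdivlMr// in k1; rewrite ltr_pdivrMr// in k2.
have kn : (k < n.+1)%N.
  rewrite -(ltr_nat R) -(ltr_pM2r dt) (le_lt_trans k1)// (lt_le_trans rt)//.
  by rewrite mulrC divfK.
exists (part n k).
  rewrite distrC ger0_norm ?subr_ge0// /part.
  move: k1 k2; set D := t / _; rewrite (mulrSr 1 k) mulrDl mul1r; lra.
rewrite /elementary_process (bigD1 (Ordinal kn))//= big1 => [|j jk].
  by rewrite addr0 indicE mem_set ?mulr1//= in_itv/= /part k1 k2.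
rewrite indicE memNset ?mulr0//= in_itv/= => /andP[j1 j2].
move/eqP: jk; apply; apply: val_inj => /=; apply/eqP; rewrite eqn_leq.
have := le_lt_trans k1 j2; rewrite ltr_pM2r// ltr_nat ltnS => ->; rewrite andbT.
by have := le_lt_trans j1 k2; rewrite ltr_pM2r// ltr_nat ltnS.
Qed.

Lemma rect_riemann_cvg q : (fun n => rect t (EP n) q) @ \oo --> rect t h q.
Proof.
case: q => r w; rewrite rectE; under eq_fun do rewrite rectE.
case: ifPn => rt; last exact: cvg_cst.
apply/cvgrPdist_le => eps eps0.
have /cvgrPdist_le /(_ _ eps0) /nbhs_ballP [del /= del0 delP] := @ch w r.
have dcv : (fun n => t / n.+1%:R) @ \oo --> (0 : R).
  rewrite -[X in _ --> X](mulr0 t); apply: cvgM; [exact: cvg_cst|exact: cvg_harmonic].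
move/cvgrPdist_lt : dcv => /(_ _ del0); apply: filterS => n.
rewrite sub0r normrN ger0_norm// => dn.
have [s sr ->] := riemann_value n w rt; apply: delP.
by rewrite /ball/= distrC (le_lt_trans sr).
Qed.

Lemma measurable_rect : measurable_fun setT (rect t h).
Proof.
apply: (measurable_fun_cvg (h := fun n => rect t (EP n))) => [n|q _].
  exact: (elementary_process_rect (elementary_riemann n)).
exact: rect_riemann_cvg.
Qed.

Let K0 : 0 <= K. Proof. exact: le_trans (hK 0 point). Qed.

Lemma rect_bounded q : `|rect t h q| <= K.
Proof. by case: q => r w; rewrite rectE; case: ifP => // _; rewrite normr0. Qed.

Lemma rect_riemann_bounded n q : `|rect t (EP n) q| <= K.
Proof.
case: q => r w; rewrite rectE; case: ifPn => rt; last by rewrite normr0.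
by have [s _ ->] := riemann_value n w rt.
Qed.

Lemma integral_slab (c : R) : 0 <= c ->
  (\int[leb \x P]_q (c * \1_(`[0%R, t[%classic `*` [set: Omega]) q)%:E = (c * t)%:E)%E.
Proof.
move=> c0.
have mD : measurable (`[0%R, t[%classic `*` [set: Omega] : set (R * Omega)).
  exact: (measurableX (measurable_itv _) measurableT).
under eq_integral do rewrite EFinM.
rewrite ge0_integralZl_EFin//; last by apply/measurable_EFinP; exact: measurable_indic.
rewrite integral_indic// setIT.
transitivity (c%:E * (leb `[0%R, t[%classic * P setT))%E.
  by congr (_ * _)%E; apply: product_measure1E => //; exact: measurable_itv.
rewrite probability_setT mule1 lebesgue_measure_itv/= lte_fin EFinM.
case: ifPn => [_|]; first by rewrite -EFinB subr0.
by rewrite -leNgt => t0'; have -> : t = 0 by apply/eqP; rewrite eq_le t0' t0.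
Qed.

(** Dominated convergence on the slab, with bound [(2 * K) ^+ 2]. The second process is left free,
    because both [h] and a fixed Riemann process take its place. *)
Lemma dist2_riemann_cvg g : measurable_fun setT (rect t g) -> (forall q, `|rect t g q| <= K) ->
  (fun n => dist2 t (EP n) g) @ \oo --> dist2 t h g.
Proof.
move=> mg gK; rewrite (dist2E measurable_rect mg).
under eq_fun do rewrite (dist2E (elementary_process_rect (elementary_riemann _)) mg).
pose G : R * Omega -> \bar R := fun q => ((2 * K) ^+ 2 * \1_(`[0, t[%classic `*` [set: Omega]) q)%:E.
have mD : measurable (`[0%R, t[%classic `*` [set: Omega] : set (R * Omega)).
  exact: (measurableX (measurable_itv _) measurableT).
apply: (@dominated_cvg _ _ _ (leb \x P)%E setT measurableT
  (fun n q => ((rect t (EP n) q - rect t g q) ^+ 2)%:E) _ G).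
- move=> n; apply/measurable_EFinP; apply: measurable_funX; apply: measurable_funB => //.
  exact: (elementary_process_rect (elementary_riemann n)).
- move=> q _; apply: cvg_EFin; first exact: nearW.
  by apply: cvgM; apply: cvgB; [exact: rect_riemann_cvg|exact: cvg_cst|exact: rect_riemann_cvg|exact: cvg_cst].
- by [].
- apply/integrableP; split.
    by apply/measurable_EFinP; apply: measurable_funM => //; exact: measurable_indic.
  have GE q : (`|G q| = G q)%E by rewrite gee0_abs// lee_fin mulr_ge0 ?sqr_ge0.
  under eq_integral do rewrite GE.
  by rewrite integral_slab ?sqr_ge0// ltry.
- move=> n [r w] _; rewrite /G gee0_abs ?lee_fin ?sqr_ge0//.
  rewrite indicE; have [qD|qD] := pselect ((`[0, t[%classic `*` [set: Omega]) (r, w)).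
    rewrite mem_set// mulr1 -(@real_normK _ (_ - _)) ?num_real//.
    rewrite lerXn2r ?nnegrE ?mulr_ge0//; apply: le_trans (ler_normB _ _) _.
    by have := rect_riemann_bounded n (r, w); have := gK (r, w); lra.
  rewrite memNset// mulr0 /rect !patchE memNset// subrr expr0n//.
Qed.

Lemma dist2_riemann_cvg0 : (fun n => dist2 t h (EP n)) @ \oo --> 0%E.
Proof.
under eq_fun do rewrite dist2C.
have := dist2_riemann_cvg measurable_rect rect_bounded.
rewrite [X in _ --> X](_ : dist2 t h h = 0%E)//.
rewrite /dist2; under eq_integral do under eq_integral do rewrite subrr expr0n/=.
by rewrite integral0_eq// => w _; exact: integral0_eq.
Qed.

(** The left-point sums tend to [I] in L2 and to [l] almost surely, so a pathwise limit computes the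
    stochastic integral. *)
Lemma ito_integral_lim I l : ito_integral P F b t h I ->
  {ae P, forall w, (fun n => EI n w) @ \oo --> l w} -> {ae P, forall w, I w = l w}.
Proof.
move=> hI EIl; have [_ _ _ mI _] := hI.
have H := ito_elementary_cvg t0 hI elementary_riemann dist2_riemann_cvg0.
have mEI n := elementary_integral_measurable (elementary_riemann n).
have := integral_cvg0_ae (f := fun n w => (I w - EI n w) ^+ 2) (l := fun w => (I w - l w) ^+ 2) _ _ H.
case/(_ _ _ _)/wrap.
- by move=> n; apply: measurable_funX; exact: measurable_funB.
- by move=> n w; exact: sqr_ge0.
- apply: filterS EIl => w cw; apply: cvgM; apply: cvgB => //; exact: cvg_cst.
apply: filterS => w /eqP; rewrite sqrf_eq0 subr_eq0 => /eqP //.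
Qed.

(** The existence counterpart of [ito_integral_lim]: only pathwise convergence is assumed, and
    convergence in L2 is deduced from the isometry. *)
Lemma ito_integral_riemann l : (forall w, (fun n => EI n w) @ \oo --> l w) ->
  ito_integral P F b t h l.
Proof.
move=> EIl.
have mEI n := elementary_integral_measurable (elementary_riemann n).
have ml : measurable_fun setT l.
  by apply: (measurable_fun_cvg mEI) => w _; exact: EIl.
have mht : measurable_fun setT (h t) by exact: (measurable_wrt_fun hF t0 (ah t0)).
split=> //.
(* The definition asks for the closed interval, so the slice at time [t] is added back to
   [rect t h]. *)
- apply: (@eq_measurable_fun _ _ _ _ _
    (fun q : R * Omega => rect t h q + h t q.2 * \1_([set t]) q.1)).
    move=> [r w]; rewrite inE/= => -[/=]; rewrite in_itv/= => /andP[r0 rt] _.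
    rewrite rectE r0/= indicE; move: rt; rewrite le_eqVlt => /predU1P[->|rt].
      by rewrite ltxx mem_set// mulr1 add0r.
    by rewrite rt memNset ?mulr0 ?addr0//= => /eqP; rewrite lt_eqF.
  apply: measurable_funTS; apply: measurable_funD; first exact: measurable_rect.
  apply: measurable_funM; first exact: (measurableT_comp mht measurable_snd).
  by apply: (measurableT_comp _ measurable_fst); apply: measurable_indic; exact: measurable_set1.
- by move=> r r0 _; exact: ah.
- have -> : (\int[P]_w \int[leb]_(r in `[0%R, t]) (h r w ^+ 2)%:E = dist2 t h (fun _ _ => 0%R))%E.
    by apply: eq_integral => w _; apply: eq_integral => r _; rewrite subr0.
  have r0 q : rect t (fun _ _ => 0%R) q = 0 by case: q => r w; rewrite rectE; case: ifP.
  have mr0 : measurable_fun setT (rect t (fun _ _ => 0%R)).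
    by rewrite (_ : rect _ _ = fun=> 0)//; apply/funext.
  rewrite (dist2E measurable_rect mr0).
  apply: (@le_lt_trans _ _ (K ^+ 2 * t)%:E); last exact: ltry.
  rewrite -(integral_slab (sqr_ge0 K)); apply: ge0_le_integral => //.
  + by move=> q _; rewrite lee_fin sqr_ge0.
  + apply/measurable_EFinP; apply: measurable_funX; apply: measurable_funB => //.
    exact: measurable_rect.
  + apply/measurable_EFinP; apply: measurable_funM => //; apply: measurable_indic.
    exact: (measurableX (measurable_itv _) measurableT).
  + move=> q _; rewrite lee_fin r0 subr0 indicE.
    have [qD|qD] := pselect ((`[0, t[%classic `*` [set: Omega]) q).
      rewrite mem_set// mulr1 -(@real_normK _ (rect t h q)) ?num_real//.
      by rewrite lerXn2r ?nnegrE// rect_bounded.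
    by rewrite memNset// mulr0 /rect patchE memNset// expr0n.
- exists (fun n => n.+1), part, e; split.
  + exact: elementary_riemann.
  + exact: dist2_riemann_cvg0.
  (* Fatou in [k] with [EI n] fixed: the distance between [EI k] and [EI n] is that of the
     processes, which tends to [dist2 t h (EP n)]. *)
  + have le n : (\int[P]_w ((l w - EI n w) ^+ 2)%:E <= dist2 t h (EP n))%E.
      apply: (integral_cvg_le (f := fun k w => (EI k w - EI n w) ^+ 2)).
      - by move=> k; apply: measurable_funX; exact: measurable_funB.
      - by move=> k w; exact: sqr_ge0.
      - under eq_fun do rewrite (elementary_dist (elementary_riemann _) (elementary_riemann n)).
        apply: dist2_riemann_cvg; last exact: rect_riemann_bounded.
        exact: (elementary_process_rect (elementary_riemann n)).
      - by move=> w; apply: cvgM; apply: cvgB; [exact: EIl|exact: cvg_cst|exact: EIl|exact: cvg_cst].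
    apply: (@squeeze_cvge _ _ _ _ (fun=> 0%E) _ (fun n => dist2 t h (EP n))).
    * by near=> n; rewrite le andbT; apply: integral_ge0 => w _; rewrite lee_fin sqr_ge0.
    * exact: cvg_cst.
    * exact: dist2_riemann_cvg0.
Unshelve. all: end_near. Qed.

End riemann.

Lemma ito_integral_eq t H H' I : (forall r w, 0 <= r <= t -> H r w = H' r w) ->
  ito_integral P F b t H I -> ito_integral P F b t H' I.
Proof.
move=> HH [mH aH fH mI [k [s [e [He Hcv Icv]]]]].
have HHi r w : r \in `[0, t]%classic -> H r w = H' r w.
  by rewrite inE/= in_itv/= => rt; exact: HH.
split; [| | |exact: mI|].
- apply: eq_measurable_fun mH => -[r w]; rewrite inE/= => -[/= rt _].
  by apply: HHi; rewrite inE.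
- move=> r r0 rt; rewrite (_ : H' r = H r); first exact: aH.
  by apply/funext => w; rewrite HH// r0.
- have E : (\int[P]_w \int[leb]_(r in `[0%R, t]) (H r w ^+ 2)%:E =
      \int[P]_w \int[leb]_(r in `[0%R, t]) (H' r w ^+ 2)%:E)%E.
    by apply: eq_integral => w _; apply: eq_integral => r rt; rewrite HHi.
  by rewrite -E.
- exists k, s, e; split; [exact: He| |exact: Icv].
  have E n : (\int[P]_w \int[leb]_(r in `[0%R, t])
      ((H r w - elementary_process (k n) (s n) (e n) r w) ^+ 2)%:E =
    \int[P]_w \int[leb]_(r in `[0%R, t])
      ((H' r w - elementary_process (k n) (s n) (e n) r w) ^+ 2)%:E)%E.
    by apply: eq_integral => w _; apply: eq_integral => r rt; rewrite HHi.
  by rewrite -(eq_cvg _ _ E); exact: Hcv.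
Qed.

End ito.

(** * Deterministic Riemann sums and integral equations *)

Section riemann_sums.
Context {R : realType}.
Notation leb := (@lebesgue_measure R).

Lemma Rintegral_part t (u : R -> R) n k : 0 <= t -> continuous u -> (k <= n.+1)%N ->
  \int[leb]_(s in `[0, part t n k]) u s =
  \sum_(j < k) \int[leb]_(s in `[part t n j, part t n j.+1]) u s.
Proof.
move=> t0 cu; elim: k => [|k IH] kn.
  by rewrite big_ord0 /part mul0r set_itv1 Rintegral_set1.
have p0 j : 0 <= part t n j by exact: part_ge0.
have pS : part t n k <= part t n k.+1 by rewrite ler_wpM2r ?divr_ge0// ler_nat.
rewrite big_ord_recr/= -IH 1?ltnW//; apply: Rintegral_itv_cat => //.
exact: continuous_itv_integrable.
Qed.

(** The terms need only equal the mesh times [u] up to [e] times the mesh, uniformly in [k]; this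
    covers terms built from increments of a quantity of class C^1. *)
Lemma riemann_sum_cvg t (u : R -> R) (del : nat -> nat -> R) : 0 <= t -> continuous u ->
  (forall e, 0 < e -> \forall n \near \oo, forall k, (k <= n)%N ->
    `|del n k - t / n.+1%:R * u (part t n k)| <= e * (t / n.+1%:R)) ->
  (fun n => \sum_(k < n.+1) del n k) @ \oo --> \int[leb]_(s in `[0, t]) u s.
Proof.
move=> t0 cu delP; apply/cvgrPdist_le => e e0.
have e1 : 0 < e / 2 / (t + 1) by rewrite !divr_gt0// ltr_wpDl.
(* One-entry rows, as [continuous_uniform_itv] is about row vectors. *)
have cu1 : continuous (fun s => \row_(_ < 1) u s).
  move=> s; apply/cvg_rVP => i; rewrite mxE; under eq_fun do rewrite mxE.
  exact: cu.
have [r /= r0 rP] := continuous_uniform_itv t cu1 e1.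
have dcv : (fun n => t / n.+1%:R) @ \oo --> (0 : R).
  rewrite -[X in _ --> X](mulr0 t); apply: cvgM; [exact: cvg_cst|exact: cvg_harmonic].
move/cvgrPdist_lt : dcv => /(_ _ r0) dcv.
have := delP _ e1; move: dcv; apply: filterS2 => n; rewrite sub0r normrN => dn dP.
set D := t / n.+1%:R in dn dP *.
have D0 : 0 <= D by rewrite divr_ge0.
have tE : t = part t n n.+1 by rewrite /part mulrC divfK.
rewrite {1}tE Rintegral_part// -sumrB.
apply: le_trans (ler_norm_sum _ _ _) _.
have term (k : 'I_n.+1) : `|\int[leb]_(s in `[part t n k, part t n k.+1]) u s - del n k| <=
    2 * (e / 2 / (t + 1)) * D.
  have kn : (k <= n)%N by rewrite -ltnS.
  have pk : part t n k.+1 - part t n k = D by rewrite /part (mulrSr 1 k) mulrDl mul1r addrAC subrr add0r.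
  have pS : part t n k <= part t n k.+1 by rewrite -subr_ge0 pk.
  have pt : part t n k <= t.
    by rewrite [leRHS]tE ler_wpM2r ?divr_ge0// ler_nat ltnW.
  have p0 : 0 <= part t n k by exact: part_ge0.
  have := @Rintegral_itv_approx R u _ _ (u (part t n k)) (e / 2 / (t + 1)) pS (continuous_itv_integrable _ _ cu).
  case/(_ _)/wrap => [s /andP[s1 s2]|].
    have sk : `|s - part t n k| <= D by rewrite ger0_norm ?subr_ge0// -pk lerD2r ltW.
    have [D00|Dn0] := eqVneq D 0.
      have -> : s = part t n k.
        by apply/eqP; rewrite -subr_eq0 -normr_le0 -D00.
      by rewrite subrr normr0 ltW.
    have Dp : 0 < D by rewrite lt_neqAle eq_sym Dn0.
    have := rP D; rewrite /ball_/= sub0r normrN => /(_ dn Dp (part t n k) s).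
    rewrite p0 pt => /(_ isT sk) /(norm_rV_leP _ (ltW e1)) /(_ ord0).
    by rewrite !mxE.
  rewrite pk => i1; have i2 := dP k kn.
  rewrite -(subrK (D * u (part t n k)) (\int[leb]_(s in _) u s)) -addrA.
  apply: le_trans (ler_normD _ _) _; rewrite [`|_ - del n k|]distrC.
  by move: i1 i2; rewrite -[leRHS]mulrA; lra.
apply: le_trans (ler_sum _ (fun k _ => term k)) _.
have DE : D * n.+1%:R = t by rewrite /D divfK.
have -> : \sum_(k < n.+1) 2 * (e / 2 / (t + 1)) * D = 2 * (e / 2 / (t + 1)) * t.
  by rewrite sumr_const card_ord -[LHS]mulr_natr -mulrA; congr (_ * _).
have -> : 2 * (e / 2 / (t + 1)) * t = e * (t / (t + 1)).
  by field; rewrite gt_eqF// ltr_wpDl.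
by rewrite ger_pMr// ler_pdivrMr ?mul1r ?lerDl// ltr_wpDl.
Qed.

Lemma Rintegral_itv_cvg (u : R -> R) t (s : nat -> R) : continuous u ->
  (forall n, 0 <= s n <= t) -> s @ \oo --> t ->
  (fun n => \int[leb]_(r in `[0, s n]) u r) @ \oo --> \int[leb]_(r in `[0, t]) u r.
Proof.
move=> cu sT st.
have cu1 : continuous (fun r => \row_(_ < 1) u r).
  move=> r; apply/cvg_rVP => i; rewrite mxE; under eq_fun do rewrite mxE.
  exact: cu.
have [M uM] := continuous_bounded_itv t cu1.
have M0 : 0 <= Num.max 0 M by rewrite le_max lexx.
apply/cvgrPdist_le => e e0.
have e1 : 0 < e / (Num.max 0 M + 1) by rewrite divr_gt0// ltr_wpDl.
move/cvgrPdist_le : st => /(_ _ e1); apply: filterS => n.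
have /andP[s0 s1] := sT n; rewrite ger0_norm ?subr_ge0// => tsn.
rewrite (Rintegral_itv_cat s0 s1); last exact: continuous_itv_integrable.
rewrite addrAC subrr add0r.
apply: le_trans (le_norm_Rintegral_itv (e := Num.max 0 M) s1 (continuous_itv_integrable _ _ cu) _) _.
  move=> r /andP[r0 r1]; rewrite le_max; apply/orP; right.
  have rT : 0 <= r <= t by rewrite (le_trans s0 r0) ltW.
  by have := norm_coord_le (\row_(_ < 1) u r) ord0; rewrite mxE => /le_trans; apply; exact: uM.
apply: (@le_trans _ _ (Num.max 0 M * (e / (Num.max 0 M + 1)))); first by rewrite ler_wpM2l.
rewrite mulrCA ger_pMr// ler_pdivrMr ?mul1r ?lerDl// ltr_wpDl//.
Qed.

(** An identity that is almost sure at each time holds almost surely at countably many times at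
    once, here the [k / (n + 1)]; continuity of both sides reaches all the others. *)
Lemma integral_equation_dense (u v : R -> R) (u0 : R) : continuous u -> continuous v ->
  (forall k n : nat, u (k%:R / n.+1%:R) = u0 + \int[leb]_(r in `[0, k%:R / n.+1%:R]) v r) ->
  forall t, 0 <= t -> u t = u0 + \int[leb]_(r in `[0, t]) v r.
Proof.
move=> cu cv uv t t0.
pose s n : R := (Num.truncn (t * n.+1%:R))%:R / n.+1%:R.
have sT n : 0 <= s n <= t.
  rewrite divr_ge0//= ler_pdivrMr//.
  by have /andP[] := truncn_itv (mulr_ge0 t0 (ler0n R n.+1)).
have st : s @ \oo --> t.
  apply/cvgrPdist_le => e e0; have := @cvg_harmonic R.
  move/cvgrPdist_le => /(_ _ e0); apply: filterS => n; rewrite sub0r normrN; apply: le_trans.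
  have /andP[s0 s1] := sT n; rewrite ger0_norm ?subr_ge0// [`|harmonic n|]ger0_norm ?harmonic_ge0//.
  have /andP[_] := truncn_itv (mulr_ge0 t0 (ler0n R n.+1)).
  rewrite -ltr_pdivlMr// /s; set K := Num.truncn _; rewrite (mulrSr 1 K) mulrDl mul1r /harmonic/=.
  by move=> H; rewrite lerBlDl; exact: ltW.
have c1 : (fun n => u (s n)) @ \oo --> u t by apply: continuous_cvg => //; exact: cu.
have c2 : (fun n => u (s n)) @ \oo --> u0 + \int[leb]_(r in `[0, t]) v r.
  rewrite (_ : (fun n => u (s n)) = (fun n => u0 + \int[leb]_(r in `[0, s n]) v r)).
    by apply: cvgD; [exact: cvg_cst|exact: Rintegral_itv_cvg].
  by apply/funext => n; exact: uv.
exact: (cvg_unique _ c1 c2).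
Qed.

End riemann_sums.

(** * The equation path by path *)

Section langevin_integral_equation.
Context {R : realType}.
Notation leb := (@lebesgue_measure R).
Variables (d : nat) (gamma : R) (g sigma : 'rV[R]_d -> R) (c sg : 'rV[R]_d -> 'rV[R]_d) (B : R).
Hypothesis HB : langevin_bounds gamma g sigma c sg B.
Variables (w : R -> 'rV[R]_d) (Z : R -> 'rV[R]_(d + d)) (z : 'rV[R]_(d + d)).
Hypotheses (cw : continuous w) (w0 : w 0 = 0) (cZ : continuous Z).

Let x s := lsubmx (Z s).
Let p s := rsubmx (Z s).
Let v s := g (x s) *: p s.
Let a s := dotrV (sg (x s)) (v s).
Let b s := c (x s) - (gamma * g (x s)) *: p s.

Let B1 := lb_B1 HB.
Let B0 : 0 < B. Proof. exact: lt_le_trans B1. Qed.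

Let cx : continuous x. Proof. by move=> s; apply: lsubmx_cvg; exact: cZ. Qed.
Let cp : continuous p. Proof. by move=> s; apply: rsubmx_cvg; exact: cZ. Qed.

Let lip_cvg (f : 'rV[R]_d -> R) : (forall x y, `|f x - f y| <= B * `|x - y|) ->
  continuous (fun s => f (x s)).
Proof.
move=> lip s; apply/cvgrPdist_le => e e0.
have eB : 0 < e / B by rewrite divr_gt0.
have /cvgrPdist_le /(_ _ eB) := @cx s; apply: filterS => s' xs.
apply: le_trans (lip _ _) _.
by rewrite -ler_pdivlMl// mulrC.
Qed.

Let cg : continuous (fun s => g (x s)). Proof. exact: lip_cvg (lb_g_lip HB). Qed.

Lemma velocity_continuous : continuous (fun s => g (lsubmx (Z s)) *: rsubmx (Z s)).
Proof. by move=> s; apply: cvgZ; [exact: cg|exact: cp]. Qed.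

Let cv : continuous v := velocity_continuous.

(** [sg] is controlled through its pairings, so the difference is split by bilinearity into a
    variation of [sg] and a variation of the velocity. *)
Lemma acceleration_continuous :
  continuous (fun s => dotrV (sg (lsubmx (Z s))) (g (lsubmx (Z s)) *: rsubmx (Z s))).
Proof.
move=> s; apply/cvgrPdist_le => e e0.
have M0 : 0 < B * (1 + `|v s| + 1) by rewrite mulr_gt0// addr_gt0// ltr_pwDl.
have e1 : 0 < Num.min 1 (e / (B * (1 + `|v s| + 1))) by rewrite lt_min ltr01 divr_gt0.
have /cvgrPdist_le /(_ _ e1) xs := @cx s.
have /cvgrPdist_le /(_ _ e1) vs := @cv s.
near=> s'.
have : `|x s - x s'| <= Num.min 1 (e / (B * (1 + `|v s| + 1))) by near: s'.
rewrite le_min => /andP[x1 x2].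
have : `|v s - v s'| <= Num.min 1 (e / (B * (1 + `|v s| + 1))) by near: s'.
rewrite le_min => /andP[v1 v2].
have -> : a s - a s' = dotrV (sg (x s) - sg (x s')) (v s) + dotrV (sg (x s')) (v s - v s').
  by rewrite /a dotrVBl dotrVBr addrA subrK.
apply: le_trans (ler_normD _ _) _.
have h1 := lb_sg_lip HB (x s) (x s') (v s).
have h2 := lb_sg HB (x s') (v s - v s').
set q := e / _ in x2 v2.
have q1 : B * `|x s - x s'| * `|v s| <= B * q * `|v s| by rewrite ler_wpM2r// ler_pM2l.
have q2 : B * `|v s - v s'| <= B * q by rewrite ler_pM2l.
have : q * (B * (1 + `|v s| + 1)) = e by rewrite /q divfK ?gt_eqF.
have q0 : 0 <= B * q by rewrite mulr_ge0 ?(ltW B0)// divr_ge0// ltW.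
lra.
Unshelve. all: end_near. Qed.

Let ca : continuous a := acceleration_continuous.

Lemma force_continuous :
  continuous (fun s => c (lsubmx (Z s)) - (gamma * g (lsubmx (Z s))) *: rsubmx (Z s)).
Proof.
move=> s; apply: cvgB; last first.
  apply: cvgZ; last exact: cp.
  by apply: cvgM; [exact: cvg_cst|exact: cg].
apply/cvg_rVP => i; apply: (@lip_cvg (fun y => c y ord0 i)) => y y'.
apply: le_trans (lb_c_lip HB y y').
by have := norm_coord_le (c y - c y') i; rewrite !mxE.
Qed.

Let cb : continuous b := force_continuous.

Let coordc (f : R -> 'rV[R]_d) i : continuous f -> continuous (fun s => f s ord0 i).
Proof. by move=> cf s; have /cvg_rVP := @cf s; exact. Qed.

Definition position_eq := forall (t : R) j, 0 <= t ->
  lsubmx (Z t) ord0 j = lsubmx z ord0 j +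
    \int[leb]_(s in `[0, t]) (g (lsubmx (Z s)) *: rsubmx (Z s)) ord0 j.

Definition momentum_eq := forall (t : R) j, 0 <= t ->
  rsubmx (Z t) ord0 j = rsubmx z ord0 j +
    \int[leb]_(s in `[0, t])
      (c (lsubmx (Z s)) - (gamma * g (lsubmx (Z s))) *: rsubmx (Z s)) ord0 j +
    (sigma (lsubmx (Z t)) * w t ord0 j - \int[leb]_(s in `[0, t])
      (w s ord0 j * dotrV (sg (lsubmx (Z s))) (g (lsubmx (Z s)) *: rsubmx (Z s)))).

Let fieldE s : lang_field gamma g sigma c sg w s (to_ode sigma (w s) (Z s)) =
  row_mx (v s) (b s - a s *: w s).
Proof. by rewrite /lang_field /to_ode !row_mxKl !row_mxKr subrK. Qed.

Let cwa j : continuous (fun s => w s ord0 j * a s).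
Proof. by move=> s; apply: cvgM; [exact: coordc|exact: ca]. Qed.

Let field_int j (t : R) : \int[leb]_(s in `[0, t]) (b s - a s *: w s) ord0 j =
  \int[leb]_(s in `[0, t]) b s ord0 j - \int[leb]_(s in `[0, t]) (w s ord0 j * a s).
Proof.
rewrite -RintegralB//; last 2 first.
- by apply: continuous_itv_integrable; exact: (@coordc b j cb).
- exact: continuous_itv_integrable.
by apply: eq_Rintegral => s _; rewrite !mxE [a s * _]mulrC.
Qed.

(** [path_sol] lives in the variables [(x, p - sigma x w)]. Undoing the change of variables, with
    [w 0 = 0] at the start, leaves in the momentum equation the pathwise value of the stochastic
    integral. *)
Lemma path_solP : path_sol gamma g sigma c sg w z Z <-> position_eq /\ momentum_eq.
Proof.
have y0E : to_ode sigma (w 0) z = z by rewrite /to_ode w0 scaler0 subr0 hsubmxK.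
have momE t j : (p t - sigma (x t) *: w t) ord0 j = p t ord0 j - sigma (x t) * w t ord0 j.
  by rewrite [LHS]mxE [X in _ + X]mxE [X in - X]mxE.
have zE j : z ord0 (rshift d j) = rsubmx z ord0 j by rewrite mxE.
rewrite /path_sol y0E; split=> [sol|[xE pE] T T0].
  have eqs (t : R) j : 0 <= t -> to_ode sigma (w t) (Z t) ord0 j = z ord0 j +
      \int[leb]_(s in `[0, t]) row_mx (v s) (b s - a s *: w s) ord0 j.
    move=> t0; have [r [_ _ H]] := sol t t0.
    have := H t j; rewrite lexx t0 => /(_ isT); rewrite normr_le0 => /eqP E.
    under eq_Rintegral do rewrite -fieldE.
    by apply/eqP; rewrite -subr_eq0 opprD addrA E.
  split=> t j t0.
    have := eqs t (lshift d j) t0; rewrite row_mxEl -/(x t) => ->.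
    rewrite [in RHS]mxE; congr (_ + _); apply: eq_Rintegral => s _.
    by rewrite row_mxEl.
  have := eqs t (rshift d j) t0; rewrite row_mxEr -/(x t) -/(p t) momE.
  under eq_Rintegral do rewrite row_mxEr.
  by rewrite field_int zE; lra.
have cy : continuous (fun t => to_ode sigma (w t) (Z t)).
  move=> t; apply: row_mx_cvg; first exact: cx.
  apply: cvgB; first exact: cp.
  by apply: cvgZ; [exact: (lip_cvg (lb_sigma_lip HB))|exact: cw].
have [r rP] := continuous_bounded_itv T cy.
exists r; split=> //.
- move=> j; rewrite (_ : (fun s => _) =
     EFin \o (fun s => row_mx (v s) (b s - a s *: w s) ord0 j)); last first.
    by apply/funext => s /=; rewrite fieldE.
  apply: continuous_itv_integrable; case: (split_ordP j) => k ->.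
    rewrite (_ : (fun s => _) = fun s => v s ord0 k); first exact: (@coordc v k cv).
    by apply/funext => s; rewrite row_mxEl.
  rewrite (_ : (fun s => _) = fun s => (b s - a s *: w s) ord0 k).
    apply: (@coordc (fun s => b s - a s *: w s)) => s; apply: cvgB; first exact: cb.
    by apply: cvgZ; [exact: ca|exact: cw].
  by apply/funext => s; rewrite row_mxEr.
- move=> t j /andP[t0 tT]; under eq_Rintegral do rewrite fieldE.
  rewrite normr_le0 subr_eq0 subr_eq addrC; apply/eqP.
  case: (split_ordP j) => k ->.
    rewrite row_mxEl -/(x t) xE// [in LHS]mxE; congr (_ + _); apply: eq_Rintegral => s _.
    by rewrite row_mxEl.
  rewrite row_mxEr; under eq_Rintegral do rewrite row_mxEr.
  by rewrite field_int -/(x t) -/(p t) momE pE// zE; ring.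
Qed.

(** Summation by parts, with [w 0 = 0], moves the differences from [w] to [sigma] along the path; by
    [position_eq] the position is of class C^1, so the Taylor bound on [sigma] gives these
    differences to first order. *)
Lemma langevin_riemann_cvg t i : 0 <= t -> position_eq ->
  (fun n => \sum_(k < n.+1) sigma (lsubmx (Z (part t n k))) *
     (w (part t n k.+1) ord0 i - w (part t n k) ord0 i)) @ \oo -->
  sigma (lsubmx (Z t)) * w t ord0 i - \int[leb]_(s in `[0, t])
    (w s ord0 i * dotrV (sg (lsubmx (Z s))) (g (lsubmx (Z s)) *: rsubmx (Z s))).
Proof.
rewrite -[sigma (lsubmx (Z t))]/(sigma (x t)).
move=> t0 xE.
pose del n k := w (part t n k.+1) ord0 i * (sigma (x (part t n k.+1)) - sigma (x (part t n k))).
have -> : (fun n => \sum_(k < n.+1) sigma (x (part t n k)) *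
     (w (part t n k.+1) ord0 i - w (part t n k) ord0 i)) =
   (fun n => sigma (x t) * w t ord0 i - \sum_(k < n.+1) del n k).
  apply/funext => n; have tE : t = part t n n.+1 by rewrite /part mulrC divfK.
  suff H k : \sum_(j < k) sigma (x (part t n j)) * (w (part t n j.+1) ord0 i - w (part t n j) ord0 i) =
      sigma (x (part t n k)) * w (part t n k) ord0 i - \sum_(j < k) del n j by rewrite H -tE.
  elim: k => [|k IH]; last by rewrite !big_ord_recr/= IH /del; ring.
  by rewrite !big_ord0 /part mul0r w0 mxE mulr0 subr0.
apply: cvgB; first exact: cvg_cst.
apply: riemann_sum_cvg => // e e0.
have [M1 wM] := continuous_bounded_itv t cw.
have [M2 vM] := continuous_bounded_itv t cv.
pose M := Num.max 1 (Num.max M1 M2).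
have M_1 : 1 <= M by rewrite le_max lexx.
have M0 : 0 < M by exact: lt_le_trans M_1.
(* Per unit of mesh and of [e1], the summands bound the error of the position, the Taylor remainder
   of [sigma] and the variation of [w] over a step. *)
pose C := M * B + M * B * (M + 1) ^+ 2 + B * M.
have MB : 0 < M * B by exact: mulr_gt0.
have M10 : 0 < (M + 1) ^+ 2 by rewrite exprn_gt0// addr_gt0.
have C0 : 0 < C.
  apply: addr_gt0; last by rewrite mulr_gt0.
  exact: (addr_gt0 MB (mulr_gt0 MB M10)).
pose e1 := Num.min 1 (e / C).
have e10 : 0 < e1 by rewrite lt_min ltr01 divr_gt0.
have [r1 /= r10 r1P] := continuous_uniform_itv t cw e10.
have [r2 /= r20 r2P] := continuous_uniform_itv t cv e10.
have dcv : (fun n => t / n.+1%:R) @ \oo --> (0 : R).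
  rewrite -[X in _ --> X](mulr0 t); apply: cvgM; [exact: cvg_cst|exact: cvg_harmonic].
have r0 : 0 < Num.min e1 (Num.min r1 r2) by rewrite lt_min e10 lt_min r10.
move/cvgrPdist_lt : dcv => /(_ _ r0); apply: filterS => n; rewrite sub0r normrN.
set h := t / n.+1%:R; have h0 : 0 <= h by rewrite divr_ge0.
rewrite (ger0_norm h0) lt_min [X in _ && X]lt_min => /and3P[he hr1 hr2] k kn.
(* The mesh vanishes when [t = 0], and the uniform continuity bounds need a positive one. *)
have [h00|hn0] := eqVneq h 0.
  have pE j : part t n j = 0 by rewrite /part -/h h00 mulr0.
  by rewrite /del !pE subrr mulr0 h00 mul0r subr0 normr0 mulr0.
have hp : 0 < h by rewrite lt_neqAle eq_sym hn0.
have pS : part t n k.+1 = part t n k + h by rewrite /part (mulrSr 1 k) mulrDl mul1r.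
have tE : t = part t n n.+1 by rewrite /part mulrC divfK.
have pk0 : 0 <= part t n k by exact: part_ge0.
have pk1 : part t n k.+1 <= t by rewrite [leRHS]tE ler_wpM2r// ler_nat.
rewrite /del pS in pk1 *; set s := part t n k in pk0 pk1 *; set s' := s + h in pk1 *.
have ss' : s <= s' by rewrite lerDl.
have sT : 0 <= s <= t by rewrite pk0 (le_trans ss').
have s'T : 0 <= s' <= t by rewrite (le_trans pk0 ss').
have bw u : 0 <= u <= t -> `|w u| <= M by move=> uT; rewrite !le_max wM// orbT.
have bv u : 0 <= u <= t -> `|v u| <= M by move=> uT; rewrite !le_max vM// !orbT.
have near (f : R -> 'rV[R]_d) r (fP : ball_ Num.norm 0 r `<=` (fun del => 0 < del ->
     forall s t0, 0 <= s <= t -> `|t0 - s| <= del -> `|f t0 - f s| <= e1)) : h < r ->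
     forall u, s <= u <= s' -> `|f u - f s| <= e1.
  move=> hr u /andP[u1 u2]; apply: (fP h) => //.
    by rewrite /ball_/= sub0r normrN ger0_norm.
  by rewrite ger0_norm ?subr_ge0// lerBlDl.
have dw : `|w s' - w s| <= e1 by apply: (near w r1 r1P hr1); rewrite ss' lexx.
have dv u : s <= u <= s' -> `|v u - v s| <= e1 by exact: (near v r2 r2P hr2).
have dx : `|x s' - x s - h *: v s| <= e1 * h.
  apply/norm_rV_leP => [|j]; first by rewrite mulr_ge0// ltW.
  have s'0 : 0 <= s' by case/andP: s'T.
  have cvj : continuous (fun u => v u ord0 j) by exact: coordc.
  have := @Rintegral_itv_approx R (fun u => v u ord0 j) s s' (v s ord0 j) e1 ss'
    (continuous_itv_integrable _ _ cvj).
  case/(_ _)/wrap => [u /andP[u1 u2]|].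
    have /dv : s <= u <= s' by rewrite u1 ltW.
    by move/(le_trans _); apply; have := norm_coord_le (v u - v s) j; rewrite !mxE.
  rewrite (_ : s' - s = h); last by rewrite /s' addrAC subrr add0r.
  congr (`|_| <= _); rewrite 2![in RHS]mxE [(- x s) _ _]mxE [(- (h *: v s)) _ _]mxE [(h *: v s) _ _]mxE.
  rewrite !xE// (Rintegral_itv_cat pk0 ss'); last exact: continuous_itv_integrable.
  ring.
have xx : `|x s' - x s| <= (M + 1) * h.
  rewrite -(subrK (h *: v s) (x s' - x s)); apply: le_trans (ler_normD _ _) _.
  rewrite normrZ (ger0_norm h0).
  have : h * `|v s| <= h * M by rewrite ler_wpM2l// bv.
  have : e1 * h <= h by rewrite ler_piMl// ge_min lexx.
  by move: dx; lra.
have ds : `|sigma (x s') - sigma (x s) - h * a s| <= h * (B * e1 + B * (M + 1) ^+ 2 * h).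
  have := lb_sg_taylor HB (x s) (x s').
  have -> : sigma (x s') - sigma (x s) - h * a s =
    (sigma (x s') - sigma (x s) - dotrV (sg (x s)) (x s' - x s)) +
    dotrV (sg (x s)) (x s' - x s - h *: v s).
    by rewrite [dotrV _ (_ - h *: _)]dotrVBr dotrVZr /a; ring.
  move=> tay; apply: le_trans (ler_normD _ _) _.
  have l1 := le_trans (lb_sg HB (x s) (x s' - x s - h *: v s)) (ler_wpM2l (ltW B0) dx).
  have l2 : `|x s' - x s| ^+ 2 <= ((M + 1) * h) ^+ 2.
    by rewrite lerXn2r ?nnegrE ?mulr_ge0 ?addr_ge0// ltW.
  have := ler_wpM2l (ltW B0) l2.
  by rewrite [X in B * X <= _]/GRing.exp/= in tay *; move: tay l1; lra.
have as_ : `|a s| <= B * M.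
  by apply: le_trans (lb_sg HB _ _) _; rewrite ler_pM2l// bv.
have -> : w s' ord0 i * (sigma (x s') - sigma (x s)) - h * (w s ord0 i * a s) =
  w s' ord0 i * (sigma (x s') - sigma (x s) - h * a s) + h * ((w s' - w s) ord0 i * a s).
  by rewrite !mxE; ring.
apply: le_trans (ler_normD _ _) _; rewrite (normrM (w s' _ _)) (normrM h) (normrM ((w s' - w s) _ _)).
rewrite (ger0_norm h0).
have l1 : `|w s' ord0 i| * `|sigma (x s') - sigma (x s) - h * a s| <=
    M * (h * (B * e1 + B * (M + 1) ^+ 2 * h)).
  by rewrite ler_pM//; apply: le_trans (norm_coord_le _ _) _; exact: bw.
have l2 : h * (`|(w s' - w s) ord0 i| * `|a s|) <= h * (e1 * (B * M)).
  by rewrite ler_wpM2l// ler_pM//; apply: le_trans (norm_coord_le _ _) _.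
apply: le_trans (lerD l1 l2) _.
have l3 : M * B * (M + 1) ^+ 2 * h <= M * B * (M + 1) ^+ 2 * e1.
  by rewrite ler_wpM2l ?(ltW he)// !mulr_ge0 ?exprn_ge0 ?addr_ge0// ltW.
have -> : M * (h * (B * e1 + B * (M + 1) ^+ 2 * h)) + h * (e1 * (B * M)) =
  (M * B * e1 + M * B * (M + 1) ^+ 2 * h + e1 * (B * M)) * h by ring.
rewrite ler_wpM2r//; apply: (@le_trans _ _ (C * e1)).
  rewrite /C !mulrDl; lra.
by rewrite mulrC -ler_pdivlMr// ge_min lexx orbT.
Qed.

End langevin_integral_equation.

Lemma ae_forall_countable d (T : measurableType d) (R : realType)
    (mu : {measure set T -> \bar R}) (I : countType) (Q : I -> T -> Prop) :
  (forall i, {ae mu, forall x, Q i x}) -> {ae mu, forall x, forall i, Q i x}.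
Proof.
move=> H; have := @ae_foralln _ _ _ mu (fun n x => if unpickle n is Some i then Q i x else True).
case/(_ _)/wrap => [n|]; first by case: (unpickle n) => [i|]; [exact: H|exact: nearW].
by apply: filterS => x Hx i; have := Hx (pickle i); rewrite pickleK.
Qed.

(** * Pathwise solutions and solutions of the stochastic equation *)

Section langevin_sde.
Context {R : realType} {dO} {Omega : measurableType dO}.
Notation leb := (@lebesgue_measure R).
Variables (P : probability Omega R) (F : R -> set (set Omega)).
Hypothesis hF : complete_filtration P F.
Variables (d : nat) (gamma : R) (g sigma : 'rV[R]_d -> R) (c sg : 'rV[R]_d -> 'rV[R]_d) (B : R).
Hypothesis HB : langevin_bounds gamma g sigma c sg B.
Variables (W X : R -> Omega -> 'rV[R]_d) (N : set Omega).
Hypotheses (gX : gaussian_motion P F X) (mN : measurable N) (PN : P N = 0%E)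
  (XW : forall w t, ~ N w -> 0 <= t -> X t w = W t w).

(** The Langevin coefficients with an abstract force [c], and an abstract [sigma] in [diffusion];
    for the concrete ones, these are convertible to [langevin_drift] and [langevin_diffusion]. *)
Definition drift (z : 'rV[R]_(d + d)) : 'rV[R]_(d + d) :=
  row_mx (g (lsubmx z) *: rsubmx z)
    (c (lsubmx z) - (gamma * g (lsubmx z)) *: rsubmx z).

Definition diffusion (z : 'rV[R]_(d + d)) : 'M[R]_(d, d + d) :=
  row_mx 0 (sigma (lsubmx z))%:M.

Notation sol w := (path_sol gamma g sigma c sg (X ^~ w)).

Lemma ae_notin_null : {ae P, forall w, ~ N w}.
Proof. by exists N; split => // w /= /contrapT. Qed.

(** Transfers stochastic integrals between the Brownian motion and its regular version: elementary
    integrals against integrators that agree off [N] are almost surely equal. *)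
Lemma ito_integral_version (X1 X2 : R -> Omega -> 'rV[R]_d) i t H I :
  (forall w r, ~ N w -> 0 <= r -> X1 r w = X2 r w) ->
  (forall r, 0 <= r -> measurable_fun setT (X1 r)) ->
  (forall r, 0 <= r -> measurable_fun setT (X2 r)) ->
  ito_integral P F (fun s w => X1 s w ord0 i) t H I ->
  ito_integral P F (fun s w => X2 s w ord0 i) t H I.
Proof.
move=> X12 mX1 mX2 [mH aH fH mI [k [s [e [He Hcv Icv]]]]].
split; [exact: mH|exact: aH|exact: fH|exact: mI|].
exists k, s, e; split; [exact: He|exact: Hcv|].
have mEI (Y : R -> Omega -> 'rV[R]_d) n : (forall r, 0 <= r -> measurable_fun setT (Y r)) ->
    measurable_fun setT (elementary_integral (fun s w => Y s w ord0 i) (k n) (s n) (e n)).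
  move=> mY; apply: measurable_sum => j; have [_ _ _ ae _] := He n.
  have /andP[sj _] := elementary_times (He n) (ltnW (ltn_ord j)).
  have /andP[sj' _] := elementary_times (He n) (ltn_ord j).
  apply: measurable_funM; first exact: (measurable_wrt_fun hF sj (ae j (ltn_ord j))).
  by apply: measurable_funB; apply: (measurableT_comp (measurable_coord i)); exact: mY.
have E n : (\int[P]_w ((I w - elementary_integral (fun s w => X1 s w ord0 i) (k n) (s n) (e n) w) ^+ 2)%:E =
  \int[P]_w ((I w - elementary_integral (fun s w => X2 s w ord0 i) (k n) (s n) (e n) w) ^+ 2)%:E)%E.
  apply: ae_eq_integral => //.
  - by apply/measurable_EFinP; apply: measurable_funX; apply: measurable_funB => //; exact: mEI.
  - by apply/measurable_EFinP; apply: measurable_funX; apply: measurable_funB => //; exact: mEI.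
  - apply: filterS ae_notin_null => w Nw _; congr ((_ - _) ^+ 2)%:E.
    apply: eq_bigr => j _.
    have /andP[sj _] := elementary_times (He n) (ltnW (ltn_ord j)).
    have /andP[sj' _] := elementary_times (He n) (ltn_ord j).
    by rewrite !X12.
by rewrite -(eq_cvg _ _ E); exact: Icv.
Qed.

Let mX r : 0 <= r -> measurable_fun setT (X r).
Proof. by move=> r0; exact: (measurable_wrt_fun hF r0 (gm_adapted gX r0)). Qed.

Let cX w : continuous (X ^~ w). Proof. exact: (gm_cont gX). Qed.

Hypothesis aW : adapted F W.

Let mW' r : 0 <= r -> measurable_fun setT (W r).
Proof. by move=> r0; exact: (measurable_wrt_fun hF r0 (aW r0)). Qed.

Lemma ito_integral_zero i t I : 0 <= t ->
  ito_integral P F (fun s w => W s w ord0 i) t (fun _ _ => 0) I -> {ae P, forall w, I w = 0}.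
Proof.
move=> t0 /(@ito_integral_version W X); move=> /(_ _ mW' mX).
case/(_ _)/wrap => [w r Nw r0|]; first by rewrite XW.
move=> hI; apply: (ito_integral_lim hF gX (K := 0) t0 _ _ _ hI) => //.
- by move=> r w; rewrite normr0.
- by move=> r r0; apply/(measurable_wrtP hF _ r0); exact: measurable_cst.
- by move=> w r; exact: cvg_cst.
- apply: nearW => w; rewrite (_ : (fun n => _) = fun=> 0); first exact: cvg_cst.
  by apply/funext => n; rewrite /elementary_integral big1// => j _; rewrite mul0r.
Qed.

Let measurable_sigma : measurable_fun setT (fun z : 'rV[R]_(d + d) => sigma (lsubmx z)).
Proof.
apply: (measurableT_comp _ (@measurable_lsubmx R d d)); apply: continuous_measurable_rV.
by move=> x; have := @sigma_cvg _ _ _ _ _ _ _ _ HB _ (nbhs x) _ id x (@cvg_id _ _); exact.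
Qed.

Let diffusion_l z i j : diffusion z i (lshift d j) = 0.
Proof. by rewrite /diffusion row_mxEl mxE. Qed.

Let diffusion_r z i j : diffusion z i (rshift d j) = if i == j then sigma (lsubmx z) else 0.
Proof. by rewrite /diffusion row_mxEr mxE; case: eqP. Qed.

Section uniqueness.
Variables (z : 'rV[R]_(d + d)) (Z : R -> Omega -> 'rV[R]_(d + d)).
Hypothesis hZ : sde_solution P F W drift diffusion z Z.

(** Freezing the path before time 0 makes it continuous on the whole line, as the lemmas on paths
    require. *)
Let Zm w t := Z (Num.max 0 t) w.

Let cZm w : continuous (Zm w).
Proof. by case: hZ => _ cZ _ _; apply: (@continuous_max0 R _ (Z ^~ w)); exact: cZ. Qed.

Let ZmE w t : 0 <= t -> Zm w t = Z t w.
Proof. by move=> t0; rewrite /Zm; congr Z; apply/max_idPr. Qed.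

Let int_Zm w t (f : 'rV[R]_(d + d) -> R) :
  \int[leb]_(s in `[0, t]) f (Z s w) = \int[leb]_(s in `[0, t]) f (Zm w s).
Proof.
by apply: eq_Rintegral => s; rewrite inE/= in_itv/= => /andP[s0 _]; rewrite ZmE.
Qed.

(** The first [d] columns of [diffusion] vanish, and an Ito integral of 0 is almost surely 0, so the
    position satisfies an ordinary integral equation at the times [k / (n + 1)], hence at all
    times. *)
Lemma sde_position : {ae P, forall w, position_eq g (Zm w) z}.
Proof.
have H (k n : nat) (j : 'I_d) : {ae P, forall w, lsubmx (Zm w (k%:R / n.+1%:R)) ord0 j =
    lsubmx z ord0 j + \int[leb]_(s in `[0, k%:R / n.+1%:R])
      (g (lsubmx (Zm w s)) *: rsubmx (Zm w s)) ord0 j}.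
  pose t : R := k%:R / n.+1%:R; have t0 : 0 <= t by rewrite divr_ge0.
  have [_ _ _ /(_ t (lshift d j) t0)[I [itoI EI]]] := hZ.
  have I0 i : {ae P, forall w, I i w = 0}.
    apply: (ito_integral_zero (i := i) t0); apply: ito_integral_eq (itoI i) => r w _.
    by rewrite diffusion_l.
  have I0' : {ae P, forall w, forall i, I i w = 0} by apply: ae_forall_countable.
  move: EI; apply: filterS2 I0' => w Iw.
  rewrite [X in _ + X]big1; last by move=> i _; exact: Iw.
  rewrite addr0 -(ZmE w t0) => E.
  rewrite mxE E mxE; congr (_ + _).
  by rewrite (int_Zm w t (fun y => drift y ord0 (lshift d j))); apply: eq_Rintegral => s _; rewrite row_mxEl.
have H' : {ae P, forall w, forall k n (j : 'I_d), lsubmx (Zm w (k%:R / n.+1%:R)) ord0 j =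
    lsubmx z ord0 j + \int[leb]_(s in `[0, k%:R / n.+1%:R])
      (g (lsubmx (Zm w s)) *: rsubmx (Zm w s)) ord0 j}.
  by do 3! apply: ae_forall_countable => ?; exact: H.
apply: filterS H' => w Hw t j t0.
have := integral_equation_dense (u := fun t => lsubmx (Zm w t) ord0 j)
  (v := fun s => (g (lsubmx (Zm w s)) *: rsubmx (Zm w s)) ord0 j) (u0 := lsubmx z ord0 j).
case/(_ _ _ _ _ t0)/wrap => //.
- move=> s; have /cvg_rVP Hs : lsubmx (Zm w s') @[s' --> s] --> lsubmx (Zm w s) by apply: lsubmx_cvg; exact: cZm.
  exact: Hs.
- by move=> s; have cv := velocity_continuous HB (@cZm w); have /cvg_rVP := @cv s; exact.
Qed.

(** The position equation comes first: thanks to it, [langevin_riemann_cvg] computes the limit of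
    the Riemann sums path by path, and [ito_integral_lim] recognises the stochastic integral in that
    limit. *)
Lemma sde_path_sol : {ae P, forall w, sol w z (Zm w)}.
Proof.
pose h r w := sigma (lsubmx (Zm w r)).
have aZ : adapted F Z by case: hZ.
have ch w : continuous (h ^~ w).
  by move=> r; apply: (sigma_cvg HB); apply: lsubmx_cvg; exact: cZm.
have hB r w : `|h r w| <= B by exact: (lb_sigma HB).
have ah r : 0 <= r -> measurable_wrt (F r) (h r).
  move=> r0; rewrite (_ : h r = fun w => sigma (lsubmx (Z r w))); last first.
    by apply/funext => w; rewrite /h ZmE.
  apply/(measurable_wrtP hF _ r0); apply: (measurableT_comp measurable_sigma).
  exact/(measurable_wrtP hF _ r0)/aZ.
pose a w s := dotrV (sg (lsubmx (Zm w s))) (g (lsubmx (Zm w s)) *: rsubmx (Zm w s)).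
pose b w s := c (lsubmx (Zm w s)) - (gamma * g (lsubmx (Zm w s))) *: rsubmx (Zm w s).
have ca w : continuous (a w) by exact: (acceleration_continuous HB (@cZm w)).
have cb w : continuous (b w) by exact: (force_continuous HB (@cZm w)).
have cXj w (j : 'I_d) : continuous (fun s => X s w ord0 j).
  by move=> s; have /cvg_rVP := @cX w s; exact.
have H (k n : nat) (j : 'I_d) : {ae P, forall w,
    rsubmx (Zm w (k%:R / n.+1%:R)) ord0 j -
      sigma (lsubmx (Zm w (k%:R / n.+1%:R))) * X (k%:R / n.+1%:R) w ord0 j =
    rsubmx z ord0 j + \int[leb]_(s in `[0, k%:R / n.+1%:R])
      (b w s ord0 j - X s w ord0 j * a w s)}.
  pose t : R := k%:R / n.+1%:R; have t0 : 0 <= t by rewrite divr_ge0.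
  have [_ _ _ /(_ t (rshift d j) t0)[I [itoI EI]]] := hZ.
  have Ij : {ae P, forall w, I j w =
      h t w * X t w ord0 j - \int[leb]_(s in `[0, t]) (X s w ord0 j * a w s)}.
    have : ito_integral P F (fun s w => X s w ord0 j) t h (I j).
      apply: (ito_integral_version _ mW' mX); last first.
        apply: ito_integral_eq (itoI j) => r w /andP[r0 _].
        by rewrite diffusion_r eqxx /h ZmE.
      by move=> w r Nw r0; rewrite XW.
    move=> /(ito_integral_lim hF gX t0 hB ah ch); apply.
    apply: filterS sde_position => w Hw.
    exact: (langevin_riemann_cvg HB (@cX w) (gm_0 gX w) (@cZm w) t0 Hw).
  (* [diffusion] couples the momentum [j] with the noise [j] alone. *)
  have Ii : {ae P, forall w, forall i, i != j -> I i w = 0}.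
    apply: ae_forall_countable => i; have [->|ij] := eqVneq i j.
      by apply: nearW => w /negP.
    suff : {ae P, forall w, I i w = 0} by apply: filterS.
    apply: (ito_integral_zero (i := i) t0); apply: ito_integral_eq (itoI i) => r w _.
    by rewrite diffusion_r (negbTE ij).
  move: EI; apply: filterS3 Ij Ii => w Ijw Iiw.
  rewrite (bigD1 j)//= Ijw big1 ?addr0; last exact: Iiw.
  rewrite -(ZmE w t0) (int_Zm w t (fun y => drift y ord0 (rshift d j))) => E.
  rewrite -/t RintegralB//; last 2 first.
  - by apply: continuous_itv_integrable => s; have /cvg_rVP := @cb w s; exact.
  - apply: continuous_itv_integrable => s; apply: cvgM; [exact: cXj|exact: ca].
  have bE : \int[leb]_(s in `[0, t]) drift (Zm w s) ord0 (rshift d j) =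
      \int[leb]_(s in `[0, t]) b w s ord0 j.
    by apply: eq_Rintegral => s _; rewrite row_mxEr.
  rewrite bE in E; rewrite [(rsubmx (Zm w t)) _ _]mxE E [(rsubmx z) _ _]mxE /h.
  ring.
have H' : {ae P, forall w, forall k n (j : 'I_d),
    rsubmx (Zm w (k%:R / n.+1%:R)) ord0 j -
      sigma (lsubmx (Zm w (k%:R / n.+1%:R))) * X (k%:R / n.+1%:R) w ord0 j =
    rsubmx z ord0 j + \int[leb]_(s in `[0, k%:R / n.+1%:R])
      (b w s ord0 j - X s w ord0 j * a w s)}.
  by do 3! apply: ae_forall_countable => ?; exact: H.
move: sde_position; apply: filterS2 H' => w Hw pw.
apply/(path_solP HB z (@cX w) (gm_0 gX w) (@cZm w)); split => // t j t0.
have := integral_equation_dense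
  (u := fun t => rsubmx (Zm w t) ord0 j - sigma (lsubmx (Zm w t)) * X t w ord0 j)
  (v := fun s => b w s ord0 j - X s w ord0 j * a w s) (u0 := rsubmx z ord0 j).
case/(_ _ _ _ _ t0)/wrap.
- move=> s; have /cvg_rVP Hs : rsubmx (Zm w s') @[s' --> s] --> rsubmx (Zm w s) by apply: rsubmx_cvg; exact: cZm.
  apply: cvgB; first exact: Hs.
  by apply: cvgM; [exact: ch|exact: cXj].
- move=> s; apply: cvgB; first by have /cvg_rVP := @cb w s; exact.
  by apply: cvgM; [exact: cXj|exact: ca].
- by move=> k n; exact: Hw.
rewrite RintegralB//; last 2 first.
- by apply: continuous_itv_integrable => s; have /cvg_rVP := @cb w s; exact.
- apply: continuous_itv_integrable => s; apply: cvgM; [exact: cXj|exact: ca].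
rewrite -/(a w) -/(b w); lra.
Qed.

End uniqueness.

(** The converse of [sde_path_sol]: [ito_integral_riemann] promotes the pathwise limit of Riemann
    sums to an Ito integral. *)
Lemma path_sol_sde z (Z : R -> Omega -> 'rV[R]_(d + d)) :
  adapted F Z -> (forall w, continuous (Z ^~ w)) -> (forall w, sol w z (Z ^~ w)) ->
  sde_solution P F W drift diffusion z Z.
Proof.
move=> aZ cZ solZ.
have eqs w := (path_solP HB z (@cX w) (gm_0 gX w) (@cZ w)).1 (solZ w).
pose v w s := g (lsubmx (Z s w)) *: rsubmx (Z s w).
pose b w s := c (lsubmx (Z s w)) - (gamma * g (lsubmx (Z s w))) *: rsubmx (Z s w).
have cv w : continuous (v w) by exact: (velocity_continuous HB (@cZ w)).
have cb w : continuous (b w) by exact: (force_continuous HB (@cZ w)).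
pose h r w := sigma (lsubmx (Z r w)).
have ch w : continuous (h ^~ w).
  by move=> r; apply: (sigma_cvg HB); apply: lsubmx_cvg; exact: cZ.
have hB r w : `|h r w| <= B by exact: (lb_sigma HB).
have ah r : 0 <= r -> measurable_wrt (F r) (h r).
  move=> r0; apply/(measurable_wrtP hF _ r0); apply: (measurableT_comp measurable_sigma).
  exact/(measurable_wrtP hF _ r0)/aZ.
split=> //.
- by move=> w; apply: continuous_subspaceT; exact: cZ.
- move=> t j t0; apply: nearW => w; case: (split_ordP j) => k ->.
    rewrite (_ : (fun s => _) = EFin \o (fun s => v w s ord0 k)); last first.
      by apply/funext => s /=; rewrite row_mxEl.
    by apply: continuous_itv_integrable => s; have /cvg_rVP := @cv w s; exact.
  rewrite (_ : (fun s => _) = EFin \o (fun s => b w s ord0 k)); last first.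
    by apply/funext => s /=; rewrite row_mxEr.
  by apply: continuous_itv_integrable => s; have /cvg_rVP := @cb w s; exact.
have ito0 (i : 'I_d) t : 0 <= t ->
    ito_integral P F (fun s w => W s w ord0 i) t (fun _ _ => 0) (fun=> 0).
  move=> t0; apply: (ito_integral_version _ mX mW'); first by move=> w r; exact: XW.
  apply: (ito_integral_riemann hF gX (K := 0) t0) => //.
  - by move=> r w; rewrite normr0.
  - by move=> r r0; apply/(measurable_wrtP hF _ r0); exact: measurable_cst.
  - by move=> w r; exact: cvg_cst.
  - move=> w; rewrite (_ : (fun n => _) = fun=> 0); first exact: cvg_cst.
    by apply/funext => n; rewrite /elementary_integral big1// => j _; rewrite mul0r.
move=> t j t0; case: (split_ordP j) => k ->.
  exists (fun _ _ => 0); split.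
    move=> i; apply: ito_integral_eq (ito0 i t t0) => r w _.
    by rewrite diffusion_l.
  apply: nearW => w; rewrite big1// addr0; have := (eqs w).1 t k t0; rewrite !mxE => ->.
  by congr (_ + _); apply: eq_Rintegral => s _; rewrite row_mxEl.
pose l w := h t w * X t w ord0 k - \int[leb]_(s in `[0, t]) (X s w ord0 k *
   dotrV (sg (lsubmx (Z s w))) (v w s)).
exists (fun i w => if i == k then l w else 0); split.
  move=> i; have [->|ik] := eqVneq i k; last first.
    apply: ito_integral_eq (ito0 i t t0) => r w _.
    by rewrite diffusion_r (negbTE ik).
  apply: (@ito_integral_eq _ _ _ _ _ _ _ _ _ h) => [r w _|]; first by rewrite diffusion_r eqxx.
  apply: (ito_integral_version _ mX mW'); first by move=> w r; exact: XW.
  apply: (ito_integral_riemann hF gX t0 hB ah ch) => w.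
  exact: (langevin_riemann_cvg HB (@cX w) (gm_0 gX w) (@cZ w) t0 (eqs w).1).
apply: nearW => w; rewrite (bigD1 k)//= eqxx big1 ?addr0; last by move=> i /negbTE ->.
have := (eqs w).2 t k t0; rewrite !mxE => ->; congr (_ + _ + _).
by apply: eq_Rintegral => s _; rewrite row_mxEr.
Qed.

End langevin_sde.

(** * The flow and its semigroup *)

Section laws_of_random_vectors.
Context {R : realType}.

Lemma measurable_rV_cvg d (T : measurableType d) n (f_ : nat -> T -> 'rV[R]_n) (f : T -> 'rV[R]_n) :
  (forall k, measurable_fun setT (f_ k)) -> (forall x, (f_ ^~ x) @ \oo --> f x) ->
  measurable_fun setT f.
Proof.
move=> mf fcv; apply: measurable_fun_rVP => i.
apply: (@measurable_fun_cvg _ _ _ setT (fun k x => f_ k x ord0 i)).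
  by move=> k; exact: (measurableT_comp (measurable_coord i) (mf k)).
by move=> x _; have /cvg_rVP := fcv x; exact.
Qed.

Lemma weighted_cvg d (T : measurableType d) (mu : {measure set T -> \bar R}) (w : T -> R)
    (u_ : nat -> T -> R) (u : T -> R) :
  measurable_fun setT w -> (forall x, 0 <= w x) -> (\int[mu]_x (w x)%:E < +oo)%E ->
  (forall n, measurable_fun setT (u_ n)) -> (forall n x, 0 <= u_ n x <= 1) ->
  (forall x, (u_ ^~ x) @ \oo --> u x) ->
  (fun n => \int[mu]_x (w x * u_ n x)%:E)%E @ \oo --> (\int[mu]_x (w x * u x)%:E)%E.
Proof.
move=> mw w0 wi mu_ u01 ucv.
have mu' : measurable_fun setT u.
  by apply: (@measurable_fun_cvg _ _ _ setT u_) => // x _; exact: ucv.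
apply: (@dominated_cvg _ T R mu setT measurableT (fun n x => (w x * u_ n x)%:E) _ (EFin \o w)).
- by move=> n; apply/measurable_EFinP; exact: measurable_funM.
- by move=> x _; apply: cvg_EFin; [exact: nearW|apply: cvgM; [exact: cvg_cst|exact: ucv]].
- by [].
- apply/integrableP; split; first exact/measurable_EFinP.
  by under eq_integral do rewrite /= ger0_norm//.
- move=> n x _; have /andP[u0 u1] := u01 n x.
  by rewrite /= lee_fin ger0_norm ?mulr_ge0// ler_piMr.
Qed.

Lemma bounded_cvg d (T : measurableType d) (P : probability T R)
    (u_ : nat -> T -> R) (u : T -> R) :
  (forall n, measurable_fun setT (u_ n)) -> (forall n x, 0 <= u_ n x <= 1) ->
  (forall x, (u_ ^~ x) @ \oo --> u x) ->
  (fun n => \int[P]_x (u_ n x)%:E)%E @ \oo --> (\int[P]_x (u x)%:E)%E.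
Proof.
move=> mu_ u01 ucv.
have := @weighted_cvg _ T P (fun=> 1) u_ u (measurable_cst _) (fun=> ler01) _ mu_ u01 ucv.
case/(_ _)/wrap => [|H].
  by rewrite integral_cst// mul1e; exact: (le_lt_trans (probability_le1 P measurableT) (ltry _)).
rewrite (_ : (fun n => _) = (fun n => \int[P]_x (1 * u_ n x)%:E)%E).
  by rewrite (_ : (\int[P]_x (u x)%:E)%E = (\int[P]_x (1 * u x)%:E)%E)//; apply: eq_integral => x _; rewrite mul1r.
by apply/funext => n; apply: eq_integral => x _; rewrite mul1r.
Qed.

Lemma cvg_prodr (I T : Type) (r : seq I) (F : set_system T) {FF : Filter F}
    (f : I -> T -> R) (l : I -> R) : (forall i, f i @ F --> l i) ->
  (fun t => \prod_(i <- r) f i t) @ F --> \prod_(i <- r) l i.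
Proof.
move=> fl; elim: r => [|i r IH].
  by rewrite big_nil; under eq_fun do rewrite big_nil; exact: cvg_cst.
rewrite big_cons; under eq_fun do rewrite big_cons.
by apply: cvgM; [exact: fl|exact: IH].
Qed.

Let ramp (m : nat) (x : R) : R := Num.min 1 (m%:R * Num.max 0 x).

Let ramp01 m x : 0 <= ramp m x <= 1.
Proof. by rewrite ge_min lexx andbT le_min ler01 mulr_ge0// le_max lexx. Qed.

Let ramp_continuous m : continuous (ramp m).
Proof.
move=> x; apply: (@continuous_min R R (fun=> 1) (fun x => m%:R * Num.max 0 x)); first exact: cvg_cst.
apply: cvgM; first exact: cvg_cst.
by apply: (@continuous_max R R (fun=> 0) id); [exact: cvg_cst|exact: cvg_id].
Qed.

Let ramp_cvg x : (ramp ^~ x) @ \oo --> (\1_(`]0, +oo[%classic) x : R).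
Proof.
rewrite indicE; case: (leP x 0) => x0.
  rewrite memNset/=; last by rewrite in_itv/= andbT ltNge x0.
  rewrite (_ : ramp ^~ x = fun=> 0); first exact: cvg_cst.
  by apply/funext => m; rewrite /ramp (max_idPl x0) mulr0; apply/min_idPr.
rewrite mem_set/= ?in_itv/= ?x0//; apply/cvgrPdist_le => e e0.
exists (Num.truncn x^-1).+1 => // m /= Hm; suff -> : ramp m x = 1 by rewrite subrr normr0 ltW.
rewrite /ramp (max_idPr (ltW x0)); apply/min_idPl.
rewrite -ler_pdivrMr// mul1r.
have /andP[_ /ltW] := truncn_itv (ltW (eq_ind_r is_true x0 (invr_gt0 x))).
by move=> /le_trans; apply; rewrite ler_nat.
Qed.

(* The measures of upper orthants determine a law, and their indicators are
   limits of products of ramps. *)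
Lemma rV_law_unique n d1 (T1 : measurableType d1) (P1 : probability T1 R)
    d2 (T2 : measurableType d2) (P2 : probability T2 R)
    (f1 : T1 -> 'rV[R]_n) (f2 : T2 -> 'rV[R]_n) :
  measurable_fun setT f1 -> measurable_fun setT f2 ->
  (forall u : 'rV[R]_n -> R, continuous u -> (forall v, 0 <= u v <= 1) ->
    (\int[P1]_x (u (f1 x))%:E = \int[P2]_x (u (f2 x))%:E)%E) ->
  forall A, measurable A -> P1 (f1 @^-1` A) = P2 (f2 @^-1` A).
Proof.
move=> mf1 mf2 H.
pose O (a : 'rV[R]_n) := rV_box (fun i : 'I_n => `]a ord0 i, +oo[%classic).
have mO a : measurable (O a) by apply: measurable_rV_box.
pose G := [set A | exists a, A = O a].
pose u (a : 'rV[R]_n) m (v : 'rV[R]_n) : R := \prod_(i < n) ramp m (v ord0 i - a ord0 i).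
have uc a m : continuous (u a m).
  move=> v; apply: (@cvg_prodr _ _ _ (nbhs v)) => i.
  have cv : (fun v' : 'rV[R]_n => v' ord0 i - a ord0 i) @ v --> v ord0 i - a ord0 i.
    by apply: (@cvgB _ _ _ (nbhs v)); [exact: (@continuous_coord _ _ i v)|exact: cvg_cst].
  exact: (continuous_cvg _ (@ramp_continuous m _) cv).
have u01 a m v : 0 <= u a m v <= 1.
  rewrite prodr_ge0 /=; last by move=> i _; have /andP[] := ramp01 m (v ord0 i - a ord0 i).
  by apply: prodr_ile1 => i _; exact: ramp01.
have ucv a v : (u a ^~ v) @ \oo --> (\1_(O a) v : R).
  rewrite (_ : \1_(O a) v = \prod_(i < n) (\1_(`]0, +oo[%classic) (v ord0 i - a ord0 i) : R)).
    by apply: cvg_prodr => i; exact: ramp_cvg.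
  rewrite indicE; have [vO|vO] := pselect (O a v).
    rewrite mem_set// big1// => i _; rewrite indicE mem_set//= in_itv/= andbT subr_gt0.
    by have := vO i; rewrite /= in_itv/= andbT.
  rewrite memNset//; have [i vi] : exists i, ~ (`]a ord0 i, +oo[%classic (v ord0 i)).
    exact/existsNP.
  rewrite (bigD1 i)//= indicE memNset ?mul0r//= in_itv/= andbT subr_gt0 => av.
  by apply: vi; rewrite /= in_itv/= av.
have cvP d (T : measurableType d) (P : probability T R) (f : T -> 'rV[R]_n) a :
    measurable_fun setT f ->
    (fun m => \int[P]_x (u a m (f x))%:E)%E @ \oo --> P (f @^-1` O a).
  move=> mf; have mfO : measurable (f @^-1` O a) by rewrite -[X in measurable X]setTI; exact: mf.
  rewrite (_ : P _ = (\int[P]_x (\1_(O a) (f x))%:E)%E); last by have := integral_indic P measurableT mfO; rewrite setIT => <-.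
  apply: bounded_cvg => [m|m x|x] //.
  by apply: (measurableT_comp _ mf); apply: continuous_measurable_rV; exact: uc.
have [p1 p1E] := image_probability P1 mf1; have [p2 p2E] := image_probability P2 mf2.
move=> A mA; rewrite -p1E// -p2E//; move: A mA.
have GE : (measurable : set (set 'rV[R]_n)) = <<s G >>.
  apply/seteqP; split; last first.
    by apply: smallest_sub; [exact: sigma_algebra_measurable|move=> A [a ->]].
  have mid : measurable_fun [set: g_sigma_algebraType G] (id : g_sigma_algebraType G -> 'rV[R]_n).
    apply: measurable_fun_rVP => i; apply: (measurability _ (RGenOInfty.measurableE R)).
    move=> _ [_ [y ->] <-]; rewrite setTI.
    (* A half-space in the coordinate [i] is an increasing union of orthants whose other thresholds
       go to minus infinity. *)
    rewrite (_ : _ @^-1` _ = \bigcup_k O (\row_j (if j == i then y else - k%:R))).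
      by apply: bigcup_measurable => k _; apply: sub_sigma_algebra; exists (\row_j (if j == i then y else - k%:R)).
    apply/seteqP; split => v /=; rewrite in_itv/= andbT; last first.
      by case=> k _ /(_ i); rewrite /= mxE eqxx in_itv/= andbT.
    move=> yv; exists (Num.truncn `|v|).+1 => // j; rewrite /= in_itv/= andbT mxE.
    case: eqP => [->//|_]; have /andP[_ vk] := truncn_itv (normr_ge0 v).
    by rewrite ltrNl (le_lt_trans _ vk)// (le_trans _ (norm_coord_le v j))// -normrN ler_norm.
  by move=> A mA; have := mid measurableT A mA; rewrite setTI.
apply: (@measure_unique _ _ _ G (fun k => O (\row__ (- k%:R)))).
- exact: GE.
- move=> _ _ [a ->] [b ->]; exists (\row_i Num.max (a ord0 i) (b ord0 i)).
  apply/seteqP; split => v /=.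
    by move=> [va vb] i; have := va i; have := vb i; rewrite /= !in_itv/= !andbT mxE gt_max => -> ->.
  by move=> ab; split=> i; have := ab i; rewrite /= !in_itv/= !andbT mxE gt_max => /andP[].
- by move=> k; exists (\row__ (- k%:R)).
- apply/seteqP; split => // v _; exists (Num.truncn `|v|).+1 => // j; rewrite /= in_itv/= andbT mxE.
  have /andP[_ vk] := truncn_itv (normr_ge0 v).
  by rewrite ltrNl (le_lt_trans _ vk)// (le_trans _ (norm_coord_le v j))// -normrN ler_norm.
- move=> _ [a ->]; apply: etrans (p1E _ (mO a)) _; apply: etrans (esym (p2E _ (mO a))).
  have := cvP _ _ P1 _ a mf1; have := cvP _ _ P2 _ a mf2.
  rewrite (_ : (fun m => \int[P2]_x (u a m (f2 x))%:E)%E = (fun m => \int[P1]_x (u a m (f1 x))%:E)%E).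
    move=> c2 c1; exact: (cvg_unique _ c1 c2).
  by apply/funext => m; rewrite H.
- by move=> k; apply: (le_lt_trans (probability_le1 p1 (mO _))); exact: ltry.
Qed.

End laws_of_random_vectors.

Section law_kernel.
Context {R : realType} d1 d2 d3 (X : measurableType d1) (Omega : measurableType d2)
  (Y : measurableType d3).
Variables (P : probability Omega R) (f : X * Omega -> Y).

Definition law_kernel (mf : measurable_fun setT f) (x : X) : {measure set Y -> \bar R} :=
  image_measure P (measurableT_comp mf (measurable_pair1 x)).

Hypothesis mf : measurable_fun setT f.

Lemma law_kernelE x A : law_kernel mf x A = P ((fun w => f (x, w)) @^-1` A).
Proof. by []. Qed.

Let measurable_law_kernel A : measurable A -> measurable_fun setT (law_kernel mf ^~ A).
Proof.
move=> mA; have mfA : measurable (f @^-1` A) by rewrite -[X in measurable X]setTI; exact: mf.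
rewrite (_ : law_kernel mf ^~ A = P \o xsection (f @^-1` A)).
  exact: (@measurable_fun_xsection _ _ X Omega R P _ mfA).
by apply/funext => x /=; congr (P _); apply/seteqP; split=> w; rewrite /xsection/= inE.
Qed.

HB.instance Definition _ := isKernel.Build _ _ _ _ _ (law_kernel mf) measurable_law_kernel.

Let law_kernel_setT x : law_kernel mf x setT = 1%E.
Proof. by rewrite law_kernelE preimage_setT probability_setT. Qed.

HB.instance Definition _ := Kernel_isProbability.Build _ _ _ _ _ (law_kernel mf) law_kernel_setT.

End law_kernel.

(** * The flow, its measurability and its semigroup property *)

Section flow.
Context {R : realType} {dO} {Omega : measurableType dO}.
Variables (P : probability Omega R) (F : R -> set (set Omega)).
Hypothesis hF : complete_filtration P F.
Variables (d : nat) (gamma : R) (g sigma : 'rV[R]_d -> R) (c sg : 'rV[R]_d -> 'rV[R]_d) (B h0 : R).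
Hypotheses (HB : langevin_bounds gamma g sigma c sg B) (h00 : 0 < h0) (h01 : h0 <= 1).
Hypothesis mstep : forall h, 0 <= h -> measurable_fun setT
  (fun q : 'rV[R]_(d + d) * 'rV[R]_d => langevin_step gamma g sigma c h q.1 q.2).
Variable X : R -> Omega -> 'rV[R]_d.
Hypothesis gX : gaussian_motion P F X.

Local Notation S := 'rV[R]_(d + d).
Local Notation h := (mesh h0).
Implicit Types (z : S) (w : Omega) (u : S -> R) (t : R) (K : nat -> nat).

Definition noise n w j : 'rV[R]_d := X (j.+1%:R * h n) w - X (j%:R * h n) w.

Let cX w : continuous (X ^~ w). Proof. exact: (gm_cont gX). Qed.

(** A path is chosen for each [z] and [w] separately; measurability is recovered from [flow_cvg],
    which exhibits the chosen path as a limit of chains. *)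
Definition flow z w : R -> S := sval (cid (path_sol_exists HB h00 h01 (@cX w) z)).

Local Notation chain n w := (chain gamma g sigma c (h n) (noise n w)).

Let h_gt0 n : 0 < h n. Proof. by rewrite divr_gt0. Qed.

Lemma flow_sol z w : path_sol gamma g sigma c sg (X ^~ w) z (flow z w).
Proof. by rewrite /flow; case: cid => Z []. Qed.

Lemma flow_continuous z w : continuous (flow z w).
Proof. by rewrite /flow; case: cid => Z []. Qed.

Lemma flow_cvg (z_ : nat -> S) z w K t : z_ @ \oo --> z -> 0 <= t ->
  (fun n => (K n)%:R * h n) @ \oo --> t ->
  (fun n => chain n w (z_ n) (K n)) @ \oo --> flow z w t.
Proof. exact: (chain_cvg HB h00 h01 (@cX w) (flow_sol z w)). Qed.

Lemma flow0 z w : flow z w 0 = z.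
Proof.
have H : (fun n => chain n w z 0) @ \oo --> flow z w 0.
  apply: (@flow_cvg (fun=> z) z w (fun=> 0%N)) => //; first exact: cvg_cst.
  by under eq_fun do rewrite mul0r; exact: cvg_cst.
exact: (cvg_unique _ H (cvg_cst z)).
Qed.

Definition steps t n := Num.truncn (t / h n).

Lemma steps_cvg t : 0 <= t -> (fun n => (steps t n)%:R * h n) @ \oo --> t.
Proof. exact: truncn_mesh_cvg. Qed.

Lemma steps_le t n : 0 <= t -> (steps t n)%:R * h n <= t.
Proof.
move=> t0; have /andP[+ _] := truncn_itv (divr_ge0 t0 (ltW (h_gt0 n))).
by rewrite ler_pdivlMr.
Qed.

Section measurability.
Context {dT} {T : measurableType dT} (a : T -> S) (pi : T -> Omega) (t : R).
Hypotheses (ma : measurable_fun setT a) (t0 : 0 <= t)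
  (mX : forall r, 0 <= r <= t -> measurable_fun setT (fun x => X r (pi x))).

Lemma measurable_chain n k : k%:R * h n <= t ->
  measurable_fun setT (fun x => chain n (pi x) (a x) k).
Proof.
elim: k => [//|k IH] kt.
have k1 : k%:R * h n <= k.+1%:R * h n by rewrite ler_pM2r// ler_nat.
have mk := IH (le_trans k1 kt).
have m1 : measurable_fun setT (fun x => X (k.+1%:R * h n) (pi x)).
  by apply: mX; rewrite kt andbT mulr_ge0// ltW.
have m2 : measurable_fun setT (fun x => X (k%:R * h n) (pi x)).
  by apply: mX; rewrite (le_trans k1)// andbT mulr_ge0// ltW.
suff mN : measurable_fun setT (fun x => noise n (pi x) k).
  exact: (measurableT_comp (mstep (ltW (h_gt0 n))) (measurable_fun_pair mk mN)).
apply: measurable_fun_rVP => i.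
under eq_fun do rewrite /noise mxE [X in _ + X]mxE.
by apply: measurable_funB; [exact: (measurableT_comp (measurable_coord i) m1)|
  exact: (measurableT_comp (measurable_coord i) m2)].
Qed.

(** The parameters [T], [a] and [pi] let one proof serve twice: on [S * Omega] for joint
    measurability, and on [Omega] equipped with [F t] for adaptedness. *)
Lemma measurable_flow_comp : measurable_fun setT (fun x => flow (a x) (pi x) t).
Proof.
apply: (@measurable_rV_cvg _ _ _ _ (fun n x => chain n (pi x) (a x) (steps t n))).
  by move=> n; apply: measurable_chain; exact: steps_le.
by move=> x; apply: flow_cvg => //; [exact: cvg_cst|exact: steps_cvg].
Qed.

End measurability.

Let mX r : 0 <= r -> measurable_fun setT (X r).
Proof. by move=> r0; exact: (measurable_wrt_fun hF r0 (gm_adapted gX r0)). Qed.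

Lemma measurable_flow t : 0 <= t -> measurable_fun setT (fun q : S * Omega => flow q.1 q.2 t).
Proof.
move=> t0; apply: (measurable_flow_comp measurable_fst t0) => r /andP[r0 _].
exact: (measurableT_comp (mX r0) measurable_snd).
Qed.

Lemma adapted_chain n z k : measurable_wrt (F (k%:R * h n)) (fun w => chain n w z k).
Proof.
have k0 : 0 <= k%:R * h n by rewrite mulr_ge0// ltW.
apply/(measurable_wrtP hF _ k0).
apply: (@measurable_chain _ (g_sigma_algebraType (F (k%:R * h n))) (fun=> z) id (k%:R * h n)) => //.
move=> r /andP[r0 rk]; apply/(measurable_wrtP hF _ k0).
exact: (measurable_wrtS hF r0 rk (gm_adapted gX r0)).
Qed.

Let measurable_path n z k : measurable_fun setT (fun w => chain n w z k).
Proof.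
have k0 : 0 <= k%:R * h n by rewrite mulr_ge0// ltW.
exact: (measurable_wrt_fun hF k0 (adapted_chain n z k)).
Qed.

Lemma adapted_flow z : adapted F (fun t w => flow z w t).
Proof.
move=> t t0; apply/(measurable_wrtP hF _ t0).
apply: (@measurable_flow_comp _ (g_sigma_algebraType (F t)) (fun=> z) id t) => //.
move=> r /andP[r0 rk]; apply/(measurable_wrtP hF _ t0).
exact: (measurable_wrtS hF r0 rk (gm_adapted gX r0)).
Qed.

Definition step_op n u z : R :=
  gauss_avg (h n) (fun v => u (langevin_step gamma g sigma c (h n) z v)).

Section step_op.
Variables (n : nat).

Lemma step_opP u : measurable_fun setT u -> (forall z, 0 <= u z <= 1) ->
  [/\ measurable_fun setT (step_op n u), (forall z, 0 <= step_op n u z <= 1) &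
    forall z, (step_op n u z)%:E =
      (\int[lebesgue_rV d]_v (gauss_pdf (h n) v * u (langevin_step gamma g sigma c (h n) z v))%:E)%E].
Proof.
move=> mu u01; have h0n := ltW (h_gt0 n).
have mz z : measurable_fun setT (fun v => u (langevin_step gamma g sigma c (h n) z v)).
  exact: (measurableT_comp mu (measurableT_comp (mstep h0n) (measurable_pair1 z))).
split=> [|z|z].
- apply: (@measurable_gauss_avg R d (h n) _ _ (fun q => u (langevin_step gamma g sigma c (h n) q.1 q.2))).
    exact: (measurableT_comp mu (mstep h0n)).
  by move=> q; have /andP[] := u01 (langevin_step gamma g sigma c (h n) q.1 q.2).
- exact: (gauss_avgE (h_gt0 n) (mz z) (fun=> u01 _)).2.
- exact: (gauss_avgE (h_gt0 n) (mz z) (fun=> u01 _)).1.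
Qed.

Lemma iter_step_opP u k : measurable_fun setT u -> (forall z, 0 <= u z <= 1) ->
  measurable_fun setT (iter k (step_op n) u) /\ forall z, 0 <= iter k (step_op n) u z <= 1.
Proof.
move=> mu u01; elim: k => [//|k [mk k01]].
by have [] := step_opP mk k01.
Qed.

(** The last increment is independent of the chain up to step [k]; averaging over it replaces [u] by
    [step_op n u], and the induction takes this as its test function. *)
Lemma chain_law u z k : measurable_fun setT u -> (forall z, 0 <= u z <= 1) ->
  (\int[P]_w (u (chain n w z k))%:E = (iter k (step_op n) u z)%:E)%E.
Proof.
elim: k u => [|k IH] u mu u01.
  rewrite /= integral_cst// [X in (_ * X)%E](_ : _ = 1%E) ?mule1//; exact: probability_setT.
have [m1 q01 qE] := step_opP mu u01.
rewrite iterSr -IH//.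
have k0 : 0 <= k%:R * h n by rewrite mulr_ge0// ltW.
have kk : k%:R * h n < k.+1%:R * h n by rewrite ltr_pM2r// ltr_nat.
have := gm_law gX k0 kk (f := fun q : S * 'rV[R]_d => u (langevin_step gamma g sigma c (h n) q.1 q.2))
  (adapted_chain n z k).
case/(_ _ _)/wrap => [||->].
- exact: (measurableT_comp mu (mstep (ltW (h_gt0 n)))).
- by move=> q; have /andP[] := u01 (langevin_step gamma g sigma c (h n) q.1 q.2).
apply: eq_integral => w _; rewrite qE.
suff -> : k.+1%:R * h n - k%:R * h n = h n by [].
by rewrite -mulrBl -natrB// subSnn mul1r.
Qed.

End step_op.

Section semigroup.
Variable u : S -> R.
Hypotheses (cu : continuous u) (u01 : forall z, 0 <= u z <= 1).

Let mu : measurable_fun setT u. Proof. exact: continuous_measurable_rV. Qed.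

Definition flow_avg t z : R := fine (\int[P]_w (u (flow z w t))%:E)%E.

Lemma flow_avgP t : 0 <= t ->
  [/\ measurable_fun setT (flow_avg t), (forall z, 0 <= flow_avg t z <= 1) &
    forall z, (flow_avg t z)%:E = (\int[P]_w (u (flow z w t))%:E)%E].
Proof.
move=> t0; have mf := measurable_flow t0.
have mz z : measurable_fun setT (fun w => u (flow z w t)).
  exact: (measurableT_comp mu (measurableT_comp mf (measurable_pair1 z))).
have I0 z : (0 <= \int[P]_w (u (flow z w t))%:E)%E.
  by apply: integral_ge0 => w _; rewrite lee_fin; have /andP[] := u01 (flow z w t).
have I1 z : (\int[P]_w (u (flow z w t))%:E <= 1)%E.
  apply: (@le_trans _ _ (\int[P]_w (1%:E))%E); last by rewrite integral_cst// mul1e probability_le1.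
  apply: ge0_le_integral => //.
  - by move=> w _; rewrite lee_fin; have /andP[] := u01 (flow z w t).
  - exact/measurable_EFinP.
  - by move=> w _; rewrite lee_fin; have /andP[] := u01 (flow z w t).
have E z : (flow_avg t z)%:E = (\int[P]_w (u (flow z w t))%:E)%E.
  by rewrite /flow_avg fineK// ge0_fin_numE// (le_lt_trans (I1 z))// ltry.
split=> // [|z]; last by rewrite -!lee_fin E I0 I1.
apply: measurableT_comp => //.
apply: (@measurable_integral_snd R _ _ S Omega P (fun q => (u (flow q.1 q.2 t))%:E)).
  by apply/measurable_EFinP; exact: (measurableT_comp mu mf).
by move=> q; rewrite lee_fin; have /andP[] := u01 (flow q.1 q.2 t).
Qed.

(** The starting points may vary with [n]; this joint convergence is what permits the passage to the
    limit in [flow_avgD]. *)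
Lemma iter_step_op_cvg (z_ : nat -> S) z K t : z_ @ \oo --> z -> 0 <= t ->
  (fun n => (K n)%:R * h n) @ \oo --> t ->
  (fun n => iter (K n) (step_op n) u (z_ n)) @ \oo --> flow_avg t z.
Proof.
move=> zcv t0 Kt; have [_ _ E] := flow_avgP t0; 
suff H : (fun n => (iter (K n) (step_op n) u (z_ n))%:E) @ \oo --> (flow_avg t z)%:E.
  exact: (fine_cvg H).
rewrite E (_ : (fun n => _) = (fun n => \int[P]_w (u (chain n w (z_ n) (K n)))%:E)%E); last first.
  by apply/funext => n; rewrite chain_law.
apply: bounded_cvg => [n|n w|w].
- exact: (measurableT_comp mu (measurable_path n (z_ n) (K n))).
- exact: u01.
- by apply: (continuous_cvg _ (@cu _)); exact: flow_cvg.
Qed.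

(** The chain runs for [steps s n + steps t n] steps, whose duration also tends to [s + t]. Taken as
    one run it converges to the left-hand side; cut after [steps s n] steps, to the right-hand
    side. *)
Lemma flow_avgD s t z : 0 <= s -> 0 <= t ->
  ((flow_avg (s + t) z)%:E = \int[P]_w (flow_avg t (flow z w s))%:E)%E.
Proof.
move=> s0 t0; have [mt t01 _] := flow_avgP t0.
pose q n := iter (steps t n) (step_op n) u.
have qP n := iter_step_opP n (steps t n) mu u01.
have H1 : (fun n => (iter (steps s n + steps t n) (step_op n) u z)%:E) @ \oo --> (flow_avg (s + t) z)%:E.
  apply: cvg_EFin; first exact: nearW.
  apply: iter_step_op_cvg; [exact: cvg_cst|exact: addr_ge0|].
  by under eq_fun do rewrite natrD mulrDl; apply: cvgD; exact: steps_cvg.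
have H2 : (fun n => (iter (steps s n + steps t n) (step_op n) u z)%:E) @ \oo -->
    (\int[P]_w (flow_avg t (flow z w s))%:E)%E.
  rewrite (_ : (fun n => _) = (fun n => \int[P]_w (q n (chain n w z (steps s n)))%:E)%E); last first.
    by apply/funext => n; rewrite iterD chain_law//; [exact: (qP n).1|exact: (qP n).2].
  apply: bounded_cvg => [n|n w|w].
  - exact: (measurableT_comp (qP n).1 (measurable_path n z (steps s n))).
  - exact: (qP n).2.
  - apply: iter_step_op_cvg => //; last exact: steps_cvg.
    by apply: flow_cvg => //; [exact: cvg_cst|exact: steps_cvg].
exact: (cvg_unique _ H1 H2).
Qed.

End semigroup.

End flow.

(** * The transition kernel and invariance of the Gibbs measure *)

Section invariance.
Context {R : realType} {dO} {Omega : measurableType dO}.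
Variables (P : probability Omega R) (F : R -> set (set Omega)).
Hypothesis hF : complete_filtration P F.
Variables (d : nat) (beta gamma vm : R) (V g sigma : 'rV[R]_d -> R)
  (dV dg sg : 'rV[R]_d -> 'rV[R]_d) (B h0 : R).
Let c x := - (g x *: dV x) + beta^-1 *: dg x.
Hypotheses (HB : langevin_bounds gamma g sigma c sg B) (GB : gibbs_bounds beta vm V g dV dg B).
Hypotheses (sigma0 : forall x, 0 < sigma x)
  (sigmaE : forall x, beta * sigma x ^+ 2 = 2 * gamma * g x).
Hypothesis V_int : forall k, 0 < k -> (\int[lebesgue_rV d]_x (expR (- (k * V x)))%:E < +oo)%E.
Hypotheses (h00 : 0 < h0) (h01 : h0 <= 1) (hg : forall x, 2 * gamma * g x * h0 <= 1)
  (hB : h0 * B ^+ 2 <= 1) (hB5 : 34 * B ^+ 5 * h0 <= beta / 4).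
Variables (W X : R -> Omega -> 'rV[R]_d) (N : set Omega).
Hypotheses (gX : gaussian_motion P F X) (mN : measurable N) (PN : P N = 0%E)
  (XW : forall w t, ~ N w -> 0 <= t -> X t w = W t w) (aW : adapted F W).

Local Notation S := 'rV[R]_(d + d).
Local Notation leb := (lebesgue_rV (d + d)).
Local Notation wt := (gibbs_weight V beta).
Local Notation h := (mesh h0).
Implicit Types (u : S -> R) (t : R) (z : S).

Let msigma : measurable_fun setT sigma.
Proof.
apply: continuous_measurable_rV => x.
by apply: (@sigma_cvg _ _ _ _ _ _ _ _ HB _ (nbhs x) _ id x); exact: cvg_id.
Qed.

Let mstep k : 0 <= k -> measurable_fun setT
  (fun q : S * 'rV[R]_d => langevin_step gamma g sigma c k q.1 q.2).
Proof. exact: (measurable_langevin_step GB gamma msigma). Qed.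

Local Notation flow := (flow HB h00 h01 gX).
Local Notation flow_avg := (flow_avg HB h00 h01 gX).
Local Notation step_op := (step_op gamma g sigma c h0).

Let beta0 : 0 < beta := gb_beta0 GB.
Let mw : measurable_fun setT wt := measurable_gibbs_weight GB beta.
Let w0 z : 0 <= wt z. Proof. exact: expR_ge0. Qed.
Let w_lty : (\int[leb]_z (wt z)%:E < +oo)%E := gibbs_weight_integral_lty GB V_int beta0.

Let h_gt0 n : 0 < h n. Proof. by rewrite divr_gt0. Qed.
Let h_le n : h n <= h0. Proof. by rewrite ler_pdivrMr// ler_peMr ?(ltW h00)// ler1n. Qed.

Let J := fine (\int[leb]_z (gibbs_weight V (beta / 2) z)%:E).
Let C := d%:R * ham_step_cst beta vm B * J.

Let JE : (J%:E = \int[leb]_z (gibbs_weight V (beta / 2) z)%:E)%E.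
Proof.
rewrite fineK// ge0_fin_numE; last by apply: integral_ge0 => z _; rewrite lee_fin expR_ge0.
by apply: (gibbs_weight_integral_lty GB V_int); rewrite divr_gt0.
Qed.

Let C0 : 0 <= C.
Proof.
apply: mulr_ge0.
  by apply: mulr_ge0; [exact: ler0n|exact: (ham_step_cst_ge0 GB)].
by rewrite -lee_fin JE; apply: integral_ge0 => z _; rewrite lee_fin expR_ge0.
Qed.

Let mean (u : S -> R) : R := fine (\int[leb]_z (wt z * u z)%:E)%E.

Let meanE u : measurable_fun setT u -> (forall z, 0 <= u z <= 1) ->
  ((mean u)%:E = \int[leb]_z (wt z * u z)%:E)%E.
Proof.
move=> mu u01; have wu0 z : 0 <= wt z * u z by rewrite mulr_ge0//; have /andP[] := u01 z.
rewrite fineK// ge0_fin_numE; last by apply: integral_ge0 => z _; rewrite lee_fin.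
apply: le_lt_trans w_lty; apply: ge0_le_integral => //.
- by move=> z _; rewrite lee_fin.
- by apply/measurable_EFinP; exact: measurable_funM.
- by apply/measurable_EFinP.
- by move=> z _; rewrite lee_fin ler_piMr//; have /andP[] := u01 z.
Qed.

Let mean_step n u : measurable_fun setT u -> (forall z, 0 <= u z <= 1) ->
  `|mean (step_op n u) - mean u| <= C * h n ^+ 2.
Proof.
move=> mu u01; have [m1 q01 _] := step_opP h00 mstep n mu u01.
have B0 : 0 <= B by rewrite (le_trans ler01)// (gb_B1 GB).
have hn x : 2 * gamma * g x * h n <= 1.
  apply: le_trans (hg x); apply: ler_wpM2l => //.
  by rewrite !mulr_ge0// ltW// ?(lb_gamma0 HB)// (gb_g0 GB).
have hn1 : h n <= 1 by exact: le_trans h01.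
have hnB : h n * B ^+ 2 <= 1 by apply: le_trans hB; rewrite ler_wpM2r// exprn_ge0.
have hnB5 : 34 * B ^+ 5 * h n <= beta / 4.
  by apply: le_trans hB5; rewrite ler_wpM2l// mulr_ge0// exprn_ge0.
have := langevin_op_almost_invariant GB msigma sigma0 sigmaE (h_gt0 n) hn mu u01 hn1 hnB hnB5.
cbv zeta; rewrite -JE -EFinM -(meanE mu u01) -(meanE m1 q01) -!EFinD !lee_fin.
have -> : d%:R * (ham_step_cst beta vm B * h n ^+ 2) * J = C * h n ^+ 2 by rewrite /C; ring.
by move=> [H1 H2]; rewrite ler_norml; lra.
Qed.

Let mean_iter n u k : measurable_fun setT u -> (forall z, 0 <= u z <= 1) ->
  `|mean (iter k (step_op n) u) - mean u| <= k%:R * (C * h n ^+ 2).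
Proof.
move=> mu u01; elim: k => [|k IH]; first by rewrite subrr normr0 mul0r.
have [mk k01] := iter_step_opP h00 mstep n k mu u01.
rewrite -(subrK (mean (iter k (step_op n) u)) (mean (iter k.+1 _ _))) -addrA.
apply: le_trans (ler_normD _ _) _; apply: le_trans (lerD (mean_step n mk k01) IH) _.
by rewrite (mulrSr 1 k) mulrDl mul1r addrC.
Qed.

Lemma gibbs_weight_flow_invariant (u : S -> R) t : continuous u -> (forall z, 0 <= u z <= 1) -> 0 <= t ->
  (\int[leb]_z (wt z * flow_avg u t z)%:E = \int[leb]_z (wt z * u z)%:E)%E.
Proof.
move=> cu u01 t0; have mu : measurable_fun setT u by exact: continuous_measurable_rV.
have [mt t01 _] := flow_avgP hF HB h00 h01 mstep gX cu u01 t0.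
rewrite -meanE// -meanE//; congr EFin.
pose q n := iter (steps h0 t n) (step_op n) u.
have qP n := iter_step_opP h00 mstep n (steps h0 t n) mu u01.
have H1 : (fun n => mean (q n)) @ \oo --> mean (flow_avg u t).
  have H : (fun n => (mean (q n))%:E) @ \oo --> (mean (flow_avg u t))%:E.
    rewrite meanE// (_ : (fun n => _) = (fun n => \int[leb]_z (wt z * q n z)%:E)%E); last first.
      by apply/funext => n; rewrite meanE//; [exact: (qP n).1|exact: (qP n).2].
    apply: weighted_cvg => // [n|n z|z]; [exact: (qP n).1|exact: (qP n).2|].
    by apply: iter_step_op_cvg => //; [exact: cvg_cst|exact: steps_cvg].
  exact: (fine_cvg H).
have H2 : (fun n => mean (q n)) @ \oo --> mean u.
  apply/cvgrPdist_le => e e0.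
  have D0 : 0 < C * t + 1 by rewrite ltr_wpDl// mulr_ge0.
  have := mesh_le_near h00 (divr_gt0 e0 D0); apply: filterS => n hn.
  rewrite distrC; apply: le_trans (mean_iter n (steps h0 t n) mu u01) _.
  have -> : (steps h0 t n)%:R * (C * h n ^+ 2) = C * ((steps h0 t n)%:R * h n) * h n by ring.
  apply: (@le_trans _ _ (C * t * h n)).
    by rewrite ler_wpM2r ?(ltW (h_gt0 n))// ler_wpM2l// (steps_le h00).
  apply: (@le_trans _ _ ((C * t + 1) * h n)); first by rewrite ler_wpM2r ?(ltW (h_gt0 n))// lerDl.
  by rewrite mulrC -ler_pdivlMr.
exact: (cvg_unique _ H1 H2).
Qed.

Let mflow t : measurable_fun setT (fun q : S * Omega => flow q.1 q.2 (Num.max 0 t)).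
Proof. by apply: (measurable_flow hF HB h00 h01 mstep gX); rewrite le_max lexx. Qed.

(** The type asks for a probability kernel at every real [t], while the flow is known to be
    measurable at nonnegative times, hence [Num.max 0 t]. *)
Definition langevin_kernel (t : R) : R.-pker S ~> S := law_kernel P (mflow t).

Let kernelE t z A : 0 <= t -> langevin_kernel t z A = P ((fun w => flow z w t) @^-1` A).
Proof. by move=> t0; rewrite /langevin_kernel law_kernelE (max_idPr t0). Qed.

Let mflowz z t : 0 <= t -> measurable_fun setT (fun w => flow z w t).
Proof.
by move=> t0; exact: (measurableT_comp (measurable_flow hF HB h00 h01 mstep gX t0) (measurable_pair1 z)).
Qed.

(** The right-hand side is the law of a flow restarted with an independent copy of the noise, hence
    the product [P \x P]; [flow_avgD] equates the two laws on continuous functions, and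
    [rV_law_unique] extends this to all measurable sets. *)
Lemma langevin_kernel_markov : markov_semigroup langevin_kernel.
Proof.
split=> [z A mA|s t s0 t0 z A mA].
  rewrite kernelE//; rewrite diracE; have [zA|zA] := pselect (A z).
    rewrite mem_set// (_ : _ @^-1` _ = setT) ?probability_setT//.
    by apply/seteqP; split=> w //= _; rewrite flow0.
  rewrite memNset// (_ : _ @^-1` _ = set0) ?measure0//.
  by apply/seteqP; split=> w //=; rewrite flow0.
have mst := mflowz z s0; have mt := measurable_flow hF HB h00 h01 mstep gX t0.
pose f (q : Omega * Omega) := flow (flow z q.1 s) q.2 t.
have mf : measurable_fun setT f.
  exact: (measurableT_comp mt (measurable_fun_pair (measurableT_comp mst measurable_fst) measurable_snd)).
rewrite kernelE ?addr_ge0//.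
rewrite (@rV_law_unique R _ _ _ P _ _ (P \x P)%E (fun w => flow z w (s + t)) f (mflowz z (addr_ge0 s0 t0)) mf)//.
  rewrite (_ : (\int[langevin_kernel s z]_y langevin_kernel t y A)%E =
      (\int[P]_w P ((fun w' => flow (flow z w s) w' t) @^-1` A))%E).
    apply: eq_integral => w _; congr (P _); apply/seteqP; split=> w'; by rewrite /xsection/= inE.
  rewrite (eq_measure_integral (image_measure P mst)); last first.
    by move=> D mD _; rewrite kernelE.
  rewrite ge0_integral_pushforward//; last 1 first.
    by apply: (@measurable_kernel _ _ _ _ _ (langevin_kernel t)).
  by apply: eq_integral => w _; rewrite /= kernelE.
move=> u cu u01; have mu : measurable_fun setT u by exact: continuous_measurable_rV.
have [m1 _ E1] := flow_avgP hF HB h00 h01 mstep gX cu u01 (addr_ge0 s0 t0).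
have [m2 _ E2] := flow_avgP hF HB h00 h01 mstep gX cu u01 t0.
rewrite -E1 flow_avgD// fubini_tonelli1/=.
- by apply: eq_integral => w _; rewrite E2.
- by apply/measurable_EFinP; exact: (measurableT_comp mu mf).
- by move=> q; rewrite lee_fin; have /andP[] := u01 (f q).
Qed.

(** Existence is the flow itself. Any other solution is almost surely a pathwise solution, and
    [chain_cvg] makes it the limit of the same chain as the flow. *)
Lemma langevin_kernel_solution :
  solution_semigroup P F W (drift gamma g c) (diffusion sigma) langevin_kernel.
Proof.
split; first exact: langevin_kernel_markov.
move=> z; split.
  exists (fun t w => flow z w t).
  apply: (path_sol_sde hF HB gX mN PN XW aW).
  - exact: (adapted_flow hF HB h00 h01 mstep gX).
  - by move=> w; exact: flow_continuous.
  - by move=> w; exact: flow_sol.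
move=> Z solZ t A t0 mA; rewrite kernelE//.
have aZ : adapted F Z by case: solZ.
have mZ : measurable_fun setT (Z t) by exact: (measurable_wrt_fun hF t0 (aZ t t0)).
have mZA : measurable (Z t @^-1` A) by rewrite -[X in measurable X]setTI; exact: mZ.
have mfA : measurable ((fun w => flow z w t) @^-1` A).
  by rewrite -[X in measurable X]setTI; exact: (mflowz z t0).
have Zflow : {ae P, forall w, Z t w = flow z w t}.
  have := sde_path_sol hF HB gX mN PN XW aW solZ; apply: filterS => w solw.
  have cw : continuous (X ^~ w) by exact: (gm_cont gX).
  have H := chain_cvg HB h00 h01 cw solw (cvg_cst z) t0 (steps_cvg h00 t0).
  have H' := @flow_cvg _ _ _ _ _ _ _ _ _ _ _ _ _ HB h00 h01 _ gX (fun=> z) z w _ t (cvg_cst z) t0 (steps_cvg h00 t0).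
  have E := cvg_unique _ (H _) (H' _); rewrite /= (max_idPr t0) in E; exact: E.
have I D : measurable D -> (P D = \int[P]_w (\1_D w)%:E)%E.
  by move=> mD; rewrite integral_indic// setIT.
rewrite I// [RHS]I//; apply: ae_eq_integral => //.
- by apply/measurable_EFinP; exact: measurable_indic.
- by apply/measurable_EFinP; exact: measurable_indic.
- by apply: filterS Zflow => w E _; rewrite !indicE; congr ((nat_of_bool _)%:R%:E); apply/idP/idP; rewrite !inE/= E.
Qed.

(** The left-hand side is the law of the flow under [mu \x P], that is, started from [mu]; it is
    compared with [mu] on continuous functions through [gibbs_weight_flow_invariant]. *)
Lemma langevin_kernel_invariant (mu : probability S R) (k : R) : 0 <= k ->
  (forall A, measurable A -> mu A = \int[leb]_(z in A) (k * wt z)%:E)%E ->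
  forall t A, 0 <= t -> measurable A -> (\int[mu]_z langevin_kernel t z A)%E = mu A.
Proof.
move=> k0 muE t A t0 mA.
have mkw : measurable_fun setT (fun z => k * wt z) by apply: measurable_funM.
have kw0 z : 0 <= k * wt z by rewrite mulr_ge0.
have muint (u : S -> R) : measurable_fun setT u -> (forall z, 0 <= u z) ->
    (\int[mu]_z (u z)%:E = k%:E * \int[leb]_z (wt z * u z)%:E)%E.
  move=> mu_ u0; rewrite (eq_measure_integral (density leb mkw kw0)); last by move=> D mD _; exact: muE.
  rewrite ge0_integral_density//; last exact/measurable_EFinP.
  rewrite -ge0_integralZl_EFin//.
  - by apply: eq_integral => z _; rewrite -!EFinM; congr EFin; ring.
  - by move=> z _; rewrite lee_fin mulr_ge0.
  - by apply/measurable_EFinP; exact: measurable_funM.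
have mt := measurable_flow hF HB h00 h01 mstep gX t0.
have H : (mu \x P)%E ((fun q : S * Omega => flow q.1 q.2 t) @^-1` A) = mu A.
  apply: (@rV_law_unique R _ _ _ (mu \x P)%E _ _ mu (fun q : S * Omega => flow q.1 q.2 t) id mt) => //.
  move=> u cu u01; have mu_ : measurable_fun setT u by exact: continuous_measurable_rV.
  have u0 z : 0 <= u z by have /andP[] := u01 z.
  have [m1 f01 E1] := flow_avgP hF HB h00 h01 mstep gX cu u01 t0.
  rewrite fubini_tonelli1/=; last 2 first.
  - by apply/measurable_EFinP; exact: (measurableT_comp mu_ mt).
  - by move=> q; rewrite lee_fin.
  rewrite (_ : fubini_F P _ = fun z => (flow_avg u t z)%:E); last first.
    by apply/funext => z; rewrite E1.
  rewrite muint//; last by move=> z; have /andP[] := f01 z.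
  by rewrite muint// gibbs_weight_flow_invariant.
rewrite -H; apply: eq_integral => z _; rewrite kernelE//; congr (P _).
by apply/seteqP; split=> w; rewrite /xsection/= inE.
Qed.

End invariance.

(** * The bounds on the coefficients *)

Section gradient.
Context {R : realType}.

Lemma enorm_ge n (x : 'rV[R]_n) : `|x| <= enorm x.
Proof.
have e0 : 0 <= enorm x by exact: sqrtr_ge0.
apply/norm_rV_leP => // i; rewrite -(@ler_pXn2r _ 2)// sqr_sqrtr; last first.
  by apply: sumr_ge0 => j _; exact: sqr_ge0.
rewrite -normrX ger0_norm ?sqr_ge0// (bigD1 i)//= lerDl.
by apply: sumr_ge0 => j _; exact: sqr_ge0.
Qed.

Variable n : nat.
Implicit Types (x y v : 'rV[R]_n) (i : 'I_n).

(** The factor is a crude bound for [sqrt n], positive also for [n = 0]. *)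
Lemma enorm_le x : enorm x <= n.+1%:R * `|x|.
Proof.
have m0 : 0 <= n.+1%:R * `|x| by rewrite mulr_ge0.
rewrite -(@ler_pXn2r _ 2) ?nnegrE ?sqrtr_ge0// sqr_sqrtr; last first.
  by apply: sumr_ge0 => j _; exact: sqr_ge0.
apply: (@le_trans _ _ (\sum_(i < n) `|x| ^+ 2)).
  apply: ler_sum => i _; rewrite -[leLHS]ger0_norm ?sqr_ge0// normrX.
  by rewrite lerXn2r ?nnegrE// norm_coord_le.
rewrite sumr_const card_ord -[leLHS]mulr_natl exprMn ler_wpM2r ?exprn_ge0//.
apply: (@le_trans _ _ n.+1%:R); first by rewrite ler_nat.
by rewrite expr2 ler_peMr// ler1n.
Qed.

Lemma lipschitz_norm m (f : 'rV[R]_n -> 'rV[R]_m) (L : R) : 0 <= L ->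
  (forall x y, enorm (f x - f y) <= L * enorm (x - y)) ->
  forall x y, `|f x - f y| <= L * n.+1%:R * `|x - y|.
Proof.
move=> L0 lip x y; rewrite -mulrA.
by apply: le_trans (enorm_ge _) _; apply: le_trans (lip x y) _; rewrite ler_wpM2l// enorm_le.
Qed.

Lemma derive_grad (f : 'rV[R]_n -> R) x v : differentiable f x -> 'D_v f x = dotrV (grad f x) v.
Proof.
move=> df; rewrite deriveE// {1}[v]row_sum_delta linear_sum.
apply: eq_bigr => i _; rewrite linearZ /grad mxE /partial deriveE//.
by rewrite mulrC.
Qed.

Lemma is_derive_line (f : 'rV[R]_n -> R) x v (t : R) : differentiable f (x + t *: v) ->
  is_derive t 1 (fun s => f (x + s *: v)) (dotrV (grad f (x + t *: v)) v).
Proof.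
move=> df; rewrite -derive_grad//; have := @diff_derivable _ _ _ f _ v df.
have E : (fun h : R => h^-1 *: (((fun s => f (x + s *: v)) \o shift t) (h *: 1) - f (x + t *: v))) =
    (fun h : R => h^-1 *: ((f \o shift (x + t *: v)) (h *: v) - f (x + t *: v))).
  apply/funext => h /=; congr (_ *: (f _ - _)).
  by rewrite [h *: 1]mulr1 scalerDl addrCA.
by move=> dv; apply: DeriveDef; rewrite /derivable /derive E.
Qed.

Lemma rV_updZ x i (s : R) : rV_upd x i s = rV_upd x i 0 + s *: delta_mx ord0 i.
Proof.
apply/rowP => j; rewrite !mxE eqxx/=; case: eqP => _; first by rewrite add0r mulr1.
by rewrite mulr0 addr0.
Qed.

Lemma rV_upd_id x i (s : R) : rV_upd x i (x ord0 i + s) = x + s *: delta_mx ord0 i.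
Proof.
apply/rowP => j; rewrite !mxE eqxx/=; case: eqP => [->|_]; first by rewrite mulr1.
by rewrite mulr0 addr0.
Qed.

Lemma dotrV_delta (u : 'rV[R]_n) i : dotrV u (delta_mx ord0 i) = u ord0 i.
Proof.
rewrite /dotrV (bigD1 i)//= mxE !eqxx mulr1 big1 ?addr0// => j ji.
by rewrite mxE (negbTE ji) mulr0.
Qed.

Lemma norm_delta i : `|delta_mx ord0 i : 'rV[R]_n| = 1.
Proof.
apply/eqP; rewrite eq_le; apply/andP; split.
  apply/norm_rV_leP => // j; rewrite mxE eqxx/=; case: (j == i) => /=; rewrite ?normr1// normr0//.
by have := norm_coord_le (delta_mx ord0 i : 'rV[R]_n) i; rewrite mxE !eqxx normr1.
Qed.

Lemma is_derive_rV_upd (f : 'rV[R]_n -> R) x i (t : R) : (forall y, differentiable f y) ->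
  is_derive t 1 (fun s => f (rV_upd x i s)) (grad f (rV_upd x i t) ord0 i).
Proof.
move=> df; rewrite -dotrV_delta rV_updZ.
rewrite (_ : (fun s => _) = fun s => f (rV_upd x i 0 + s *: delta_mx ord0 i)).
  exact: is_derive_line.
by apply/funext => s; rewrite rV_updZ.
Qed.

(** Mean value theorem on the segment from [x] to [y]; the factor [n] comes from the dot product
    estimated in the sup norm. *)
Lemma grad_taylor (f : 'rV[R]_n -> R) (C : R) : (forall x, differentiable f x) ->
  (forall x y, `|grad f x - grad f y| <= C * `|x - y|) ->
  forall x y, `|f y - f x - dotrV (grad f x) (y - x)| <= n%:R * C * `|y - x| ^+ 2.
Proof.
move=> df lip x y; set v := y - x.
pose phi (s : R) := f (x + s *: v).
have dphi (t : R) : is_derive t 1 phi (dotrV (grad f (x + t *: v)) v) by exact: is_derive_line.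
have [s s01] := @MVT R phi (fun t => dotrV (grad f (x + t *: v)) v) 0 1 ltr01 (fun t _ => dphi t)
  (derivable_within_continuous (fun t _ => @ex_derive _ _ _ _ _ _ _ (dphi t))).
rewrite /phi scale1r scale0r addr0 subr0 mulr1 (_ : x + v = y) => [->|]; last by rewrite /v addrC subrK.
rewrite -dotrVBl; apply: le_trans (norm_dotrV_le _ _) _.
rewrite -mulrA ler_wpM2l// expr2 mulrA ler_wpM2r//.
apply: le_trans (lip _ _) _; rewrite (addrC x) addrK normrZ.
have C0 : 0 <= C * `|v|.
  by apply: le_trans (lip y x); exact: normr_ge0.
move: s01; rewrite in_itv/= => /andP[s0 s1].
by rewrite mulrCA ger0_norm ?(ltW s0)// ler_piMl// ltW.
Qed.

(** The difference quotients along a coordinate vector, of sup norm 1, are bounded by [L]. *)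
Lemma grad_bound (f : 'rV[R]_n -> R) (L : R) : (forall x, differentiable f x) ->
  (forall x y, `|f x - f y| <= L * `|x - y|) -> forall x i, `|grad f x ord0 i| <= L.
Proof.
move=> df lip x i.
have L0 : 0 <= L.
  have := lip (x + delta_mx ord0 i) x; rewrite (addrC x) addrK norm_delta mulr1.
  by apply: le_trans; exact: normr_ge0.
rewrite mxE /partial.
have cv : (fun h : R => h^-1 *: ((f \o shift x) (h *: delta_mx ord0 i) - f x)) @ 0^' -->
    'D_(delta_mx ord0 i) f x by exact: (@diff_derivable _ _ _ f _ (delta_mx ord0 i) (df x)).
rewrite leNgt; apply/negP => Ll; have H := cvgr_norm_gt _ cv _ Ll.
have [h [h0 +]] := filter_ex (filterI (nbhs_dnbhs_neq (0 : R)) (H _)).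
apply/negP; rewrite -leNgt normrZ normfV ler_pdivrMl ?normr_gt0// mulrC.
by apply: le_trans (lip _ _) _; rewrite /= addrK normrZ norm_delta mulr1.
Qed.

End gradient.

(** * The coefficients satisfy the bounds with a single constant *)

Section langevin_constants.
Context {R : realType}.
Variables (d : nat) (beta gamma vm m1 M1 D C1 C2 C3 : R) (V g : 'rV[R]_d -> R).
Hypotheses (beta0 : 0 < beta) (gamma0 : 0 < gamma) (m10 : 0 < m1).
Hypotheses (dV : forall x, differentiable V x) (dg : forall x, differentiable g x).
Hypotheses (gradV_lip : forall x y, `|grad V x - grad V y| <= D * `|x - y|)
  (g_lip : forall x y, `|g x - g y| <= C1 * `|x - y|)
  (gradg_lip : forall x y, `|grad g x - grad g y| <= C2 * `|x - y|)
  (gV_lip : forall x y, `|g x *: grad V x - g y *: grad V y| <= C3 * `|x - y|)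
  (gm : forall x, m1 < g x < M1) (V_ge : forall x, vm <= V x)
  (D0 : 0 <= D) (C10 : 0 <= C1) (C20 : 0 <= C2).
Implicit Types x y v : 'rV[R]_d.

Let kappa := 2 * gamma * beta^-1.
Let sigma x := Num.sqrt (kappa * g x).
(** The gradient of [sigma] by the chain rule, as [sigma x ^+ 2 = kappa * g x]. *)
Let sg x := (kappa / (2 * sigma x)) *: grad g x.
Let c x := - (g x *: grad V x) + beta^-1 *: grad g x.
Let s0 := Num.sqrt (kappa * m1).

Let kappa0 : 0 < kappa. Proof. by rewrite divr_gt0// mulr_gt0. Qed.
Let g0 x : 0 < g x. Proof. by have /andP[+ _] := gm x; exact: lt_trans. Qed.
Let s00 : 0 < s0. Proof. by rewrite sqrtr_gt0 mulr_gt0. Qed.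

Let sigma_ge x : s0 <= sigma x.
Proof. by apply: ler_wsqrtr; rewrite ler_pM2l//; have /andP[/ltW] := gm x. Qed.

Let sigma_gt0 x : 0 < sigma x. Proof. exact: lt_le_trans (sigma_ge x). Qed.

Let sigma_sq x : sigma x ^+ 2 = kappa * g x.
Proof. by rewrite sqr_sqrtr// ltW// mulr_gt0. Qed.

Let two_s00 : 0 < 2 * s0. Proof. exact: mulr_gt0. Qed.
Let two_sigma0 x : 0 < 2 * sigma x. Proof. exact: mulr_gt0. Qed.

Let two_sigmaV x : `|(2 * sigma x)^-1| <= (2 * s0)^-1.
Proof.
by rewrite normfV (gtr0_norm (two_sigma0 x)) lef_pV2 ?posrE// ler_pM2l.
Qed.

Let Ls := kappa * C1 / (2 * s0).

Let Ls0 : 0 <= Ls.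
Proof. by apply: divr_ge0; apply: mulr_ge0 => //; exact: ltW. Qed.

(** Difference of squares: [m1] keeps [sigma] above [s0], so one may divide by the sum. *)
Let sigma_lip x y : `|sigma x - sigma y| <= Ls * `|x - y|.
Proof.
have ab : 2 * s0 <= sigma x + sigma y by rewrite mulr_natl mulr2n; exact: (lerD (sigma_ge x) (sigma_ge y)).
have ab0 : 0 < sigma x + sigma y by exact: addr_gt0.
rewrite -(ler_pM2r ab0) -{1}(gtr0_norm ab0) -normrM.
have -> : (sigma x - sigma y) * (sigma x + sigma y) = kappa * (g x - g y).
  by rewrite mulrBr -!sigma_sq; ring.
rewrite normrM (gtr0_norm kappa0).
apply: (@le_trans _ _ (kappa * (C1 * `|x - y|))); first by rewrite ler_pM2l.
have -> : kappa * (C1 * `|x - y|) = Ls * `|x - y| * (2 * s0).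
  by rewrite /Ls; field; rewrite gt_eqF.
by rewrite ler_wpM2l// mulr_ge0.
Qed.

Let dot_gradg_le x v : `|dotrV (grad g x) v| <= d%:R * C1 * `|v|.
Proof.
apply: le_trans (norm_dotrV_le _ _) _; rewrite -mulrA ler_wpM2l// ler_wpM2r//.
by apply/norm_rV_leP => // i; exact: grad_bound.
Qed.

Let dot_gradgB_le x y v : `|dotrV (grad g x - grad g y) v| <= d%:R * C2 * `|x - y| * `|v|.
Proof.
apply: le_trans (norm_dotrV_le _ _) _; rewrite -!mulrA ler_wpM2l// mulrA ler_wpM2r//.
Qed.

Let sgE x v : dotrV (sg x) v = kappa / (2 * sigma x) * dotrV (grad g x) v.
Proof. by rewrite /dotrV mulr_sumr; apply: eq_bigr => i _; rewrite mxE mulrA. Qed.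

Let sg_le x v : `|dotrV (sg x) v| <= kappa / (2 * s0) * (d%:R * C1) * `|v|.
Proof.
rewrite sgE normrM -mulrA; apply: ler_pM => //.
by rewrite normrM (gtr0_norm kappa0) ler_pM2l.
Qed.

Let sg_lip x y v : `|dotrV (sg x - sg y) v| <=
  kappa / 2 * (d%:R * C2 / s0 + d%:R * C1 * Ls / s0 ^+ 2) * `|x - y| * `|v|.
Proof.
have inv z : `|(sigma z)^-1| <= s0^-1.
  by rewrite normfV gtr0_norm// lef_pV2 ?posrE.
have -> : dotrV (sg x - sg y) v = kappa / 2 * (dotrV (grad g x - grad g y) v * (sigma x)^-1 +
    dotrV (grad g y) v * (sigma y - sigma x) * ((sigma x)^-1 * (sigma y)^-1)).
  rewrite (dotrVBl (sg x)) (sgE x) (sgE y) dotrVBl; field.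
  by rewrite !gt_eqF.
have k2 : 0 <= kappa / 2 by apply: divr_ge0 => //; exact: ltW.
have -> : kappa / 2 * (d%:R * C2 / s0 + d%:R * C1 * Ls / s0 ^+ 2) * `|x - y| * `|v| =
    kappa / 2 * (d%:R * C2 * `|x - y| * `|v| * s0^-1 +
      d%:R * C1 * `|v| * (Ls * `|y - x|) * (s0^-1 * s0^-1)).
  by rewrite (distrC y x); field; rewrite gt_eqF.
rewrite normrM [`|kappa / 2|]ger0_norm//; apply: ler_wpM2l => //.
apply: le_trans (ler_normD _ _) _; apply: lerD.
  by rewrite normrM ler_pM.
rewrite normrM [X in X * _]normrM [X in _ * X]normrM.
by apply: ler_pM; [exact: mulr_ge0|exact: mulr_ge0|exact: ler_pM|exact: ler_pM].
Qed.

(** [2 * sigma x * (sigma y - sigma x) = sigma y ^+ 2 - sigma x ^+ 2 - (sigma y - sigma x) ^+ 2]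
    reduces the Taylor formula of the root to that of [g]. *)
Let sg_taylor x y : `|sigma y - sigma x - dotrV (sg x) (y - x)| <=
  (kappa * (d%:R * C2) + Ls ^+ 2) / (2 * s0) * `|y - x| ^+ 2.
Proof.
have -> : sigma y - sigma x - dotrV (sg x) (y - x) =
   (kappa * (g y - g x - dotrV (grad g x) (y - x)) - (sigma y - sigma x) ^+ 2) / (2 * sigma x).
  rewrite sgE; have -> : kappa * (g y - g x - dotrV (grad g x) (y - x)) =
    sigma y ^+ 2 - sigma x ^+ 2 - kappa * dotrV (grad g x) (y - x) by rewrite !sigma_sq; ring.
  by field; rewrite gt_eqF.
set n2 := `|y - x| ^+ 2.
have -> : (kappa * (d%:R * C2) + Ls ^+ 2) / (2 * s0) * n2 =
    (kappa * (d%:R * C2 * n2) + Ls ^+ 2 * n2) * (2 * s0)^-1 by ring.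
rewrite normrM; apply: ler_pM => //.
  apply: le_trans (ler_normB _ _) _; apply: lerD.
    rewrite normrM (gtr0_norm kappa0) ler_pM2l//; exact: grad_taylor.
by rewrite normrX -exprMn lerXn2r// nnegrE mulr_ge0.
Qed.

Let c_lip x y : `|c x - c y| <= (C3 + beta^-1 * C2) * `|x - y|.
Proof.
have -> : c x - c y = - (g x *: grad V x - g y *: grad V y) + beta^-1 *: (grad g x - grad g y).
  by rewrite /c scalerBr opprB opprD opprK addrACA [in RHS]addrC addrC; congr (_ + _); rewrite addrC.
apply: le_trans (ler_normD _ _) _; rewrite mulrDl normrN lerD//.
by rewrite normrZ gtr0_norm ?invr_gt0// -mulrA ler_pM2l// invr_gt0.
Qed.

Let V_taylor x i (s : R) :
  `|V (rV_upd x i (x ord0 i + s)) - V x - grad V x ord0 i * s| <= d%:R * D * s ^+ 2.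
Proof.
have := grad_taylor dV gradV_lip x (x + s *: delta_mx ord0 i).
rewrite -rV_upd_id rV_upd_id (addrC x) addrK normrZ norm_delta mulr1 dotrVZr dotrV_delta.
by rewrite -[`|s| ^+ 2]normrX [`|s ^+ 2|]ger0_norm ?sqr_ge0// [s * _]mulrC.
Qed.

(* The minimum over [s] of the Taylor upper bound [V x + V_i s + Q s^2]. *)
Let gradV_sq x i : grad V x ord0 i ^+ 2 <= 4 * (d%:R * D + 1) * (1 + V x - vm).
Proof.
(* The added 1 keeps [Q] positive even when [D = 0]. *)
set q := grad V x ord0 i; set Q := d%:R * D + 1.
have Q0 : 0 < Q by rewrite ltr_wpDl// mulr_ge0.
have := V_taylor x i (- q / (2 * Q)); rewrite ler_norml -/q => /andP[_].
set u := rV_upd _ _ _; have := V_ge u.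
have e1 : q * (- q / (2 * Q)) = - (q ^+ 2 / (2 * Q)) by rewrite mulNr mulrN mulrA.
have e2 : Q * (- q / (2 * Q)) ^+ 2 = q ^+ 2 / (4 * Q) by field; rewrite gt_eqF.
have e3 : q ^+ 2 / (2 * Q) = 2 * (q ^+ 2 / (4 * Q)) by field; rewrite gt_eqF.
have e4 : q ^+ 2 = 4 * Q * (q ^+ 2 / (4 * Q)) by field; rewrite gt_eqF.
have s2 : 0 <= (- q / (2 * Q)) ^+ 2 by exact: sqr_ge0.
have : (d%:R * D) * (- q / (2 * Q)) ^+ 2 <= Q * (- q / (2 * Q)) ^+ 2 by rewrite ler_wpM2r// lerDl.
rewrite e2 e1 e3 [in X in _ -> X]e4 => l1 l2 l3.
rewrite ler_pM2l ?mulr_gt0//; lra.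
Qed.

Let lip_cvg (f : 'rV[R]_d -> 'rV[R]_d) (L : R) : 0 <= L ->
  (forall x y, `|f x - f y| <= L * `|x - y|) -> continuous f.
Proof.
move=> L0 lip x; apply/(@cvgrPdist_le _ _ _ (nbhs x) (nbhs_filter x)) => e e0.
have e1 : 0 < e / (L + 1) by rewrite divr_gt0// ltr_wpDl.
have /cvgrPdist_le /(_ _ e1) := @cvg_id _ (nbhs x); apply: filterS => y xy.
apply: le_trans (lip x y) _; apply: (@le_trans _ _ ((L + 1) * `|x - y|)).
  by rewrite ler_wpM2r// lerDl.
by rewrite mulrC -ler_pdivlMr// ltr_wpDl.
Qed.

Lemma measurable_continuous_rV (f : 'rV[R]_d -> 'rV[R]_d) : continuous f -> measurable_fun setT f.
Proof.
move=> cf; apply: measurable_fun_rVP => i; apply: continuous_measurable_rV => x.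
by have /cvg_rVP := @cf x; exact.
Qed.

Lemma langevin_gibbs_bounds :
  exists B, langevin_bounds gamma g sigma c sg B /\
    gibbs_bounds beta vm V g (grad V) (grad g) B.
Proof.
(* As a list, so that each bound [k <= B] is a membership settled by computation; the sum of
   absolute values dominates every entry. *)
pose ks : seq R := [:: 1; gamma; M1; C1; `|c 0|; C3 + beta^-1 * C2; Num.sqrt (kappa * M1); Ls;
  kappa / (2 * s0) * (d%:R * C1);
  kappa / 2 * (d%:R * C2 / s0 + d%:R * C1 * Ls / s0 ^+ 2);
  (kappa * (d%:R * C2) + Ls ^+ 2) / (2 * s0);
  beta; beta^-1; 4 * (d%:R * D + 1); d%:R * D].
pose B := \sum_(k <- ks) `|k|; exists B.
have mem k : k \in ks -> k <= B.
  move=> kks; apply: le_trans (ler_norm k) _; rewrite /B (big_rem k)//= lerDl.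
  by apply: sumr_ge0.
have mono k a b : k \in ks -> 0 <= b -> a <= k * b -> a <= B * b.
  by move=> /mem kB b0 /le_trans; apply; rewrite ler_wpM2r.
have cV : continuous (grad V) by exact: (lip_cvg D0).
have cg : continuous (grad g) by exact: (lip_cvg C20).
have mVg : measurable_fun setT (grad V) by exact: measurable_continuous_rV.
have mgg : measurable_fun setT (grad g) by exact: measurable_continuous_rV.
have mg : measurable_fun setT g.
  by apply: continuous_measurable_rV => x; exact: differentiable_continuous.
split; split.
- by apply: mem; rewrite !inE eqxx.
- exact: gamma0.
- by apply: mem; rewrite !inE eqxx ?orbT.
- exact: g0.
- move=> x; apply: (@le_trans _ _ M1); first by have /andP[_ /ltW] := gm x.
  by apply: mem; rewrite !inE eqxx ?orbT.
- by move=> x y; apply: mono (g_lip x y) => //; rewrite !inE eqxx ?orbT.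
- by apply: mem; rewrite !inE eqxx ?orbT.
- by move=> x y; apply: mono (c_lip x y) => //; rewrite !inE eqxx ?orbT.
- move=> x; apply: (@le_trans _ _ (Num.sqrt (kappa * M1))).
    rewrite ger0_norm ?(ltW (sigma_gt0 x))// ler_wsqrtr// ler_pM2l//.
    by have /andP[_ /ltW] := gm x.
  by apply: mem; rewrite !inE eqxx ?orbT.
- by move=> x y; apply: mono (sigma_lip x y) => //; rewrite !inE eqxx ?orbT.
- by move=> x v; apply: mono (sg_le x v) => //; rewrite !inE eqxx ?orbT.
- move=> x y v; rewrite -mulrA; have := sg_lip x y v; rewrite -[leRHS]mulrA.
  by apply: mono; [rewrite !inE eqxx ?orbT|exact: mulr_ge0].
- by move=> x y; apply: mono (sg_taylor x y); [rewrite !inE eqxx ?orbT|exact: exprn_ge0].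
- by apply: mem; rewrite !inE eqxx.
- exact: beta0.
- by apply: mem; rewrite !inE eqxx ?orbT.
- by apply: mem; rewrite !inE eqxx ?orbT.
- exact: g0.
- move=> x; apply: (@le_trans _ _ M1); first by have /andP[_ /ltW] := gm x.
  by apply: mem; rewrite !inE eqxx ?orbT.
- move=> x i; apply: le_trans (grad_bound dg g_lip x i) _.
  by apply: mem; rewrite !inE eqxx ?orbT.
- exact: V_ge.
- move=> x i; apply: mono (gradV_sq x i); first by rewrite !inE eqxx ?orbT.
  by have := V_ge x; lra.
- move=> x i s; apply: mono (V_taylor x i s); first by rewrite !inE eqxx ?orbT.
  exact: sqr_ge0.
- by move=> x y; apply: mono (c_lip x y) => //; rewrite !inE eqxx ?orbT.
- by apply: continuous_measurable_rV => x; exact: differentiable_continuous.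
- exact: mg.
- exact: mgg.
- apply: measurable_fun_rVP => i.
  rewrite (_ : (fun x => _) = fun x => - (g x * grad V x ord0 i) + beta^-1 * grad g x ord0 i).
    apply: measurable_funD.
      apply: measurableT_comp => //; apply: measurable_funM => //.
      exact: (measurableT_comp (measurable_coord i) mVg).
    by apply: measurable_funM => //; exact: (measurableT_comp (measurable_coord i) mgg).
  by apply/funext => x; rewrite !mxE.
- by move=> x i t; exact: is_derive_rV_upd.
- move=> x i t.
  have ct : rV_upd x i s @[s --> t] --> rV_upd x i t.
    apply/cvg_rVP => j; rewrite mxE; under eq_fun do rewrite mxE.
    by case: (j == i); [exact: cvg_id|exact: cvg_cst].
  have Hc : grad g (rV_upd x i s) @[s --> t] --> grad g (rV_upd x i t).
    exact: (continuous_cvg _ (@cg _) ct).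
  have /cvg_rVP := Hc; exact.
Qed.

End langevin_constants.

(** * The Gibbs weight as a normalisable density *)

Lemma gibbs_weight_hamiltonian (R : realType) d (beta : R) (V : 'rV[R]_d -> R) z :
  expR (- beta * hamiltonian V z) = gibbs_weight V beta z.
Proof.
have kE : enorm (rsubmx z) ^+ 2 / 2 = kinetic (rsubmx z).
  rewrite /kinetic -mulr_suml; congr (_ / _); apply: sqr_sqrtr.
  by apply: sumr_ge0 => i _; exact: sqr_ge0.
by rewrite /gibbs_weight /hamiltonian kE mulNr.
Qed.

(** Otherwise the positive integrand would vanish almost everywhere and the whole space would be
    null, whereas the unit cube has measure 1. *)
Lemma integral_expR_gt0 (R : realType) n (f : 'rV[R]_n -> R) : measurable_fun setT f ->
  (0 < \int[lebesgue_rV n]_z (expR (f z))%:E)%E.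
Proof.
move=> mf; have mE : measurable_fun setT (fun z => (expR (f z))%:E).
  by apply/measurable_EFinP; exact: (measurableT_comp (@measurable_expR R) mf).
rewrite lt0e integral_ge0 ?andbT; last by move=> z _; rewrite lee_fin expR_ge0.
apply/eqP => I0.
have : (\int[lebesgue_rV n]_z `|(expR (f z))%:E|)%E = 0%E.
  by rewrite -[RHS]I0; apply: eq_integral => z _; rewrite /= ger0_norm// expR_ge0.
move/(ae_eq_integral_abs _ measurableT mE) => [N [mN N0 sub]].
have NT : N = setT.
  apply/seteqP; split=> // z _; apply: sub => /= /(_ Logic.I) [] /eqP.
  by rewrite gt_eqF// expR_gt0.
have m01 (i : 'I_n) : measurable (`[0%R, 1%R]%classic : set R) by exact: measurable_itv.
have := lebesgue_rV_box m01; rewrite big1 => [H|i _]; last first.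
  by rewrite lebesgue_measure_itv/= lte_fin ltr01 oppr0 adde0.
have : (lebesgue_rV n [set v | forall i, `[0%R, 1%R]%classic (v ord0 i)] <= lebesgue_rV n N)%E.
  by apply: le_measure; rewrite ?inE ?NT//; exact: (measurable_rV_box m01).
by rewrite N0 H lee_fin ler10.
Qed.

(** Beyond some radius [r] confinement gives [V x >= 0]; inside it, the Taylor bound at the origin
    gives an explicit constant. *)
Lemma confining_lower_bound (R : realType) d (V : 'rV[R]_d -> R) (D : R) :
  (forall x, differentiable V x) -> 0 <= D ->
  (forall x y, `|grad V x - grad V y| <= D * `|x - y|) -> confining V ->
  exists vm, forall x, vm <= V x.
Proof.
move=> dV D0 lip [/(_ 0)[r rP] _].
exists (Num.min 0 (V 0 - d%:R * (`|grad V 0| * `|r|) - d%:R * D * r ^+ 2)) => x.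
rewrite ge_min; have [/rP ->//|xr] := leP r (enorm x).
apply/orP; right; have xr' : `|x| <= `|r|.
  by apply: le_trans (enorm_ge x) _; apply: le_trans (ltW xr) _; exact: ler_norm.
have := grad_taylor dV lip 0 x; have := norm_dotrV_le (grad V 0) x; rewrite !subr0.
have h1 : d%:R * (`|grad V 0| * `|x|) <= d%:R * (`|grad V 0| * `|r|).
  by rewrite ler_wpM2l// ler_wpM2l.
have h2 : d%:R * D * `|x| ^+ 2 <= d%:R * D * r ^+ 2.
  rewrite ler_wpM2l ?mulr_ge0// -[leRHS]ger0_norm ?sqr_ge0// normrX.
  by rewrite lerXn2r// nnegrE.
rewrite !ler_norml => /andP[h3 _] /andP[h4 _]; lra.
Qed.

Theorem theorem4p2
  (R : realType)
  (dO : measure_display) (Omega : measurableType dO) (P : probability Omega R)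
  (d : nat) (hd : (1 <= d)%N)
  (F : R -> set (set Omega)) (hF : complete_filtration P F)
  (W : R -> Omega -> 'rV[R]_d) (hW : brownian_motion P F W)
  (beta gamma : R) (hbeta : 0 < beta) (hgamma : 0 < gamma)
  (V : 'rV[R]_d -> R) (hVs : smooth V) (hVc : confining V)
  (hVl : exists D : R, forall x y : 'rV[R]_d,
     enorm (grad V x - grad V y) <= D * enorm (x - y))
  (g : 'rV[R]_d -> R) (hg : forall x : 'rV[R]_d, differentiable g x)
  (h1 : exists C1 : R, 0 < C1 /\ forall x y : 'rV[R]_d,
     `|g x - g y| <= C1 * enorm (x - y))
  (h2 : exists C2 : R, 0 < C2 /\ forall x y : 'rV[R]_d,
     enorm (grad g x - grad g y) <= C2 * enorm (x - y))
  (h3 : exists m1 M1 : R, [/\ 0 < m1, m1 < M1 &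
     forall x : 'rV[R]_d, m1 < g x < M1])
  (h4 : exists C3 : R, 0 < C3 /\ forall x y : 'rV[R]_d,
     enorm (g x *: grad V x - g y *: grad V y) <= C3 * enorm (x - y)) :
  exists mu : probability 'rV[R]_(d + d) R,
    (forall A, measurable A ->
       mu A = (\int[@lebesgue_rV R (d + d)]_(z in A)
                 (gibbs_density beta V z)%:E)%E) /\
    invariant_distribution P F W (langevin_drift beta gamma V g)
      (langevin_diffusion beta gamma g) mu.
Proof.
have dV x : differentiable V x := hVs [::] x.
have [D0 D0P] := hVl; have [C1 [C10 C1P]] := h1; have [C2 [C20 C2P]] := h2.
have [m1 [M1 [m10 m1M1 gm]]] := h3; have [C3 [C30 C3P]] := h4.
(* The constant [D0] comes without a sign, hence its absolute value. *)
have V_lip : forall x y, `|grad V x - grad V y| <= `|D0| * d.+1%:R * `|x - y|.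
  apply: lipschitz_norm => // x y; apply: le_trans (D0P x y) _.
  by rewrite ler_wpM2r ?sqrtr_ge0// ler_norm.
have gg_lip := lipschitz_norm (ltW C20) C2P.
have gV_lip := lipschitz_norm (f := fun x => g x *: grad V x) (ltW C30) C3P.
have g_lip : forall x y, `|g x - g y| <= C1 * d.+1%:R * `|x - y|.
  move=> x y; apply: le_trans (C1P x y) _.
  by rewrite -mulrA ler_wpM2l ?(ltW C10)// enorm_le.
have D0' : 0 <= `|D0| * d.+1%:R by exact: mulr_ge0.
have [vm V_ge] := confining_lower_bound dV D0' V_lip hVc.
have [B [HB GB]] := langevin_gibbs_bounds hbeta hgamma m10 dV hg V_lip g_lip gg_lip gV_lip gm
  V_ge D0' (mulr_ge0 (ltW C10) (ler0n _ _)) (mulr_ge0 (ltW C20) (ler0n _ _)).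
have V_int k : 0 < k -> (\int[lebesgue_rV d]_x (expR (- (k * V x)))%:E < +oo)%E.
  move=> k0; have [_ /(_ k k0) /integrableP[_]] := hVc; apply: le_lt_trans.
  rewrite le_eqVlt; apply/orP; left; apply/eqP; apply: eq_integral => x _.
  by rewrite /= ger0_norm ?expR_ge0// mulNr.
have B1 := lb_B1 HB; have B0 : 0 <= B by exact: le_trans B1.
(* Its inverse is the first step [h0]; the summands are those demanded by [h0 <= 1],
   [2 * B ^+ 2 * h0 <= 1] and [34 * B ^+ 5 * h0 <= beta / 4]. *)
pose Q := 1 + 2 * B ^+ 2 + 4 / beta * (34 * B ^+ 5).
have q2 : 0 <= 2 * B ^+ 2 by rewrite mulr_ge0// exprn_ge0.
have q5 : 0 <= 4 / beta * (34 * B ^+ 5).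
  by apply: mulr_ge0; [rewrite divr_ge0// ltW|rewrite mulr_ge0// exprn_ge0].
have Q0 : 0 < Q by rewrite /Q; lra.
have QV k : k <= Q -> k * Q^-1 <= 1 by move=> kQ; rewrite ler_pdivrMr// mul1r.
have h00 : 0 < Q^-1 by rewrite invr_gt0.
have h01 : Q^-1 <= 1 by rewrite -[leLHS]mul1r; apply: QV; rewrite /Q; lra.
have hB2 : 2 * B ^+ 2 * Q^-1 <= 1 by apply: QV; rewrite /Q; lra.
have hgB x : 2 * gamma * g x * Q^-1 <= 1.
  apply: le_trans hB2; rewrite ler_pM2r// -!mulrA ler_pM2l// expr2.
  by apply: ler_pM; [exact: ltW|exact: ltW (lb_g0 HB x)|exact: lb_gamma HB|exact: lb_g HB x].
have hB : Q^-1 * B ^+ 2 <= 1.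
  rewrite mulrC; apply: QV; rewrite /Q; have : 0 <= B ^+ 2 by exact: sqr_ge0.
  lra.
have hB5 : 34 * B ^+ 5 * Q^-1 <= beta / 4.
  have -> : 34 * B ^+ 5 * Q^-1 = beta / 4 * (4 / beta * (34 * B ^+ 5) * Q^-1).
    by field; rewrite gt_eqF//= gt_eqF.
  by apply: ler_piMr; [rewrite divr_ge0// ltW|apply: QV; rewrite /Q; lra].
have [X [N [mN PN gX XW]]] := regular_version hF hW.
have aW : adapted F W by case: hW.
have sigma0 x : 0 < Num.sqrt (2 * gamma * beta^-1 * g x).
  by rewrite sqrtr_gt0 mulr_gt0 ?(lb_g0 HB)// divr_gt0// mulr_gt0.
have sigmaE x : beta * Num.sqrt (2 * gamma * beta^-1 * g x) ^+ 2 = 2 * gamma * g x.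
  have s2 : Num.sqrt (2 * gamma * beta^-1 * g x) ^+ 2 = 2 * gamma * beta^-1 * g x.
    by apply: sqr_sqrtr; apply: ltW; rewrite -sqrtr_gt0.
  by rewrite s2; field; rewrite gt_eqF.
have mw := measurable_gibbs_weight GB beta.
have wE z : gibbs_density beta V z = (partition_function beta V)^-1 * gibbs_weight V beta z.
  by rewrite /gibbs_density gibbs_weight_hamiltonian.
have ZE : ((partition_function beta V)%:E = \int[lebesgue_rV (d + d)]_z (gibbs_weight V beta z)%:E)%E.
  rewrite /partition_function /Rintegral fineK.
    by apply: eq_integral => z _; rewrite gibbs_weight_hamiltonian.
  under eq_integral do rewrite gibbs_weight_hamiltonian.
  rewrite ge0_fin_numE; last by apply: integral_ge0 => z _; rewrite lee_fin expR_ge0.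
  exact: (gibbs_weight_integral_lty GB V_int).
have Z0 : 0 < partition_function beta V.
  rewrite -lte_fin ZE; apply: integral_expR_gt0.
  (* The exponent is measurable as the logarithm of the weight. *)
  have -> : (fun z => - (beta * (kinetic (rsubmx z) + V (lsubmx z)))) = (fun z => ln (gibbs_weight V beta z)).
    by apply/funext => z; rewrite expRK.
  exact: (measurableT_comp (@measurable_ln R) mw).
have Z0' := ltW Z0.
have mdens : measurable_fun setT (gibbs_density beta V).
  by rewrite (funext wE); apply: measurable_funM.
have dens0 z : 0 <= gibbs_density beta V z by rewrite wE mulr_ge0 ?invr_ge0 ?expR_ge0.
have dens1 : (\int[lebesgue_rV (d + d)]_z (gibbs_density beta V z)%:E = 1)%E.
  under eq_integral do rewrite wE EFinM.
  rewrite ge0_integralZl_EFin ?invr_ge0//; last 2 first.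
  - by move=> z _; rewrite lee_fin expR_ge0.
  - exact/measurable_EFinP.
  by rewrite -ZE -EFinM mulVf// gt_eqF.
have [mu muE] := density_probability mdens dens0 dens1.
exists mu; split; first by move=> A mA; rewrite muE.
exists (langevin_kernel hF HB GB h00 h01 gX); split.
  exact: (langevin_kernel_solution hF HB GB h00 h01 gX mN PN XW aW).
apply: (langevin_kernel_invariant hF HB GB sigma0 sigmaE V_int h00 h01 hgB hB hB5 gX (k := (partition_function beta V)^-1)).
  by rewrite invr_ge0.
by move=> A mA; rewrite muE; apply: eq_integral => z _; rewrite wE.
Qed.
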